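(* Let $(X,d,\mu)$ be a normal space of order $\theta$ with $0<\mu(X)<\infty$, and let $(f_Q)_{Q\in\mathcal F}$ be the orthonormal system constructed in the context. There exists $C>0$ such that for all $f\in H^1(X,d,\mu)$ $$\left\|\sum_{Q\in\mathcal F}(f|f_Q)f_Q\right\|_{H^1(X,d,\mu)}\le C\|f\|_{H^1(X,d,\mu)},$$ where $(f|f_Q)=\int_Xff_Q\,d\mu$.
   Context: Normal space: $X$ is a set, $d:X\times X\to[0,\infty)$ is a quasi-metric (symmetric, $d(x,y)=0$ iff $x=y$, and $d(x,y)\le K'(d(x,z)+d(z,y))$ for a fixed $K'$), $B(x,r)=\{y: d(x,y)<r\}$, and $\mu$ is a non-negative measure on $X$ defined on a $\sigma$-algebra containing the balls. $(X,d,\mu)$ is normal of order $\theta>0$ if there are constants $A_1,A_2,K_1,K_2\in(0,\infty)$ with $K_2\le1\le K_1$ and $K_0>0$ such that for all $x\in X$, $r>0$: $A_1r\le\mu(B(x,r))$ if $r\le K_1\mu(X)$; $B(x,r)=X$ if $r>K_1\mu(X)$; $A_2r\ge\mu(B(x,r))$ if $r\ge K_2\mu(\{x\})$; $B(x,r)=\{x\}$ if $r<K_2\mu(\{x\})$; and $|d(x,z)-d(y,z)|\le K_0r^{1-\theta}d(x,y)^\theta$ whenever $d(x,z)<r$, $d(y,z)<r$. Atomic $H^1(X,d,\mu)$ (Coifman–Weiss): an atom is a function $a:X\to\mathbf R$ supported in a ball $B$ with $\|a\|_\infty\le\mu(B)^{-1}$ and $\int a\,d\mu=0$; since $\mu(X)<\infty$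 the constant function $1/\mu(X)$ is also an atom. $H^1(X,d,\mu)$ is the space of all $f=\sum_i\lambda_ia_i$ (convergence in $L^1(\mu)$) with $a_i$ atoms and $\sum|\lambda_i|<\infty$, normed by the infimum of $\sum_i|\lambda_i|$ over all such representations. Dyadic cubes (David, Christ): $\mathcal E=\{Q^k_i:k\ge0,i\in I_k\}$ is a collection of subsets of $X$ with constants $\delta\in(0,1)$, $a_0,\eta>0$, $C_1,C_2<\infty$ such that for each $k$ the $Q_i^k$ ($i\in I_k$) cover $X$ up to a $\mu$-null set; if $l\ge k$ then either $Q^l_j\subset Q^k_i$ or $Q^l_j\cap Q^k_i=\emptyset$; for each $(k,i)$ and $l<k$ there is a unique $j$ with $Q^k_i\subset Q^l_j$; $\operatorname{diam}Q^k_i\le C_1\delta^k$; each $Q^k_i$ contains a ball $B(z^k_i,a_0\delta^k)$; and $\mu\{x\in Q^k_i:\operatorname{dist}(x,X\setminus Q^k_i)\le t\delta^k\}\le C_2t^\eta\mu(Q^k_i)$ for $t\ge0$. The indexing is such that $X$ is the only cube of level $0$ (up to a null set). $G_n(X|\mathcal E)$ is the set of cubes of level $n$, and for $Q\in G_n(X|\mathcal E)$, $G_1(Q|\mathcal E)$ is the set of cubes of level $n+1$ contained in $Q$; write $G_1(Q|\mathcal E)=\{P_0,\dots,P_{N}\}$, $N=N(Q)$. Functions $h_{Q,i}$, $1\le i\le N(Q)$: supported in $Q$, constant on each $P_j$, taking at most three values (including $0$), with $\int h_{Q,i}\,d\mu=0$, and $\frac1C(\sum\alpha_i^2)^{1/2}\le\|\sum_i\alpha_ih_{Q,i}\|_{L^2}\le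 C(\sum\alpha_i^2)^{1/2}$ for all real $\alpha_i$, with $C$ independent of $Q$, $N$ and $\delta$ (such systems were constructed by Maurey). Smoothing: fix $0<\beta\le\theta$; $\operatorname{Lip}_\beta(f)=\sup_{x\ne y}|f(x)-f(y)|/d(x,y)^\beta$. For each $n$, $(\psi^{(n)}_k)_k$ is a partition of unity (nonnegative functions, uniformly bounded overlap, as constructed by Macías–Segovia) with $\sum_k\psi^{(n)}_k=1$, $\operatorname{diam}(\operatorname{supp}\psi^{(n)}_k)\le\tau\delta^n$, $\operatorname{Lip}_\beta(\psi^{(n)}_k)\le(\tau\delta^n)^{-\beta}$. Put $K_n(x,y)=\sum_k\psi_k^{(n)}(x)\psi^{(n)}_k(y)/\|\psi^{(n)}_k\|_1$, and for $Q\in G_n(X|\mathcal E)$ put $\tilde\varphi_{Q,i}(x)=\int_XK_{n+1}(x,y)h_{Q,i}(y)\,d\mu(y)$ and $\varphi_{Q,i}=\tilde\varphi_{Q,i}/\|\tilde\varphi_{Q,i}\|_2$. Family $\mathcal F$: fix a large constant $K$; split each $G_n(X|\mathcal E)$ into $\mathcal P_{n,1},\dots,\mathcal P_{n,l}$ ($l$ depending only on $K$ and the geometry of $X$) so that $\operatorname{dist}(P,Q)\ge K\max\{\mu(P),\mu(Q)\}$ for distinct $P,Q\in\mathcal P_{n,j}$. Fix integers $m\ge2$, $0<s\le m$, $1\le j\le l$ and $i_0\ge1$, and let $\mathcal F=\bigcup_{k\ge0}\mathcal P_{mk+s,j}\cup\{X\}$, keeping only those cubes $Q\neq X$ with $N(Q)\ge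 i_0$. Put $\varphi_Q=\varphi_{Q,i_0}$ for $Q\in\mathcal F$, $Q\ne X$, and $\varphi_X=\mathbf 1_X$. The system $f_Q$: fix $0<\alpha<\beta/2$. The parameters are chosen so that $\tau$ is sufficiently small (in particular $\tau<1/(500C_1)$), $\delta$ is sufficiently small depending on $\tau$, $\beta$ and the geometry of $X$, $K$ is sufficiently large, and $m$ is sufficiently large depending on $\alpha,\beta,\delta,\tau$ and the geometry. Then the Gram matrix $G=(\int_X\varphi_Q\varphi_P\,d\mu)_{Q,P\in\mathcal F}$ is positive definite and invertible on $\ell^2(\mathcal F)$; with $(a_{P,Q})$ the coefficients of $G^{-1/2}$, put $f_Q=\sum_{P\in\mathcal F}a_{P,Q}\varphi_P$. The $f_Q$ form an orthonormal system in $L^2(X,\mu)$. *)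

(* Defs.v *)
From mathcomp Require Import all_boot all_order all_algebra finmap.
From mathcomp Require Import all_classical all_reals all_analysis.
From mathcomp.analysis.showcase Require summability.
Import Order.TTheory GRing.Theory Num.Theory.
Import numFieldNormedType.Exports.

Set Implicit Arguments.
Unset Strict Implicit.
Unset Printing Implicit Defensive.

Local Open Scope classical_set_scope.
Local Open Scope card_scope.
Local Open Scope ring_scope.

Notation totally := summability.totally.

Section QuasiMetric.
Context {R : realType} {X : Type}.
Variable d : X -> X -> R.

Definition quasi_metric : Prop :=
  [/\ forall x y, 0 <= d x y,
      forall x y, d x y = d y x,
      forall x y, d x y = 0 <-> x = y
    & exists K', forall x y z, d x y <= K' * (d x z + d z y)].

Definition qball (x : X) (r : R) : set X := [set y | d x y < r].

(* -oo on the empty set *)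
Definition qdiam (A : set X) : \bar R :=
  ereal_sup [set (d x y)%:E | x in A & y in A].

(* +oo if one of the sets is empty *)
Definition qdist (A B : set X) : \bar R :=
  ereal_inf [set (d x y)%:E | x in A & y in B].

Definition Lip (beta : R) (f : X -> R) : \bar R :=
  ereal_sup [set e | exists x y, x <> y /\
                     e = (`|f x - f y| / d x y `^ beta)%:E].

End QuasiMetric.

Section NormalSpace.
Context {R : realType} {disp : measure_display} {X : measurableType disp}.
Variables (mu : {measure set X -> \bar R}) (d : X -> X -> R).

Definition normal_order_space (theta : R) : Prop :=
  [/\ quasi_metric d,
      forall x r, measurable (qball d x r),
      0 < theta
    & exists A1 A2 K1 K2 K0 : R,
      [/\ [/\ 0 < A1, 0 < A2, 0 < K2, K2 <= 1 & 1 <= K1], 0 < K0 &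
      forall x r, 0 < r ->
      [/\ (r%:E <= K1%:E * mu setT -> (A1 * r)%:E <= mu (qball d x r))%E,
          (K1%:E * mu setT < r%:E -> qball d x r = setT)%E,
          (K2%:E * mu [set x] <= r%:E -> mu (qball d x r) <= (A2 * r)%:E)%E,
          (r%:E < K2%:E * mu [set x] -> qball d x r = [set x])%E
        & forall y z, d x z < r -> d y z < r ->
            `|d x z - d y z| <= K0 * r `^ (1 - theta) * d x y `^ theta]]].

(* The second disjunct is the constant atom of a space of finite measure. *)
Definition atom (a : X -> R) : Prop :=
  measurable_fun setT a /\
  ((exists x r, [/\ 0 < r,
      forall y, ~ qball d x r y -> a y = 0,
      ('N[mu]_+oo[EFin \o a] <= ((fine (mu (qball d x r)))^-1)%:E)%E
    & (\int[mu]_y (a y)%:E = 0)%E])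
   \/ a = cst (fine (mu setT))^-1).

Definition atomic_decomposition (f : X -> R) (la : nat -> R)
    (a : nat -> X -> R) : Prop :=
  [/\ forall i, atom (a i),
      (\sum_(i <oo) `|la i|%:E < +oo)%E
    & 'N[mu]_1[EFin \o (fun x => f x - \sum_(i < n) la i * a i x)%R]%E
        @[n --> \oo] --> 0%E].

Definition H1 : set (X -> R) :=
  [set f | mu.-integrable setT (EFin \o f) /\
           exists la a, atomic_decomposition f la a].

(* +oo when f has no atomic decomposition *)
Definition H1norm (f : X -> R) : \bar R :=
  ereal_inf [set s | exists la a,
    atomic_decomposition f la a /\ s = (\sum_(i <oo) `|la i|%:E)%E].

End NormalSpace.

(* Cubes of level n are represented by the set [E n] of subsets of X, so that
   a cube is a pair (n, Q) with [E n Q]; the same subset may occur at several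
   levels. *)
Section DyadicCubes.
Context {R : realType} {disp : measure_display} {X : measurableType disp}.
Variables (mu : {measure set X -> \bar R}) (d : X -> X -> R).

Record dyadic_cubes (delta a0 eta C1 C2 : R) (E : nat -> set (set X)) : Prop :=
  DyadicCubes {
  cube_measurable : forall k Q, E k Q -> measurable Q ;
  cube_cover : forall k, mu.-negligible (~` \bigcup_(Q in E k) Q) ;
  cube_nested : forall k l Q P, (k <= l)%N -> E k Q -> E l P ->
    P `<=` Q \/ P `&` Q = set0 ;
  cube_parent : forall k l Q, (l < k)%N -> E k Q ->
    exists! P, E l P /\ Q `<=` P ;
  cube_diam : forall k Q, E k Q -> (qdiam d Q <= (C1 * delta ^+ k)%:E)%E ;
  cube_ball : forall k Q, E k Q ->
    exists z, qball d z (a0 * delta ^+ k) `<=` Q ;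
  cube_boundary : forall k Q t, E k Q -> 0 <= t ->
    (mu [set x | Q x /\ qdist d [set x] (~` Q) <= (t * delta ^+ k)%:E]
       <= (C2 * t `^ eta)%:E * mu Q)%E ;
  cube_root : exists Q, E 0%N = [set Q] /\ mu.-negligible (~` Q)
}.

(* G_1(Q|E) for a cube Q of level n *)
Definition children (E : nat -> set (set X)) (n : nat) (Q : set X) :
  set (set X) := [set P | E n.+1 P /\ P `<=` Q].

(* G_1(Q|E) = {P_0, ..., P_N} has N + 1 elements. *)
Definition nchild (E : nat -> set (set X)) (n : nat) (Q : set X) : nat :=
  (#|` fset_set (children E n Q)|).-1.

(* [h n Q i] is h_{Q,i}, for Q of level n and 1 <= i <= N(Q). *)
Definition three_valued_system (E : nat -> set (set X)) (Ch : R)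
    (h : nat -> set X -> nat -> X -> R) : Prop :=
  forall n Q, E n Q ->
  (forall i, (1 <= i <= nchild E n Q)%N ->
    [/\ measurable_fun setT (h n Q i),
        forall x, ~ Q x -> h n Q i x = 0,
        forall P, children E n Q P ->
          forall x y, P x -> P y -> h n Q i x = h n Q i y,
        exists u v, forall x, [\/ h n Q i x = 0, h n Q i x = u | h n Q i x = v]
      & (\int[mu]_x (h n Q i x)%:E = 0)%E]) /\
  forall al : nat -> R,
    let s := Num.sqrt (\sum_(1 <= i < (nchild E n Q).+1) al i ^+ 2) in
    ((Ch^-1 * s)%:E <= 'N[mu]_2%:E[EFin \o
        (fun x => \sum_(1 <= i < (nchild E n Q).+1) al i * h n Q i x)%R]
      <= (Ch * s)%:E)%E.

(* Each [psi n] is indexed by nat; indices not needed carry the function 0.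
   [M] bounds the overlap of the supports. *)
Definition partitions_of_unity (beta tau delta : R) (M : nat)
    (psi : nat -> nat -> X -> R) : Prop :=
  (forall n x, [set k | psi n k x != 0] #<= `I_M /\
               \sum_(k \in [set: nat]) psi n k x = 1) /\
  (forall n k,
    [/\ measurable_fun setT (psi n k),
        forall x, 0 <= psi n k x,
        (qdiam d [set x | psi n k x != 0%R] <= (tau * delta ^+ n)%:E)%E
      & (Lip d beta (psi n k) <= ((tau * delta ^+ n) `^ (- beta))%:E)%E]).

(* K_n; only finitely many terms are nonzero at (x, y), and the terms with
   psi n k = 0 vanish since 0^-1 = 0. *)
Definition smoothing_kernel (psi : nat -> nat -> X -> R) (n : nat) (x y : X) :
    R :=
  \sum_(k \in [set: nat])
    psi n k x * psi n k y / fine ('N[mu]_1[EFin \o psi n k])%E.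

Definition phi_tilde (psi : nat -> nat -> X -> R)
    (h : nat -> set X -> nat -> X -> R) (n : nat) (Q : set X) (i : nat)
    (x : X) : R :=
  \int[mu]_y (smoothing_kernel psi n.+1 x y * h n Q i y).

Definition phi_cube (psi : nat -> nat -> X -> R)
    (h : nat -> set X -> nat -> X -> R) (n : nat) (Q : set X) (i : nat)
    (x : X) : R :=
  phi_tilde psi h n Q i x /
  fine ('N[mu]_2%:E[EFin \o phi_tilde psi h n Q i])%E.

(* [Pc n j] is P_{n,j}, for 1 <= j <= l. *)
Definition separated_splitting (E : nat -> set (set X)) (K : R) (l : nat)
    (Pc : nat -> nat -> set (set X)) : Prop :=
  [/\ forall n, E n = \bigcup_(j in [set j | (1 <= j <= l)%N]) Pc n j,
      forall n, trivIset [set j | (1 <= j <= l)%N] (Pc n)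
    & forall n j P Q, (1 <= j <= l)%N -> Pc n j P -> Pc n j Q -> P <> Q ->
        (K%:E * Order.max (mu P) (mu Q) <= qdist d P Q)%E].

(* The family F: [Some (n, Q)] is the cube Q of level n and [None] is X. *)
Definition cube_family (E : nat -> set (set X))
    (Pc : nat -> nat -> set (set X)) (m s j i0 : nat) :
    set (option (nat * set X)) :=
  [set q | match q with
           | None => True
           | Some (n, Q) => [/\ exists k, n = (m * k + s)%N,
                              Pc n j Q & (i0 <= nchild E n Q)%N]
           end].

Definition phi_family (psi : nat -> nat -> X -> R)
    (h : nat -> set X -> nat -> X -> R) (i0 : nat)
    (q : option (nat * set X)) : X -> R :=
  if q is Some (n, Q) then phi_cube psi h n Q i0 else cst 1.

End DyadicCubes.

Section SquareSummable.
Context {R : realType} {J : choiceType}.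
Implicit Types (x y : J -> R) (U : (J -> R) -> J -> R).

Definition l2sq x : \bar R := \esum_(j in [set: J]) (x j ^+ 2)%:E.

Definition l2 : set (J -> R) := [set x | (l2sq x < +oo)%E].

Definition l2dot x y : R := summability.sum (fun j => x j * y j : R^o).

(* U is only meaningful on [l2]. *)
Definition l2_operator U : Prop :=
  (forall (c : R) x y, l2 x -> l2 y ->
     U (fun j => c * x j + y j) = (fun j => c * U x j + U y j)) /\
  exists M : R, forall x, l2 x -> (l2sq (U x) <= M%:E * l2sq x)%E.

Definition l2_positive U : Prop :=
  (forall x y, l2 x -> l2 y -> l2dot (U x) y = l2dot x (U y)) /\
  (forall x, l2 x -> 0 <= l2dot (U x) x).

Definition l2_delta (q : J) : J -> R := fun j => (j == q)%:R.

(* (U e_q | e_p) *)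
Definition l2_coef U (p q : J) : R := U (l2_delta q) p.

(* [a] is the matrix of G^{-1/2}, the positive operator S with S^2 = G^{-1},
   where G is the positive bounded operator with matrix [g]. *)
Definition is_inv_sqrt_coef (g a : J -> J -> R) : Prop :=
  exists G S : (J -> R) -> J -> R,
    [/\ l2_operator G /\ l2_operator S,
        l2_positive G /\ l2_positive S,
        l2_coef G = g,
        l2_coef S = a
      & forall x, l2 x -> G (S (S x)) = x /\ S (S (G x)) = x].

End SquareSummable.

Section OrthonormalSystem.
Context {R : realType} {disp : measure_display} {X : measurableType disp}.
Variable mu : {measure set X -> \bar R}.
Context {J : choiceType}.

(* The series of the [u j] converges unconditionally to [g] in L^p(mu). *)
Definition Lp_sum (p : \bar R) (u : J -> X -> R) (g : X -> R) : Prop :=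
  [/\ forall j, measurable_fun setT (u j), measurable_fun setT g
    & (fun A : {fset J} =>
         'N[mu]_p[EFin \o (fun x => g x - \sum_(j <- A) u j x)%R]%E)
        @ totally --> 0%E].

Definition gram (phi : J -> X -> R) (p q : J) : R :=
  \int[mu]_x (phi p x * phi q x).

(* The f_q are determined up to mu-null sets only. *)
Definition is_orthonormalized (phi f : J -> X -> R) : Prop :=
  exists a, is_inv_sqrt_coef (gram phi) a /\
    forall q, Lp_sum 2%:E (fun p x => a p q * phi p x) (f q).

End OrthonormalSystem.

(* Main.v *)
Require Import Defs.
From mathcomp Require Import all_boot all_order all_algebra finmap.
From mathcomp Require Import all_classical all_reals all_analysis.
From mathcomp Require Import measurable_realfun ess_sup_inf.
From mathcomp Require Import zify lra.
Import Order.TTheory GRing.Theory Num.Theory.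
Import numFieldNormedType.Exports.

Set Implicit Arguments.
Unset Strict Implicit.
Unset Printing Implicit Defensive.

Local Open Scope classical_set_scope.
Local Open Scope ring_scope.

(* Two facts carry the theorem: the matrix of [G^(-1/2)] is almost diagonal, and such a matrix maps
   the coefficients of an atom to coefficients whose expansion is bounded in H1.

   Decay. The function [1] of the cube [X] is orthogonal to all the others, which have mean zero, so
   [G] splits off one diagonal entry; on the rest [G = I - T]. The separation of the cubes gives
   distinct functions of one level disjoint supports, and two different levels of the family are at
   least [m] apart. Across levels, the cancellation of the smaller function against the Hoelder
   regularity of the larger one bounds [T] by [sg ^+ k * om ^+ (2 * k)] up to a constant, with [k]
   the difference of the levels, [sg = delta^(1/2)] and [om = delta^(beta/2)] ([gm_le], [tt_facts]).
   For [m] large [T] is therefore small both on l2 and in sup norms weighted by the columns of the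
   kernel [wt p * wt q * ker (qd p q)], that is [(delta^k delta^l)^((1+beta)/2) / (delta^k + delta^l
   + d)^(1+beta)] for cubes of levels [k] and [l] ([schur_sg], [schur_wq]). The iteration that
   solves [(I + Y)^2 G = I] respects both norms and converges to [G^(-1/2)], whose entries inherit
   the decay ([S_le_weight], [a_le]).

   Atoms. A function of H1 is a sum of atoms, so a uniform bound for the expansion of one atom
   suffices ([proj_atoms], [proj_Hbd]). Let [b] be an atom on a ball of radius [r], and call a cube
   near if its size is at most [r] and it lies within a fixed multiple of [r] from the centre. The
   coefficients [(b|f_q)] of the other cubes are absolutely summable against the H1 norms of the
   [f_q] ([far_sum], [f_Hbd]). The near part is expanded again in the smoothed functions [ph p]: the
   terms away from the ball are again absolutely summable by the decay ([ee_far]), and the others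
   add up to a function of mean zero on a ball of radius [C3 * r] whose L2 norm is of order
   [r^(-1/2)] at most, by Bessel inequalities ([bb_Hbd]).

   Such a function is bounded in H1 although atoms are defined by sup norms: this is [L2_H1], proved
   by a Calderon-Zygmund stopping argument on the dyadic cubes. The constant atom is treated
   directly, since it only meets the function of the cube [X]. *)
#[global] Existing Instance summability.totally_filter.


(** * Integrable real functions and the L1 norm *)

Section L1.
Context {R : realType} {disp : measure_display} {X : measurableType disp}.
Variable mu : {measure set X -> \bar R}.
Implicit Types (f g : X -> R) (A : set X) (c : R).

Definition itg (f : X -> R) : Prop := mu.-integrable setT (EFin \o f).

Definition l1norm (f : X -> R) : R := \int[mu]_x `|f x|.

Lemma itg_meas f : itg f -> measurable_fun setT f.
Proof. by move/(measurable_int mu)/measurable_EFinP. Qed.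

Lemma itgD f g : itg f -> itg g -> itg (fun x => f x + g x).
Proof.
move=> If Ig; have := integrableD measurableT If Ig.
by apply: eq_integrable => // x _ /=; rewrite EFinD.
Qed.

Lemma itgZ c f : itg f -> itg (fun x => c * f x).
Proof.
move=> If; have := integrableZl measurableT c If.
by apply: eq_integrable => // x _ /=; rewrite EFinM.
Qed.

Lemma itgB f g : itg f -> itg g -> itg (fun x => f x - g x).
Proof.
move=> If Ig; have := integrableB measurableT If Ig.
by apply: eq_integrable => // x _ /=; rewrite EFinB.
Qed.

Lemma itgN f : itg f -> itg (fun x => - f x).
Proof.
move=> If; have := itgZ (-1) If.
by apply: eq_integrable => // x _ /=; rewrite mulN1r.
Qed.

Lemma itg0 : itg (fun=> 0).
Proof. exact: integrable0. Qed.

Lemma itg_norm f : itg f -> itg (fun x => `|f x|).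
Proof. exact: integrable_norm. Qed.

Lemma itg_sum (I : Type) (s : seq I) (P : pred I) (F : I -> X -> R) :
  (forall i, P i -> itg (F i)) -> itg (fun x => \sum_(i <- s | P i) F i x).
Proof.
move=> IF; have := @integrable_sum _ _ _ mu setT measurableT I s P
  (fun i => EFin \o F i) IF.
by apply: eq_integrable => // x _ /=; rewrite sumEFin.
Qed.

Lemma int_sum (I : Type) (s : seq I) (P : pred I) (F : I -> X -> R) :
  (forall i, P i -> itg (F i)) ->
  \int[mu]_x (\sum_(i <- s | P i) F i x) = \sum_(i <- s | P i) \int[mu]_x F i x.
Proof.
move=> IF; elim: s => [|i s IH].
  under eq_Rintegral do rewrite big_nil; rewrite big_nil.
  by rewrite Rintegral_cst// mul0r.
under eq_Rintegral do rewrite big_cons; rewrite big_cons.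
case: ifPn => Pi //.
by rewrite RintegralD// ?IH//; [exact: IF|exact: itg_sum].
Qed.

Lemma le_itg f g : measurable_fun setT f -> itg g ->
  {ae mu, forall x, `|f x| <= `|g x|} -> itg f.
Proof.
rewrite /itg => mf /integrableP[mg gfin] fg; apply/integrableP; split.
  exact/measurable_EFinP.
apply: le_lt_trans gfin; apply: ae_ge0_le_integral => //.
- by apply: measurableT_comp => //; exact/measurable_EFinP.
- by apply: measurableT_comp.
- by apply: filterS fg => x fg _; rewrite lee_fin.
Qed.

Lemma le_int f g : itg f -> itg g -> {ae mu, forall x, f x <= g x} ->
  \int[mu]_x f x <= \int[mu]_x g x.
Proof.
move=> If Ig fg; rewrite -subr_ge0 -RintegralB//.
have -> : \int[mu]_x (g x - f x) = \int[mu]_x `|g x - f x|.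
  congr fine; apply: ae_eq_integral => //.
  - by apply/measurable_EFinP/itg_meas/itgB.
  - by apply/measurable_EFinP/itg_meas/itg_norm/itgB.
  - by apply: filterS fg => x fg _ /=; rewrite ger0_norm// subr_ge0.
by apply: Rintegral_ge0.
Qed.

Lemma eq_ae_int f g : measurable_fun setT f -> measurable_fun setT g ->
  {ae mu, forall x, f x = g x} -> \int[mu]_x f x = \int[mu]_x g x.
Proof.
move=> mf mg fg; congr fine; apply: ae_eq_integral => //.
- exact/measurable_EFinP.
- exact/measurable_EFinP.
- by apply: filterS fg => x fg _ /=; rewrite fg.
Qed.

Lemma l1norm_ge0 f : 0 <= l1norm f.
Proof. exact: Rintegral_ge0. Qed.

Lemma l1norm0 : l1norm (fun=> 0) = 0.
Proof.
rewrite /l1norm; under eq_Rintegral do rewrite normr0.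
by rewrite Rintegral_cst// mul0r.
Qed.

Lemma le_int_l1 f : itg f -> `|\int[mu]_x f x| <= l1norm f.
Proof. by move=> If; exact: le_normr_Rintegral. Qed.

Lemma l1normD f g : itg f -> itg g ->
  l1norm (fun x => f x + g x) <= l1norm f + l1norm g.
Proof.
move=> If Ig; rewrite -RintegralD//; [|exact: itg_norm|exact: itg_norm].
apply: le_Rintegral => //; first by apply/itg_norm/itgD.
- by apply/itgD; apply/itg_norm.
- by move=> x _; exact: ler_normD.
Qed.

Lemma l1normZ c f : itg f -> l1norm (fun x => c * f x) = `|c| * l1norm f.
Proof.
move=> If; rewrite -RintegralZl//; last exact: itg_norm.
by apply: eq_Rintegral => x _; rewrite normrM.
Qed.

Lemma l1normN f : l1norm (fun x => - f x) = l1norm f.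
Proof. by apply: eq_Rintegral => x _; rewrite normrN. Qed.

Lemma l1normB f g : itg f -> itg g ->
  l1norm (fun x => f x - g x) <= l1norm f + l1norm g.
Proof.
move=> If Ig; rewrite -[l1norm g]l1normN; apply: l1normD => //.
exact: itgN.
Qed.

Lemma l1norm_distC f g : l1norm (fun x => f x - g x) = l1norm (fun x => g x - f x).
Proof. by apply: eq_Rintegral => x _; rewrite distrC. Qed.

Lemma l1norm_sum (I : Type) (s : seq I) (P : pred I) (F : I -> X -> R) :
  (forall i, P i -> itg (F i)) ->
  l1norm (fun x => \sum_(i <- s | P i) F i x) <=
    \sum_(i <- s | P i) l1norm (F i).
Proof.
move=> IF; rewrite -int_sum; last by move=> i Pi; apply/itg_norm/IF.
apply: le_Rintegral => //; first by apply/itg_norm/itg_sum.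
- by apply/itg_sum => i Pi; apply/itg_norm/IF.
- by move=> x _; exact: ler_norm_sum.
Qed.

Lemma le_l1norm f g : itg f -> itg g ->
  {ae mu, forall x, `|f x| <= g x} -> l1norm f <= \int[mu]_x g x.
Proof. by move=> If Ig fg; apply: le_int => //; apply/itg_norm. Qed.

Lemma eq_ae_l1 f g : measurable_fun setT f -> measurable_fun setT g ->
  {ae mu, forall x, f x = g x} -> l1norm f = l1norm g.
Proof.
move=> mf mg fg; apply: eq_ae_int.
- exact: measurableT_comp.
- exact: measurableT_comp.
- by apply: filterS fg => x ->.
Qed.

Lemma LnormE1 f : itg f -> 'N[mu]_1[EFin \o f]%E = (l1norm f)%:E.
Proof.
move=> If; rewrite Lnorm1 /l1norm fineK//.
exact/integrable_fin_num/itg_norm.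
Qed.

Lemma l1norm_eq0 f : itg f -> l1norm f = 0 -> {ae mu, forall x, f x = 0}.
Proof.
move=> If f0; have := @ae_eq_integral_abs _ _ _ mu setT measurableT (EFin \o f).
move=> /(_ (measurable_int _ If))[h _].
have /h : (\int[mu]_x `|(EFin \o f) x|)%E = 0%E.
  by rewrite -Lnorm1 LnormE1// f0.
by apply: filterS => x /(_ Logic.I) /= [].
Qed.

Hypothesis muT : (mu setT < +oo)%E.

Lemma mu_fin A : measurable A -> mu A \is a fin_num.
Proof.
move=> mA; rewrite ge0_fin_numE//; apply: le_lt_trans muT.
by apply: le_measure => //; rewrite inE.
Qed.

Lemma mu_ltoo A : measurable A -> (mu A < +oo)%E.
Proof. by move=> /mu_fin; rewrite ge0_fin_numE. Qed.

Lemma itg_cst c : itg (fun=> c).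
Proof.
apply: measurable_bounded_integrable => //.
by exists `|c|; split => // y cy x _; exact: ltW.
Qed.

Lemma itg_indic A c : measurable A -> itg (fun x => c * \1_A x).
Proof.
move=> mA; apply: (le_itg _ (itg_cst c)).
  by apply: measurable_funM => //.
apply: aeW => x; rewrite normrM ler_piMr// indicE.
by case: (_ \in _); rewrite ?normr1// normr0.
Qed.

Lemma int_indic A c : measurable A ->
  \int[mu]_x (c * \1_A x) = c * fine (mu A).
Proof.
move=> mA; rewrite -[in RHS](@Rintegral_cst _ _ _ mu)// [RHS]Rintegral_mkcond.
apply: eq_Rintegral => x _; rewrite indicE patchE.
by case: (_ \in _); rewrite ?mulr1 ?mulr0.
Qed.

Lemma itg_bdd A c f : measurable A -> measurable_fun setT f ->
  {ae mu, forall x, `|f x| <= c * \1_A x} -> itg f.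
Proof.
move=> mA mf h; apply: (le_itg mf (itg_indic c mA)).
by apply: filterS h => x h; apply: le_trans h _; exact: ler_norm.
Qed.

Lemma l1norm_bdd A c f : measurable A -> measurable_fun setT f ->
  {ae mu, forall x, `|f x| <= c * \1_A x} -> l1norm f <= c * fine (mu A).
Proof.
move=> mA mf h; rewrite -int_indic//; apply: le_l1norm => //.
- exact: itg_bdd h.
- exact: itg_indic.
Qed.

Lemma itgM f g c : itg f -> measurable_fun setT g ->
  {ae mu, forall x, `|g x| <= c} -> itg (fun x => f x * g x).
Proof.
move=> If mg gc; apply: (le_itg _ (itgZ c If)).
  by apply: measurable_funM => //; exact: itg_meas.
apply: filterS gc => x gc; rewrite !normrM mulrC ler_wpM2r//.
by apply: le_trans gc _; exact: ler_norm.
Qed.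

Lemma le_intM f g c : itg f -> measurable_fun setT g ->
  {ae mu, forall x, `|g x| <= c} -> `|\int[mu]_x (f x * g x)| <= c * l1norm f.
Proof.
move=> If mg gc; have Ifg := itgM If mg gc.
apply: le_trans (le_int_l1 Ifg) _; rewrite -RintegralZl//; last exact: itg_norm.
apply: le_l1norm => //; first by apply/itgZ/itg_norm.
by apply: filterS gc => x gc; rewrite normrM mulrC ler_wpM2r.
Qed.

End L1.


(** * Tails and reindexing of sums *)

Section Sums.
Context {R : realType}.

Lemma tail_small (u : nat -> R) (C : R) : (forall i, 0 <= u i) ->
  (forall n, \sum_(i < n) u i <= C) ->
  forall e, 0 < e -> exists N, forall M, \sum_(N <= i < M) u i <= e.
Proof.
move=> u0 uC e e0; pose S := range (fun n => \sum_(i < n) u i).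
have hS : has_sup S.
  split; first by exists (\sum_(i < 0) u i), 0%N.
  by exists C => _ [n _ <-]; exact: uC.
have [_ [N _ <-] supN] := sup_adherent e0 hS.
exists N => M; have [NM|/ltnW MN] := leqP N M; last by rewrite big_geq ?ltW.
have : \sum_(i < M) u i <= sup S by apply: ub_le_sup => //; [case: hS|exists M].
rewrite -(big_mkord xpredT) (big_cat_nat _ NM)//= big_mkord; lra.
Qed.

Lemma fset_tail (J : choiceType) (t : J -> R) (C : R) : (forall j, 0 <= t j) ->
  (forall A : {fset J}, \sum_(j <- A) t j <= C) ->
  forall e, 0 < e -> exists A0 : {fset J}, forall A : {fset J},
    [disjoint A & A0]%fset -> \sum_(j <- A) t j <= e.
Proof.
move=> t0 tC e e0; pose S := range (fun A : {fset J} => \sum_(j <- A) t j).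
have hS : has_sup S.
  split; first by exists (\sum_(j <- fset0) t j), fset0.
  by exists C => _ [A _ <-]; exact: tC.
have [_ [A0 _ <-] supA] := sup_adherent e0 hS.
exists A0 => A AA0.
have : \sum_(j <- (A `|` A0)%fset) t j <= sup S.
  by apply: ub_le_sup => //; [case: hS|exists (A `|` A0)%fset].
rewrite (big_fsetID _ (mem A))/=.
have -> : [fset x in (A `|` A0)%fset | x \in A]%fset = A.
  apply/fsetP => x; rewrite !inE /=; case: (x \in A); rewrite ?andbT ?andbF//.
have -> : [fset x in (A `|` A0)%fset | x \notin A]%fset = A0.
  apply/fsetP => x; rewrite !inE /=; have := fdisjointP AA0 x.
  by case: (x \in A) => //= h; rewrite ?andbT ?andbF// (negbTE (h isT)).
lra.
Qed.

Lemma fset_sum_le (J : choiceType) (t : J -> R) (A B : {fset J}) :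
  (forall j, 0 <= t j) -> (A `<=` B)%fset ->
  \sum_(j <- A) t j <= \sum_(j <- B) t j.
Proof.
move=> t0 AB; rewrite [leRHS](big_fsetID _ (mem A))/=.
have -> : [fset x in B | x \in A]%fset = A.
  apply/fsetP => x; rewrite !inE /= andbC; case xA: (x \in A) => //=.
  by rewrite (fsubsetP AB).
by rewrite lerDl sumr_ge0.
Qed.

(** The codes below [N] stand for finitely many pairs, all of which lie in any large enough square.
    This merges countably many atomic decompositions into a single one. *)
Lemma sum_pickle (N : nat) : exists M0, forall M,
  (M0 <= M)%N -> forall g : nat -> nat -> R,
  \sum_(n < N) (if @pickle_inv (nat * nat)%type n is Some p then g p.1 p.2 else 0)
  = \sum_(i < M) \sum_(k < M) (if (@choice.pickle (nat * nat)%type (i : nat, k : nat) < N)%N then g i k else 0).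
Proof.
elim: N => [|N [M0 IH]].
  exists 0%N => M _ g; rewrite big_ord0 big1// => i _; rewrite big1// => k _.
have [M1 hM1] : exists M1, forall p, pickle_inv N = Some p ->
    (p.1 < M1)%N /\ (p.2 < M1)%N.
  case: (pickle_inv N) => [[i k]|]; last by exists 0%N.
  exists (maxn i k).+1 => p [<-] /=.
  by rewrite !ltnS leq_maxl leq_maxr.
exists (maxn M0 M1) => M; rewrite geq_max => /andP[M0M M1M] g.
rewrite big_ord_recr/= (IH _ M0M).
have -> : (if @pickle_inv (nat * nat)%type N is Some p then g p.1 p.2 else 0) =
    \sum_(i < M) \sum_(k < M) (if @choice.pickle (nat * nat)%type (i : nat, k : nat) == N then g i k else 0).
  case E : (@pickle_inv (nat * nat)%type N) => [[i0 k0]|].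
    have [/= i0M k0M] := hM1 _ E.
    have pN : @choice.pickle (nat * nat)%type (i0, k0) = N by have := @pickle_invK (nat * nat)%type N; rewrite E.
    rewrite (bigD1 (Ordinal (leq_trans i0M M1M)))//=.
    rewrite (bigD1 (Ordinal (leq_trans k0M M1M)))//= pN eqxx big1 => [|k kk0].
      rewrite addr0 big1 ?addr0// => i ii0; rewrite big1// => k _.
      case: eqP => // pE; move: ii0; rewrite -val_eqE/=.
      by have /(pcan_inj (@choice.pickleK (nat * nat)%type)) [-> _] := etrans pE (esym pN); rewrite eqxx.
    case: eqP => // pE; move: kk0; rewrite -val_eqE/=.
    by have /(pcan_inj (@choice.pickleK (nat * nat)%type)) [->] := etrans pE (esym pN); rewrite eqxx.
  rewrite big1// => i _; rewrite big1// => k _; case: eqP => // pN.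
  by have := @pickleK_inv (nat * nat)%type (i : nat, k : nat); rewrite pN E.
rewrite -big_split/=; apply: eq_bigr => i _; rewrite -big_split/=.
apply: eq_bigr => k _; rewrite ltnS [in RHS]leq_eqVlt.
by case: eqP => [->|_] /=; rewrite ?ltnn ?add0r ?addr0.
Qed.

End Sums.

Lemma cvgE0P {R : realType} {T : Type} {F : set_system T} {FF : Filter F}
    (u : T -> R) : (forall x, 0 <= u x) ->
  ((u x)%:E @[x --> F] --> 0%E) <-> (forall e, 0 < e -> \forall x \near F, u x <= e).
Proof.
move=> u0; split => [cu e e0|h].
  have /fine_cvgP[_ /cvgrPdist_le/(_ e e0)] := cu.
  by apply: filterS => x /=; rewrite sub0r normrN ger0_norm.
apply: cvg_EFin; first exact: nearW.
apply/cvgrPdist_le => e e0; apply: filterS (h e e0) => x /=.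
by rewrite sub0r normrN ger0_norm.
Qed.

(** * Completeness of L1 *)

Section L1complete.
Context {R : realType} {disp : measure_display} {X : measurableType disp}.
Variable mu : {measure set X -> \bar R}.

(** The sum of the absolute values is integrable, hence finite almost everywhere, and it dominates
    the partial sums. *)
Lemma l1_series (F : nat -> X -> R) (C : R) : (forall n, itg mu (F n)) ->
  (forall n, \sum_(i < n) l1norm mu (F i) <= C) ->
  exists g, itg mu g /\ forall e, 0 < e -> exists N, forall n, (N <= n)%N ->
    l1norm mu (fun x => g x - \sum_(i < n) F i x) <= e.
Proof.
move=> IF FC.
pose H x := (\sum_(0 <= i <oo) `|F i x|%:E)%E.
have mabs i : measurable_fun setT (fun x => `|F i x|%:E).
  by apply/measurable_EFinP/itg_meas; apply: itg_norm.
have mH : measurable_fun setT H by apply: ge0_emeasurable_sum.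
have intH : (\int[mu]_x H x <= C%:E)%E.
  rewrite integral_nneseries//.
  apply: lime_le; first by apply: is_cvg_nneseries => i _ _; apply: integral_ge0.
  apply: nearW => n; rewrite big_mkord.
  rewrite (eq_bigr (fun i : 'I_n => (l1norm mu (F i))%:E)) => [|i _].
    by rewrite sumEFin lee_fin; exact: FC.
  by rewrite -LnormE1// Lnorm1.
have H0 x : (0 <= H x)%E by apply: nneseries_ge0.
have IH : mu.-integrable setT H.
  apply/integrableP; split => //; apply: le_lt_trans (ltry C).
  by apply: le_trans intH; under eq_integral do rewrite gee0_abs//.
pose A := [set x | H x \is a fin_num].
have mA : measurable A by have := emeasurable_fin_num measurableT mH; rewrite setTI.
(* Cutting off where the majorant is infinite makes the partial sums converge at every point, so
   that the limit is measurable. *)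
pose G n x := (\sum_(i < n) F i x) * \1_A x.
have cG x : cvgn (G ^~ x).
  have [xA|xA] := boolP (x \in A); last first.
    apply: (@cvgP _ _ 0); rewrite (_ : G ^~ x = fun=> 0) ?cvg_cst//.
      exact: cvg_cst.
    by apply/funext => n; rewrite /G indicE (negbTE xA) mulr0.
  have -> : G ^~ x = series (F ^~ x).
    by apply/funext => n; rewrite /G indicE xA mulr1 /series/= big_mkord.
  apply: normed_cvg; apply: nondecreasing_is_cvgn.
    by apply/nondecreasing_seqP => n; rewrite /normed_series_of /series/= big_nat_recr//= lerDl.
  exists (fine (H x)) => _ [n _ <-]; rewrite -lee_fin fineK; last by rewrite inE in xA.
  rewrite /normed_series_of /series/= -sumEFin.
  exact: (@nneseries_lim_ge _ (fun i => `|F i x|%:E) xpredT 0%N n).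
pose g x := limn (G ^~ x).
have mG n : measurable_fun setT (G n).
  by apply: measurable_funM => //; apply/itg_meas/itg_sum.
have mg : measurable_fun setT g.
  by apply: (@measurable_fun_cvg _ _ _ _ G) => // x _; exact: cG.
have mS n : measurable_fun setT (fun x => (\sum_(i < n) F i x)%:E).
  by apply/measurable_EFinP/itg_meas/itg_sum.
have mgE : measurable_fun setT (EFin \o g) by exact/measurable_EFinP.
have cgE : \forall x \ae mu, setT x ->
    (\sum_(i < n) F i x)%:E @[n --> \oo] --> (EFin \o g) x.
  apply: filterS (integrable_ae measurableT IH) => x /(_ Logic.I) xA _.
  apply: cvg_EFin; first exact: nearW.
  rewrite (_ : fine \o _ = G ^~ x); first exact: cG.
  by apply/funext => n; rewrite /G indicE mem_set//= mulr1.
have domH : \forall x \ae mu, forall n, setT x ->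
    (`|(\sum_(i < n) F i x)%:E| <= H x)%E.
  apply: aeW => x n _ /=.
  apply: le_trans (@nneseries_lim_ge _ (fun i => `|F i x|%:E) xpredT 0%N n _) => //.
  by rewrite big_mkord sumEFin lee_fin ler_norm_sum.
have [Ig lim0 _] := @dominated_convergence _ _ _ mu setT measurableT
   (fun n x => (\sum_(i < n) F i x)%:E) (EFin \o g) H
   mS mgE cgE IH domH.
exists g; split => // e e0.
have In n : itg mu (fun x => \sum_(i < n) F i x - g x).
  by apply: itgB => //; exact: itg_sum.
have {}lim0 : (l1norm mu (fun x => \sum_(i < n) F i x - g x))%:E @[n --> \oo] --> 0%E.
  rewrite (_ : (fun n => _) = (fun n => \int[mu]_x `|(\sum_(i < n) F i x)%:E - (EFin \o g) x|)%E)//.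
  by apply/funext => n; rewrite -LnormE1// Lnorm1.
have [N _ hN] := (cvgE0P (fun n => l1norm_ge0 _ _)).1 lim0 _ e0.
by exists N => n /hN /=; rewrite l1norm_distC.
Qed.

End L1complete.


Lemma sum_const_le (R : realType) (x : R) (n : nat) : 0 <= x ->
  \sum_(i < n) x / (n%:R + 1) <= x.
Proof.
move=> x0; rewrite sumr_const card_ord -[_ *+ n]mulr_natr -mulrA ler_piMr//.
by rewrite mulrC ler_pdivrMr ?ltr_wpDl// mul1r lerDl.
Qed.

(** * Membership in H1 with an explicit bound *)

Section Hardy.
Context {R : realType} {disp : measure_display} {X : measurableType disp}.
Variables (mu : {measure set X -> \bar R}) (d : X -> X -> R).
Hypothesis muT0 : (0 < mu setT)%E.
Hypothesis muT : (mu setT < +oo)%E.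
Hypothesis mball : forall x r, measurable (qball d x r).
Implicit Types (f g : X -> R) (A : set X) (c : R).

Lemma LnormooP f c :
  ('N[mu]_+oo[EFin \o f] <= c%:E)%E <-> {ae mu, forall x, `|f x| <= c}.
Proof.
rewrite unlock /= muT0; split => [/ess_supP|h].
  by apply: filterS => x /=; rewrite lee_fin.
by apply/ess_supP; apply: filterS h => x /=; rewrite lee_fin.
Qed.

Lemma atom_l1 a : atom mu d a -> itg mu a /\ l1norm mu a <= 1.
Proof.
case=> ma [[x [r [r0 a0 /LnormooP ale _]]]|->]; last first.
  have I1 : itg mu (cst (fine (mu setT))^-1) by apply: itg_cst.
  split=> //; rewrite /l1norm (_ : \int[mu]_x _ = \int[mu]_(x in setT) `|(fine (mu setT))^-1|)//.
  rewrite Rintegral_cst// ger0_norm ?invr_ge0 ?fine_ge0// mulVf// gt_eqF//.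
  by rewrite fine_gt0// muT0 muT.
have h : {ae mu, forall y, `|a y| <= (fine (mu (qball d x r)))^-1 * \1_(qball d x r) y}.
  apply: filterS ale => y ay; rewrite indicE; have [yB|yB] := boolP (y \in _).
    by rewrite mulr1.
  by rewrite a0 ?normr0 ?mulr0//; move/negP: yB; rewrite inE.
split; first exact: itg_bdd h.
apply: le_trans (l1norm_bdd muT (mball x r) ma h) _.
have : 0 <= fine (mu (qball d x r)) by rewrite fine_ge0.
by rewrite le_eqVlt => /predU1P[<-|m0]; rewrite ?mulr0// mulVf// gt_eqF.
Qed.

(** A real-valued certificate for a bound of the H1 norm: one decomposition whose partial sums of
    coefficients stay below [c]. Such bounds can be added and summed without the infimum in
    [H1norm]; [atomic_Hbd] and [Hbd_atomic] translate between the two forms. *)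
Definition Hbd f c : Prop := itg mu f /\ exists (la : nat -> R) (a : nat -> X -> R),
  [/\ forall i, atom mu d (a i), forall n, \sum_(i < n) `|la i| <= c
    & forall e, 0 < e -> exists N, forall n, (N <= n)%N ->
        l1norm mu (fun x => f x - \sum_(i < n) la i * a i x) <= e].

Lemma Hbd_itg f c : Hbd f c -> itg mu f. Proof. by case. Qed.

Lemma itg_la (la : nat -> R) (a : nat -> X -> R) i : (forall i, atom mu d (a i)) -> itg mu (fun x => la i * a i x).
Proof. by move=> /(_ i)/atom_l1[Ia _]; apply: itgZ. Qed.

Lemma atomic_Hbd f la a c : itg mu f -> atomic_decomposition mu d f la a ->
  (\sum_(i <oo) `|la i|%:E <= c%:E)%E -> Hbd f c.
Proof.
move=> If [at_ _ lim0] sc; split => //; exists la, a; split => // [n|e e0].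
  rewrite -lee_fin -sumEFin; apply: le_trans sc.
  by have := @nneseries_lim_ge _ (fun i => `|la i|%:E) xpredT 0%N n; rewrite big_mkord; apply.
have {}lim0 : (l1norm mu (fun x => f x - \sum_(i < n) la i * a i x))%:E @[n --> \oo] --> 0%E.
  rewrite (_ : (fun n => _) = (fun n => 'N[mu]_1[EFin \o (fun x => f x - \sum_(i < n) la i * a i x)%R])%E)//.
  apply/funext => n; rewrite LnormE1//; apply: itgB => //.
  by apply: itg_sum => i _; exact: itg_la.
have [N _ hN] := (cvgE0P (fun n => l1norm_ge0 _ _)).1 lim0 _ e0.
by exists N => n /hN.
Qed.

Lemma Hbd_atomic f c : Hbd f c -> exists la a, atomic_decomposition mu d f la a /\
  (\sum_(i <oo) `|la i|%:E <= c%:E)%E.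
Proof.
move=> [If [la [a [at_ sc lim0]]]]; exists la, a.
have sE : (\sum_(i <oo) `|la i|%:E <= c%:E)%E.
  apply: lime_le; first exact: is_cvg_nneseries.
  by apply: nearW => n; rewrite big_mkord sumEFin lee_fin.
split => //; split => //; first by rewrite (le_lt_trans sE)// ltry.
rewrite (_ : (fun n => _) = (fun n => (l1norm mu (fun x => f x - \sum_(i < n) la i * a i x))%:E)); last first.
  apply/funext => n; rewrite LnormE1//; apply: itgB => //.
  by apply: itg_sum => i _; exact: itg_la.
apply/cvgE0P => [n|e e0]; first exact: l1norm_ge0.
by have [N hN] := lim0 _ e0; exists N => // n /hN.
Qed.

Lemma Hbd_ge0 f c : Hbd f c -> 0 <= c.
Proof. by move=> [_ [la [a [_ /(_ 0%N)]]]]; rewrite big_ord0. Qed.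

Lemma HbdW f c c' : Hbd f c -> c <= c' -> Hbd f c'.
Proof.
move=> [If [la [a [at_ sc lim0]]]] cc; split => //; exists la, a; split => // n.
exact: le_trans cc.
Qed.

Lemma Hbd_ext f g c : f = g -> Hbd f c -> Hbd g c. Proof. by move=> ->. Qed.

Lemma Hbd_l1 f c : Hbd f c -> l1norm mu f <= c.
Proof.
move=> [If [la [a [at_ sc lim0]]]]; apply/ler_addgt0Pr => e e0.
have [N /(_ N (leqnn _)) hN] := lim0 _ e0.
have IS : itg mu (fun x => \sum_(i < N) la i * a i x).
  by apply: itg_sum => i _; exact: itg_la.
have -> : f = (fun x => (f x - \sum_(i < N) la i * a i x) + \sum_(i < N) la i * a i x).
  by apply/funext => x; rewrite subrK.
apply: le_trans (l1normD (itgB If IS) IS) _; rewrite addrC lerD//.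
apply: le_trans (sc N); apply: le_trans (l1norm_sum _ _) _.
  by move=> i _; exact: itg_la.
apply: ler_sum => i _; have [Ia a1] := atom_l1 (at_ i).
by rewrite l1normZ// ler_piMr.
Qed.

(** The zero atom pads decompositions, at indices that code no pair or lie beyond a finite sum. *)
Lemma atom0 : atom mu d (fun=> 0).
Proof.
split; first exact: measurable_cst.
left; exists point, 1; split => //.
- apply/LnormooP; apply: aeW => x; rewrite normr0 invr_ge0 fine_ge0//.
- by rewrite integral0.
Qed.

Lemma Hbd_atom a c : atom mu d a -> Hbd (fun x => c * a x) `|c|.
Proof.
move=> at_; split; first by apply: itgZ; case: (atom_l1 at_).
exists (fun i => if i is 0%N then c else 0), (fun i => if i is 0%N then a else fun=> 0).
split => [[|i]//|[|n]|e e0]; first exact: atom0.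
- by rewrite big_ord0.
- by rewrite big_ord_recl big1 ?addr0// => i _; rewrite /= normr0.
- exists 1%N => -[//|n] _; rewrite (_ : (fun x => _) = (fun=> 0)) ?l1norm0 ?ltW//.
  by apply/funext => x; rewrite big_ord_recl big1 ?addr0 ?subrr// => i _; rewrite /= mul0r.
Qed.

Lemma Hbd0 : Hbd (fun=> 0) 0.
Proof.
have := Hbd_atom 0 atom0; rewrite normr0; apply: Hbd_ext.
by apply/funext => x; rewrite mul0r.
Qed.

(** The decompositions of all terms are merged along an enumeration of pairs. Every partial sum of
    the merged coefficients is contained in a square, hence bounded by a partial sum of [cs]. *)
Lemma Hbd_series (F : nat -> X -> R) (cs : nat -> R) f C :
  (forall i, Hbd (F i) (cs i)) -> (forall n, \sum_(i < n) cs i <= C) ->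
  itg mu f -> (forall e, 0 < e -> exists N, forall n, (N <= n)%N ->
    l1norm mu (fun x => f x - \sum_(i < n) F i x) <= e) -> Hbd f C.
Proof.
move=> HF csC If fF; split => //.
have cs0 i := Hbd_ge0 (HF i).
have IF i := Hbd_itg (HF i).
have /choice[la /choice[a laP]] : forall i, exists (la : nat -> R) (a : nat -> X -> R), [/\ forall k, atom mu d (a k),
    forall n, \sum_(k < n) `|la k| <= cs i
    & forall e, 0 < e -> exists N, forall n, (N <= n)%N ->
        l1norm mu (fun x => F i x - \sum_(k < n) la k * a k x) <= e].
  by move=> i; case: (HF i).
have at_ i k : atom mu d (a i k) by case: (laP i).
have sla i n : \sum_(k < n) `|la i k| <= cs i by case: (laP i).
pose la' n := if @pickle_inv (nat * nat)%type n is Some p then la p.1 p.2 else 0.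
pose a' n : X -> R := if @pickle_inv (nat * nat)%type n is Some p then a p.1 p.2 else fun=> 0.
exists la', a'; split => [n|N|e e0].
- by rewrite /a'; case: pickle_inv => [p|]; [exact: at_|exact: atom0].
- have [M0 /(_ M0 (leqnn _) (fun i k => `|la i k|))] := @sum_pickle R N.
  rewrite (eq_bigr (fun n : 'I_N => `|la' n|)) => [->|n _]; last first.
    by rewrite /la'; case: pickle_inv => // ; rewrite normr0.
  apply: le_trans (csC M0); apply: ler_sum => i _.
  by apply: le_trans (sla i M0); apply: ler_sum => k _; case: ifP.
- have e4 : 0 < e / 4 by rewrite divr_gt0.
  have [N1 hN1] := fF _ e4.
  have [N2 hN2] := tail_small cs0 csC e4.
  pose I := maxn N1 N2.
  have eI : 0 < e / 4 / (I%:R + 1) by rewrite divr_gt0// ltr_wpDl.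
  have /choice[J1 hJ1] : forall i, exists J, forall n, (J <= n)%N ->
      l1norm mu (fun x => F i x - \sum_(k < n) la i k * a i k x) <= e / 4 / (I%:R + 1).
    by move=> i; case: (laP i) => _ _ /(_ _ eI).
  have /choice[J2 hJ2] : forall i, exists J, forall n,
      \sum_(J <= k < n) `|la i k| <= e / 4 / (I%:R + 1).
    by move=> i; apply: (tail_small _ (sla i)).
  pose J := \max_(i < I) maxn (J1 i) (J2 i).
  (* From [N0] on, all pairs of the rectangle [I] times [J] have been enumerated; the other pairs
     met so far are controlled by tails only. *)
  pose N0 := (\max_(i < I) \max_(k < J) (@choice.pickle (nat * nat)%type (i : nat, k : nat)).+1)%N.
  exists N0 => N NN.
  have [M0 HM0] : exists M0, forall M, (M0 <= M)%N -> forall x,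
     \sum_(n < N) la' n * a' n x =
     \sum_(i < M) \sum_(k < M) (if (@choice.pickle (nat * nat)%type (i : nat, k : nat) < N)%N
         then la i k * a i k x else 0).
    have [M0 hM0] := @sum_pickle R N.
    exists M0 => M MM x; rewrite -(hM0 M MM (fun i k => la i k * a i k x)).
    by apply: eq_bigr => n _; rewrite /la' /a'; case: pickle_inv => //; rewrite mul0r.
  pose M := maxn M0 (maxn I J).
  have IM : (I <= M)%N := leq_trans (leq_maxl I J) (leq_maxr _ _).
  have JM : (J <= M)%N := leq_trans (leq_maxr I J) (leq_maxr _ _).
  pose u i k x := la i k * a i k x.
  have Iu i k : itg mu (u i k) by apply: itgZ; case: (atom_l1 (at_ i k)).
  have lu i k : l1norm mu (u i k) <= `|la i k|.
    by have [Ia a1] := atom_l1 (at_ i k); rewrite l1normZ// ler_piMr.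
  pose v i k x := if (@choice.pickle (nat * nat)%type (i : nat, k : nat) < N)%N then u i k x else 0.
  have Iv i k : itg mu (v i k) by rewrite /v; case: (_ < N)%N => //; exact: itg0.
  have lv i k : l1norm mu (v i k) <= `|la i k|.
    by rewrite /v; case: (_ < N)%N => //; rewrite (@l1norm0 _ _ _ mu).
  have vE i k x : (i < I)%N -> (k < J)%N -> v i k x = u i k x.
    move=> iI kJ; rewrite /v ifT//; apply: leq_trans NN.
    apply: leq_trans (leq_bigmax (Ordinal iI)).
    by apply: leq_trans (leq_bigmax (Ordinal kJ)).
  (* Four errors, each at most [e / 4]: the tail of the series, the tails of the first [I]
     decompositions, and the enumerated pairs to the right of the rectangle and below it. *)
  have -> : (fun x => f x - \sum_(n < N) la' n * a' n x) = (fun x =>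
      (f x - \sum_(i < I) F i x) + \sum_(0 <= i < I) (F i x - \sum_(k < J) u i k x)
      - (\sum_(0 <= i < I) \sum_(J <= k < M) v i k x + \sum_(I <= i < M) \sum_(0 <= k < M) v i k x)).
    apply/funext => x; rewrite (HM0 M) ?leq_maxl//.
    rewrite -(big_mkord xpredT (fun i => \sum_(k < M) v i k x)) (big_cat_nat _ IM)//=.
    rewrite [X in _ = _ + X - _]sumrB !big_mkord.
    have -> : \sum_(i < I) \sum_(k < M) v i k x =
        \sum_(i < I) \sum_(k < J) u i k x + \sum_(i < I) \sum_(J <= k < M) v i k x.
      rewrite -big_split/=; apply: eq_bigr => i _.
      rewrite -(big_mkord xpredT (fun k => v i k x)) (big_cat_nat _ JM)//= big_mkord.
      by congr (_ + _); apply: eq_bigr => k _; rewrite vE.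
    have -> : \sum_(I <= i < M) \sum_(k < M) v i k x = \sum_(I <= i < M) \sum_(0 <= k < M) v i k x.
      by apply: eq_bigr => i _; rewrite big_mkord.
    lra.
  have IA : itg mu (fun x => f x - \sum_(i < I) F i x) by apply: itgB => //; exact: itg_sum.
  have IBi i : itg mu (fun x => F i x - \sum_(k < J) u i k x) by apply: itgB => //; exact: itg_sum.
  have IB : itg mu (fun x => \sum_(0 <= i < I) (F i x - \sum_(k < J) u i k x)).
    by apply: itg_sum.
  have ICi i a1 b : itg mu (fun x => \sum_(a1 <= k < b) v i k x) by apply: itg_sum.
  have IC a1 b a2 b2 : itg mu (fun x => \sum_(a1 <= i < b) \sum_(a2 <= k < b2) v i k x).
    by apply: itg_sum.
  apply: le_trans (l1normB (itgD IA IB) (itgD (IC _ _ _ _) (IC _ _ _ _))) _.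
  have hA := hN1 I (leq_maxl _ _).
  have hAB := l1normD IA IB.
  have hCD := l1normD (IC 0%N I J M) (IC I M 0%N M).
  have hB : l1norm mu (fun x => \sum_(0 <= i < I) (F i x - \sum_(k < J) u i k x)) <= e / 4.
    apply: le_trans (l1norm_sum _ _) _ => //.
    rewrite big_mkord; apply: (@le_trans _ _ (\sum_(i < I) e / 4 / (I%:R + 1))).
      apply: ler_sum => i _; apply: hJ1; apply: leq_trans (leq_bigmax i).
      exact: leq_maxl.
    exact/sum_const_le/ltW.
  have hC : l1norm mu (fun x => \sum_(0 <= i < I) \sum_(J <= k < M) v i k x) <= e / 4.
    apply: le_trans (l1norm_sum _ _) _ => //.
    rewrite big_mkord; apply: (@le_trans _ _ (\sum_(i < I) e / 4 / (I%:R + 1))).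
      apply: ler_sum => i _; apply: le_trans (l1norm_sum _ _) _ => //.
      apply: le_trans (hJ2 i M); apply: (@le_trans _ _ (\sum_(J <= k < M) `|la i k|)).
        exact: ler_sum.
      have J2J : (J2 i <= J)%N.
        by apply: leq_trans (leq_bigmax i); exact: leq_maxr.
      by rewrite [leRHS](big_cat_nat J2J JM)//= lerDr sumr_ge0.
    exact/sum_const_le/ltW.
  have hD : l1norm mu (fun x => \sum_(I <= i < M) \sum_(0 <= k < M) v i k x) <= e / 4.
    apply: le_trans (l1norm_sum _ _) _ => //.
    apply: (@le_trans _ _ (\sum_(I <= i < M) cs i)).
      apply: ler_sum => i _; apply: le_trans (l1norm_sum _ _) _ => //.
      by rewrite big_mkord; apply: le_trans (sla i M); apply: ler_sum.
    apply: le_trans (hN2 M); have N2I : (N2 <= I)%N by rewrite leq_maxr.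
    by rewrite [leRHS](big_cat_nat N2I IM)//= lerDr sumr_ge0.
  lra.
Qed.

End Hardy.


(** * Operations on H1 bounds *)

Section HardyOps.
Context {R : realType} {disp : measure_display} {X : measurableType disp}.
Variables (mu : {measure set X -> \bar R}) (d : X -> X -> R).
Hypothesis muT0 : (0 < mu setT)%E.
Hypothesis muT : (mu setT < +oo)%E.
Hypothesis mball : forall x r, measurable (qball d x r).
Implicit Types (f g : X -> R) (A : set X) (c : R).

Local Notation Hbd := (Hbd mu d).

Lemma HbdD f g c c' : Hbd f c -> Hbd g c' -> Hbd (fun x => f x + g x) (c + c').
Proof.
move=> Hf Hg; pose F i := match i with 0%N => f | 1%N => g | _ => fun=> 0 end.
pose cs i := match i with 0%N => c | 1%N => c' | _ => 0 end.
have c0 := Hbd_ge0 Hf; have c'0 := Hbd_ge0 Hg.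
apply: (@Hbd_series _ _ _ mu d muT0 muT mball F cs).
- by move=> [|[|i]] //; exact: Hbd0.
- case=> [|[|n]]; first by rewrite big_ord0 addr_ge0.
    by rewrite big_ord_recl big_ord0 addr0 lerDl.
  by rewrite !big_ord_recl/= big1// addr0.
- by apply: itgD; [exact: Hbd_itg Hf|exact: Hbd_itg Hg].
- move=> e e0; exists 2%N => -[|[|n]]// _.
  rewrite (_ : (fun x => _) = (fun=> 0)) ?l1norm0 ?ltW//.
  by apply/funext => x; rewrite !big_ord_recl/= big1// addr0 subrr.
Qed.

Lemma Hbd_ae f g c : Hbd f c -> measurable_fun setT g ->
  {ae mu, forall x, f x = g x} -> Hbd g c.
Proof.
move=> Hf mg fg; have c0 := Hbd_ge0 Hf; have If := Hbd_itg Hf.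
have Ig : itg mu g by apply: (le_itg mg If); apply: filterS fg => x ->.
apply: (@Hbd_series _ _ _ mu d muT0 muT mball
  (fun i => if i is 0%N then f else fun=> 0) (fun i => if i is 0%N then c else 0)) => //.
- by move=> [|i] //; exact: Hbd0.
- by case=> [|n]; rewrite ?big_ord0// big_ord_recl big1 ?addr0.
- move=> e e0; exists 1%N => -[|n]// _.
  rewrite (@eq_ae_l1 _ _ _ mu _ (fun=> 0)) ?l1norm0 ?ltW//.
    apply: measurable_funB => //; apply/itg_meas/itg_sum => -[[|i] ?] _.
      exact: If.
    exact: itg0.
  apply: filterS fg => x fgx.
  by rewrite big_ord_recl big1// addr0 /= fgx subrr.
Qed.

Lemma HbdZ f c k : Hbd f c -> Hbd (fun x => k * f x) (`|k| * c).
Proof.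
move=> [If [la [a [at_ sc lim0]]]]; split; first exact: itgZ.
exists (fun i => k * la i), a; split => // [n|e e0].
  rewrite (eq_bigr (fun i : 'I_n => `|k| * `|la i|)) => [|i _]; last by rewrite normrM.
  by rewrite -mulr_sumr ler_wpM2l//; exact: sc.
have ke : 0 < e / (`|k| + 1) by rewrite divr_gt0// ltr_wpDl.
have [N hN] := lim0 _ ke; exists N => n /hN {}hN.
rewrite (_ : (fun x => _) = (fun x => k * (f x - \sum_(i < n) la i * a i x))); last first.
  apply/funext => x; rewrite mulrBr mulr_sumr; congr (_ - _).
  by apply: eq_bigr => i _; rewrite mulrA.
rewrite l1normZ; last first.
  apply: itgB => //; apply: itg_sum => i _.
  by apply: (itg_la muT0 muT mball).
apply: (@le_trans _ _ ((`|k| + 1) * (e / (`|k| + 1)))).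
  by rewrite ler_pM// ?l1norm_ge0// lerDl.
by rewrite mulrC divfK// gt_eqF// ltr_wpDl.
Qed.

Lemma Hbd_sum (I : Type) (s : seq I) (P : pred I) (F : I -> X -> R) (cs : I -> R) :
  (forall i, P i -> Hbd (F i) (cs i)) ->
  Hbd (fun x => \sum_(i <- s | P i) F i x) (\sum_(i <- s | P i) cs i).
Proof.
move=> HF; elim: s => [|i s IH].
  rewrite big_nil; apply: Hbd_ext (Hbd0 muT0 muT mball).
  by apply/funext => x; rewrite big_nil.
case Pi : (P i); last first.
  rewrite big_cons Pi; apply: Hbd_ext IH.
  by apply/funext => x; rewrite big_cons Pi.
rewrite big_cons Pi; apply: Hbd_ext (HbdD (HF _ Pi) IH).
by apply/funext => x; rewrite big_cons Pi.
Qed.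

(** Divided by [c] times the measure of the ball, the function is an atom; if that product is zero,
    the function vanishes almost everywhere. *)
Lemma Hbd_ball f c x r : 0 < r -> measurable_fun setT f ->
  {ae mu, forall y, `|f y| <= c} -> (forall y, ~ qball d x r y -> f y = 0) ->
  \int[mu]_y f y = 0 -> 0 <= c -> Hbd f (c * fine (mu (qball d x r))).
Proof.
move=> r0 mf fc f0 intf c0.
have mB := mball x r; set B := qball d x r in mB f0 *.
have muB0 : 0 <= fine (mu B) by rewrite fine_ge0.
have fB : {ae mu, forall y, `|f y| <= c * \1_B y}.
  apply: filterS fc => y fy; rewrite indicE; have [yB|yB] := boolP (y \in _).
    by rewrite mulr1.
  by rewrite f0 ?normr0 ?mulr0//; move/negP: yB; rewrite inE.
have If : itg mu f by exact: itg_bdd fB.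
have := c0; rewrite le_eqVlt => /predU1P[cE|cp]; last first.
  have := muB0; rewrite le_eqVlt => /predU1P[mB0|mBp].
    rewrite -mB0 mulr0; apply: (Hbd_ae (Hbd0 muT0 muT mball) mf).
    have := l1norm_bdd muT mB mf fB; rewrite -mB0 mulr0 => l0.
    have /(l1norm_eq0 If) : l1norm mu f = 0 by apply/eqP; rewrite eq_le l0 l1norm_ge0.
    by apply: filterS => y ->.
  set k := c * fine (mu B).
  have k0 : 0 < k by rewrite mulr_gt0.
  have at_ : atom mu d (fun y => k^-1 * f y).
    split; first by apply: measurable_funM => //.
    left; exists x, r; split => //.
    - by move=> y yB; rewrite f0// mulr0.
    - apply/(LnormooP muT0); apply: filterS fc => y fy.
      rewrite normrM gtr0_norm ?invr_gt0// mulrC ler_pdivrMr// /k mulrCA.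
      by rewrite mulVf ?mulr1// gt_eqF.
    - have := RintegralZl k^-1 measurableT If; rewrite intf mulr0 => h.
      by rewrite -[LHS]fineK; [rewrite -/(Rintegral _ _ _) h|exact/integrable_fin_num/itgZ].
  have := Hbd_atom muT0 muT mball k at_; rewrite gtr0_norm//; apply: Hbd_ext.
  by apply/funext => y; rewrite mulrA divff ?mul1r// gt_eqF.
rewrite -cE mul0r; apply: (Hbd_ae (Hbd0 muT0 muT mball) mf).
have := l1norm_bdd muT mB mf fB; rewrite -cE mul0r => l0.
have /(l1norm_eq0 If) : l1norm mu f = 0 by apply/eqP; rewrite eq_le l0 l1norm_ge0.
by apply: filterS => y ->.
Qed.

(** Unordered sums reduce to series: along increasing finite sets with errors tending to zero, the
    successive differences form a series to which [Hbd_series] applies. *)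
Lemma Hbd_fam (J : choiceType) (u : J -> X -> R) (cs : J -> R) f C :
  (forall j, Hbd (u j) (cs j)) -> (forall A : {fset J}, \sum_(j <- A) cs j <= C) ->
  itg mu f ->
  (forall e, 0 < e -> exists A0 : {fset J}, forall A : {fset J}, (A0 `<=` A)%fset ->
     l1norm mu (fun x => f x - \sum_(j <- A) u j x) <= e) -> Hbd f C.
Proof.
move=> Hu csC If lim0.
have /choice[B hB] : forall n : nat, exists A0 : {fset J}, forall A : {fset J}, (A0 `<=` A)%fset ->
     l1norm mu (fun x => f x - \sum_(j <- A) u j x) <= n.+1%:R^-1.
  by move=> n; apply: lim0.
pose A := fix A n := if n is n'.+1 then (A n' `|` B n')%fset else fset0.
have AS n : (A n `<=` A n.+1)%fset by rewrite /= fsubsetUl.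
have sumE (V : zmodType) (h : J -> V) n :
    \sum_(i < n) \sum_(j <- (A i.+1 `\` A i)%fset) h j = \sum_(j <- A n) h j.
  elim: n => [|n IH]; first by rewrite big_ord0 big_seq_fset0.
  rewrite big_ord_recr /= IH [RHS](big_fsetID _ (mem (A n)))/=; congr (_ + _).
    apply: eq_fbigl => j; rewrite !inE /=; case: (j \in A n) => //=.
    by rewrite andbF.
  by apply: eq_fbigl => j; rewrite !inE /= andbC.
apply: (@Hbd_series _ _ _ mu d muT0 muT mball
  (fun n x => \sum_(j <- (A n.+1 `\` A n)%fset) u j x)
  (fun n => \sum_(j <- (A n.+1 `\` A n)%fset) cs j)) => //.
- by move=> i; exact: Hbd_sum.
- by move=> n; rewrite sumE.
- move=> e e0; have [N NE] : exists N : nat, N.+1%:R^-1 <= e.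
    have [N _ hN] := near_infty_natSinv_lt (PosNum e0).
    by exists N; exact/ltW/hN/leqnn.
  exists N.+1 => -[//|n] Nn; rewrite (_ : (fun x => _) = (fun x => f x - \sum_(j <- A n.+1) u j x)).
    apply: le_trans (hB n _ _) _; first by rewrite /= fsubsetUr.
    apply: le_trans NE; rewrite lef_pV2 ?posrE// ler_nat.
    exact: Nn.
  by apply/funext => x; rewrite -sumE.
Qed.

(** The infimum that defines the norm of [f] need not be attained, so the hypothesis has to cover
    every admissible bound [c]. *)
Lemma Hbd_H1norm f g C : 0 < C -> H1 mu d f ->
  (forall c, Hbd f c -> Hbd g (C * c)) ->
  (H1norm mu d g <= C%:E * H1norm mu d f)%E.
Proof.
move=> C0 [If _] h; rewrite -ereal_inf_pZl//.
apply: le_ereal_inf_tmp => _ [_ [la [a [dec ->]]] <-].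
have [_ fin _] := dec.
have sE : (\sum_(i <oo) `|la i|%:E)%E \is a fin_num.
  by rewrite ge0_fin_numE//; apply: nneseries_ge0.
have : Hbd f (fine (\sum_(i <oo) `|la i|%:E)%E).
  by apply: (atomic_Hbd muT0 muT mball If dec); rewrite fineK.
move=> /h /(Hbd_atomic muT0 muT mball)[la' [a' [dec' le']]].
apply: ge_ereal_inf; exists (\sum_(i <oo) `|la' i|%:E)%E; first by exists la', a'.
by rewrite -(fineK sE) -EFinM.
Qed.

End HardyOps.


#[global] Existing Instance summability.totally_filter.

Lemma cvg_fsum {R : realType} {T : Type} {F : set_system T} {FF : Filter F}
    (I : Type) (s : seq I) (f : I -> T -> R) (l : I -> R) :
  (forall i, f i x @[x --> F] --> l i) ->
  \sum_(i <- s) f i x @[x --> F] --> \sum_(i <- s) l i.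
Proof.
move=> fl; elim: s => [|i s IH].
  rewrite big_nil; under eq_fun do rewrite big_nil; exact: cvg_cst.
by rewrite big_cons; under eq_fun do rewrite big_cons; apply: cvgD.
Qed.

(** * Square-summable families *)

Section L2seq.
Context {R : realType} {J : choiceType}.
Implicit Types (x y z : J -> R) (A B : {fset J}).
Import summability.

Lemma near_totally (P : {fset J} -> Prop) (A0 : {fset J}) :
  (forall A, (A0 `<=` A)%fset -> P A) -> \forall A \near totally, P A.
Proof. by move=> h; exists A0 => // A; exact: h. Qed.

Lemma fset_sum_cvg (u : J -> R) (C : R) : (forall j, 0 <= u j) ->
  (forall A, \sum_(j <- A) u j <= C) ->
  exists s : R, (fun A => \sum_(j <- A) u j) @ totally --> s.
Proof.
move=> u0 uC; pose S := range (fun A : {fset J} => \sum_(j <- A) u j).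
have hS : has_sup S.
  split; first by exists (\sum_(j <- fset0) u j), fset0.
  by exists C => _ [A _ <-]; exact: uC.
exists (sup S); apply/cvgrPdist_le => e e0.
have [_ [A0 _ <-] supA] := sup_adherent e0 hS.
apply: (near_totally (A0 := A0)) => A AA.
have h : \sum_(j <- A) u j <= sup S by apply: ub_le_sup; [case: hS|exists A].
rewrite ger0_norm ?subr_ge0// lerBlDr -lerBlDl; apply: le_trans (ltW supA) _.
have -> : \sum_(j <- A0) u j <= \sum_(j <- A) u j.
  rewrite [leRHS](big_fsetID _ (mem A0))/= (_ : [fset x in A | x \in A0]%fset = A0).
    by rewrite lerDl sumr_ge0.
  apply/fsetP => x; rewrite !inE /= andbC; case xA: (x \in A0) => //=.
  by rewrite (fsubsetP AA).
by [].
Qed.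

Lemma l2P x : l2 x <-> exists C, forall A, \sum_(j <- A) x j ^+ 2 <= C.
Proof.
split => [xl|[C hC]].
  have x0 : (0 <= l2sq x)%E by apply: esum_ge0 => j _; rewrite lee_fin sqr_ge0.
  exists (fine (l2sq x)) => A; rewrite -lee_fin fineK ?ge0_fin_numE//.
  apply: esum_ge; exists [set` A]; first by split.
  by rewrite fsbig_finite//= set_fsetK sumEFin.
rewrite /l2 /=; apply: (@le_lt_trans _ _ C%:E); last exact: ltry.
apply: ge_ereal_sup => _ [F [finF _] <-].
by rewrite fsbig_finite//= sumEFin lee_fin.
Qed.

Lemma l2D x y c : l2 x -> l2 y -> l2 (fun j => c * x j + y j).
Proof.
move=> /l2P[Cx hx] /l2P[Cy hy]; apply/l2P; exists (2 * (c ^+ 2 * Cx + Cy)) => A.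
apply: (@le_trans _ _ (\sum_(j <- A) 2 * (c ^+ 2 * x j ^+ 2 + y j ^+ 2))).
  apply: ler_sum => j _; have := sqr_ge0 (c * x j - y j); lra.
rewrite -mulr_sumr ler_pM2l// big_split/= -mulr_sumr lerD//.
by rewrite ler_wpM2l ?sqr_ge0.
Qed.

Lemma l2_0 : l2 (fun _ : J => 0 : R).
Proof.
by apply/l2P; exists 0 => A; rewrite big1// => j _; rewrite expr0n.
Qed.

Lemma l2_e q : l2 (l2_delta q : J -> R).
Proof.
apply/l2P; exists 1 => A; have [qA|qA] := boolP (q \in A).
  rewrite (big_fsetD1 q qA)/= /l2_delta eqxx expr1n big1_seq ?addr0// => j.
  by rewrite !inE => /= /andP[/negbTE ->]; rewrite expr0n.
rewrite big1_seq// => j /= jA; rewrite /l2_delta (_ : j == q = false) ?expr0n//.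
by apply: contraNF qA => /eqP <-.
Qed.

Lemma l2Z x c : l2 x -> l2 (fun j => c * x j).
Proof.
move=> xl; have := l2D c xl l2_0.
by rewrite (_ : (fun j => _) = (fun j => c * x j))//; apply/funext => j; rewrite addr0.
Qed.

Lemma l2A x y : l2 x -> l2 y -> l2 (fun j => x j + y j).
Proof.
move=> xl yl; have := l2D 1 xl yl.
by rewrite (_ : (fun j => _) = (fun j => x j + y j))//; apply/funext => j; rewrite mul1r.
Qed.

Lemma l2B x y : l2 x -> l2 y -> l2 (fun j => x j - y j).
Proof.
move=> xl yl; have := l2D (-1) yl xl.
by rewrite (_ : (fun j => _) = (fun j => x j - y j))//; apply/funext => j; rewrite mulN1r addrC.
Qed.

(** By polarization the sum is a difference of two unordered sums of squares, each of which
    converges because its partial sums are bounded. *)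
Lemma dot_cvg x y : l2 x -> l2 y ->
  (fun A => \sum_(j <- A) x j * y j) @ totally --> l2dot x y.
Proof.
move=> xl yl; rewrite /l2dot /sum.
have E : (fun A => \sum_(j <- A) x j * y j) = partial_sum (fun j => x j * y j : R^o).
  by apply/funext => A; rewrite /partial_sum big_seq_fsetE.
suff [s cs] : exists s : R, (fun A => \sum_(j <- A) x j * y j) @ totally --> s.
  rewrite E in cs *; exact: cvgP cs.
have /l2P[C1 h1] := l2A xl yl; have /l2P[C2 h2] := l2B xl yl.
have [s1 c1] := fset_sum_cvg (fun j => sqr_ge0 (x j + y j)) h1.
have [s2 c2] := fset_sum_cvg (fun j => sqr_ge0 (x j - y j)) h2.
exists (4^-1 * (s1 - s2)).
have -> : (fun A => \sum_(j <- A) x j * y j) =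
    (fun A => 4^-1 * (\sum_(j <- A) (x j + y j) ^+ 2 - \sum_(j <- A) (x j - y j) ^+ 2)).
  apply/funext => A; rewrite -sumrB mulr_sumr; apply: eq_bigr => j _; lra.
by apply: cvgMr; apply: cvgB.
Qed.

Lemma dot_unique x y s : l2 x -> l2 y ->
  (fun A => \sum_(j <- A) x j * y j) @ totally --> s -> l2dot x y = s.
Proof.
move=> xl yl cs; have := dot_cvg xl yl => cd.
exact: (cvg_unique (@Rhausdorff R) cd cs).
Qed.

Lemma dot_le x y b : l2 x -> l2 y -> (forall A, \sum_(j <- A) x j * y j <= b) ->
  l2dot x y <= b.
Proof.
move=> xl yl h; have cd := dot_cvg xl yl.
by apply: (cvgr_to_le cd); apply: (near_totally (A0 := fset0)) => A _; exact: h.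
Qed.

Lemma dotC x y : l2dot x y = l2dot y x.
Proof. by rewrite /l2dot; congr sum; apply/funext => j; rewrite mulrC. Qed.

Lemma dotDl c x y z : l2 x -> l2 y -> l2 z ->
  l2dot (fun j => c * x j + y j) z = c * l2dot x z + l2dot y z.
Proof.
move=> xl yl zl; apply: dot_unique => //; first exact: l2D.
have -> : (fun A => \sum_(j <- A) (c * x j + y j) * z j) =
    (fun A => c * \sum_(j <- A) x j * z j + \sum_(j <- A) y j * z j).
  apply/funext => A; rewrite mulr_sumr -big_split/=; apply: eq_bigr => j _; lra.
by apply: cvgD; [apply: cvgMr; exact: dot_cvg|exact: dot_cvg].
Qed.

Lemma dotDr c x y z : l2 x -> l2 y -> l2 z ->
  l2dot z (fun j => c * x j + y j) = c * l2dot z x + l2dot z y.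
Proof. by move=> xl yl zl; rewrite dotC dotDl// ![l2dot _ z]dotC. Qed.

Lemma dot_e x q : l2 x -> l2dot x (l2_delta q) = x q.
Proof.
move=> xl; apply: dot_unique => //; first exact: l2_e.
apply: cvg_near_cst; apply: (near_totally (A0 := [fset q]%fset)) => A.
rewrite fsub1set => qA; rewrite (big_fsetD1 q qA)/= /l2_delta eqxx mulr1.
rewrite big1_seq ?addr0// => j; rewrite !inE => /= /andP[/negbTE ->].
by rewrite mulr0.
Qed.

Lemma dotxx_ge x A : l2 x -> \sum_(j <- A) x j ^+ 2 <= l2dot x x.
Proof.
move=> xl; have cd := dot_cvg xl xl.
apply: (cvgr_to_ge cd); apply: (near_totally (A0 := A)) => B AB.
rewrite [leRHS](big_fsetID _ (mem A))/= (_ : [fset x in B | x \in A]%fset = A).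
  rewrite -[leLHS]addr0 lerD//; last by rewrite sumr_ge0// => j _; rewrite -expr2 sqr_ge0.
apply/fsetP => j; rewrite !inE /= andbC; case jA: (j \in A) => //=.
by rewrite (fsubsetP AB).
Qed.

Lemma dotxx_ge0 x : l2 x -> 0 <= l2dot x x.
Proof. by move=> xl; have := dotxx_ge fset0 xl; rewrite big_seq_fset0. Qed.

Lemma dotxx_le x b : (forall A, \sum_(j <- A) x j ^+ 2 <= b) -> l2 x /\ l2dot x x <= b.
Proof.
move=> h; have xl : l2 x by apply/l2P; exists b.
by split => //; apply: dot_le.
Qed.

Lemma l2sqE x : l2 x -> l2sq x = (l2dot x x)%:E.
Proof.
move=> xl; apply/eqP; rewrite eq_le; apply/andP; split.
  apply: ge_ereal_sup => _ [F [finF _] <-].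
  by rewrite fsbig_finite//= sumEFin lee_fin dotxx_ge.
have x0 : (0 <= l2sq x)%E by apply: esum_ge0 => j _; rewrite lee_fin sqr_ge0.
rewrite -(@fineK _ (l2sq x)) ?ge0_fin_numE// lee_fin; apply: dot_le => // A.
rewrite -lee_fin fineK ?ge0_fin_numE//; apply: esum_ge; exists [set` A] => //.
by rewrite fsbig_finite//= set_fsetK sumEFin.
Qed.

Definition l2norm x : R := Num.sqrt (l2dot x x).

Lemma l2norm_ge0 x : 0 <= l2norm x. Proof. exact: sqrtr_ge0. Qed.

Lemma l2norm_sqr x : l2 x -> l2norm x ^+ 2 = l2dot x x.
Proof. by move=> /dotxx_ge0 h; rewrite sqr_sqrtr. Qed.

Lemma le_l2norm x b : 0 <= b -> l2dot x x <= b ^+ 2 -> l2norm x <= b.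
Proof.
by move=> b0 h; rewrite -(ger0_norm b0) -sqrtr_sqr ler_wsqrtr.
Qed.

Lemma le_coord x p : l2 x -> `|x p| <= l2norm x.
Proof.
move=> xl; rewrite -sqrtr_sqr ler_wsqrtr//.
by have := dotxx_ge [fset p]%fset xl; rewrite big_seq_fset1.
Qed.

Lemma dot_CS x y : l2 x -> l2 y -> `|l2dot x y| <= l2norm x * l2norm y.
Proof.
move=> xl yl; rewrite -(ler_pXn2r (n := 2))// ?nnegrE ?mulr_ge0 ?l2norm_ge0//.
rewrite exprMn !l2norm_sqr// real_normK ?num_real//.
set a := l2dot x x; set b := l2dot x y; set c := l2dot y y.
have H t : 0 <= t ^+ 2 * a + 2 * t * b + c.
  have := dotxx_ge0 (l2D t xl yl).
  rewrite dotDl// ?dotDr//; try exact: l2D.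
  rewrite -/a -/c (dotC y x) -/b; lra.
have c0 : 0 <= c by exact: dotxx_ge0.
have : 0 <= a by exact: dotxx_ge0.
rewrite le_eqVlt => /predU1P[a0|a0].
  rewrite -a0 mul0r; have [->|b0] := eqVneq b 0; first by rewrite expr0n.
  have := H (- (c + 1) / (2 * b)); rewrite -a0.
  have -> : 2 * (- (c + 1) / (2 * b)) * b = - (c + 1).
    by rewrite mulrAC mulrC divfK// mulf_neq0.
  lra.
have := H (- b / a).
have -> : (- b / a) ^+ 2 * a + 2 * (- b / a) * b + c = c - b ^+ 2 / a.
  have aa : a / a = 1 by rewrite divff// gt_eqF.
  have -> : (- b / a) ^+ 2 * a = b ^+ 2 / a * (a / a) by lra.
  rewrite aa; lra.
by rewrite subr_ge0 ler_pdivrMr// mulrC.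
Qed.

Lemma l2norm_triangle x y c : l2 x -> l2 y ->
  l2norm (fun j => c * x j + y j) <= `|c| * l2norm x + l2norm y.
Proof.
move=> xl yl; have zl := l2D c xl yl.
apply: le_l2norm; first by rewrite addr_ge0 ?mulr_ge0 ?l2norm_ge0.
rewrite dotDl// !dotDr// (dotC y x).
have h := dot_CS xl yl; rewrite sqrrD exprMn !l2norm_sqr// real_normK ?num_real//.
have : c * l2dot x y <= `|c| * (l2norm x * l2norm y).
  by apply: le_trans (ler_norm _) _; rewrite normrM ler_wpM2l.
lra.
Qed.

End L2seq.

(** * Entrywise decay of the inverse square root of a perturbed identity *)

Section InvSqrt.
Context {R : realType} {J : choiceType}.
Implicit Types (x y z : J -> R) (A B : {fset J}).
Import summability.
Let op := (J -> R) -> J -> R.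

Variables (r0 : J) (m : R) (G S : op).
Hypothesis oG : l2_operator G.
Hypothesis oS : l2_operator S.
Hypothesis pG : l2_positive G.
Hypothesis pS : l2_positive S.
Hypothesis GSS : forall x, l2 x -> G (S (S x)) = x /\ S (S (G x)) = x.
Hypothesis m0 : 0 < m.
Hypothesis Gr0 : G (l2_delta r0) = fun p => m * l2_delta r0 p.

Lemma opl2 (U : op) x : l2_operator U -> l2 x -> l2 (U x).
Proof.
move=> [_ [M hM]] xl; have := hM x xl; rewrite (l2sqE xl) -EFinM => h.
by rewrite /l2/=; apply: le_lt_trans h _; exact: ltry.
Qed.

Lemma opN (U : op) : l2_operator U -> exists2 c, 0 <= c & forall x, l2 x -> l2norm (U x) <= c * l2norm x.
Proof.
move=> oU; have [_ [M hM]] := oU; exists (Num.sqrt `|M|); first exact: sqrtr_ge0.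
move=> x xl; apply: le_l2norm; first by rewrite mulr_ge0 ?sqrtr_ge0// l2norm_ge0.
rewrite exprMn sqr_sqrtr// l2norm_sqr// -lee_fin -l2sqE; last exact: opl2.
apply: le_trans (hM x xl) _; rewrite l2sqE// -EFinM lee_fin.
by rewrite ler_wpM2r ?ler_norm// dotxx_ge0.
Qed.

Lemma opB (U : op) x y : l2_operator U -> l2 x -> l2 y ->
  U (fun j => x j - y j) = (fun j => U x j - U y j).
Proof.
move=> [lin _] xl yl; have := lin (-1) y x yl xl.
rewrite (_ : (fun j => -1 * y j + x j) = (fun j => x j - y j)); last first.
  by apply/funext => j; rewrite mulN1r addrC.
by move=> ->; apply/funext => j; rewrite mulN1r addrC.
Qed.

Lemma opZ (U : op) x c : l2_operator U -> l2 x ->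
  U (fun j => c * x j) = (fun j => c * U x j).
Proof.
move=> oU xl; have [lin _] := oU.
have U0 : U (fun=> 0) = (fun=> 0).
  have := lin (-1) (fun=> 0) (fun=> 0) l2_0 l2_0.
  rewrite (_ : (fun j => _) = fun=> 0); last by apply/funext => j; rewrite mulr0 addr0.
  by move=> ->; apply/funext => j; rewrite mulN1r addNr.
have := lin c x (fun=> 0) xl l2_0; rewrite U0.
rewrite (_ : (fun j => c * x j + 0) = (fun j => c * x j)); last first.
  by apply/funext => j; rewrite addr0.
by move=> ->; apply/funext => j; rewrite addr0.
Qed.

Lemma dot_0 x : l2 x -> l2dot x (fun=> 0) = 0.
Proof.
move=> xl; apply: dot_unique => //; first exact: l2_0.
rewrite (_ : (fun A => _) = fun=> 0); first exact: cvg_cst.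
by apply/funext => A; rewrite big1// => r _; rewrite mulr0.
Qed.

Lemma S_G x : l2 x -> S (G x) = G (S x).
Proof.
move=> xl; have Gx := opl2 oG xl; have SGx := opl2 oS Gx.
have [_ h] := GSS xl; rewrite -[in RHS]h.
by have [-> _] := GSS SGx.
Qed.

(** With [c = m^(-1/2)] and [S (S e) = c^2 e], the vector [v = S e - c e] satisfies [S v = - c v].
    Positivity of [S] forces [v = 0]. *)
Lemma S_r0 : S (l2_delta r0) = fun p => (Num.sqrt m)^-1 * l2_delta r0 p.
Proof.
set e := l2_delta r0; set c := (Num.sqrt m)^-1.
have el : l2 e := l2_e r0.
have c0 : 0 < c by rewrite invr_gt0 sqrtr_gt0.
have c2 : c * c = m^-1.
  by rewrite /c -invfM -expr2 sqr_sqrtr// ltW.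
have SSe : S (S e) = fun p => m^-1 * e p.
  have [_ h] := GSS el; rewrite -[in RHS]h Gr0 opZ// opZ//; last exact: opl2.
  by apply/funext => p; rewrite mulrA mulVf ?mul1r// gt_eqF.
have Sel : l2 (S e) by exact: opl2.
have cel : l2 (fun j => c * e j) by exact: l2Z.
set v := fun j => S e j - c * e j.
have vl : l2 v by apply: l2B.
have Sv : S v = fun j => - c * v j.
  rewrite opB// opZ// SSe; apply/funext => j; rewrite /v -c2; lra.
have [_ /(_ v vl)] := pS; rewrite Sv.
have -> : l2dot (fun j => - c * v j) v = - c * l2dot v v.
  have := dotDl (- c) vl l2_0 vl.
  rewrite (_ : (fun j => - c * v j + 0) = (fun j => - c * v j)); last first.
    by apply/funext => j; rewrite addr0.
  by move=> ->; rewrite dotC dot_0 ?addr0.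
rewrite mulNr oppr_ge0 pmulr_rle0// => vv.
have v0 : l2dot v v = 0 by apply/eqP; rewrite eq_le vv dotxx_ge0.
apply/funext => p; apply/eqP; rewrite -subr_eq0 -normr_le0.
by have := le_coord p vl; rewrite /l2norm v0 sqrtr0.
Qed.

(** The orthogonal complement of the vector of [r0]. Both [G] and [S] leave it invariant, and only
    there is [G] close to the identity. *)
Definition V0 x := l2 x /\ x r0 = 0.

Lemma S_V0 x : V0 x -> V0 (S x).
Proof.
move=> [xl x0]; split; first exact: opl2.
have el : l2 (l2_delta r0 : J -> R) := l2_e r0.
rewrite -dot_e; last exact: opl2.
have [-> // _] := pS; rewrite S_r0.
have := dotDr (Num.sqrt m)^-1 el l2_0 xl.
rewrite (_ : (fun j => _ + 0) = (fun p => (Num.sqrt m)^-1 * l2_delta r0 p)); last first.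
  by apply/funext => j; rewrite addr0.
by move=> ->; rewrite dot_e// x0 mulr0 add0r dot_0.
Qed.

(** The matrix of [I - G] on [V0]. The row and the column of [r0] are erased, because the entry of
    [G] there is [m], which may be far from [1]. *)
Definition tm p r : R := if (p == r0) || (r == r0) then 0 else (p == r)%:R - G (l2_delta r) p.

Lemma G_sym p r : G (l2_delta r) p = G (l2_delta p) r.
Proof.
have rl : l2 (l2_delta r : J -> R) := l2_e r.
have pl : l2 (l2_delta p : J -> R) := l2_e p.
rewrite -[LHS]dot_e; last exact: opl2.
have [sym _] := pG; rewrite (sym _ _ rl pl).
by rewrite dotC dot_e//; exact: opl2.
Qed.

Lemma tm_sym p r : tm p r = tm r p.
Proof. by rewrite /tm orbC [p == r]eq_sym G_sym. Qed.

Let T : op := fun x j => x j - G x j.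

(** [G] is given as an operator; its self-adjointness recovers the values [G x p] from the matrix
    entries, as limits of finite sums. *)
Lemma T_cvg x p : V0 x -> (fun A => \sum_(r <- A) x r * tm p r) @ totally --> T x p.
Proof.
move=> [xl x0]; have el : l2 (l2_delta p : J -> R) := l2_e p.
have Gel : l2 (G (l2_delta p)) by apply: opl2.
have GE : G x p = l2dot x (G (l2_delta p)).
  by rewrite -dot_e ?(pG.1 _ _ xl el)//; exact: opl2.
have [pr|pr] := eqVneq p r0.
  have -> : T x p = 0.
    rewrite /T GE pr Gr0.
    have := dotDr m (l2_e r0) l2_0 xl.
    rewrite (_ : (fun j => _ + 0) = (fun p => m * l2_delta r0 p)); last first.
      by apply/funext => j; rewrite addr0.
    by move=> ->; rewrite dot_e// x0 mulr0 !add0r dot_0// oppr0.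
  rewrite (_ : (fun A => _) = fun=> 0); first exact: cvg_cst.
  by apply/funext => A; rewrite big1// => r _; rewrite /tm pr eqxx mulr0.
have -> : T x p = l2dot x (fun r => l2_delta p r - G (l2_delta p) r).
  rewrite /T GE -[x p]dot_e//.
  have := dotDr (-1) Gel el xl.
  rewrite (_ : (fun j => _ + _) = (fun r => l2_delta p r - G (l2_delta p) r)); last first.
    by apply/funext => r; rewrite mulN1r addrC.
  by move=> ->; rewrite mulN1r addrC.
have := dot_cvg xl (l2B el Gel).
rewrite (_ : (fun A => _) = (fun A => \sum_(r <- A) x r * tm p r))//.
apply/funext => A; apply: eq_bigr => r _; rewrite /tm (negbTE pr) /=.
have [->|rr] := eqVneq r r0; first by rewrite x0 !mul0r.
by rewrite G_sym /l2_delta [p == r]eq_sym.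
Qed.

Variables (kap : R) (s u : J -> R).
Hypothesis kap0 : 0 <= kap.
Hypothesis kap8 : kap <= 8^-1.
Hypothesis s0 : forall p, 0 < s p.
Hypothesis sT : forall p A, \sum_(r <- A) `|tm p r| * s r <= kap * s p.
Hypothesis u0 : forall p, 0 <= u p.
Hypothesis uT : forall p A, \sum_(r <- A) `|tm p r| * u r <= kap * u p.

(** Bounds an operator on [V0] in two norms at once: the l2 norm, in which the iteration converges
    to [S], and the sup norm weighted by [u], which carries the decay. Both behave well under sums
    and compositions. *)
Definition bnd (U : op) c := [/\ 0 <= c, forall x, V0 x -> V0 (U x),
  (forall x, V0 x -> l2norm (U x) <= c * l2norm x)
  & (forall x k, V0 x -> (forall p, `|x p| <= k * u p) ->
       forall p, `|U x p| <= c * k * u p)].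

(** The Schur test with the weight [s], used once for rows and once, by symmetry of the matrix, for
    columns, bounds the l2 norm. The weighted sup norm is bounded directly by [uT]. *)
Lemma bnd_T : bnd T kap.
Proof.
have key x A B : V0 x -> \sum_(p <- A) (\sum_(r <- B) x r * tm p r) ^+ 2 <= kap ^+ 2 * l2dot x x.
  move=> xV.
  have h p : (\sum_(r <- B) x r * tm p r) ^+ 2 <=
      kap * s p * \sum_(r <- B) `|tm p r| * (x r ^+ 2 / s r).
    set a := \sum_(r <- B) `|tm p r| * s r.
    set b := \sum_(r <- B) `|tm p r| * (x r ^+ 2 / s r).
    have b0 : 0 <= b.
      by apply: sumr_ge0 => r _; rewrite mulr_ge0// divr_ge0 ?sqr_ge0// ltW.
    apply: (@le_trans _ _ (a * b)); last by rewrite ler_wpM2r//; exact: sT.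
    have a0 : 0 <= a by apply: sumr_ge0 => r _; rewrite mulr_ge0// ltW.
    pose c := \sum_(r <- B) `|x r| * `|tm p r|.
    have hc : `|\sum_(r <- B) x r * tm p r| <= c.
      by apply: le_trans (ler_norm_sum _ _ _) _; apply: ler_sum => r _; rewrite normrM.
    (* Cauchy-Schwarz without square roots: the quadratic inequality for all positive [t] gives
       [c^2 <= a b] at [t = c / a], or by a large [t] when [a] is zero. *)
    have H t : 0 < t -> 2 * t * c <= t ^+ 2 * a + b.
      move=> t0; rewrite !mulr_sumr -big_split/=; apply: ler_sum => r _.
      have sr := s0 r.
      rewrite [leLHS](_ : _ = `|tm p r| * (2 * t * `|x r|)); last by lra.
      rewrite [leRHS](_ : _ = `|tm p r| * (t ^+ 2 * s r + x r ^+ 2 / s r)); last by lra.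
      rewrite ler_wpM2l//.
      have ss : s r / s r = 1 by rewrite divff// gt_eqF.
      have : 0 <= (t * s r - `|x r|) ^+ 2 / s r by rewrite divr_ge0 ?sqr_ge0// ltW.
      have -> : (t * s r - `|x r|) ^+ 2 / s r =
          t ^+ 2 * s r * (s r / s r) - 2 * t * `|x r| * (s r / s r) + `|x r| ^+ 2 / s r by lra.
      rewrite ss real_normK ?num_real//; lra.
    have c0 : 0 <= c by apply: sumr_ge0 => r _; rewrite mulr_ge0.
    have cab : c ^+ 2 <= a * b.
      move: a0; rewrite le_eqVlt => /predU1P[a0|a0].
        rewrite -a0 mul0r; have [->|cn] := eqVneq c 0; first by rewrite expr0n.
        have cp : 0 < c by rewrite lt_def cn.
        have := H ((b + 1) / (2 * c)); rewrite -a0 divr_gt0 ?ltr_wpDl ?mulr_gt0//.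
        rewrite [2 * _ * c](_ : _ = b + 1); last by rewrite mulrAC mulrC divfK// mulf_neq0.
        by move/(_ isT); lra.
      move: c0; rewrite le_eqVlt => /predU1P[<-|c0].
        by rewrite expr0n mulr_ge0// ltW.
      have := H (c / a) (divr_gt0 c0 a0).
      have aa : a / a = 1 by rewrite divff// gt_eqF.
      have -> : (c / a) ^+ 2 * a = c ^+ 2 / a * (a / a) by lra.
      have -> : 2 * (c / a) * c = 2 * (c ^+ 2 / a) by lra.
      rewrite aa => hh; have : c ^+ 2 / a <= b by lra.
      by rewrite ler_pdivrMr// mulrC.
    apply: le_trans cab; rewrite -real_normK ?num_real//.
    by rewrite ler_pXn2r.
  apply: (@le_trans _ _ (\sum_(p <- A) kap * s p * \sum_(r <- B) `|tm p r| * (x r ^+ 2 / s r))).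
    by apply: ler_sum.
  under eq_bigr do rewrite mulr_sumr.
  rewrite exchange_big /=.
  apply: (@le_trans _ _ (\sum_(r <- B) kap ^+ 2 * x r ^+ 2)).
    apply: ler_sum => r _.
    have -> : \sum_(p <- A) kap * s p * (`|tm p r| * (x r ^+ 2 / s r)) =
        kap * (x r ^+ 2 / s r) * \sum_(p <- A) `|tm r p| * s p.
      rewrite mulr_sumr; apply: eq_bigr => p _; rewrite tm_sym; lra.
    apply: (@le_trans _ _ (kap * (x r ^+ 2 / s r) * (kap * s r))).
      by rewrite ler_wpM2l// mulr_ge0// divr_ge0 ?sqr_ge0// ltW.
    have ss : s r / s r = 1 by rewrite divff// gt_eqF.
    have -> : kap * (x r ^+ 2 / s r) * (kap * s r) = kap ^+ 2 * x r ^+ 2 * (s r / s r) by lra.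
    by rewrite ss mulr1.
  by rewrite -mulr_sumr ler_wpM2l ?sqr_ge0// dotxx_ge//; case: xV.
have TV x : V0 x -> V0 (T x) /\ l2dot (T x) (T x) <= kap ^+ 2 * l2dot x x.
  move=> xV; have [|Tl Tle] := @dotxx_le _ _ (T x) (kap ^+ 2 * l2dot x x).
    move=> A; have cT : (fun B => \sum_(p <- A) (\sum_(r <- B) x r * tm p r) ^+ 2) @ totally
        --> \sum_(p <- A) (T x p) ^+ 2.
      apply: cvg_fsum => p; rewrite expr2; under eq_fun do rewrite expr2.
      by apply: cvgM; exact: T_cvg.
    by apply: (cvgr_to_le cT); apply: (near_totally (A0 := fset0)) => B _; exact: key.
  split => //; split => //.
  have c1 := T_cvg (p := r0) xV; apply: (cvg_unique (@Rhausdorff R) c1).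
  rewrite (_ : (fun A => _) = fun=> 0); first exact: cvg_cst.
  by apply/funext => A; rewrite big1// => r _; rewrite /tm eqxx mulr0.
split => //.
- by move=> x /TV[].
- move=> x xV; have [xl _] := xV; have [_ h] := TV x xV.
  apply: le_l2norm; first by rewrite mulr_ge0 ?l2norm_ge0.
  by rewrite exprMn l2norm_sqr.
- move=> x k xV xk p; have c1 := T_cvg (p := p) xV.
  have {}c1 : (fun A => `|\sum_(r <- A) x r * tm p r|) @ totally --> `|T x p| by apply: cvg_norm.
  apply: (cvgr_to_le c1); apply: (near_totally (A0 := fset0)) => B _.
  apply: le_trans (ler_norm_sum _ _ _) _.
  apply: (@le_trans _ _ (\sum_(r <- B) k * (`|tm p r| * u r))).
    apply: ler_sum => r _; rewrite normrM mulrC mulrCA ler_wpM2l//.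
  rewrite -mulr_sumr; have [k0|k0] := leP 0 k.
    by rewrite [kap * k]mulrC -mulrA ler_wpM2l.
  have up r : u r = 0.
    apply/eqP; rewrite eq_le u0 andbT.
    by have := le_trans (normr_ge0 _) (xk r); rewrite nmulr_rge0.
  by rewrite up mulr0 big1 ?mulr0// => r _; rewrite up mulr0.
Qed.

Lemma bnd_add U1 U2 c1 c2 k : bnd U1 c1 -> bnd U2 c2 ->
  bnd (fun x j => k * U1 x j + U2 x j) (`|k| * c1 + c2).
Proof.
move=> [c10 V1 N1 B1] [c20 V2 N2 B2]; split.
- by rewrite addr_ge0// mulr_ge0.
- move=> x xV; have [l1 z1] := V1 x xV; have [l2 z2] := V2 x xV.
  by split; [exact: l2D|rewrite z1 z2 mulr0 addr0].
- move=> x xV; have [l1 _] := V1 x xV; have [l2 _] := V2 x xV.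
  apply: le_trans (l2norm_triangle _ l1 l2) _.
  by rewrite mulrDl lerD ?N2// -mulrA ler_wpM2l// N1.
- move=> x b xV xb p; apply: le_trans (ler_normD _ _) _.
  rewrite !mulrDl lerD ?B2// normrM -!mulrA ler_wpM2l// mulrA.
  exact: B1.
Qed.

Lemma bnd_comp U1 U2 c1 c2 : bnd U1 c1 -> bnd U2 c2 ->
  bnd (fun x => U1 (U2 x)) (c1 * c2).
Proof.
move=> [c10 V1 N1 B1] [c20 V2 N2 B2]; split.
- by rewrite mulr_ge0.
- by move=> x xV; apply: V1; apply: V2.
- move=> x xV; apply: le_trans (N1 _ (V2 _ xV)) _.
  by rewrite -mulrA ler_wpM2l// N2.
- move=> x b xV xb p; have := B1 _ (c2 * b) (V2 _ xV) (B2 _ _ xV xb) p.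
  by rewrite mulrA.
Qed.

Lemma bnd_id : bnd (fun x => x) 1.
Proof. by split=> // [x _|x b _ h p]; rewrite mul1r. Qed.

Lemma bndW U c c' : bnd U c -> c <= c' -> bnd U c'.
Proof.
move=> [c0 V N B] cc; split => //; first exact: le_trans cc.
- by move=> x xV; apply: le_trans (N _ xV) _; rewrite ler_wpM2r// l2norm_ge0.
- move=> x b xV xb p; apply: le_trans (B _ _ xV xb p) _.
  rewrite -!mulrA ler_wpM2r//.
  exact: le_trans (normr_ge0 _) (xb p).
Qed.

Lemma bnd_eq U U' c : (forall x, V0 x -> U x = U' x) -> bnd U c -> bnd U' c.
Proof.
move=> e [c0 V N B]; split => //.
- by move=> x xV; rewrite -e//; exact: V.
- by move=> x xV; rewrite -e//; exact: N.
- by move=> x b xV xb p; rewrite -e//; exact: B.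
Qed.

Definition lin (U : op) := forall c x y, V0 x -> V0 y ->
  U (fun j => c * x j + y j) = fun j => c * U x j + U y j.
Definition comS (U : op) := forall x, V0 x -> S (U x) = U (S x).

Lemma V0D x y c : V0 x -> V0 y -> V0 (fun j => c * x j + y j).
Proof.
by move=> [xl x0] [yl y0]; split; [exact: l2D|rewrite x0 y0 mulr0 addr0].
Qed.

Lemma G_T x : G x = fun j => - 1 * T x j + x j.
Proof. by apply/funext => j; rewrite /T mulN1r opprB subrK. Qed.

Lemma lin_T : lin T.
Proof.
move=> c x y [xl _] [yl _]; rewrite /T; have [-> // _] := oG.
apply/funext => j; lra.
Qed.

Lemma comS_T : comS T.
Proof.
by move=> x [xl _]; rewrite /T opB// ?S_G//; exact: opl2.
Qed.

Lemma bnd_G : bnd G (1 + kap).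
Proof.
have := bnd_add (-1) bnd_T bnd_id; rewrite normrN1 mul1r addrC.
by apply: bnd_eq => x _; rewrite [RHS]G_T.
Qed.

(** As [G = I - T], the equation [(I + Y)^2 G = I] reads [2 Y = T + 2 Y T - Y Y G]. This is its
    fixed-point iteration, which [Y] runs from zero. *)
Let step (Y : op) : op := fun x j =>
  2^-1 * (T x j + 2 * Y (T x) j - Y (Y (G x)) j).
Let Y n : op := iter n step (fun _ _ => 0).

Lemma lin_comp U1 U2 : lin U1 -> lin U2 -> (forall x, V0 x -> V0 (U2 x)) ->
  lin (fun x => U1 (U2 x)).
Proof. by move=> l1 l2 V c x y xV yV; rewrite l2// l1//; exact: V. Qed.

Lemma lin_G : lin G.
Proof. by move=> c x y [xl _] [yl _]; have [->] := oG. Qed.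

Lemma S_lin x y c : l2 x -> l2 y -> S (fun j => c * x j + y j) = fun j => c * S x j + S y j.
Proof. by move=> xl yl; have [-> ] := oS. Qed.

Lemma V0_0 : V0 (fun=> 0).
Proof. by split; first exact: l2_0. Qed.

Lemma bnd_0 : bnd (fun _ _ => 0) 0.
Proof.
split => // [x _|x _|x k _ _ p]; first exact: V0_0.
  by rewrite mul0r /l2norm dot_0 ?sqrtr0//; exact: l2_0.
by rewrite !mul0r normr0.
Qed.

Lemma bnd_scale U c k : bnd U c -> bnd (fun x j => k * U x j) (`|k| * c).
Proof.
move=> bU; have := bnd_add k bU bnd_0; rewrite addr0.
by apply: bnd_eq => x _; apply/funext => j; rewrite addr0.
Qed.

Lemma bnd_step U c : bnd U c ->
  bnd (step U) (2^-1 * (kap + 2 * (c * kap) + c * (c * (1 + kap)))).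
Proof.
move=> bU.
have b1 := bnd_add 2 (bnd_comp bU bnd_T) bnd_T.
have b2 := bnd_add (-1) (bnd_comp bU (bnd_comp bU bnd_G)) b1.
have := bnd_scale 2^-1 b2.
rewrite normrN1 !ger0_norm ?invr_ge0// => b3.
apply: (bndW (bnd_eq _ b3)); last by lra.
by move=> x _; rewrite /step; apply/funext => j; lra.
Qed.

(** A bound [2 kap] is reproduced by the iteration: [kap / 2 + 4 kap^2 + 2 kap^3] is at most [2 kap]
    when [kap <= 1/8]. *)
Lemma bnd_Y n : bnd (Y n) (2 * kap).
Proof.
elim: n => [|n IH]; first by apply: bndW bnd_0 _; rewrite mulr_ge0.
apply: bndW (bnd_step IH) _.
have : kap * (3 / 2 - 4 * kap - 2 * kap ^+ 2) >= 0; last by move=> ?; lra.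
rewrite mulr_ge0//.
have k0 := kap0; have k8 := kap8.
have : 0 <= kap * (8^-1 - kap) by rewrite mulr_ge0// subr_ge0.
lra.
Qed.

Lemma lin_step U : lin U -> (forall x, V0 x -> V0 (U x)) -> lin (step U).
Proof.
move=> lU VU c x y xV yV; rewrite /step.
have [_ VT _ _] := bnd_T; have [_ VG _ _] := bnd_G.
have gx := VG x xV; have gy := VG y yV.
rewrite (lin_T c xV yV) (lin_G c xV yV) (lU c _ _ (VT x xV) (VT y yV)).
rewrite (lU c _ _ gx gy) (lU c _ _ (VU _ gx) (VU _ gy)).
by apply/funext => j; lra.
Qed.

Lemma lin_Y n : lin (Y n).
Proof.
elim: n => [|n IH]; last by apply: lin_step => //; case: (bnd_Y n).
by move=> c x y _ _; apply/funext => j; rewrite /= mulr0 addr0.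
Qed.

Lemma YS n x j : Y n.+1 x j = 2^-1 * (T x j + 2 * Y n (T x) j - Y n (Y n (G x)) j).
Proof. by []. Qed.

Lemma V0_Y n x : V0 x -> V0 (Y n x).
Proof. by case: (bnd_Y n) => _ + _ _; apply. Qed.

Lemma V0_T x : V0 x -> V0 (T x).
Proof. by case: bnd_T => _ + _ _; apply. Qed.

Lemma V0_G x : V0 x -> V0 (G x).
Proof. by case: bnd_G => _ + _ _; apply. Qed.

Lemma comS_Y n : comS (Y n).
Proof.
elim: n => [|n IH] x xV.
  have := opB oS l2_0 l2_0.
  rewrite (_ : (fun j => 0 - 0) = fun=> 0); last by apply/funext => j; rewrite subrr.
  by move=> /= ->; apply/funext => j; rewrite subrr.
have -> : Y n.+1 x = fun j => 2^-1 * ((-1) * Y n (Y n (G x)) j + (2 * Y n (T x) j + T x j)) + 0.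
  by apply/funext => j; rewrite /= /step; lra.
have a1 := V0_Y n (V0_Y n (V0_G xV)); have a2 := V0_Y n (V0_T xV); have a3 := V0_T xV.
have a4 := V0D 2 a2 a3; have a5 := V0D (-1) a1 a4.
rewrite S_lin; [|by case: a5|exact: l2_0].
rewrite S_lin; [|by case: a1|by case: a4].
rewrite S_lin; [|by case: a2|by case: a3].
rewrite IH; last exact: V0_Y (V0_G xV).
rewrite IH; last exact: V0_G.
rewrite IH; last exact: V0_T.
rewrite S_G; last by case: xV.
rewrite comS_T//.
have -> : S (fun=> 0) = fun=> 0.
  have := opB oS l2_0 l2_0.
  rewrite (_ : (fun j => 0 - 0) = fun=> 0); last by apply/funext => j; rewrite subrr.
  by move=> ->; apply/funext => j; rewrite subrr.
by apply/funext => j; rewrite /= /step; lra.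
Qed.

Let D n : op := fun x j => -1 * Y n x j + Y n.+1 x j.

(** Subtracting two consecutive steps gives [2 D_(n+1) = 2 D_n T - Y_(n+1) D_n G - D_n Y_n G]. The
    contraction factor is at most [3 kap + 2 kap^2], hence at most [1/2]. *)
Lemma bnd_D n : bnd (D n) (kap / 2 ^+ n).
Proof.
elim: n => [|n IH].
  have := bnd_scale 2^-1 bnd_T; rewrite expr0 divr1 => h.
  apply: (bndW (bnd_eq _ h)).
    by move=> x _; apply/funext => j; rewrite /D /= /step; lra.
  by have k0 := kap0; rewrite ger0_norm ?invr_ge0//; lra.
set e := kap / 2 ^+ n in IH.
have e0 : 0 <= e by case: IH.
have b1 := bnd_comp (bnd_Y n.+1) (bnd_comp IH bnd_G).
have b2 := bnd_comp IH (bnd_comp (bnd_Y n) bnd_G).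
have b3 := bnd_add 1 b1 b2.
have b4 := bnd_add (-1) b3 (bnd_scale 2 (bnd_comp IH bnd_T)).
have := bnd_scale 2^-1 b4.
rewrite normrN1 normr1 !ger0_norm ?invr_ge0// => b5.
apply: (bndW (bnd_eq _ b5)).
  move=> x xV; have gV := V0_G xV.
  have -> : Y n.+1 (D n (G x)) = fun j => -1 * Y n.+1 (Y n (G x)) j + Y n.+1 (Y n.+1 (G x)) j.
    by rewrite /D lin_Y; [|exact: V0_Y|exact: V0_Y].
  apply/funext => j; rewrite /D [in RHS](YS n.+1) [in RHS](YS n x); lra.
have -> : kap / 2 ^+ n.+1 = e / 2 by rewrite exprSr invfM mulrA.
have : e * (2^-1 - 3 * kap - 2 * kap ^+ 2) >= 0; last by move=> ?; lra.
rewrite mulr_ge0//.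
have k0 := kap0; have k8 := kap8.
have : 0 <= kap * (8^-1 - kap) by rewrite mulr_ge0// subr_ge0.
lra.
Qed.

Let Xn n : op := fun x j => 1 * Y n x j + x j.

(** The defect of [I + Y_n] as an inverse square root is exactly the next increment of the
    iteration. *)
Lemma Xn_sqr n z : V0 z ->
  Xn n (Xn n (G z)) = fun j => z j - 2 * D n z j.
Proof.
move=> zV; have gV := V0_G zV.
rewrite /Xn lin_Y//; last exact: V0_Y.
apply/funext => j; rewrite /D /= /step.
have -> : T z = fun j => -1 * G z j + z j.
  by apply/funext => i; rewrite /T mulN1r addrC.
rewrite lin_Y//; rewrite /T; lra.
Qed.

Lemma Xn_pos n y : V0 y -> 2^-1 * l2norm y ^+ 2 <= l2dot (Xn n y) y.
Proof.
move=> yV; have [yl _] := yV; have [Yl _] := V0_Y n yV.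
rewrite dotDl// mul1r.
have h := dot_CS Yl yl.
have [_ _ /(_ _ yV) hN _] := bnd_Y n.
rewrite -l2norm_sqr//.
have : l2norm (Y n y) * l2norm y <= 4^-1 * l2norm y * l2norm y.
  rewrite ler_wpM2r ?l2norm_ge0//; apply: le_trans hN _.
  by rewrite ler_wpM2r ?l2norm_ge0//; have k8 := kap8; lra.
have := ler_norm (- l2dot (Y n y) y); rewrite normrN.
have := sqr_ge0 (l2norm y); lra.
Qed.

(** A quantitative uniqueness of the positive square root. For [y = S x - X_n x], commutation gives
    [(S + X_n) y = 2 D_n S S x]; pairing with [y] and using [S >= 0] and [X_n >= 1/2] bounds the
    norm of [y]. *)
Lemma S_approx n x : V0 x ->
  l2norm (fun j => -1 * Xn n x j + S x j) <= 4 * (kap / 2 ^+ n) * l2norm (S (S x)).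
Proof.
move=> xV; have Sx := S_V0 xV; have SSx := S_V0 Sx.
have XV z : V0 z -> V0 (Xn n z) by move=> zV; apply: V0D => //; exact: V0_Y.
have comX z : V0 z -> S (Xn n z) = Xn n (S z).
  move=> zV; rewrite /Xn S_lin ?comS_Y//; [by case: (V0_Y n zV)|by case: zV].
have linX c a b : V0 a -> V0 b -> Xn n (fun j => c * a j + b j) = fun j => c * Xn n a j + Xn n b j.
  move=> aV bV; rewrite /Xn lin_Y//; apply/funext => j; lra.
set y := fun j => _.
have yV : V0 y by apply: V0D => //; exact: XV.
have [yl _] := yV.
have E1 : (fun j => 1 * S y j + Xn n y j) = (fun j => 2 * D n (S (S x)) j).
  rewrite /y S_lin; [|by case: (XV _ xV)|by case: Sx].
  rewrite comX// linX//; last exact: XV.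
  have E := Xn_sqr n SSx.
  have [G1 _] := GSS (proj1 xV); rewrite G1 in E.
  apply/funext => j; have := congr1 (fun f => f j) E => /= Ej.
  rewrite Ej; lra.
have [bD0 VD ND _] := bnd_D n.
have [Dl _] := VD _ SSx; have [SSl _] := SSx.
have [Xyl _] := XV _ yV; have Syl : l2 (S y) by exact: opl2.
have h1 : l2dot (fun j => 1 * S y j + Xn n y j) y = l2dot (S y) y + l2dot (Xn n y) y.
  by rewrite dotDl// mul1r.
have h2 : l2dot (fun j => 2 * D n (S (S x)) j) y = 2 * l2dot (D n (S (S x))) y.
  have := dotDl 2 Dl l2_0 yl; rewrite [l2dot (fun=> 0) _]dotC dot_0// addr0 => <-.
  by congr (l2dot _ y); apply/funext => j; rewrite addr0.
have h3 := Xn_pos n yV.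
have h4 : 0 <= l2dot (S y) y by apply: pS.2.
have h5 := dot_CS Dl yl.
have h6 : l2dot (D n (S (S x))) y <= kap / 2 ^+ n * l2norm (S (S x)) * l2norm y.
  apply: le_trans (ler_norm _) _; apply: le_trans h5 _.
  by rewrite ler_wpM2r ?l2norm_ge0// ND.
have h7 : 2^-1 * l2norm y ^+ 2 <= 2 * (kap / 2 ^+ n * l2norm (S (S x)) * l2norm y).
  by rewrite E1 h2 in h1; lra.
have := l2norm_ge0 y; rewrite le_eqVlt => /predU1P[<-|y0].
  by rewrite mulr_ge0 ?l2norm_ge0// mulr_ge0.
rewrite -(ler_pM2r y0); move: h7; rewrite expr2; lra.
Qed.

(** The unit vector at [q] has weighted norm [1 / u q], and [X_n] enlarges it by at most
    [1 + 2 kap <= 2]. Coordinates of [X_n] converge to those of [S], so the bound survives the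
    limit. *)
Lemma S_le_weight q p : q != r0 -> 0 < u q -> `|S (l2_delta q) p| <= 2 * (u p / u q).
Proof.
move=> qr uq; set e : J -> R := l2_delta q.
have eV : V0 e by split; [exact: l2_e|rewrite /e /l2_delta eq_sym (negbTE qr)].
have eu j : `|e j| <= (u q)^-1 * u j.
  rewrite /e /l2_delta; have [->|_] := eqVneq j q; first by rewrite normr1 mulVf ?gt_eqF.
  by rewrite normr0 mulr_ge0// invr_ge0 ltW.
apply/ler_addgt0Pr => ep ep0.
have [n hn] : exists n, 4 * (kap / 2 ^+ n) * l2norm (S (S e)) <= ep.
  pose b := kap * 4 * l2norm (S (S e)) / ep.
  have [n bn] : exists n : nat, b <= 2 ^+ n.
    pose N := Num.bound b; exists N; apply: le_trans (ltW (archi_boundP _)) _.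
      by rewrite /b !mulr_ge0 ?invr_ge0 ?l2norm_ge0// ltW.
    have : (N <= 2 ^ N)%N by apply/ltnW/ltn_expl.
    by rewrite -(ler_nat R) natrX.
  exists n; move: bn; rewrite /b ler_pdivrMr// => bn.
  rewrite [leLHS](_ : _ = kap * 4 * l2norm (S (S e)) / 2 ^+ n); last by lra.
  by rewrite ler_pdivrMr ?exprn_gt0// [ep * _]mulrC.
have h1 := S_approx n eV.
have Sl : l2 (S e) by apply: opl2 => //; case: eV.
have Xl : l2 (Xn n e) by case: (V0D 1 (V0_Y n eV) eV).
have /(le_coord p) h2 := l2D (-1) Xl Sl.
have [_ _ _ /(_ e _ eV eu p) hY] := bnd_Y n.
have hep := eu p.
have : `|Xn n e p| <= 2 * kap * (u q)^-1 * u p + (u q)^-1 * u p.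
  by rewrite /Xn mul1r; apply: le_trans (ler_normD _ _) _; apply: lerD.
have : 2 * kap * (u q)^-1 * u p <= (u q)^-1 * u p.
  rewrite -mulrA ler_piMl ?mulr_ge0// ?invr_ge0 ?ltW//.
  by have k8 := kap8; lra.
have : `|S e p| <= `|Xn n e p| + `|-1 * Xn n e p + S e p|.
  have -> : S e p = Xn n e p + (-1 * Xn n e p + S e p) by lra.
  by apply: le_trans (ler_normD _ _) _; rewrite lerD2l mulN1r addKr.
lra.
Qed.

End InvSqrt.


(** * Sums over levels and geometric series *)

Section Levels.
Context {R : realType} {J : choiceType}.
Variable lev : J -> nat.
Implicit Types (A : {fset J}).

Lemma sum_levels (g : J -> R) (b : nat -> R) (C : R) A :
  (forall n, \sum_(r <- A | lev r == n) g r <= b n) ->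
  (forall N, \sum_(n < N) b n <= C) -> \sum_(r <- A) g r <= C.
Proof.
move=> gb bC; pose N := (\max_(r <- A) lev r).+1.
apply: le_trans (bC N).
have -> : \sum_(r <- A) g r = \sum_(n < N) \sum_(r <- A | lev r == n) g r.
  rewrite [RHS](exchange_big_dep xpredT)//= [LHS]big_seq [RHS]big_seq.
  apply: eq_bigr => r rA; have rN : (lev r < N)%N by rewrite ltnS; apply: leq_bigmax_seq.
  by rewrite (big_pred1 (Ordinal rN)).
by apply: ler_sum.
Qed.

End Levels.

Section Geo.
Context {R : realType}.
Variables (G : R -> R) (de om : R).
Hypothesis G0 : forall x, 0 < x -> 0 < G x.
Hypothesis GM : forall x y, 0 < x -> 0 < y -> G (x * y) = G x * G y.
Hypothesis Gmono : forall x y, 0 < x -> x <= y -> G x <= G y.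
Hypothesis Gde : G de = om.
Hypothesis de0 : 0 < de.
Hypothesis om0 : 0 < om.
Hypothesis om1 : om < 1.

Lemma G1 : G 1 = 1.
Proof.
have := GM ltr01 ltr01; rewrite mulr1 => h.
have g0 : G 1 != 0 by rewrite gt_eqF// G0.
by apply: (mulfI g0); rewrite -h mulr1.
Qed.

Lemma GX x n : 0 < x -> G (x ^+ n) = G x ^+ n.
Proof.
move=> x0; elim: n => [|n IH]; first by rewrite !expr0 G1.
by rewrite !exprS GM ?exprn_gt0// IH.
Qed.

Lemma Gdelta n : G (de ^+ n) = om ^+ n.
Proof. by rewrite GX// Gde. Qed.

Lemma geoA rho N : 0 < rho ->
  \sum_(n < N) (if de ^+ n <= rho then om ^+ n else 0) <= G rho / (1 - om).
Proof.
move=> r0; have o1 : 0 < 1 - om by rewrite subr_gt0.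
have om0' := om0; have om1' := om1.
rewrite ler_pdivlMr//.
(* Telescoped form: the terms start at the first [n] with [de ^+ n <= rho], where [om ^+ n] is at
   most [G rho]; until then the sum is zero. *)
suff : (\sum_(n < N) (if de ^+ n <= rho then om ^+ n else 0)) * (1 - om) <= Num.max 0 (G rho - om ^+ N).
  move/le_trans; apply; rewrite ge_max (ltW (G0 r0))/= lerBlDr lerDl exprn_ge0// ltW//.
elim: N => [|N IH]; first by rewrite big_ord0 mul0r le_max lexx.
rewrite big_ord_recr/= mulrDl.
have oN : 0 < om ^+ N by rewrite exprn_gt0.
case: ifPn => [dr|_].
  have gr : om ^+ N <= G rho by rewrite -Gdelta Gmono// exprn_gt0.
  rewrite le_max; apply/orP; right.
  move: IH; rewrite (_ : Num.max 0 (G rho - om ^+ N) = G rho - om ^+ N).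
    rewrite exprS => IH; lra.
  by apply/max_idPr; rewrite subr_ge0.
rewrite mul0r addr0; apply: le_trans IH _.
rewrite ge_max le_max lexx/= le_max; apply/orP; right.
rewrite lerB// exprS ler_piMl// ltW//.
Qed.

Lemma geoB rho N : 0 < rho ->
  \sum_(n < N) (if rho < de ^+ n then (om ^+ n)^-1 else 0) <= (G rho)^-1 / (1 - om).
Proof.
move=> r0; have o1 : 0 < 1 - om by rewrite subr_gt0.
have om0' := om0; have om1' := om1.
rewrite ler_pdivlMr//.
(* The second inequality is the plain geometric bound. It pays for a new term [(om ^+ N)^-1], whose
   presence means [rho < de ^+ N] and yields the first inequality again. *)
suff [//] : (\sum_(n < N) (if rho < de ^+ n then (om ^+ n)^-1 else 0)) * (1 - om) <= (G rho)^-1 /\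
  (\sum_(n < N) (if rho < de ^+ n then (om ^+ n)^-1 else 0)) * (1 - om) <= om / om ^+ N.
elim: N => [|N [IH1 IH2]].
  rewrite big_ord0 mul0r expr0 divr1 invr_ge0; split; first by apply/ltW/G0.
  exact: ltW.
rewrite big_ord_recr/= mulrDl.
have oN : 0 < (om ^+ N)^-1 by rewrite invr_gt0 exprn_gt0.
have E : om / om ^+ N.+1 = (om ^+ N)^-1.
  by rewrite exprS invfM mulrA divff ?mul1r// gt_eqF.
rewrite E; case: ifPn => [dr|_].
  have gr : (om ^+ N)^-1 <= (G rho)^-1.
    rewrite lef_pV2 ?posrE ?exprn_gt0 ?G0//.
    by rewrite -Gdelta Gmono// ltW.
  split; last by lra.
  apply: le_trans gr; lra.
rewrite mul0r addr0; split => //; apply: le_trans IH2 _.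
by rewrite ler_piMl// ltW.
Qed.

Lemma geo_sum N : \sum_(n < N) om ^+ n <= (1 - om)^-1.
Proof.
have o1 : 0 < 1 - om by rewrite subr_gt0.
have om0' := om0.
rewrite -[leRHS]mul1r ler_pdivlMr// mulrC.
have -> : (1 - om) * \sum_(n < N) om ^+ n = 1 - om ^+ N.
  have := @subrX1 _ om N; rewrite -(opprB 1 om) mulNr => h.
  by apply: oppr_inj; rewrite -h opprB.
by rewrite lerBlDr lerDl exprn_ge0// ltW//.
Qed.

Lemma geo_dist l m N :
  \sum_(n < N) (if (m <= (l - n) + (n - l))%N then om ^+ ((l - n) + (n - l)) else 0)
    <= 2 * (om ^+ m / (1 - om)).
Proof.
have o1 : 0 < 1 - om by rewrite subr_gt0.
have key (k : nat) : \sum_(n < k) (if (m <= n)%N then om ^+ n else 0) <= om ^+ m / (1 - om).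
  have [km|mk] := leqP k m.
    rewrite big1 ?divr_ge0 ?exprn_ge0 ?ltW// => -[i ik] _ /=.
    by rewrite leqNgt (leq_trans ik km).
  rewrite -(big_mkord xpredT (fun n => if (m <= n)%N then om ^+ n else 0)).
  rewrite (big_cat_nat (leq0n m) (ltnW mk))/= big_nat_cond big1 ?add0r; last first.
    by move=> i /andP[/andP[_ im] _]; rewrite leqNgt im.
  rewrite -{1}[m]add0n big_addn big_mkord.
  under eq_bigr do rewrite leq_addl exprD mulrC.
  rewrite -mulr_sumr; apply: ler_wpM2l; first by rewrite exprn_ge0// ltW.
  exact: geo_sum.
have f0 (k : nat) : 0 <= (if (m <= k)%N then om ^+ k else 0).
  by case: ifP => // _; rewrite exprn_ge0// ltW.
rewrite -(big_mkord xpredT (fun n => if (m <= (l - n) + (n - l))%N then om ^+ ((l - n) + (n - l)) else 0)).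
apply: (@le_trans _ _ (\sum_(0 <= n < l + N) (if (m <= (l - n) + (n - l))%N then om ^+ ((l - n) + (n - l)) else 0))).
  rewrite [leRHS](big_cat_nat (leq0n N) (leq_addl _ _))/= lerDl sumr_ge0//.
rewrite (big_cat_nat (leq0n l) (leq_addr _ _))/= mulrDl mul1r lerD//.
  apply: le_trans (key l.+1); rewrite big_nat_rev /= add0n big_mkord big_ord_recl/=.
  rewrite -[leLHS]add0r lerD//; apply: ler_sum => -[i il] _ /=.
  rewrite /bump/= add1n subKn// (_ : (l - i.+1 - l)%N = 0%N) ?addn0//.
  by apply/eqP; rewrite subn_eq0 leq_subLR leq_addl.
rewrite -{1}[l]add0n big_addn addKn big_mkord.
apply: le_trans (key N); apply: ler_sum => i _.
by rewrite addnK (_ : (l - (i + l))%N = 0%N) ?add0n//; apply/eqP; rewrite subn_eq0 leq_addl.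
Qed.

End Geo.


Ltac pos := solve [repeat first [assumption | apply: ltW; assumption
  | apply: mulr_ge0 | apply: exprn_ge0 | apply: addr_ge0 | rewrite invr_ge0
  | exact: ler01 | exact: ler0n]].

Lemma ldist_le l n :
  (l + ((l - n) + (n - l)) <= 2 * ((l - n) + (n - l)) + n)%N.
Proof. lia. Qed.

(** * Almost diagonal matrices and the Schur test *)

Section AlmostDiagonal.
Context {R : realType} {X : Type}.
Variables (d : X -> X -> R) (G : R -> R) (Kt Cc Ct Cn de om sg : R).

(** For [G x = x^(beta/2)] this is [x^(-1-beta)]: one power more than the exponent [1] with which
    the number of cubes of a level grows with the distance. *)
Definition ker (x : R) : R := (x * G x ^+ 2)^-1.

Hypothesis d0 : forall x y, 0 <= d x y.
Hypothesis dxx : forall x, d x x = 0.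
Hypothesis dC : forall x y, d x y = d y x.
Hypothesis Kt1 : 1 <= Kt.
Hypothesis dT : forall x y z, d x y <= Kt * (d x z + d z y).
Hypothesis G0 : forall x, 0 < x -> 0 < G x.
Hypothesis GM : forall x y, 0 < x -> 0 < y -> G (x * y) = G x * G y.
Hypothesis Gmono : forall x y, 0 < x -> x <= y -> G x <= G y.
Hypothesis G2 : 1 < G 2.
Hypothesis Gde : G de = om.
Hypothesis sg0 : 0 < sg.
Hypothesis sg2 : sg ^+ 2 = de.
Hypothesis de1 : de < 1.
Hypothesis om0 : 0 < om.
Hypothesis om1 : om < 1.
Hypothesis Cc0 : 0 <= Cc.
Hypothesis Ct0 : 0 <= Ct.
Hypothesis Cn0 : 0 <= Cn.

Lemma de0 : 0 < de. Proof. by rewrite -sg2 exprn_gt0. Qed.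

Lemma den0 n : 0 < de ^+ n. Proof. by rewrite exprn_gt0// de0. Qed.

Lemma ker_gt0 x : 0 < x -> 0 < ker x.
Proof. by move=> x0; rewrite invr_gt0 mulr_gt0// exprn_gt0// G0. Qed.

Lemma ker_ge0 x : 0 < x -> 0 <= ker x.
Proof. by move=> /ker_gt0/ltW. Qed.

Lemma kerM x y : 0 < x -> 0 < y -> ker (x * y) = ker x * ker y.
Proof.
move=> x0 y0; rewrite /ker GM// exprMn -invfM; congr (_^-1); lra.
Qed.

Lemma ker_anti x y : 0 < x -> x <= y -> ker y <= ker x.
Proof.
move=> x0 xy; have y0 := lt_le_trans x0 xy.
have gx := G0 x0; have gy := G0 y0; have g := Gmono x0 xy.
rewrite lef_pV2 ?posrE ?mulr_gt0 ?exprn_gt0//.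
apply: ler_pM => //; [exact: ltW|exact/exprn_ge0/ltW|].
by rewrite ler_pXn2r// nnegrE ltW.
Qed.

Lemma ker_scale c x y : 0 < c -> 0 < y -> x * c <= y -> 0 < x -> ker y <= ker c * ker x.
Proof. by move=> c0 y0 xy x0; rewrite -kerM// [c * x]mulrC ker_anti// mulr_gt0. Qed.

Lemma ker_inv x : 0 < x -> x * ker x = (G x ^+ 2)^-1.
Proof. by move=> x0; rewrite /ker invfM mulrA divff ?mul1r// gt_eqF. Qed.

Lemma ker_de n : ker (de ^+ n) = (de ^+ n * om ^+ n ^+ 2)^-1.
Proof. by rewrite /ker (Gdelta G0 GM Gde de0). Qed.

Definition sumC : R := Cc * ker 2^-1 / (1 - (G 2 ^+ 2)^-1).

Lemma q1 : (G 2 ^+ 2)^-1 < 1.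
Proof. by rewrite invf_lt1 ?exprn_gt0 ?(lt_trans ltr01)// exprn_egt1. Qed.

Lemma q0 : 0 < (G 2 ^+ 2)^-1.
Proof. by rewrite invr_gt0 exprn_gt0// (lt_trans ltr01). Qed.

Lemma sumC_ge0 : 0 <= sumC.
Proof.
by rewrite !mulr_ge0 ?ker_ge0// invr_ge0 subr_ge0 ltW// q1.
Qed.

(** The threshold of [schur_wq]: beyond [Lam] times the size of [p], replacing [p] by a neighbour
    [r] of the same or a finer level changes the distance to [q] by a bounded factor only. *)
Definition Lam : R := 2 * (1 + Kt * Cn + Kt).
Definition schurA : R := 2 * (Ct * Cc * (Cn + 1)) / (1 - om).
Definition schurB : R :=
  2 * (Ct * Cc * (Cn + 1) * ker Lam^-1 + Ct * sumC / ker Lam) / (1 - om).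

Section System.
Context {J : choiceType}.
Variables (lev : J -> nat) (pos : J -> X).
Implicit Types A : {fset J}.

Hypothesis count : forall n x rho A, de ^+ n <= rho ->
  \sum_(r <- A | (lev r == n) && (d x (pos r) < rho)) 1 <= Cc * (rho / de ^+ n).

(** The points are sorted by the first dyadic ball of radius [2 ^+ j * L] around [x] that contains
    them. Such a ball holds at most [Cc * 2 ^+ j * L / de ^+ n] points of level [n], so the terms
    decrease with ratio [2 * ker 2 = 1 / G 2 ^+ 2 < 1]. *)
Lemma sum_ker n x L A : de ^+ n <= L ->
  \sum_(r <- A | lev r == n) ker (L + d x (pos r)) <= sumC / (de ^+ n * G L ^+ 2).
Proof.
move=> dL; have L0 : 0 < L := lt_le_trans (den0 n) dL.
have /choice[j hj] : forall r, exists j : nat, d x (pos r) < 2 ^+ j * L /\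
    L * 2 ^+ j * 2^-1 <= L + d x (pos r).
  move=> r; have ex : exists j : nat, d x (pos r) < 2 ^+ j * L.
    pose N := Num.bound (d x (pos r) / L); exists N.
    rewrite -ltr_pdivrMr//; apply: lt_trans (archi_boundP _) _.
      by rewrite divr_ge0// ltW.
    have : (N < 2 ^ N)%N by apply/ltn_expl.
    by rewrite -(ltr_nat R) natrX.
  case: (ex_minnP ex) => i hi mini; exists i; split => //.
  case: i hi mini => [|i] hi mini.
    by rewrite expr0; have := d0 x (pos r); lra.
  have : ~~ (d x (pos r) < 2 ^+ i * L) by apply/negP => /mini; rewrite ltnn.
  rewrite -leNgt exprS; have := L0; lra.
pose N := (\max_(r <- A) j r).+1.
pose b i := ker L * ker 2 ^+ i * ker 2^-1.
have i2 : 0 < 2^-1 :> R by rewrite invr_gt0.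
have k2 : 0 <= ker 2 by apply: ker_ge0.
have ki2 : 0 <= ker 2^-1 by apply: ker_ge0.
have kL : 0 <= ker L by apply: ker_ge0.
have b0 i : 0 <= b i by rewrite /b !mulr_ge0// exprn_ge0.
have kX i : ker (2 ^+ i) = ker 2 ^+ i.
  elim: i => [|i IH]; last by rewrite !exprS kerM ?exprn_gt0// IH.
  by rewrite !expr0 /ker (G1 G0 GM) expr1n mulr1 invr1.
apply: (@le_trans _ _ (\sum_(i < N) \sum_(r <- A | (lev r == n) && (d x (pos r) < 2 ^+ i * L)) b i)).
  rewrite (exchange_big_dep (fun r => lev r == n))/=; last by move=> i r _ /andP[].
  rewrite big_seq_cond [leRHS]big_seq_cond; apply: ler_sum => r /andP[rA rn].
  have jN : (j r < N)%N by rewrite ltnS; apply: leq_bigmax_seq.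
  have [hj1 hj2] := hj r.
  rewrite (bigD1 (Ordinal jN))/= ?rn ?hj1// ler_wpDr ?sumr_ge0//.
  rewrite /b -kX -!kerM ?mulr_gt0 ?exprn_gt0//.
  by apply: ker_anti; rewrite ?mulr_gt0 ?exprn_gt0.
apply: (@le_trans _ _ (\sum_(i < N) sumC * (1 - (G 2 ^+ 2)^-1) / (de ^+ n * G L ^+ 2) * (G 2 ^+ 2)^-1 ^+ i)).
  apply: ler_sum => i _.
  have -> : \sum_(r <- A | (lev r == n) && (d x (pos r) < 2 ^+ i * L)) b i =
     b i * \sum_(r <- A | (lev r == n) && (d x (pos r) < 2 ^+ i * L)) 1.
    by rewrite mulr_sumr; apply: eq_bigr => r _; rewrite mulr1.
  have dn : de ^+ n <= 2 ^+ i * L.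
    by apply: le_trans dL _; rewrite ler_peMl ?exprn_ege1 ?ler1n// ltW.
  apply: le_trans (ler_wpM2l (b0 i) (count x A dn)) _.
  have E1 : sumC * (1 - (G 2 ^+ 2)^-1) = Cc * ker 2^-1.
    by have q1' := q1; rewrite divfK// gt_eqF// subr_gt0.
  have E2 : (G 2 ^+ 2)^-1 ^+ i = 2 ^+ i * ker 2 ^+ i by rewrite -ker_inv// exprMn.
  have E3 : (de ^+ n * G L ^+ 2)^-1 = (de ^+ n)^-1 * (L * ker L).
    by rewrite ker_inv// invfM.
  rewrite E1 E2 E3 /b; lra.
rewrite -mulr_sumr.
apply: (@le_trans _ _ (sumC * (1 - (G 2 ^+ 2)^-1) / (de ^+ n * G L ^+ 2) * (1 - (G 2 ^+ 2)^-1)^-1)).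
  apply: ler_wpM2l; last by apply: geo_sum; [exact: q0|exact: q1].
  apply: divr_ge0.
    by apply: mulr_ge0; [exact: sumC_ge0|rewrite subr_ge0 ltW// q1].
  by apply/ltW/mulr_gt0; [exact: den0|rewrite exprn_gt0// G0].
rewrite mulrAC mulfK//.
by rewrite gt_eqF// subr_gt0 q1.
Qed.

Definition ldist p r : nat := ((lev p - lev r) + (lev r - lev p))%N.
Definition qd p q : R := de ^+ lev p + de ^+ lev q + d (pos p) (pos q).
Definition wt p : R := sg ^+ lev p * om ^+ lev p.
(** The column of [q] in the almost diagonal kernel, without the constant factor [wt q]. It is the
    weight [u] of [S_le_weight]. *)
Definition wq q p : R := wt p * ker (qd p q).

Lemma qd_gt0 p q : 0 < qd p q.
Proof. by rewrite /qd ltr_wpDr// addr_gt0// den0. Qed.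

Lemma qdC p q : qd p q = qd q p.
Proof. by rewrite /qd dC [X in X + _]addrC. Qed.

Lemma wt_gt0 p : 0 < wt p.
Proof. by rewrite mulr_gt0// exprn_gt0. Qed.

Lemma wq_gt0 q p : 0 < wq q p.
Proof. by rewrite mulr_gt0 ?wt_gt0// ker_gt0// qd_gt0. Qed.

Lemma sgde n : sg ^+ n * sg ^+ n = de ^+ n.
Proof. by rewrite -exprMn -expr2 sg2. Qed.

Lemma wt_sqr p : wt p * wt p = de ^+ lev p * om ^+ lev p ^+ 2.
Proof. by rewrite /wt -sgde expr2; lra. Qed.

(** Because of this diagonal value, the ratio [wq q p / wq q q] that [S_le_weight] produces is the
    symmetric kernel [wt p * wt q * ker (qd p q)] divided by [ker 2]. *)
Lemma wqq q : wq q q = ker 2 / wt q.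
Proof.
rewrite /wq /qd dxx addr0 (_ : _ + _ = 2 * de ^+ lev q); last by lra.
rewrite kerM ?den0// ker_de -wt_sqr invfM.
have w0 : wt q != 0 by rewrite gt_eqF// wt_gt0.
by rewrite mulrCA; congr (_ * _); rewrite mulrA divff// mul1r.
Qed.

Variables (t : J -> J -> R) (m : nat).
Hypothesis ht : forall p r, t p r != 0 -> [/\ (m <= ldist p r)%N,
  d (pos p) (pos r) <= Cn * de ^+ minn (lev p) (lev r)
  & `|t p r| <= Ct * sg ^+ ldist p r * om ^+ (2 * ldist p r)].

(** The nonzero entries of a row lie within [Cn * de ^+ minn (lev p) n] of [pos p]; [count] bounds
    their number in one level, and each entry is bounded by [ht]. *)
Lemma sum_t p n A (k := ((lev p - n) + (n - lev p))%N) :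
  \sum_(r <- A | lev r == n) `|t p r| <= if (m <= k)%N then
    Ct * Cc * (Cn + 1) * (sg ^+ k * om ^+ (2 * k) * (de ^+ minn (lev p) n / de ^+ n)) else 0.
Proof.
have -> : \sum_(r <- A | lev r == n) `|t p r| =
   \sum_(r <- A | (lev r == n) && (t p r != 0)) `|t p r|.
  rewrite [LHS](bigID (fun r => t p r != 0))/= [X in _ + X]big1 ?addr0// => r.
  by move=> /andP[_]; rewrite negbK => /eqP ->; rewrite normr0.
case: ifPn => [mk|]; last first.
  rewrite -ltnNge => km; rewrite big1// => r /andP[/eqP rn /ht[mk _ _]].
  by move: mk; rewrite /ldist rn leqNgt km.
set M := de ^+ minn (lev p) n.
have M0 : 0 < M by exact: den0.
have Mn : de ^+ n <= (Cn + 1) * M.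
  apply: (@le_trans _ _ M); last by apply: ler_peMl; [exact: ltW|rewrite lerDr].
  by rewrite /M ler_wiXn2l ?ltW ?de0// geq_minr.
have c1 := count (pos p) A Mn.
set T := Ct * (sg ^+ k * om ^+ (2 * k)).
have T0 : 0 <= T by rewrite !mulr_ge0// exprn_ge0// ltW.
apply: (@le_trans _ _ (\sum_(r <- A | (lev r == n) && (t p r != 0)) T)).
  apply: ler_sum => r /andP[/eqP rn /ht[_ _]]; rewrite /ldist rn -/k /T; lra.
apply: (@le_trans _ _ (\sum_(r <- A | (lev r == n) && (d (pos p) (pos r) < (Cn + 1) * M)) T)).
  rewrite [leRHS](bigID (fun r => t p r != 0))/= -[leLHS]addr0 lerD ?sumr_ge0//.
  rewrite [leLHS]big_mkcond [leRHS]big_mkcond /=; apply: ler_sum => r _.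
  case: eqP => //= rn; case: ifPn => [tr|]; last by rewrite andbF.
  have [_ dr _] := ht tr; rewrite rn -/M in dr.
  by rewrite (_ : _ < _ = true)// (le_lt_trans dr)// ltr_pM2r// ltrDl.
have -> : \sum_(r <- A | (lev r == n) && (d (pos p) (pos r) < (Cn + 1) * M)) T =
    T * \sum_(r <- A | (lev r == n) && (d (pos p) (pos r) < (Cn + 1) * M)) 1.
  by rewrite mulr_sumr; apply: eq_bigr => r _; rewrite mulr1.
apply: le_trans (ler_wpM2l T0 c1) _; rewrite /T; lra.
Qed.

(** The number of finer cubes in a coarser one is exactly compensated by the factor [sg ^+ k] of the
    entries and the change of weight from [sg ^+ n] to [sg ^+ l]. *)
Lemma sg_alg l n (k := ((l - n) + (n - l))%N) :
  sg ^+ k * (de ^+ minn l n / de ^+ n) * sg ^+ n = sg ^+ l.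
Proof.
have sn0 : sg ^+ n != 0 by rewrite gt_eqF// exprn_gt0.
have [ln|nl] := leqP l n.
  have -> : k = (n - l)%N by rewrite /k (_ : (l - n)%N = 0%N)//; apply/eqP; rewrite subn_eq0.
  rewrite -!sgde invfM.
  have E : sg ^+ (n - l) * sg ^+ l = sg ^+ n by rewrite -exprD subnK.
  rewrite (_ : _ * _ = (sg ^+ (n - l) * sg ^+ l) * sg ^+ l * (sg ^+ n)^-1 * (sg ^+ n / sg ^+ n)); last by lra.
  by rewrite E divff// mulr1 mulrAC mulfV// mul1r.
have -> : k = (l - n)%N by rewrite /k (_ : (n - l)%N = 0%N) ?addn0//; apply/eqP; rewrite subn_eq0 ltnW.
by rewrite divff ?mulr1 -?exprD ?subnK// ?(ltnW nl)// gt_eqF// den0.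
Qed.

Lemma om_le a b : (b <= a)%N -> om ^+ a <= om ^+ b.
Proof. by move=> ab; rewrite ler_wiXn2l// ltW. Qed.

Lemma om_X n : 0 < om ^+ n. Proof. exact: exprn_gt0. Qed.

Lemma Bgeo (B : R) l N : 0 <= B ->
  \sum_(n < N) (if (m <= (l - n) + (n - l))%N then B * om ^+ ((l - n) + (n - l)) else 0)
   <= 2 * B / (1 - om) * om ^+ m.
Proof.
move=> B0; have := geo_dist om0 om1 l m N => h.
rewrite (_ : 2 * B / (1 - om) * om ^+ m = B * (2 * (om ^+ m / (1 - om)))); last by lra.
apply: le_trans (ler_wpM2l B0 h); rewrite mulr_sumr le_eqVlt; apply/orP; left; apply/eqP.
by apply: eq_bigr => n _; case: ifP; rewrite ?mulr0.
Qed.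

(** After the cancellation [sg_alg] only powers of [om] remain. Their exponents are at least [m],
    since closer levels do not interact, and the geometric series gives the small factor
    [om ^+ m]. *)
Lemma schur_sg p A : \sum_(r <- A) `|t p r| * sg ^+ lev r <= schurA * om ^+ m * sg ^+ lev p.
Proof.
set B := Ct * Cc * (Cn + 1).
have B0 : 0 <= B by rewrite !mulr_ge0// addr_ge0.
pose l := lev p.
apply: (@sum_levels _ _ lev _ (fun n => (if (m <= (l - n) + (n - l))%N then
    (B * sg ^+ l) * om ^+ ((l - n) + (n - l)) else 0))) => [n|N]; last first.
  apply: le_trans (Bgeo _ _ _) _; first by rewrite mulr_ge0// exprn_ge0// ltW.
  by rewrite /schurA -/B; lra.
have -> : \sum_(r <- A | lev r == n) `|t p r| * sg ^+ lev r =
    (\sum_(r <- A | lev r == n) `|t p r|) * sg ^+ n.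
  by rewrite mulr_suml; apply: eq_bigr => r /eqP ->.
apply: le_trans (ler_wpM2r _ (sum_t p n A)) _; first by rewrite exprn_ge0// ltW.
rewrite -/B -/l; case: ifP => _; last by rewrite mul0r.
set k := ((l - n) + (n - l))%N.
have E := sg_alg l n; rewrite -/k in E.
rewrite [leLHS](_ : _ = B * om ^+ (2 * k) * (sg ^+ k * (de ^+ minn l n / de ^+ n) * sg ^+ n)); last by lra.
rewrite E mulrAC; apply: ler_wpM2l; first by rewrite mulr_ge0// exprn_ge0// ltW.
by apply: om_le; rewrite mul2n -addnn leq_addl.
Qed.

Lemma Lam_ge1 : 1 <= Lam.
Proof.
have k1 := Kt1; have : 0 <= Kt * Cn by rewrite mulr_ge0// (le_trans ler01).
by rewrite /Lam; lra.
Qed.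

(** Level by level, either [ker (qd r q)] is comparable to [ker (qd p q)] for all [r] that interact
    with [p], or [q] lies at the scale of [p] and the kernel is summed over the finer [r] by
    [sum_ker]. In both cases a power of [om] is left to sum over the levels. *)
Lemma schur_wq p q A : \sum_(r <- A) `|t p r| * wq q r <= schurB * om ^+ m * wq q p.
Proof.
have L1 := Lam_ge1; have L0 : 0 < Lam := lt_le_trans ltr01 L1.
have Li0 : 0 < Lam^-1 by rewrite invr_gt0.
have Kt0 : 0 <= Kt := le_trans ler01 Kt1.
have KC0 : 0 <= Kt * Cn by rewrite mulr_ge0.
set B1 := Ct * Cc * (Cn + 1).
have B10 : 0 <= B1 by rewrite !mulr_ge0// addr_ge0.
have kLi := ker_ge0 Li0; have kL := ker_gt0 L0.
have sC := sumC_ge0.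
set B := B1 * ker Lam^-1 + Ct * sumC / ker Lam.
have Ba : 0 <= B1 * ker Lam^-1 by rewrite mulr_ge0.
have Bb : 0 <= Ct * sumC / ker Lam.
  by apply: divr_ge0; [exact: mulr_ge0|exact: ltW].
have B0 : 0 <= B by rewrite addr_ge0.
pose l := lev p.
have w0 := wq_gt0 q p.
apply: (@sum_levels _ _ lev _ (fun n => (if (m <= (l - n) + (n - l))%N then
    (B * wq q p) * om ^+ ((l - n) + (n - l)) else 0))) => [n|N]; last first.
  apply: le_trans (Bgeo _ _ _) _; first by rewrite mulr_ge0// ltW.
  by rewrite /schurB -/B1 -/B; lra.
set k := ((l - n) + (n - l))%N.
(* In the first case [r] is coarser than [p], or [q] is far from [p] at the scale of [p]; the
   triangle inequality then gives [qd p q <= Lam * qd r q]. *)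
have [bc|] := boolP ((n < l)%N || (Lam * de ^+ l <= qd p q)).
  have kk r : t p r != 0 -> lev r = n -> ker (qd r q) <= ker Lam^-1 * ker (qd p q).
    move=> tr rn; apply: ker_scale => //; try exact: qd_gt0.
    rewrite ler_pdivrMr//.
    have [_ dr _] := ht tr; rewrite rn -/l in dr.
    have dpq := dT (pos p) (pos q) (pos r).
    have dKr : Kt * d (pos p) (pos r) <= Kt * (Cn * de ^+ minn l n) by rewrite ler_wpM2l.
    have sl := den0 l; have sn := den0 n; have sq := den0 (lev q).
    have drq := d0 (pos r) (pos q).
    have p1 : 0 <= Kt * Cn * de ^+ lev q by rewrite mulr_ge0// ltW.
    have p2 : 0 <= Kt * Cn * d (pos r) (pos q) by rewrite mulr_ge0.
    have p3 : 0 <= Kt * de ^+ n by rewrite mulr_ge0// ltW.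
    have p4 : 0 <= Kt * de ^+ lev q by rewrite mulr_ge0// ltW.
    have p5 : 0 <= Kt * d (pos r) (pos q) by rewrite mulr_ge0.
    have p6 : 0 <= Kt * Cn * de ^+ n by rewrite mulr_ge0// ltW.
    move: bc; rewrite /qd rn -/l; case: (ltnP n l) => [nl _|ln /= bc].
      rewrite (minn_idPr (ltnW nl)) in dKr.
      have sln : de ^+ l <= de ^+ n.
        by apply: ler_wiXn2l; [exact/ltW/de0|exact: ltW|exact: ltnW].
      rewrite /Lam; lra.
    rewrite (minn_idPl ln) in dKr.
    rewrite /Lam in bc *.
    have p7 : 0 <= Kt * de ^+ l by rewrite mulr_ge0// ltW.
    lra.
  apply: (@le_trans _ _ ((\sum_(r <- A | lev r == n) `|t p r|) * (sg ^+ n * om ^+ n * (ker Lam^-1 * ker (qd p q))))).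
    rewrite mulr_suml; apply: ler_sum => r /eqP rn.
    have [->|tr] := eqVneq (t p r) 0; first by rewrite normr0 !mul0r.
    rewrite /wq /wt rn; apply: ler_wpM2l => //; apply: ler_wpM2l; last exact: kk.
    by pos.
  have kD := ker_ge0 (qd_gt0 p q).
  apply: le_trans (ler_wpM2r _ (sum_t p n A)) _.
    by pos.
  rewrite -/B1 -/l -/k; case: ifP => _; last by rewrite mul0r.
  have E := sg_alg l n; rewrite -/k in E.
  rewrite [leLHS](_ : _ = B1 * ker Lam^-1 * ker (qd p q) * (om ^+ (2 * k) * om ^+ n) *
     (sg ^+ k * (de ^+ minn l n / de ^+ n) * sg ^+ n)); last by lra.
  rewrite E -exprD.
  have oo : om ^+ (2 * k + n) <= om ^+ (l + k).
    by apply: om_le; exact: ldist_le.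
  apply: (@le_trans _ _ (B1 * ker Lam^-1 * ker (qd p q) * om ^+ (l + k) * sg ^+ l)).
    apply: ler_wpM2r; first by rewrite exprn_ge0// ltW.
    by apply: ler_wpM2l => //; rewrite mulr_ge0.
  rewrite [leLHS](_ : _ = B1 * ker Lam^-1 * wq q p * om ^+ k); last by rewrite /wq /wt exprD; lra.
  apply: ler_wpM2r; first by rewrite exprn_ge0// ltW.
  by apply: ler_wpM2r; [exact: ltW|rewrite lerDl].
(* Now [r] is at least as fine as [p], and [qd p q < Lam * de ^+ l] bounds [wq q p] from below by a
   multiple of [1 / wt p], while [sum_ker] bounds the sum over [r]. *)
rewrite negb_or -leqNgt -ltNge => /andP[ln dpq].
have kE : k = (n - l)%N by rewrite /k (_ : (l - n)%N = 0%N)//; apply/eqP; rewrite subn_eq0.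
case: ifPn => [mk|mk]; last first.
  rewrite big1// => r /eqP rn; have [->|/ht[mk' _ _]] := eqVneq (t p r) 0.
    by rewrite normr0 mul0r.
  by move: mk; rewrite /k -rn mk'.
apply: (@le_trans _ _ (\sum_(r <- A | lev r == n) (Ct * sg ^+ k * om ^+ (2 * k) * (sg ^+ n * om ^+ n)) * ker (de ^+ n + d (pos q) (pos r)))).
  apply: ler_sum => r /eqP rn.
  have [->|tr] := eqVneq (t p r) 0.
    have kd : 0 <= ker (de ^+ n + d (pos q) (pos r)).
      by apply: ker_ge0; rewrite ltr_wpDr// den0.
    by rewrite normr0 mul0r; pos.
  have [_ _ tle] := ht tr; rewrite /ldist rn -/l -/k in tle.
  have w0' := wt_gt0 r.
  apply: (@le_trans _ _ (Ct * sg ^+ k * om ^+ (2 * k) * wq q r)).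
    by rewrite ler_wpM2r// ltW// wq_gt0.
  rewrite /wq /wt rn -[leRHS]mulrA; apply: ler_wpM2l.
    by pos.
  apply: ler_wpM2l; first by pos.
  apply: ker_anti; first by rewrite ltr_wpDr// den0.
  by rewrite /qd rn dC lerD2r lerDl ltW// den0.
rewrite -mulr_sumr; apply: le_trans (ler_wpM2l _ (sum_ker (pos q) A (lexx _))) _.
  by pos.
have kp : ker Lam / wt p <= wq q p.
  rewrite /wq; have wp := wt_gt0 p.
  have h1 : ker (Lam * de ^+ l) <= ker (qd p q).
    by apply: ker_anti; [exact: qd_gt0|exact: ltW].
  rewrite kerM ?den0// ker_de -wt_sqr invfM in h1.
  apply: le_trans (ler_wpM2l (ltW wp) h1).
  have ww : wt p / wt p = 1 by rewrite divff// gt_eqF.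
  rewrite [leRHS](_ : _ = ker Lam / wt p * (wt p / wt p)); last by lra.
  by rewrite ww mulr1.
apply: (@le_trans _ _ (Ct * sumC / ker Lam * (ker Lam / wt p) * om ^+ k)); last first.
  apply: ler_wpM2r; first by rewrite exprn_ge0// ltW.
  apply: (@le_trans _ _ (Ct * sumC / ker Lam * wq q p)); first by apply: ler_wpM2l.
  by apply: ler_wpM2r; [exact: ltW|rewrite lerDr].
rewrite (Gdelta G0 GM Gde de0) kE /wt -/l.
have sn0 := exprn_gt0 n sg0; have on0 := om_X n.
have En : sg ^+ n = sg ^+ (n - l) * sg ^+ l by rewrite -exprD subnK.
have Eo : om ^+ n = om ^+ (n - l) * om ^+ l by rewrite -exprD subnK.
rewrite -sgde !invfM mul2n -addnn exprD.
have s1 : sg ^+ n / sg ^+ n = 1 by rewrite divff// gt_eqF.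
have o1 : om ^+ n / om ^+ n = 1 by rewrite divff// gt_eqF.
have s2 : sg ^+ (n - l) / sg ^+ n = (sg ^+ l)^-1.
  by rewrite En invfM mulrA divff ?mul1r// gt_eqF// exprn_gt0.
have o2 : om ^+ (n - l) / om ^+ n = (om ^+ l)^-1.
  by rewrite Eo invfM mulrA divff ?mul1r// gt_eqF// exprn_gt0.
have kk1 : ker Lam / ker Lam = 1 by rewrite divff// gt_eqF.
rewrite [leRHS](_ : _ = Ct * sumC * ((sg ^+ l)^-1 * (om ^+ l)^-1) * om ^+ (n - l) * (ker Lam / ker Lam)); last by lra.
rewrite [leLHS](_ : _ = Ct * sumC * ((sg ^+ (n - l) / sg ^+ n) * (om ^+ (n - l) / om ^+ n)) * om ^+ (n - l) * (sg ^+ n / sg ^+ n) * (om ^+ n / om ^+ n)); last by lra.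
by rewrite s1 o1 s2 o2 kk1 !mulr1.
Qed.

Variables (Sm : J -> J -> R) (Cs : R).
Hypothesis Cs0 : 0 <= Cs.
Hypothesis hS : forall p q, `|Sm p q| <= Cs * (wt p * wt q * ker (qd p q)).

(** On level [n] the distance is effectively at least the larger of [rho] and [de ^+ n]. [sum_ker]
    then leaves [om ^+ n / G rho ^+ 2] for the fine levels and [1 / om ^+ n] for the coarse ones;
    both series are of order [1 / G rho]. *)
Lemma tail_S rho p A : 0 < rho ->
  \sum_(q <- A | rho <= qd p q) sg ^+ lev q * `|Sm q p| <=
    2 * Cs * ker 2^-1 * sumC / (1 - om) * (wt p / G rho).
Proof.
move=> rho0; have o1 : 0 < 1 - om by have := om1; lra.
have i2 : 0 < 2^-1 :> R by rewrite invr_gt0.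
have k2 := ker_ge0 i2; have sC := sumC_ge0; have wp := wt_gt0 p; have Gr := G0 rho0.
pose B := Cs * wt p * ker 2^-1 * sumC.
have B0 : 0 <= B by pos.
rewrite big_mkcond.
apply: (@sum_levels _ _ lev _ (fun n => B * (G rho ^+ 2)^-1 * (if de ^+ n <= rho then om ^+ n else 0)
   + B * (if rho < de ^+ n then (om ^+ n)^-1 else 0))) => [n|N]; last first.
  rewrite big_split/= -!mulr_sumr.
  have h1 := geoA G0 GM Gmono Gde de0 om0 om1 N rho0.
  have h2 := geoB G0 GM Gmono Gde de0 om0 om1 N rho0.
  have p1 : 0 <= B * (G rho ^+ 2)^-1 by rewrite mulr_ge0// invr_ge0 exprn_ge0// ltW.
  have := ler_wpM2l p1 h1; have := ler_wpM2l B0 h2.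
  have gg : G rho / G rho = 1 by rewrite divff// gt_eqF.
  have E : B * (G rho ^+ 2)^-1 * (G rho / (1 - om)) = B * ((G rho)^-1 / (1 - om)).
    rewrite expr2 invfM [LHS](_ : _ = B * ((G rho)^-1 / (1 - om)) * (G rho / G rho)); last by lra.
    by rewrite gg mulr1.
  rewrite E /B; lra.
pose L := Num.max rho (de ^+ n).
have dL : de ^+ n <= L by rewrite le_max lexx orbT.
have L0 : 0 < L by apply: lt_le_trans dL; exact: den0.
apply: (@le_trans _ _ (\sum_(q <- A | lev q == n) (Cs * wt p * ker 2^-1 * (de ^+ n * om ^+ n)) * ker (L + d (pos p) (pos q)))).
  apply: ler_sum => q /eqP qn; have Ld : 0 < L + d (pos p) (pos q) by rewrite ltr_wpDr.
  case: ifPn => [rq|_]; last first.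
    by have kd := ker_ge0 Ld; have dd := de0; pos.
  have kq : ker (qd q p) <= ker 2^-1 * ker (L + d (pos p) (pos q)).
    apply: ker_scale => //; first exact: qd_gt0.
    have dp := d0 (pos p) (pos q); have sp := den0 (lev p); have sn := den0 n.
    move: rq; rewrite qdC /qd qn (dC (pos q)) => rq.
    have : L <= de ^+ n + de ^+ lev p + d (pos p) (pos q).
      by rewrite ge_max rq/=; lra.
    lra.
  have hq := hS q p.
  have sq : 0 <= sg ^+ lev q by rewrite exprn_ge0// ltW.
  have wq0 := wt_gt0 q.
  apply: le_trans (ler_wpM2l sq hq) _.
  apply: le_trans (ler_wpM2l sq (ler_wpM2l Cs0 (ler_wpM2l _ kq))) _.
    by rewrite mulr_ge0// ltW.
  rewrite /wt qn -sgde; lra.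
rewrite -mulr_sumr; apply: le_trans (ler_wpM2l _ (sum_ker (pos p) A dL)) _.
  by have dd := de0; pos.
rewrite invfM.
rewrite [leLHS](_ : _ = B * (om ^+ n / G L ^+ 2) * (de ^+ n / de ^+ n)); last by rewrite /B; lra.
rewrite divff ?mulr1; last by rewrite gt_eqF// den0.
case: (leP (de ^+ n) rho) => dr.
  have LE : L = rho by apply/max_idPl.
  by rewrite LE; lra.
have LE : L = de ^+ n by apply/max_idPr/ltW.
rewrite LE (Gdelta G0 GM Gde de0) mulr0 add0r ler_wpM2l//.
by rewrite expr2 invfM mulrA divff ?mul1r// gt_eqF// om_X.
Qed.

(** The choice [rho = de ^+ lev p] in [tail_S] excludes no index, since [qd p q] is never
    smaller. *)
Lemma total_S p A :
  \sum_(q <- A) sg ^+ lev q * `|Sm q p| <= 2 * Cs * ker 2^-1 * sumC / (1 - om) * sg ^+ lev p.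
Proof.
have := tail_S p A (den0 (lev p)); rewrite (Gdelta G0 GM Gde de0) /wt mulfK; last first.
  by rewrite gt_eqF// om_X.
apply: le_trans; rewrite [leRHS]big_mkcond/=; apply: ler_sum => q _.
by rewrite ifT// /qd -addrA lerDl addr_ge0// ltW// den0.
Qed.

End System.
End AlmostDiagonal.

(** * Square integrals and the smoothing operator *)

Section SquareIntegral.
Context {R : realType} {disp : measure_display} {X : measurableType disp}.
Variable mu : {measure set X -> \bar R}.

Lemma LnormE2 (f : X -> R) : itg mu (fun x => f x ^+ 2) ->
  ('N[mu]_2%:E[EFin \o f] = (Num.sqrt (\int[mu]_x (f x ^+ 2)))%:E)%E.
Proof.
move=> If; rewrite unlock /=.
rewrite (eq_integral (fun x => (f x ^+ 2)%:E)); last first.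
  by move=> x _; rewrite powR_mulrn// real_normK ?num_real.
rewrite -[X in (X `^ _)%E]fineK ?poweR_EFin ?powR12_sqrt//; last exact: integrable_fin_num If.
by apply: fine_ge0; apply: integral_ge0 => x _; rewrite lee_fin sqr_ge0.
Qed.

End SquareIntegral.

Section Smoothing.
Context {R : realType} {disp : measure_display} {X : measurableType disp}.
Variables (mu : {measure set X -> \bar R}) (d : X -> X -> R).
Hypothesis muT : (mu setT < +oo)%E.
Variables (M : nat) (psi : nat -> X -> R) (ep L beta : R).
Hypothesis psiM : forall x, ([set k | psi k x != 0%R] #<= `I_M)%card.
Hypothesis psi1 : forall x, \sum_(k \in [set: nat]) psi k x = 1.
Hypothesis mpsi : forall k, measurable_fun setT (psi k).
Hypothesis psi0 : forall k x, 0 <= psi k x.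
Hypothesis psid : forall k x y, psi k x != 0 -> psi k y != 0 -> d x y <= ep.
Hypothesis L0 : 0 <= L.
Hypothesis psiL : forall k x y, `|psi k x - psi k y| <= L * d x y `^ beta.
Variables (Q : set X) (h : X -> R) (B H : R).
Hypothesis mh : measurable_fun setT h.
Hypothesis hB : forall x, `|h x| <= B.
Hypothesis hH : {ae mu, forall x, `|h x| <= H}.
Hypothesis H0 : 0 <= H.
Hypothesis hQ : forall x, ~ Q x -> h x = 0.
Hypothesis h0 : \int[mu]_x h x = 0.

Lemma psi_fin x : finite_set [set k | psi k x != 0].
Proof. by apply/finite_set_leP; exists M. Qed.

Lemma psi_big x : exists N, forall k, (N <= k)%N -> psi k x = 0.
Proof.
exists (\max_(k <- fset_set [set k | psi k x != 0]) k).+1 => k hk.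
apply/eqP; apply: contraTT hk => pk; rewrite -leqNgt.
by apply: leq_bigmax_seq => //; rewrite in_fset_set ?inE//; exact: psi_fin.
Qed.

Lemma fsum_nat x N (g : nat -> R) : (forall k, (N <= k)%N -> psi k x = 0) ->
  \sum_(k \in [set: nat]) psi k x * g k = \sum_(k < N) psi k x * g k.
Proof.
move=> hN; rewrite (@fsbigE _ _ _ _ _ (index_iota 0 N)) ?iota_uniq//.
- by rewrite (eq_bigl xpredT) ?big_mkord// => i; rewrite in_setT.
- move=> i _; rewrite mem_index_iota/= -leqNgt => /hN ->; exact: mul0r.
Qed.

Lemma fsum1_nat x N : (forall k, (N <= k)%N -> psi k x = 0) ->
  \sum_(k < N) psi k x = 1.
Proof.
move=> hN; have := fsum_nat (fun=> 1) hN.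
under eq_fsbigr do rewrite mulr1.
by rewrite psi1 => ->; apply: eq_bigr => i _; rewrite mulr1.
Qed.

Lemma psi_sum_le1 x N : \sum_(k < N) psi k x <= 1.
Proof.
have [N' hN'] := psi_big x; pose N2 := maxn N N'.
rewrite -(@fsum1_nat x N2); last by move=> k hk; apply: hN'; exact: leq_trans (leq_maxr _ _) hk.
rewrite -!(big_mkord xpredT (fun k => psi k x)) [leRHS](big_cat_nat (n := N))//=; last exact: leq_maxl.
by rewrite lerDl sumr_ge0.
Qed.

Lemma psi_le1 k x : psi k x <= 1.
Proof.
apply: le_trans (psi_sum_le1 x k.+1); rewrite big_ord_recr/= lerDr.
by rewrite sumr_ge0.
Qed.

Lemma itg_psi k : itg mu (psi k).
Proof.
apply: (le_itg (mpsi k) (itg_cst muT 1)); apply: aeW => x.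
by rewrite normr1 ger0_norm// psi_le1.
Qed.

Lemma itg_h : itg mu h.
Proof.
apply: (le_itg mh (itg_cst muT B)); apply: aeW => x.
by apply: le_trans (hB x) _; exact: ler_norm.
Qed.

(** The mean of [h] with respect to [psi k]. If [psi k] vanishes almost everywhere the value is [0],
    by [0^-1 = 0]. *)
Definition cf (k : nat) : R := (\int[mu]_y (psi k y * h y)) / l1norm mu (psi k).

Definition smo (x : X) : R := \int[mu]_y ((\sum_(k \in [set: nat])
    psi k x * psi k y / fine ('N[mu]_1[EFin \o psi k])%E) * h y).

Lemma itg_psih k : itg mu (fun y => psi k y * h y).
Proof. by apply: (itgM (itg_psi k) mh) => //; exact: hH. Qed.

Lemma smo_nat x N : (forall k, (N <= k)%N -> psi k x = 0) ->
  smo x = \sum_(k < N) psi k x * cf k.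
Proof.
move=> hN; rewrite /smo.
transitivity (\int[mu]_y (\sum_(k < N) (psi k x / l1norm mu (psi k)) * (psi k y * h y))).
  apply: eq_Rintegral => y _.
  under eq_fsbigr do rewrite -mulrA.
  rewrite (fsum_nat (fun k => psi k y / _) hN) mulr_suml; apply: eq_bigr => k _.
  by rewrite (LnormE1 (itg_psi k))/=; lra.
rewrite int_sum; last by move=> k _; apply: itgZ; exact: itg_psih.
apply: eq_bigr => k _; rewrite RintegralZl//; last exact: itg_psih.
by rewrite /cf; lra.
Qed.

Lemma cf_le k : `|cf k| <= H.
Proof.
rewrite /cf normrM normfV (ger0_norm (l1norm_ge0 _ _)).
have [/eqP e|n0] := eqVneq (l1norm mu (psi k)) 0.
  by rewrite (eqP e) invr0 mulr0.
rewrite ler_pdivrMr ?lt_def ?n0 ?l1norm_ge0//.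
exact: le_intM (itg_psi k) mh hH.
Qed.

Lemma smo_le x : `|smo x| <= H.
Proof.
have [N hN] := psi_big x; rewrite (smo_nat hN).
apply: le_trans (ler_norm_sum _ _ _) _.
apply: le_trans (_ : \sum_(k < N) psi k x * H <= _).
  by apply: ler_sum => k _; rewrite normrM (ger0_norm (psi0 _ _)) ler_wpM2l// cf_le.
by rewrite -mulr_suml ler_piMl// psi_sum_le1.
Qed.

Lemma psi_card x N : \sum_(k < N) (psi k x != 0)%:R <= M%:R :> R.
Proof.
have hc := geq_card_fset_set (psiM x).
apply: le_trans (_ : (#|` fset_set [set k | psi k x != 0]|)%:R <= _); last by rewrite ler_nat.
rewrite -natr_sum ler_nat -(big_mkord xpredT (fun k => (psi k x != 0) : nat)).
rewrite -big_mkcond/= sum1_count -size_filter; apply: uniq_leq_size.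
  by rewrite filter_uniq// iota_uniq.
by move=> k; rewrite mem_filter => /andP[pk _]; rewrite in_fset_set ?inE//; exact: psi_fin.
Qed.

(** The smoothed function is a combination of the [psi k] with coefficients at most [H], and only
    the indices with [psi k] nonzero at [x] or at [y] count: at most [2 * M] of them. *)
Lemma smo_holder x y : `|smo x - smo y| <= 2 * M%:R * L * H * d x y `^ beta.
Proof.
have [N1 hN1] := psi_big x; have [N2 hN2] := psi_big y; pose N := maxn N1 N2.
rewrite (@smo_nat x N); last by move=> k hk; apply: hN1; exact: leq_trans (leq_maxl _ _) hk.
rewrite (@smo_nat y N); last by move=> k hk; apply: hN2; exact: leq_trans (leq_maxr _ _) hk.
rewrite -sumrB; apply: le_trans (ler_norm_sum _ _ _) _.
have D0 : 0 <= L * d x y `^ beta by rewrite mulr_ge0// powR_ge0.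
apply: (@le_trans _ _ (\sum_(k < N) ((psi k x != 0)%:R + (psi k y != 0)%:R) * (L * d x y `^ beta * H))).
  apply: ler_sum => k _; rewrite -mulrBl normrM mulrA; apply: ler_pM => //; last exact: cf_le.
  have [px|px] := eqVneq (psi k x) 0; have [py|py] := eqVneq (psi k y) 0 => /=.
  - by rewrite px py subrr normr0 addr0 mul0r.
  - by rewrite add0r mul1r; have := psiL k x y; rewrite px.
  - by rewrite addr0 mul1r; have := psiL k x y; rewrite py.
  - by rewrite mulrDl mul1r (le_trans (psiL k x y))// lerDl.
rewrite -mulr_suml big_split/=.
have := psi_card x N; have := psi_card y N => h1 h2.
have D1 : 0 <= L * d x y `^ beta * H by rewrite mulr_ge0.
apply: (@le_trans _ _ ((M%:R + M%:R) * (L * d x y `^ beta * H))); first by rewrite ler_wpM2r// lerD.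
by rewrite le_eqVlt; apply/orP; left; apply/eqP; lra.
Qed.

(** If [psi k] has integral zero, both sides vanish, so the convention for the inverse of zero does
    no harm. *)
Lemma cfM k : cf k * l1norm mu (psi k) = \int[mu]_y (psi k y * h y).
Proof.
rewrite /cf; have [e|n0] := eqVneq (l1norm mu (psi k)) 0; last by rewrite divfK.
rewrite e mulr0; apply/esym/eqP; rewrite -normr_le0.
by have := le_intM (itg_psi k) mh hH; rewrite e mulr0.
Qed.

Lemma int_psi k : \int[mu]_x psi k x = l1norm mu (psi k).
Proof. by apply: eq_Rintegral => x _; rewrite ger0_norm. Qed.

Lemma smo_ev x : exists N, forall n, (N <= n)%N -> smo x = \sum_(k < n) psi k x * cf k.
Proof.
have [N hN] := psi_big x; exists N => n Nn; apply: smo_nat => k nk.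
by apply: hN; exact: leq_trans nk.
Qed.

Lemma cvg_ev (u : nat -> R) l : (exists N, forall n, (N <= n)%N -> l = u n) -> u @ \oo --> l.
Proof.
by case=> N hN; apply: cvg_near_cst; exists N => // n /= /hN ->.
Qed.

Lemma msum N (c : nat -> R) : measurable_fun setT (fun x => \sum_(k < N) psi k x * c k).
Proof.
by apply: measurable_sum => k; apply: measurable_funM.
Qed.

Lemma smo_meas : measurable_fun setT smo.
Proof.
apply: (@measurable_fun_cvg _ _ _ _ (fun N x => \sum_(k < N) psi k x * cf k)) => [N|x _].
  exact: msum.
exact: cvg_ev (smo_ev x).
Qed.

Lemma dct_ev (f_ : nat -> X -> R) f c : (forall n, measurable_fun setT (f_ n)) ->
  measurable_fun setT f -> (forall x, exists N, forall n, (N <= n)%N -> f x = f_ n x) ->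
  (forall n, {ae mu, forall x, `|f_ n x| <= c}) ->
  \int[mu]_x f_ n x @[n --> \oo] --> \int[mu]_x f x.
Proof.
move=> mf_ mf cv bd; have [] := @dominated_convergence _ _ _ mu setT measurableT
  (fun n => EFin \o f_ n) (EFin \o f) (EFin \o cst c).
- by move=> n; apply/measurable_EFinP.
- exact/measurable_EFinP.
- apply: aeW => x _ /=; apply/cvg_EFin; first by apply: nearW.
  exact: cvg_ev (cv x).
- exact: (itg_cst muT c).
- have := ae_foralln bd; apply: filterS => x hx n _; rewrite /= lee_fin; exact: hx.
move=> If _; have fi n : itg mu (f_ n).
  apply: (le_itg (mf_ n) (itg_cst muT c)); apply: filterS (bd n) => x hx.
  by apply: le_trans hx _; exact: ler_norm.
rewrite -[X in _ --> X]fineK; last exact: integrable_fin_num If.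
by move=> /fine_cvgP[_].
Qed.

(** The integrals of [psi k * cf k] and of [psi k * h] agree for each [k]. The sum over [k] is
    exchanged with the integral by dominated convergence on both sides, and the [psi k] add up to
    one. *)
Lemma smo_int0 : \int[mu]_x smo x = 0.
Proof.
have c1 := dct_ev (fun n => msum n cf) smo_meas smo_ev (c := H).
have c2 := @dct_ev (fun n x => (\sum_(k < n) psi k x) * h x) h B.
have e n : \int[mu]_x (\sum_(k < n) psi k x * cf k) = \int[mu]_x ((\sum_(k < n) psi k x) * h x).
  under [RHS]eq_Rintegral do rewrite mulr_suml.
  rewrite int_sum => [|k _]; last by under eq_fun do rewrite mulrC; exact/itgZ/itg_psi.
  rewrite int_sum => [|k _]; last exact: itg_psih.
  apply: eq_bigr => k _; rewrite -cfM -int_psi.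
  under eq_Rintegral do rewrite mulrC.
  by rewrite RintegralZl//; exact: itg_psi.
have c1' : \int[mu]_x (\sum_(k < n) psi k x * cf k) @[n --> \oo] --> \int[mu]_x smo x.
  apply: c1 => n; apply: aeW => x; apply: le_trans (ler_norm_sum _ _ _) _.
  apply: le_trans (_ : \sum_(k < n) psi k x * H <= _).
    by apply: ler_sum => k _; rewrite normrM (ger0_norm (psi0 _ _)) ler_wpM2l// cf_le.
  by rewrite -mulr_suml ler_piMl// psi_sum_le1.
have c2' : \int[mu]_x (\sum_(k < n) psi k x * cf k) @[n --> \oo] --> \int[mu]_x h x.
  under eq_fun do rewrite e; apply: c2 => //.
  - move=> n; apply: measurable_funM => //; exact: measurable_sum.
  - move=> x; have [N hN] := psi_big x; exists N => n Nn.
    rewrite fsum1_nat ?mul1r// => k nk; apply: hN; exact: leq_trans nk.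
  - move=> n; apply: aeW => x; rewrite normrM; apply: le_trans (_ : 1 * `|h x| <= _).
      rewrite ler_wpM2r// ger0_norm ?psi_sum_le1// sumr_ge0//.
    by rewrite mul1r.
by rewrite -(cvg_lim (@norm_hausdorff _ _) c1') (cvg_lim (@norm_hausdorff _ _) c2').
Qed.

Lemma smo_supp x : smo x != 0 -> exists2 y, Q y & d x y <= ep.
Proof.
move=> sx; apply: contrapT => hn; move/negP: sx; apply; apply/eqP.
have [N hN] := smo_ev x; rewrite (hN N (leqnn N)) big1// => k _.
have [->|pk] := eqVneq (psi k x) 0; first exact: mul0r.
rewrite /cf (_ : \int[mu]_y _ = 0) ?mul0r ?mulr0//.
transitivity (\int[mu]_(y in setT) (0 : R)); last by rewrite Rintegral_cst// mul0r.
apply: eq_Rintegral => y _.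
have [->|py] := eqVneq (psi k y) 0; first exact: mul0r.
rewrite hQ ?mulr0// => Qy; apply: hn; exists y => //; exact: psid pk py.
Qed.

(** Every [psi k] that is nonzero at [x] lives within [ep] of [x], hence in [P], so its mean of [h]
    is [v]. The exceptional null set consists of points where some almost everywhere vanishing
    [psi k] is nonzero. *)
Lemma smo_eq (P : set X) v : (forall y, P y -> h y = v) ->
  {ae mu, forall x, (forall y, d x y <= ep -> P y) -> smo x = v}.
Proof.
move=> hP.
have hz k : {ae mu, forall x, l1norm mu (psi k) = 0 -> psi k x = 0}.
  have [e|/eqP n0] := eqVneq (l1norm mu (psi k)) 0; last by apply: aeW => x /n0.
  by have := l1norm_eq0 (itg_psi k) e; apply: filterS.
apply: filterS (ae_foralln hz) => x hx dP.
have [N hN] := psi_big x; rewrite (smo_nat hN) -[RHS]mul1r -(fsum1_nat hN) mulr_suml.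
apply: eq_bigr => k _; have [->|pk] := eqVneq (psi k x) 0; first by rewrite !mul0r.
congr (_ * _); rewrite /cf -int_psi.
have -> : \int[mu]_y (psi k y * h y) = v * \int[mu]_y psi k y.
  rewrite -RintegralZl//; last exact: itg_psi.
  apply: eq_Rintegral => y _; have [->|py] := eqVneq (psi k y) 0; first by rewrite mul0r mulr0.
  have Py : P y by apply: dP; exact: psid pk py.
  by rewrite (hP y Py) mulrC.
by rewrite mulfK// int_psi; apply/eqP => /(hx k) h1; rewrite h1 eqxx in pk.
Qed.

End Smoothing.

(** * From convergence in L2 to convergence in L1 *)

Section SquareConvergence.
Context {R : realType} {disp : measure_display} {X : measurableType disp}.
Variable mu : {measure set X -> \bar R}.
Hypothesis muT : (mu setT < +oo)%E.

Lemma Lnorm2_le (g : X -> R) e : measurable_fun setT g -> 0 <= e ->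
  ('N[mu]_2%:E[EFin \o g] <= e%:E)%E ->
  itg mu (fun x => g x ^+ 2) /\ \int[mu]_x (g x ^+ 2) <= e ^+ 2.
Proof.
move=> mg e0 h; have m2 : measurable_fun setT (fun x => g x ^+ 2) by exact: measurable_funX.
have I2 : itg mu (fun x => g x ^+ 2).
  apply/integrableP; split; first exact/measurable_EFinP.
  rewrite (eq_integral (fun x => (g x ^+ 2)%:E)); last first.
    by move=> x _; rewrite gee0_abs// lee_fin sqr_ge0.
  rewrite ltNge leye_eq; apply/negP => /eqP hi; move: h; rewrite unlock /=.
  rewrite (eq_integral (fun x => (g x ^+ 2)%:E)); last first.
    by move=> x _; rewrite powR_mulrn// real_normK ?num_real.
  by rewrite hi poweRyr ?leye_eq// invr_eq0.
split=> //; move: h; rewrite (LnormE2 I2) lee_fin => h.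
rewrite -(@sqr_sqrtr _ (\int[mu]_x (g x ^+ 2))).
  by rewrite ler_pXn2r ?nnegrE ?sqrtr_ge0.
by apply: Rintegral_ge0 => // x _; exact: sqr_ge0.
Qed.

(** Integrates [|g| <= g^2 / e + e], a majorant that is integrable because the measure is finite. *)
Lemma l1_of_l2 (g : X -> R) e : measurable_fun setT g -> 0 < e ->
  itg mu (fun x => g x ^+ 2) -> \int[mu]_x (g x ^+ 2) <= e ^+ 2 ->
  itg mu g /\ l1norm mu g <= e * (1 + fine (mu setT)).
Proof.
move=> mg e0 I2 h; pose w x := e^-1 * g x ^+ 2 + e * \1_[set: X] x.
have Iw : itg mu w by apply: itgD; [exact: itgZ|exact: itg_indic].
have gw x : `|g x| <= w x.
  rewrite /w indicT mulr1 -(@real_normK _ (g x)) ?num_real//.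
  rewrite -(ler_pM2l e0) mulrDr mulrA divff ?gt_eqF// mul1r.
  have : 0 <= (`|g x| - e) ^+ 2 by exact: sqr_ge0.
  have : 0 <= `|g x| * e by rewrite mulr_ge0// ltW.
  lra.
have Ig : itg mu g.
  apply: (le_itg mg Iw); apply: aeW => x; apply: le_trans (gw x) _; exact: ler_norm.
split=> //; apply: le_trans (le_l1norm Ig Iw _) _; first exact: aeW.
rewrite RintegralD//; [|exact: itgZ|exact: itg_indic].
rewrite (RintegralZl _ measurableT I2) int_indic// mulrDr mulr1 lerD//.
by rewrite -ler_pdivlMl ?invr_gt0// invrK.
Qed.

(** The excess of [|g|] over [B] is at most [|g - s|] for each admissible [s], so its L1 norm is
    zero. *)
Lemma le_ae_lim (g : X -> R) B : itg mu g ->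
  (forall e, 0 < e -> exists s, [/\ itg mu s, forall x, `|s x| <= B &
     l1norm mu (fun x => g x - s x) <= e]) ->
  {ae mu, forall x, `|g x| <= B}.
Proof.
move=> Ig h; pose w x := Num.max (`|g x| - B) 0.
have mw : measurable_fun setT w.
  apply: measurable_maxr => //; apply: measurable_funB => //.
  by apply: measurableT_comp => //; exact: itg_meas Ig.
have w0 x : 0 <= w x by rewrite /w le_max lexx orbT.
have ws (s : X -> R) x : `|s x| <= B -> w x <= `|g x - s x|.
  move=> sB; rewrite /w ge_max normr_ge0 andbT.
  have := ler_normD (g x - s x) (s x); rewrite subrK; lra.
have Iw : itg mu w.
  have [s [Is sB _]] := h 1 ltr01.
  apply: (le_itg mw (itgB Ig Is)); apply: aeW => x; rewrite ger0_norm//; exact: ws.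
have wz : l1norm mu w = 0.
  apply/eqP; rewrite eq_le l1norm_ge0 andbT; apply/ler_addgt0Pr => e e0; rewrite add0r.
  have [s [Is sB se]] := h e e0; apply: le_trans se.
  apply: le_l1norm => //; first exact/itg_norm/itgB.
  by apply: aeW => x; rewrite ger0_norm//; exact: ws.
apply: filterS (l1norm_eq0 Iw wz) => x wx; have : `|g x| - B <= w x by rewrite /w le_max lexx.
rewrite wx; lra.
Qed.

End SquareConvergence.

Section Expansion.
Context {R : realType} {disp : measure_display} {X : measurableType disp}.
Variable mu : {measure set X -> \bar R}.
Hypothesis muT : (mu setT < +oo)%E.
Context {J : choiceType}.
Implicit Types A B : {fset J}.
Variables (ph : J -> X -> R) (g : X -> R) (a : J -> R).
Hypothesis ph_itg : forall p, itg mu (ph p).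
Hypothesis Lg : Lp_sum mu 2%:E (fun p x => a p * ph p x) g.

Lemma Lp_sum2_l1 : itg mu g /\ forall e, 0 < e -> exists A0, forall A, (A0 `<=` A)%fset ->
  l1norm mu (fun x => g x - \sum_(p <- A) a p * ph p x) <= e.
Proof.
have [mu_ mg cg] := Lg.
have H e : 0 < e -> exists A0, forall A, (A0 `<=` A)%fset ->
    itg mu (fun x => g x - \sum_(p <- A) a p * ph p x) /\
    l1norm mu (fun x => g x - \sum_(p <- A) a p * ph p x) <= e * (1 + fine (mu setT)).
  move=> e0; have : nbhs (0%E : \bar R) (fun y => (y < e%:E)%E).
    by apply: open_ereal_lt'; rewrite lte_fin.
  move=> /cg [A0 _ hA]; exists A0 => A AA; have /ltW := hA A AA.
  have mgA : measurable_fun setT (fun x => g x - \sum_(p <- A) a p * ph p x).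
    by apply: measurable_funB => //; apply: measurable_sum => p; exact: mu_.
  move=> /(Lnorm2_le mgA (ltW e0))[I2 h2]; exact: l1_of_l2.
have Is A : itg mu (fun x => \sum_(p <- A) a p * ph p x).
  by apply: itg_sum => p _; exact: itgZ.
split.
  have [A0 /(_ A0 (fsubset_refl _))[I1 _]] := H 1 ltr01.
  have := itgD I1 (Is A0); rewrite (_ : (fun x => _) = g)//.
  by apply/funext => x; rewrite subrK.
move=> e e0; have m0 : 0 < 1 + fine (mu setT) by rewrite ltr_wpDr// fine_ge0.
have e1 : 0 < e / (1 + fine (mu setT)) by rewrite divr_gt0.
have [A0 hA] := H _ e1; exists A0 => A AA; have [_] := hA A AA.
by rewrite divfK ?gt_eqF.
Qed.

End Expansion.

(** * Unconditional sums in H1 and the passage from atoms to all of H1 *)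

Section Families.
Context {R : realType} {disp : measure_display} {X : measurableType disp}.
Variables (mu : {measure set X -> \bar R}) (d : X -> X -> R).
Hypothesis muT0 : (0 < mu setT)%E.
Hypothesis muT : (mu setT < +oo)%E.
Hypothesis mball : forall x r, measurable (qball d x r).
Context {J : choiceType}.
Implicit Types A D : {fset J}.

Lemma half_sum (n : nat) : \sum_(i < n) 2^-1 ^+ i <= 2 :> R.
Proof.
have : \sum_(i < n) 2^-1 ^+ i = 2 - 2 * 2^-1 ^+ n :> R.
  by elim: n => [|n IH]; rewrite ?big_ord0 ?expr0 ?mulr1 ?subrr// big_ord_recr/= IH exprS; lra.
by move=> ->; rewrite gerBl mulr_ge0// exprn_ge0// invr_ge0.
Qed.

Lemma half_small (K e : R) : 0 <= K -> 0 < e -> exists N, forall n, (N <= n)%N -> K * 2^-1 ^+ n <= e.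
Proof.
move=> K0 e0; have kk : 0 < e / (K + 1) by rewrite divr_gt0// ltr_wpDl.
have : (2^-1 ^+ n : R) @[n --> \oo] --> 0.
  by apply: cvg_expr; rewrite ger0_norm// invf_lt1// ltr1n.
move=> /cvgrPdist_le/(_ _ kk)[N _ hN]; exists N => n /hN.
rewrite /= sub0r normrN ger0_norm ?exprn_ge0// => h.
apply: le_trans (ler_wpM2l K0 h) _.
by rewrite mulrCA ler_piMr ?(ltW e0)// ler_pdivrMr ?ltr_wpDl// mul1r lerDl.
Qed.

Lemma sum_fsetD (u : J -> R) A D : (D `<=` A)%fset ->
  \sum_(q <- A) u q - \sum_(q <- D) u q = \sum_(q <- (A `\` D)%fset) u q.
Proof.
move=> DA; pose v q := if q \in D then u q else 0; pose w q := if q \in D then 0 else u q.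
have -> : \sum_(q <- D) u q = \sum_(q <- A) v q.
  rewrite -(big_fset_incl _ DA); last by move=> q _ qD; rewrite /v (negbTE qD).
  by rewrite big_seq [RHS]big_seq; apply: eq_bigr => q qD; rewrite /v qD.
have -> : \sum_(q <- (A `\` D)%fset) u q = \sum_(q <- A) w q.
  rewrite -(big_fset_incl _ (fsubsetDl A D)); last first.
    by move=> q qA; rewrite in_fsetD qA andbT negbK /w => ->.
  rewrite big_seq [RHS]big_seq; apply: eq_bigr => q.
  by rewrite in_fsetD /w => /andP[/negbTE -> _].
by rewrite -sumrB; apply: eq_bigr => q _; rewrite /v /w; case: ifP; rewrite ?subrr ?subr0.
Qed.

(** The bound with a square root is not additive over blocks. It becomes summable along finite sets
    [AA l] outside which [t] sums to at most [4^-l]: a block disjoint from [AA l] then has H1 norm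
    at most [(2 * K + 1) * 2^-l]. *)
Lemma Hbd_unordered (u : J -> X -> R) (t : J -> R) (K KT : R) : 0 <= K ->
  (forall q, 0 <= t q) -> (forall A, \sum_(q <- A) t q <= KT) ->
  (forall A e, 0 < e -> Hbd mu d (fun y => \sum_(q <- A) u q y)
     (K * (\sum_(q <- A) t q + Num.sqrt (\sum_(q <- A) t q)) + e)) ->
  exists g, Hbd mu d g (K * (KT + Num.sqrt KT) + 1 + 2 * (2 * K + 1)) /\
    forall e, 0 < e -> exists A0, forall A, (A0 `<=` A)%fset ->
      l1norm mu (fun x => g x - \sum_(q <- A) u q x) <= e.
Proof.
move=> K0 t0 tK hu; pose w l : R := 2^-1 ^+ l.
have w0 l : 0 < w l by rewrite exprn_gt0// invr_gt0.
have w1 l : w l <= 1 by rewrite exprn_ile1// invf_le1// ler1n.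
have /choice[B hB] : forall l, exists B : {fset J}, forall D, [disjoint D & B]%fset ->
    \sum_(q <- D) t q <= w l ^+ 2.
  by move=> l; apply: (fset_tail t0 tK); rewrite exprn_gt0.
pose fix AA l : {fset J} := if l is l'.+1 then (AA l' `|` B l)%fset else B 0%N.
have AB l : (B l `<=` AA l)%fset by case: l => [|l] //=; exact: fsubsetUr.
have AS l : (AA l `<=` AA l.+1)%fset by rewrite /= fsubsetUl.
pose S A x := \sum_(q <- A) u q x.
have diff l A : (AA l `<=` A)%fset -> Hbd mu d (fun x => S A x - S (AA l) x) ((2 * K + 1) * w l).
  move=> lA; pose D := (A `\` AA l)%fset.
  have tD : \sum_(q <- D) t q <= w l ^+ 2.
    apply: hB; apply: (fdisjointWr (AB l)).
    by rewrite -fsetI_eq0 fsetIC fsetIDA fsetDIl fsetDv fset0I.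
  apply: Hbd_ext (HbdW (hu D (w l) (w0 l)) _).
    by apply/funext => x; rewrite /S -(sum_fsetD (fun q => u q x) lA).
  have : Num.sqrt (\sum_(q <- D) t q) <= w l.
    by apply: le_trans (ler_wsqrtr tD) _; rewrite sqrtr_sqr ger0_norm// ltW.
  have w2 : w l ^+ 2 <= w l by rewrite expr2 ler_piMl// ltW.
  move=> h; have h3 : \sum_(q <- D) t q + Num.sqrt (\sum_(q <- D) t q) <= 2 * w l.
    by have := le_trans tD w2; lra.
  have := ler_wpM2l K0 h3; lra.
pose F l := if l is l'.+1 then (fun x => S (AA l'.+1) x - S (AA l') x) else S (AA 0%N).
pose cs l := if l is l'.+1 then (2 * K + 1) * w l' else K * (KT + Num.sqrt KT) + 1.
have hF l : Hbd mu d (F l) (cs l).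
  case: l => [|l]; last exact: diff (AS l).
  apply: HbdW (hu (AA 0%N) 1 ltr01) _; rewrite /cs lerD2r ler_wpM2l// lerD// ler_wsqrtr//.
have csS n : \sum_(i < n) cs i <= K * (KT + Num.sqrt KT) + 1 + 2 * (2 * K + 1).
  have KT0 : 0 <= KT by apply: le_trans (tK fset0); rewrite big_seq_fset0.
  have k1 : 0 <= K * (KT + Num.sqrt KT) by rewrite mulr_ge0// addr_ge0// sqrtr_ge0.
  case: n => [|n]; first by rewrite big_ord0; lra.
  rewrite big_ord_recl/= lerD2l -mulr_sumr mulrC ler_wpM2r ?half_sum//; lra.
have FS n x : \sum_(i < n.+1) F i x = S (AA n) x.
  by elim: n => [|n IH]; rewrite ?big_ord1// big_ord_recr/= IH addrC subrK.
have [g [Ig hg]] : exists g, itg mu g /\ forall e, 0 < e -> exists N, forall n, (N <= n)%N ->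
    l1norm mu (fun x => g x - \sum_(i < n) F i x) <= e.
  apply: (@l1_series _ _ _ _ _ (K * (KT + Num.sqrt KT) + 1 + 2 * (2 * K + 1))).
    by move=> n; exact: Hbd_itg (hF n).
  move=> n; apply: le_trans (csS n); apply: ler_sum => i _.
  exact: (Hbd_l1 muT0 muT mball (hF i)).
exists g; split; first exact: (Hbd_series muT0 muT mball hF csS Ig hg).
move=> e e0; have e2 : 0 < e / 2 by rewrite divr_gt0.
have [N1 h1] := hg _ e2.
have [N2 h2] := half_small (K := 2 * K + 1) ltac:(lra) e2.
pose N := maxn N1 N2; exists (AA N) => A NA.
have hd := diff N A NA.
have -> : (fun x => g x - \sum_(q <- A) u q x) =
    (fun x => (g x - \sum_(i < N.+1) F i x) - (S A x - S (AA N) x)).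
  by apply/funext => x; rewrite FS /S; lra.
apply: le_trans (l1normB _ (Hbd_itg hd)) _.
  apply: itgB => //; apply: itg_sum => i _; exact: Hbd_itg (hF i).
have := h1 N.+1 (leq_trans (leq_maxl _ _) (leqnSn _)).
have := le_trans (Hbd_l1 muT0 muT mball hd) (h2 N (leq_maxr _ _)); lra.
Qed.

Section Projection.
Variables (f_ : J -> X -> R) (Cf : J -> R) (C0 C1 : R).
Hypothesis mf_ : forall q, measurable_fun setT (f_ q).
Hypothesis f_le : forall q, {ae mu, forall x, `|f_ q x| <= Cf q}.
Local Notation P A f x := (\sum_(q <- A) (\int[mu]_y (f y * f_ q y)) * f_ q x).
Hypothesis C00 : 0 < C0.
Hypothesis proj_atom : forall a, atom mu d a ->
  (forall A, l1norm mu (fun x => P A a x) <= C1) /\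
  exists2 g, Hbd mu d g C0 & forall e, 0 < e -> exists A0, forall A, (A0 `<=` A)%fset ->
     l1norm mu (fun x => g x - P A a x) <= e.

Lemma f_itg' q : itg mu (f_ q).
Proof.
apply: (le_itg (mf_ q) (itg_cst muT (Cf q))); apply: filterS (f_le q) => x h.
by apply: le_trans h _; exact: ler_norm.
Qed.

Lemma P_itg A f : itg mu (fun x => P A f x).
Proof. by apply: itg_sum => q _; apply: itgZ; exact: f_itg'. Qed.

Definition is_proj f g := itg mu g /\ forall e, 0 < e -> exists A0, forall A, (A0 `<=` A)%fset ->
     l1norm mu (fun x => g x - P A f x) <= e.

Lemma proj_unique f g g' : is_proj f g -> is_proj f g' -> {ae mu, forall x, g x = g' x}.
Proof.
move=> [Ig hg] [Ig' hg'].
have z : l1norm mu (fun x => g x - g' x) = 0.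
  apply/eqP; rewrite eq_le l1norm_ge0 andbT; apply/ler_addgt0Pr => e e0; rewrite add0r.
  have e2 : 0 < e / 2 by rewrite divr_gt0.
  have [A1 h1] := hg _ e2; have [A2 h2] := hg' _ e2; pose A := (A1 `|` A2)%fset.
  have -> : (fun x => g x - g' x) = (fun x => (g x - P A f x) - (g' x - P A f x)).
    by apply/funext => x; lra.
  apply: le_trans (l1normB (itgB Ig (P_itg A f)) (itgB Ig' (P_itg A f))) _.
  by have := h1 A (fsubsetUl _ _); have := h2 A (fsubsetUr _ _); lra.
by apply: filterS (l1norm_eq0 (itgB Ig Ig') z) => x /eqP; rewrite subr_eq0 => /eqP.
Qed.

Lemma P_lin A (n : nat) (la : nat -> R) (a : nat -> X -> R) f x :
  itg mu f -> (forall i, itg mu (a i)) ->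
  P A (fun y => f y - \sum_(i < n) la i * a i y) x =
  P A f x - \sum_(i < n) la i * P A (a i) x.
Proof.
move=> If Ia; under [X in _ = _ - X]eq_bigr do rewrite mulr_sumr.
rewrite exchange_big/= -sumrB; apply: eq_bigr => q _.
have I1 i : itg mu (fun y => a i y * f_ q y) by apply: itgM (Ia i) (mf_ q) (f_le q).
have I2 : itg mu (fun y => f y * f_ q y) by apply: itgM If (mf_ q) (f_le q).
rewrite (_ : \int[mu]_y _ = \int[mu]_y (f y * f_ q y) - \sum_(i < n) la i * \int[mu]_y (a i y * f_ q y)).
  by rewrite mulrBl mulr_suml; congr (_ - _); apply: eq_bigr => i _; rewrite mulrA.
have I3 i : itg mu (fun y => la i * (a i y * f_ q y)) by exact: itgZ.
transitivity (\int[mu]_y (f y * f_ q y - \sum_(i < n) la i * (a i y * f_ q y))).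
  apply: eq_Rintegral => y _; rewrite mulrBl mulr_suml; congr (_ - _).
  by apply: eq_bigr => i _; rewrite mulrA.
rewrite RintegralB//; last by apply: itg_sum.
rewrite int_sum//; congr (_ - _); apply: eq_bigr => i _.
by rewrite (RintegralZl _ measurableT (I1 i)).
Qed.

Lemma P_l1 A f : itg mu f ->
  l1norm mu (fun x => P A f x) <= (\sum_(q <- A) Cf q * l1norm mu (f_ q)) * l1norm mu f.
Proof.
move=> If; apply: le_trans (l1norm_sum (enum_fset A) (P := xpredT) _) _ => [q _|].
  by apply: itgZ; exact: f_itg'.
rewrite mulr_suml; apply: ler_sum => q _; rewrite (l1normZ _ (f_itg' q)) mulrAC.
by rewrite ler_wpM2r ?l1norm_ge0//; exact: le_intM If (mf_ q) (f_le q).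
Qed.

(** The candidate is the sum of the projections of the atoms with the same coefficients, which
    converges in H1. The finite sums [P A f] tend to it because they are bounded in L1 on atoms
    uniformly in [A]. *)
Lemma proj_Hbd f c : Hbd mu d f c -> exists2 g, Hbd mu d g (C0 * c) & is_proj f g.
Proof.
move=> [If [la [a [ha hla hf]]]].
have Ia i : itg mu (a i) := (atom_l1 muT0 muT mball (ha i)).1.
have /choice[G hG] : forall i, exists g, Hbd mu d g C0 /\ forall e, 0 < e ->
    exists A0, forall A, (A0 `<=` A)%fset -> l1norm mu (fun x => g x - P A (a i) x) <= e.
  by move=> i; have [_ [g h1 h2]] := proj_atom (ha i); exists g.
have C10 : 0 <= C1.
  by apply: le_trans (l1norm_ge0 _ _) ((proj_atom (ha 0%N)).1 fset0).
have hla0 : 0 <= c by have := hla 0%N; rewrite big_ord0.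
have HG i : Hbd mu d (fun x => la i * G i x) (`|la i| * C0).
  by apply: HbdZ => //; exact: (hG i).1.
have cS n : \sum_(i < n) `|la i| * C0 <= C0 * c.
  by rewrite -mulr_suml mulrC ler_wpM2l ?(ltW C00).
have [g [Ig hg]] : exists g, itg mu g /\ forall e, 0 < e -> exists N, forall n, (N <= n)%N ->
    l1norm mu (fun x => g x - \sum_(i < n) la i * G i x) <= e.
  apply: (@l1_series _ _ _ _ (fun i x => la i * G i x) (C0 * c)).
    by move=> n; exact: Hbd_itg (HG n).
  move=> n; apply: le_trans (cS n); apply: ler_sum => i _.
  exact: (Hbd_l1 muT0 muT mball (HG i)).
exists g; first exact: (Hbd_series muT0 muT mball HG cS Ig hg).
split=> // e e0; have e3 : 0 < e / 3 by rewrite divr_gt0.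
have [N1 h1] := hg _ e3.
have [N2 h2] : exists N, forall M, C1 * \sum_(N <= i < M) `|la i| <= e / 6.
  have e6 : 0 < e / 6 / (C1 + 1) by rewrite !divr_gt0// ltr_wpDl.
  have [N hN] := tail_small (fun i => normr_ge0 (la i)) hla e6; exists N => M.
  apply: le_trans (ler_wpM2l C10 (hN M)) _.
  by rewrite mulrCA ler_piMr ?divr_ge0 ?(ltW e0)// ler_pdivrMr ?ltr_wpDl// mul1r lerDl.
pose n := maxn N1 N2.
have common k eps : 0 < eps -> exists A0, forall A, (A0 `<=` A)%fset -> forall i, (i < k)%N ->
    `|la i| * l1norm mu (fun x => G i x - P A (a i) x) <= eps.
  move=> eps0; elim: k => [|k [A1 hA1]]; first by exists fset0.
  have ek : 0 < eps / (`|la k| + 1) by rewrite divr_gt0// ltr_wpDl.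
  have [A2 hA2] := (hG k).2 _ ek; exists (A1 `|` A2)%fset => A; rewrite fsubUset => /andP[s1 s2] i.
  rewrite ltnS leq_eqVlt => /predU1P[->|]; last exact: (hA1 A s1 i).
  apply: le_trans (ler_wpM2l (normr_ge0 _) (hA2 A s2)) _.
  by rewrite mulrCA ler_piMr ?(ltW eps0)// ler_pdivrMr ?ltr_wpDl// mul1r lerDl.
have en : 0 < e / 3 / (n%:R + 1) by rewrite divr_gt0// ltr_wpDl.
have [A0 hA0] := common n _ en.
exists A0 => A AA.
pose rem k x := f x - \sum_(i < k) la i * a i x.
have Irem k : itg mu (rem k).
  by apply: itgB => //; apply: itg_sum => i _; exact: itgZ.
(* On the atoms from [n] to [M] the constant [C1] is uniform in [A]. The bound [W] of [P A] on L1
   depends on [A], and is used only to discard what comes after [M]. *)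
have remP : l1norm mu (fun x => P A (rem n) x) <= e / 3.
  apply/ler_addgt0Pr => e' e'0.
  pose W := \sum_(q <- A) Cf q * l1norm mu (f_ q).
  have W1 : 0 < `|W| + 1 by rewrite ltr_wpDl.
  have [N3 h3] := hf _ (divr_gt0 e'0 W1); pose M := maxn n N3.
  have nM : (n <= M)%N := leq_maxl _ _.
  have -> : (fun x => P A (rem n) x) =
      (fun x => \sum_(n <= i < M) la i * P A (a i) x + P A (rem M) x).
    apply/funext => x; rewrite !P_lin//.
    rewrite -!(big_mkord xpredT (fun i => la i * P A (a i) x)).
    by rewrite [in RHS](big_cat_nat (leq0n n) nM)/=; lra.
  have Is : itg mu (fun x => \sum_(n <= i < M) la i * P A (a i) x).
    by apply: itg_sum => i _; apply: itgZ; exact: P_itg.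
  apply: le_trans (l1normD Is (P_itg A (rem M))) _; apply: lerD.
    apply: le_trans (l1norm_sum (index_iota n M) (P := xpredT) _) _ => [i _|].
      by apply: itgZ; exact: P_itg.
    apply: (@le_trans _ _ (\sum_(n <= i < M) C1 * `|la i|)).
      apply: ler_sum => i _; rewrite (l1normZ _ (P_itg A (a i))) mulrC ler_wpM2r//.
      exact: (proj_atom (ha i)).1.
    rewrite -mulr_sumr.
    have : C1 * \sum_(n <= i < M) `|la i| <= C1 * \sum_(N2 <= i < M) `|la i|.
      rewrite ler_wpM2l// [leRHS](big_cat_nat (leq_maxr _ _ : (N2 <= n)%N) nM)/=.
      by rewrite lerDr sumr_ge0.
    by have := h2 M; lra.
  apply: le_trans (P_l1 A (Irem M)) _; rewrite -/W.
  apply: (@le_trans _ _ ((`|W| + 1) * l1norm mu (rem M))).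
    rewrite ler_wpM2r ?l1norm_ge0//; apply: le_trans (ler_norm W) _; rewrite lerDl//.
  by rewrite mulrC -ler_pdivlMr//; apply: h3; exact: leq_maxr.
have Id i : itg mu (fun x => la i * (G i x - P A (a i) x)).
  by apply: itgZ; apply: itgB; [exact: Hbd_itg (hG i).1|exact: P_itg].
have -> : (fun x => g x - P A f x) = (fun x => (g x - \sum_(i < n) la i * G i x) +
    (\sum_(i < n) la i * (G i x - P A (a i) x) - P A (rem n) x)).
  apply/funext => x; rewrite P_lin//; under [X in _ + (X - _)]eq_bigr do rewrite mulrBr.
  by rewrite sumrB; lra.
have Is : itg mu (fun x => \sum_(i < n) la i * (G i x - P A (a i) x)) by apply: itg_sum.
have I1 : itg mu (fun x => g x - \sum_(i < n) la i * G i x).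
  by apply: itgB => //; apply: itg_sum => i _; exact: Hbd_itg (HG i).
apply: le_trans (l1normD I1 (itgB Is (P_itg A (rem n)))) _.
have m2 : l1norm mu (fun x => \sum_(i < n) la i * (G i x - P A (a i) x)) <= e / 3.
  apply: le_trans (l1norm_sum (index_enum 'I_n) (P := xpredT) _) _ => //.
  apply: le_trans _ (sum_const_le n (ltW e3)); apply: ler_sum => i _.
  rewrite l1normZ; last by apply: itgB; [exact: Hbd_itg (hG i).1|exact: P_itg].
  exact: hA0.
have := l1normB Is (P_itg A (rem n)); have := h1 n (leq_maxl _ _); lra.
Qed.

Lemma proj_H1 f : H1 mu d f -> exists g,
  Lp_sum mu 1%E (fun q x => (\int[mu]_y (f y * f_ q y)) * f_ q x) g /\
  (H1norm mu d g <= C0%:E * H1norm mu d f)%E.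
Proof.
move=> Hf; have [If [la [a had]]] := Hf.
have [c hc] : exists c, (\sum_(i <oo) `|la i|%:E <= c%:E)%E.
  have [_ + _] := had; set s := (\sum_(i <oo) _)%E => s1; exists (fine s).
  have s0 : (0 <= s)%E by apply: nneseries_ge0 => n _ _; rewrite lee_fin.
  by rewrite fineK// ge0_fin_numE.
have [g Hg pg] := proj_Hbd (atomic_Hbd muT0 muT mball If had hc).
exists g; split.
  split; [by move=> q; exact: measurable_funM|exact: itg_meas pg.1|].
  have := (cvgE0P (F := summability.totally) (fun A => l1norm_ge0 mu (fun x => g x - P A f x))).2.
  rewrite (_ : (fun A => 'N[mu]_1[_]%E) = (fun A : {fset J} => (l1norm mu (fun x => g x - P A f x))%:E)).
    apply => e e0; have [A0 hA] := pg.2 e e0; exact: near_totally hA.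
  by apply/funext => A; rewrite LnormE1//; apply: itgB; [exact: pg.1|exact: P_itg].
apply: (Hbd_H1norm muT0 muT mball C00 Hf) => c' hc'.
have [g' Hg' pg'] := proj_Hbd hc'.
apply: (Hbd_ae muT0 muT mball Hg' (itg_meas pg.1)).
exact: proj_unique pg' pg.
Qed.

End Projection.

End Families.

(** * The expansion of a single atom *)

Section Atoms.
Context {R : realType} {disp : measure_display} {X : measurableType disp}.
Variables (mu : {measure set X -> \bar R}) (d : X -> X -> R).
Hypothesis muT0 : (0 < mu setT)%E.
Hypothesis muT : (mu setT < +oo)%E.
Hypothesis mball : forall x r, measurable (qball d x r).
Variables (G : R -> R) (Kt Cc de om sg : R).
Hypothesis d0 : forall x y, 0 <= d x y.
Hypothesis dxx : forall x, d x x = 0.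
Hypothesis dC : forall x y, d x y = d y x.
Hypothesis Kt1 : 1 <= Kt.
Hypothesis dT : forall x y z, d x y <= Kt * (d x z + d z y).
Hypothesis G0 : forall x, 0 < x -> 0 < G x.
Hypothesis GM : forall x y, 0 < x -> 0 < y -> G (x * y) = G x * G y.
Hypothesis Gmono : forall x y, 0 < x -> x <= y -> G x <= G y.
Hypothesis G2 : 1 < G 2.
Hypothesis Gde : G de = om.
Hypothesis sg0 : 0 < sg.
Hypothesis sg2 : sg ^+ 2 = de.
Hypothesis de1 : de < 1.
Hypothesis om0 : 0 < om.
Hypothesis om1 : om < 1.
Hypothesis Cc0 : 0 <= Cc.
Context {J : choiceType}.
Implicit Types A : {fset J}.
Variables (lev : J -> nat) (pos : J -> X) (r0 : J).
Hypothesis near_count : forall n x rho A, de ^+ n <= rho ->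
  \sum_(r <- A | (lev r == n) && (d x (pos r) < rho)) 1 <= Cc * (rho / de ^+ n).
Variables (ph : J -> X -> R) (Cp Cs CG : R).
Hypothesis Cp0 : 0 <= Cp.
Hypothesis Cs0 : 0 <= Cs.
Hypothesis CG0 : 0 < CG.
Hypothesis ph_meas : forall p, measurable_fun setT (ph p).
Hypothesis ph_le : forall p x, `|ph p x| <= Cp / sg ^+ lev p.
Hypothesis ph_osc : forall p x y rho, 0 < rho -> d x y <= rho ->
  `|ph p x - ph p y| <= Cp / sg ^+ lev p * G (rho / de ^+ lev p) ^+ 2.
Hypothesis ph_supp : forall p x, ph p x != 0 -> d (pos p) x <= Cs * de ^+ lev p.
Hypothesis ph_Hbd : forall p, Hbd mu d (ph p) (Cp * sg ^+ lev p).
Hypothesis ph_int : forall p, p != r0 -> \int[mu]_x ph p x = 0.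
Hypothesis ph_r0 : ph r0 = cst 1.
Hypothesis ph_bessel : forall (x : J -> R) A,
  \int[mu]_y ((\sum_(p <- A) x p * ph p y) ^+ 2) <= CG * \sum_(p <- A) x p ^+ 2.
Variables (S : (J -> R) -> J -> R) (nS Cm : R).
Local Notation a p q := (S (l2_delta q) p).
Hypothesis oS : l2_operator S.
Hypothesis nS0 : 0 <= nS.
Hypothesis S_le : forall x, l2 x -> l2norm (S x) <= nS * l2norm x.
Hypothesis S_sym : forall x y, l2 x -> l2 y -> l2dot (S x) y = l2dot x (S y).
Hypothesis Cm0 : 0 <= Cm.
Local Notation wt := (wt om sg lev).
Local Notation qd := (qd d de lev pos).
Local Notation ker := (ker G).
Hypothesis a_le : forall p q, `|a p q| <= Cm * (wt p * wt q * ker (qd p q)).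
Hypothesis a_r0 : forall q, q != r0 -> a r0 q = 0.
Variable f : J -> X -> R.
Hypothesis f_sum : forall q, Lp_sum mu 2%:E (fun p x => a p q * ph p x) (f q).

Lemma wave_itg p : itg mu (ph p).
Proof.
apply: (le_itg (ph_meas p) (itg_cst muT (Cp / sg ^+ lev p))); apply: aeW => x.
apply: le_trans (ph_le p x) _; exact: ler_norm.
Qed.

Lemma a_sym p q : a p q = a q p.
Proof.
have ep := @l2_e R J p; have eq := @l2_e R J q.
have := S_sym eq ep; rewrite dot_e; last exact: (opl2 oS eq).
by rewrite [RHS]dotC dot_e//; exact: (opl2 oS ep).
Qed.

Definition Ctot : R := 2 * Cm * ker 2^-1 * sumC G Cc / (1 - om).

Lemma Ctot_ge0 : 0 <= Ctot.
Proof.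
have k0 : 0 <= ker 2^-1 by apply: (ker_ge0 G0); rewrite invr_gt0.
have s0 := sumC_ge0 G0 G2 Cc0.
have o1 : 0 <= 1 - om by rewrite subr_ge0 ltW.
by apply: divr_ge0 => //; apply: mulr_ge0 => //; apply: mulr_ge0 => //; apply: mulr_ge0.
Qed.

Lemma a_tail rho p A : 0 < rho ->
  \sum_(q <- A | rho <= qd p q) sg ^+ lev q * `|a q p| <= Ctot * (wt p / G rho).
Proof.
exact: (tail_S d0 dC G0 GM Gmono G2 Gde sg0 sg2 om0 om1 Cc0 near_count Cm0 a_le).
Qed.

Lemma a_total p A : \sum_(q <- A) sg ^+ lev q * `|a q p| <= Ctot * sg ^+ lev p.
Proof.
exact: (total_S d0 dC G0 GM Gmono G2 Gde sg0 sg2 om0 om1 Cc0 near_count Cm0 a_le).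
Qed.

Lemma f_itg q : itg mu (f q).
Proof. exact: (Lp_sum2_l1 muT wave_itg (f_sum q)).1. Qed.

Lemma f_l1 q e : 0 < e -> exists A0, forall A, (A0 `<=` A)%fset ->
  l1norm mu (fun x => f q x - \sum_(p <- A) a p q * ph p x) <= e.
Proof. exact: (Lp_sum2_l1 muT wave_itg (f_sum q)).2. Qed.

Lemma deX n : 0 < de ^+ n. Proof. by rewrite -sg2 -exprM exprn_gt0. Qed.
Lemma sgX n : 0 < sg ^+ n. Proof. exact: exprn_gt0. Qed.
Lemma omX n : 0 < om ^+ n. Proof. exact: exprn_gt0. Qed.
Lemma de_gt0 : 0 < de. Proof. by rewrite -sg2 exprn_gt0. Qed.
Lemma deXle1 n : de ^+ n <= 1.
Proof. by rewrite exprn_ile1// ltW// de_gt0. Qed.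

Lemma wt0 p : 0 <= wt p.
Proof. by apply: mulr_ge0; apply: ltW; [exact: sgX|exact: omX]. Qed.

(** At a given point boundedly many [ph p] of each level are nonzero. There [|ph p|] is of order
    [1 / sg ^+ n], against which the entry [a p q] brings [sg ^+ n * om ^+ n], so the levels sum
    geometrically. This makes [f q] essentially bounded, as the pairing with H1 functions
    requires. *)
Lemma sum_ph_le q : exists B, forall A x, `|\sum_(p <- A) a p q * ph p x| <= B.
Proof.
pose Kq := Cm * wt q * ker (de ^+ lev q) * Cp.
pose Cq := Cc * (Cs + 1).
have Kq0 : 0 <= Kq.
  apply: mulr_ge0 => //; apply: mulr_ge0; last exact: (ker_ge0 G0 (deX _)).
  by apply: mulr_ge0 => //; exact: wt0.
have Cs1 : 0 < Cs + 1 by rewrite ltr_wpDl.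
have Cq0 : 0 <= Cq by rewrite mulr_ge0// ltW.
exists (Kq * Cq / (1 - om)) => A x; apply: le_trans (ler_norm_sum _ _ _) _.
apply: (sum_levels (lev := lev) (b := fun n => Kq * Cq * om ^+ n)) => [n|N]; last first.
  by rewrite -mulr_sumr; apply: ler_wpM2l; [exact: mulr_ge0|exact: (geo_sum om0 om1 N)].
have dn := deX n.
have rho : de ^+ n <= (Cs + 1) * de ^+ n by rewrite ler_peMl ?(ltW dn)// lerDr.
have cnt := near_count x A rho; rewrite mulfK ?gt_eqF// in cnt.
apply: (@le_trans _ _ (\sum_(p <- A | (lev p == n) && (d x (pos p) < (Cs + 1) * de ^+ n)) Kq * om ^+ n)).
  rewrite [leLHS](bigID (fun p => d x (pos p) < (Cs + 1) * de ^+ n))/=.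
  rewrite [X in _ + X]big1 ?addr0 => [|p /andP[/eqP pn dp]]; last first.
    have [->|/ph_supp] := eqVneq (ph p x) 0; first by rewrite mulr0 normr0.
    rewrite pn dC => hd; exfalso; move/negP: dp; apply; apply: le_lt_trans hd _.
    by rewrite ltr_pM2r// ltrDl.
  apply: ler_sum => p /andP[/eqP pn _]; rewrite normrM.
  apply: (@le_trans _ _ ((Cm * (wt p * wt q * ker (de ^+ lev q))) * (Cp / sg ^+ lev p))).
    apply: ler_pM => //; apply: le_trans (a_le p q) _; apply: ler_wpM2l => //.
    have w0 := wt0.
    apply: ler_wpM2l; [exact: mulr_ge0|apply: (ker_anti G0 Gmono (deX _))].
    by rewrite /qd addrAC lerDr addr_ge0// (ltW (deX _)).
  rewrite /wt pn /Kq (_ : _ * _ = Cm * wt q * ker (de ^+ lev q) * Cp * om ^+ n * (sg ^+ n / sg ^+ n)).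
    by rewrite divff ?mulr1// gt_eqF// sgX.
  rewrite /wt; lra.
rewrite -[X in \sum_(p <- A | _) X]mulr1 -mulr_sumr.
have Ko : 0 <= Kq * om ^+ n by apply: mulr_ge0 => //; apply: ltW; exact: omX.
apply: le_trans (ler_wpM2l Ko cnt) _.
by rewrite -/Cq mulrAC.
Qed.

Lemma f_bdd q : exists B, {ae mu, forall x, `|f q x| <= B}.
Proof.
have [B hB] := sum_ph_le q; exists B; apply: le_ae_lim; first exact: f_itg.
move=> e e0; have [A0 /(_ A0 (fsubset_refl _)) h] := f_l1 q e0.
exists (fun x => \sum_(p <- A0) a p q * ph p x); split => //.
by apply: itg_sum => p _; apply: itgZ; exact: wave_itg.
Qed.

Definition Kf : R := Cp * Ctot.

Lemma Kf_ge0 : 0 <= Kf. Proof. by rewrite mulr_ge0// Ctot_ge0. Qed.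

(** [ph p] has H1 norm of order [sg ^+ lev p], and [a_total] sums these norms against the column of
    [q]. *)
Lemma f_Hbd q : Hbd mu d (f q) (Kf * sg ^+ lev q).
Proof.
apply: (Hbd_fam muT0 muT mball (u := fun p x => a p q * ph p x)
  (cs := fun p => `|a p q| * (Cp * sg ^+ lev p))) (f_itg q) (f_l1 q).
- by move=> p; apply: HbdZ.
- move=> A; rewrite /Kf -mulrA (eq_bigr (fun p => Cp * (sg ^+ lev p * `|a p q|))); last by move=> p _; lra.
  by rewrite -mulr_sumr ler_wpM2l// a_total.
Qed.

Section OneFunction.
Variable b : X -> R.
Hypothesis mb : measurable_fun setT b.
Variables (Bb : R).
Hypothesis bB : {ae mu, forall x, `|b x| <= Bb}.

Lemma b_itg : itg mu b.
Proof.
apply: (le_itg mb (itg_cst muT Bb)); apply: filterS bB => x h.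
by apply: le_trans h _; exact: ler_norm.
Qed.

Definition al p : R := \int[mu]_x (b x * ph p x).
Definition cc q : R := \int[mu]_x (b x * f q x).

Lemma itg_bph p : itg mu (fun x => b x * ph p x).
Proof. by apply: (itgM (c := Cp / sg ^+ lev p) b_itg (ph_meas p)); exact: aeW. Qed.

Lemma b2_itg : itg mu (fun x => b x ^+ 2).
Proof. by under eq_fun do rewrite expr2; apply: itgM b_itg mb bB. Qed.

(** Duality: [ph_bessel] bounds linear combinations of the [ph p], and its dual bounds the
    coefficients of [b]. *)
Lemma al_sum A : \sum_(p <- A) al p ^+ 2 <= CG * \int[mu]_x (b x ^+ 2).
Proof.
pose u x := \sum_(p <- A) al p * ph p x.
have mu_ : measurable_fun setT u.
  by apply: measurable_sum => p; apply: measurable_funM.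
have [Bu uB] : exists Bu, forall x, `|u x| <= Bu.
  exists (\sum_(p <- A) `|al p| * (Cp / sg ^+ lev p)) => x.
  apply: le_trans (ler_norm_sum _ _ _) _; apply: ler_sum => p _.
  by rewrite normrM ler_wpM2l.
have Iu : itg mu u by apply: itg_sum => p _; apply: itgZ; exact: wave_itg.
have Iu2 : itg mu (fun x => u x ^+ 2).
  by under eq_fun do rewrite expr2; apply: itgM Iu mu_ (aeW _ uB).
have Ibu : itg mu (fun x => b x * u x) by apply: itgM b_itg mu_ (aeW _ uB).
set s := \sum_(p <- A) _; have bu : \int[mu]_x (b x * u x) = s.
  rewrite /u; under eq_Rintegral do rewrite mulr_sumr.
  rewrite int_sum => [|p _].
    apply: eq_bigr => p _; rewrite expr2 -/(al p) -(RintegralZl _ measurableT (itg_bph p)).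
    by apply: eq_Rintegral => x _; rewrite mulrCA.
  by under eq_fun do rewrite mulrCA; exact/itgZ/itg_bph.
have uu : \int[mu]_x (u x ^+ 2) <= CG * s by exact: ph_bessel.
(* The square of [b - u / CG], expanded; [b] paired with [u] gives the sum of squares itself. *)
have : 0 <= \int[mu]_x (b x ^+ 2 - (2 / CG) * (b x * u x) + CG^-1 ^+ 2 * u x ^+ 2).
  apply: Rintegral_ge0 => // x _.
  have := sqr_ge0 (b x - CG^-1 * u x); rewrite sqrrB exprMn.
  by move=> h; apply: le_trans h _; rewrite le_eqVlt; apply/orP; left; apply/eqP; lra.
rewrite RintegralD//; [|exact: (itgB b2_itg (itgZ _ Ibu))|exact: itgZ].
rewrite RintegralB//; [|exact: b2_itg|exact: itgZ].
rewrite (RintegralZl _ measurableT Ibu) (RintegralZl _ measurableT Iu2) bu.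
have Ci : 0 < CG^-1 by rewrite invr_gt0.
have : CG^-1 ^+ 2 * \int[mu]_x (u x ^+ 2) <= CG^-1 * s.
  apply: le_trans (ler_wpM2l (sqr_ge0 _) uu) _.
  by rewrite expr2 -mulrA mulKf// gt_eqF.
rewrite -(ler_pdivrMl _ _ CG0); lra.
Qed.

Lemma al_l2 : l2 al.
Proof. by apply/l2P; exists (CG * \int[mu]_x (b x ^+ 2)); exact: al_sum. Qed.

(** The expansion of [f q] converges in L1, and [b] is bounded, so it may be integrated term by
    term. *)
Lemma cc_cvg q : (fun A => \sum_(p <- A) a p q * al p) @ summability.totally --> cc q.
Proof.
have [B fB] := f_bdd q.
apply/cvgrPdist_le => e e0.
have B0 : 0 < `|Bb| + 1 by rewrite ltr_wpDl.
have [A0 hA] := f_l1 q (divr_gt0 e0 B0).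
apply: (near_totally (A0 := A0)) => A AA.
have Is : itg mu (fun x => \sum_(p <- A) a p q * ph p x).
  by apply: itg_sum => p _; apply: itgZ; exact: wave_itg.
have Id := itgB (f_itg q) Is.
have -> : cc q - \sum_(p <- A) a p q * al p =
    \int[mu]_x ((f q x - \sum_(p <- A) a p q * ph p x) * b x).
  have I1 : itg mu (fun x => b x * f q x) by apply: itgM b_itg (itg_meas (f_itg q)) fB.
  have I2 p : itg mu (fun x => a p q * (b x * ph p x)) by apply: itgZ; exact: itg_bph.
  rewrite [RHS](_ : _ = \int[mu]_x (b x * f q x - \sum_(p <- A) a p q * (b x * ph p x))).
    rewrite RintegralB//; last by apply: itg_sum.
    rewrite int_sum//; congr (_ - _); apply: eq_bigr => p _.
    by rewrite (RintegralZl _ measurableT (itg_bph p)).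
  apply: eq_Rintegral => x _; rewrite mulrBl mulrC mulr_suml; congr (_ - _).
  by apply: eq_bigr => p _; lra.
apply: le_trans (le_intM Id mb (c := `|Bb|) _) _.
  by apply: filterS bB => x h; apply: le_trans h _; exact: ler_norm.
have := hA A AA; rewrite ler_pdivlMr// => h.
apply: le_trans _ h; rewrite mulrC ler_wpM2l ?l1norm_ge0// lerDl//.
Qed.

Lemma cc_S : cc = S al.
Proof.
apply/funext => q; have eq := @l2_e R J q.
rewrite -(dot_e q (opl2 oS al_l2)) (S_sym al_l2 eq).
apply/esym/(dot_unique al_l2 (opl2 oS eq)).
rewrite (_ : (fun A => _) = (fun A => \sum_(p <- A) a p q * al p)); first exact: cc_cvg.
by apply/funext => A; apply: eq_bigr => p _; rewrite mulrC.
Qed.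

Lemma cc_l2 : l2 cc. Proof. by rewrite cc_S; exact: (opl2 oS al_l2). Qed.

Lemma cc_sum A : \sum_(q <- A) cc q ^+ 2 <= nS ^+ 2 * (CG * \int[mu]_x (b x ^+ 2)).
Proof.
apply: le_trans (dotxx_ge A cc_l2) _; rewrite -(l2norm_sqr cc_l2).
have I0 : 0 <= \int[mu]_x (b x ^+ 2) by apply: Rintegral_ge0 => // x _; exact: sqr_ge0.
have := S_le al_l2; rewrite -cc_S => h1.
apply: (@le_trans _ _ ((nS * l2norm al) ^+ 2)).
  by rewrite ler_pXn2r ?nnegrE ?mulr_ge0 ?l2norm_ge0.
rewrite exprMn ler_wpM2l ?sqr_ge0// (l2norm_sqr al_l2).
exact: (dotxx_le al_sum).2.
Qed.

End OneFunction.

Lemma amgm (u v r : R) : 0 < r -> u * v <= r * u ^+ 2 + v ^+ 2 / r.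
Proof.
move=> hr; have h := sqr_ge0 (r * u - v); have h0 := sqr_ge0 (r * u + v).
rewrite -(ler_pM2l hr) mulrDr [r * (v ^+ 2 / r)]mulrCA divff ?gt_eqF// mulr1.
by rewrite sqrrB exprMn in h; rewrite sqrrD exprMn in h0; lra.
Qed.

Section Estimate.
Variables (A2 Ca : R).
Hypothesis A20 : 0 <= A2.
Hypothesis Ca0 : 0 <= Ca.

(** Successive enlargements of the ball of the atom, in multiples of [r]: [L0] locates the fine
    cubes with a nonzero coefficient [al], [L1] and [L2] each allow one more application of the
    matrix, and [C3] contains the supports of the [ph p] near [L2]. *)
Definition L0 : R := Kt * (1 + Cs).
Definition L1 : R := Kt * (L0 + 1).
Definition L2 : R := Kt * (L1 + 1).
Definition C3 : R := Kt * (L2 + Cs) + 1.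

Lemma L_ge0 : [/\ 0 <= L0, 0 <= L1, 0 <= L2 & 0 < C3].
Proof.
have K0 : 0 <= Kt by exact: le_trans Kt1.
have l0 : 0 <= L0 by rewrite mulr_ge0// addr_ge0.
have l1 : 0 <= L1 by apply: mulr_ge0 => //; exact: addr_ge0.
have l2 : 0 <= L2 by apply: mulr_ge0 => //; exact: addr_ge0.
split => //; apply: ltr_wpDl => //; apply: mulr_ge0 => //; exact: addr_ge0.
Qed.

Section OneAtom.
Variables (x0 : X) (r : R) (b : X -> R).
Hypothesis rp : 0 < r.
Hypothesis upr : forall rho, r <= rho -> fine (mu (qball d x0 rho)) <= A2 * rho.
Hypothesis mb : measurable_fun setT b.
Hypothesis ba : {ae mu, forall x, `|b x| <= Ca / r}.
Hypothesis bs : forall x, ~ qball d x0 r x -> b x = 0.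
Hypothesis b0 : \int[mu]_x b x = 0.
Local Notation al := (al b).
Local Notation cc := (cc b).
Let Ib := b_itg mb ba.

Lemma b_l1 : l1norm mu b <= Ca * A2.
Proof.
have Cr : 0 <= Ca / r by rewrite divr_ge0// ltW.
apply: le_trans (l1norm_bdd muT (c := Ca / r) (mball x0 r) mb _) _.
  apply: filterS ba => x h; have [hx|hx] := pselect (qball d x0 r x).
    by rewrite indicE mem_set// mulr1.
  by rewrite bs// normr0 mulr_ge0.
apply: le_trans (ler_wpM2l Cr (upr (lexx r))) _.
by rewrite mulrCA divfK ?gt_eqF// mulrC.
Qed.

Lemma b_l2 : r * \int[mu]_x (b x ^+ 2) <= Ca ^+ 2 * A2.
Proof.
have h : \int[mu]_x (b x ^+ 2) <= Ca / r * l1norm mu b.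
  rewrite -(RintegralZl _ measurableT (itg_norm Ib)); apply: le_int.
  - exact: (b2_itg mb ba).
  - exact/itgZ/itg_norm.
  - by apply: filterS ba => x h; rewrite -real_normK ?num_real// expr2 ler_wpM2r.
apply: le_trans (ler_wpM2l (ltW rp) h) _.
rewrite mulrA [r * _]mulrC divfK ?gt_eqF// expr2 -mulrA ler_wpM2l//; exact: b_l1.
Qed.

Lemma al_near p : al p != 0 ->
  exists x, [/\ d x0 x < r & d (pos p) x <= Cs * de ^+ lev p].
Proof.
move=> ap; apply: contrapT => hn; move/eqP: ap; apply.
transitivity (\int[mu]_(y in setT) (0 : R)); last by rewrite Rintegral_cst// mul0r.
apply: eq_Rintegral => y _; have [->|py] := eqVneq (ph p y) 0; first by rewrite mulr0.
have [hy|/bs ->] := pselect (qball d x0 r y); last by rewrite mul0r.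
by exfalso; apply: hn; exists y; split => //; exact: ph_supp.
Qed.

Lemma al_r0 : al r0 = 0.
Proof. by rewrite /al ph_r0 -[RHS]b0; apply: eq_Rintegral => x _; rewrite mulr1. Qed.

Lemma al_pos rho p : r <= rho -> de ^+ lev p <= rho -> al p != 0 ->
  d x0 (pos p) <= L0 * rho.
Proof.
move=> rr pr /al_near[x [h1 h2]]; apply: le_trans (dT _ _ x) _.
rewrite /L0 -mulrA ler_wpM2l ?(le_trans ler01)// [d x _]dC mulrDl mul1r.
apply: lerD; first exact: le_trans (ltW h1) rr.
exact: le_trans h2 (ler_wpM2l Cs0 pr).
Qed.

(** Since [b] has mean zero, the value of [ph p] at the centre may be subtracted, and the regularity
    of [ph p] on the ball is gained. *)
Lemma al_le p : `|al p| <= Ca * A2 * (Cp / sg ^+ lev p * G (r / de ^+ lev p) ^+ 2).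
Proof.
set c := Cp / _ * _.
have c0 : 0 <= c.
  by apply: mulr_ge0; [rewrite divr_ge0// ltW// sgX|exact: sqr_ge0].
have Ip := itg_bph mb ba p.
have -> : al p = \int[mu]_x (b x * ph p x - ph p x0 * b x).
  rewrite RintegralB//; last exact: itgZ.
  by rewrite (RintegralZl _ measurableT Ib) b0 mulr0 subr0.
have Id : itg mu (fun x => b x * ph p x - ph p x0 * b x) by apply: itgB => //; exact: itgZ.
apply: le_trans (le_int_l1 Id) _.
apply: (@le_trans _ _ (\int[mu]_x (c * `|b x|))).
  apply: le_l1norm => //; first exact/itgZ/itg_norm.
  apply: aeW => x; rewrite [b x * _]mulrC -mulrBl normrM.
  have [hx|/bs ->] := pselect (qball d x0 r x); last by rewrite normr0 !mulr0.
  by rewrite ler_wpM2r//; apply: ph_osc => //; rewrite dC ltW.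
rewrite (RintegralZl _ measurableT (itg_norm Ib)) mulrC ler_wpM2r//; exact: b_l1.
Qed.

Definition near (L : R) q : bool := (de ^+ lev q <= r) && (d x0 (pos q) <= L * r).

(** By the triangle inequality, a cube outside the enlarged neighbourhood is larger than [r] or at
    distance at least [r]. This is what makes [a_tail] applicable with [rho = r]. *)
Lemma near_far L p q : near L p -> ~~ near (Kt * (L + 1)) q -> r <= qd p q.
Proof.
move=> /andP[h1 h2]; have dp := ltW (deX (lev p)); have dq := ltW (deX (lev q)).
have dd := d0 (pos p) (pos q); rewrite negb_and -!ltNge /qd => /orP[h|h]; first by lra.
have K0 : 0 < Kt by exact: lt_le_trans Kt1.
have : Kt * ((L + 1) * r) < Kt * (d x0 (pos p) + d (pos p) (pos q)).
  by rewrite mulrA; apply: lt_le_trans h _; exact: dT.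
rewrite ltr_pM2l//; lra.
Qed.

Definition Wc (L : R) : R := Cc * (L + 1) / (1 - om).

Lemma Wc_ge0 L : 0 <= L -> 0 <= Wc L.
Proof.
move=> l0; apply: divr_ge0; last by rewrite subr_ge0 ltW.
by rewrite mulr_ge0// addr_ge0.
Qed.

Lemma G_gt0 : 0 < G r. Proof. exact: G0. Qed.

(** Level [n] has at most [Cc * (L + 1) * r / de ^+ n] near cubes, each with
    [wt p ^+ 2 = de ^+ n * om ^+ (2 * n)]. One factor [om ^+ n] is estimated by [G r], the other is
    summed. *)
Lemma fine_wt L A : 0 <= L ->
  \sum_(p <- A | near L p) wt p ^+ 2 / (r * G r ^+ 2) <= Wc L.
Proof.
move=> l0; have g0 := G_gt0; have rg : 0 < r * G r ^+ 2 by rewrite mulr_gt0// exprn_gt0.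
rewrite -mulr_suml ler_pdivrMr// big_mkcond.
apply: (sum_levels (lev := lev) (b := fun n =>
   (Cc * (L + 1) * r * G r) * (if de ^+ n <= r then om ^+ n else 0))) => [n|N]; last first.
  rewrite -mulr_sumr.
  have k0 : 0 <= Cc * (L + 1) * r * G r.
    by apply: mulr_ge0; [apply: mulr_ge0; [apply: mulr_ge0 => //; exact: addr_ge0|exact: ltW]|exact: ltW].
  apply: le_trans (ler_wpM2l k0 (geoA G0 GM Gmono Gde de_gt0 om0 om1 N rp)) _.
  by rewrite le_eqVlt; apply/orP; left; apply/eqP; rewrite /Wc; lra.
rewrite -big_mkcondr/=.
case: ifPn => nr; last first.
  rewrite big1 ?mulr0// => p /andP[/eqP pn /andP[]]; rewrite pn => h.
  by rewrite h in nr.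
have dn := deX n; have rho : de ^+ n <= (L + 1) * r.
  by apply: le_trans nr _; rewrite ler_peMl ?(ltW rp)// lerDr.
have cnt := near_count x0 A rho.
have Gn : om ^+ n <= G r by rewrite -(Gdelta G0 GM Gde de_gt0); exact: Gmono.
have on := omX n.
apply: (@le_trans _ _ (\sum_(p <- A | (lev p == n) && (d x0 (pos p) < (L + 1) * r)) de ^+ n * (om ^+ n * G r))).
  rewrite big_mkcond [leRHS]big_mkcond/=; apply: ler_sum => p _.
  case: (boolP (lev p == n)) => //= /eqP pn.
  case: ifPn => [/andP[_ h]|_].
    rewrite ifT; last by apply: le_lt_trans h _; rewrite ltr_pM2r// ltrDl.
    rewrite /wt pn expr2 mulrACA -expr2 exprAC sg2 ler_wpM2l ?(ltW dn)//.
    by rewrite ler_wpM2l ?(ltW on).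
  by case: ifP => // _; apply: mulr_ge0; [exact: ltW|apply: mulr_ge0; exact: ltW].
rewrite -[X in \sum_(p <- A | _) X]mulr1 -mulr_sumr.
have w0 : 0 <= de ^+ n * (om ^+ n * G r).
  by apply: mulr_ge0; [exact: ltW|apply: mulr_ge0; exact: ltW].
apply: le_trans (ler_wpM2l w0 cnt) _.
rewrite (_ : de ^+ n * _ * _ = Cc * (L + 1) * r * G r * om ^+ n * (de ^+ n / de ^+ n)); last by lra.
by rewrite divff ?mulr1// gt_eqF.
Qed.

Definition Kco : R := Ca * A2 * Cp * (Cc * (L0 + 1)) / (1 - om).

(** Boundedly many cubes of each level larger than [r] meet the ball, and [al_le] gives each the
    factor [G (r / de ^+ n) ^+ 2]. As [r < de ^+ n] the square may be dropped, and the series of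
    [G r / om ^+ n] converges geometrically. *)
Lemma coarse_sum A : \sum_(p <- A | r < de ^+ lev p) `|al p| * sg ^+ lev p <= Kco.
Proof.
have [l0 _ _ _] := L_ge0; have g0 := G_gt0.
rewrite big_mkcond.
have k0 : 0 <= Ca * A2 * Cp * (Cc * (L0 + 1)).
  apply: mulr_ge0; first by apply: mulr_ge0 => //; exact: mulr_ge0.
  by apply: mulr_ge0 => //; exact: addr_ge0.
apply: (sum_levels (lev := lev) (b := fun n =>
   (Ca * A2 * Cp * (Cc * (L0 + 1)) * G r) * (if r < de ^+ n then (om ^+ n)^-1 else 0))) => [n|N]; last first.
  rewrite -mulr_sumr.
  have k1 : 0 <= Ca * A2 * Cp * (Cc * (L0 + 1)) * G r by apply: mulr_ge0 => //; exact: ltW.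
  apply: le_trans (ler_wpM2l k1 (geoB G0 GM Gmono Gde de_gt0 om0 om1 N rp)) _.
  rewrite (_ : _ * (_ / _) = Kco * (G r / G r)); last by rewrite /Kco; lra.
  by rewrite divff ?mulr1 ?gt_eqF.
rewrite -big_mkcondr/=.
case: ifPn => nr; last first.
  rewrite big1 ?mulr0// => p /andP[/eqP pn]; rewrite pn => h.
  by rewrite h in nr.
have dn := deX n; have on := omX n; have sn := sgX n.
have rho : de ^+ n <= (L0 + 1) * de ^+ n by rewrite ler_peMl ?(ltW dn)// lerDr.
have cnt := near_count x0 A rho; rewrite mulfK ?gt_eqF// in cnt.
have Grn : G (r / de ^+ n) = G r / om ^+ n.
  have := GM (divr_gt0 rp dn) dn; rewrite divfK ?gt_eqF// (Gdelta G0 GM Gde de_gt0) => ->.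
  by rewrite mulfK// gt_eqF.
have Gle : G r <= om ^+ n by rewrite -(Gdelta G0 GM Gde de_gt0); apply: Gmono => //; exact: ltW.
have Gq : (G r / om ^+ n) ^+ 2 <= G r / om ^+ n.
  have q1 : G r / om ^+ n <= 1 by rewrite ler_pdivrMr// mul1r.
  by rewrite expr2 ler_piMl// divr_ge0// ltW.
apply: (@le_trans _ _ (\sum_(p <- A | (lev p == n) && (d x0 (pos p) < (L0 + 1) * de ^+ n)) Ca * A2 * Cp * (G r / om ^+ n))).
  rewrite big_mkcond [leRHS]big_mkcond/=; apply: ler_sum => p _.
  have cc0 : 0 <= Ca * A2 * Cp * (G r / om ^+ n).
    by apply: mulr_ge0; [apply: mulr_ge0 => //; exact: mulr_ge0|apply: divr_ge0; exact: ltW].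
  case: (boolP (lev p == n)) => //= /eqP pn.
  rewrite pn nr; have [->|ap] := eqVneq (al p) 0.
    by rewrite normr0 mul0r; case: ifP.
  rewrite ifT; last first.
    apply: le_lt_trans (al_pos (rho := de ^+ n) (ltW nr) _ ap) _; first by rewrite pn.
    by rewrite ltr_pM2r// ltrDl.
  apply: le_trans (ler_wpM2r (ltW sn) (al_le p)) _; rewrite pn Grn.
  rewrite (_ : _ * _ * sg ^+ n = Ca * A2 * Cp * (G r / om ^+ n) ^+ 2 * (sg ^+ n / sg ^+ n)); last by lra.
  rewrite divff ?mulr1 ?gt_eqF// ler_wpM2l//.
  by apply: mulr_ge0 => //; exact: mulr_ge0.
rewrite -[X in \sum_(p <- A | _) X]mulr1 -mulr_sumr.
have w0 : 0 <= Ca * A2 * Cp * (G r / om ^+ n).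
  by apply: mulr_ge0; [apply: mulr_ge0 => //; exact: mulr_ge0|apply: divr_ge0; exact: ltW].
apply: le_trans (ler_wpM2l w0 cnt) _.
by rewrite le_eqVlt; apply/orP; left; apply/eqP; lra.
Qed.

Definition Kfi : R := CG * (Ca ^+ 2 * A2) + Wc L0.

(** The arithmetic-geometric inequality splits the product into [r * al p ^+ 2], summed by the
    Bessel inequality and [b_l2], and the weights of [fine_wt]. *)
Lemma fine_sum A : \sum_(p <- A | de ^+ lev p <= r) `|al p| * (wt p / G r) <= Kfi.
Proof.
have [l0 _ _ _] := L_ge0; have g0 := G_gt0.
apply: (@le_trans _ _ (r * \sum_(p <- A) al p ^+ 2 + \sum_(p <- A | near L0 p) wt p ^+ 2 / (r * G r ^+ 2))).
  rewrite mulr_sumr [X in _ <= _ + X]big_mkcond -big_split/= big_mkcond.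
  apply: ler_sum => p _; have w2 : 0 <= wt p ^+ 2 / (r * G r ^+ 2).
    by rewrite divr_ge0 ?sqr_ge0// mulr_ge0 ?sqr_ge0// ltW.
  have ra : 0 <= r * al p ^+ 2 by rewrite mulr_ge0 ?sqr_ge0// ltW.
  case: ifPn => pr; last by apply: addr_ge0 => //; case: ifP.
  have [e|ap] := eqVneq (al p) 0.
    by rewrite {1}e normr0 mul0r addr_ge0//; case: ifP.
  rewrite ifT; last by rewrite /near pr; exact: al_pos.
  have := amgm `|al p| (wt p / G r) rp; rewrite real_normK ?num_real//.
  suff -> : (wt p / G r) ^+ 2 / r = wt p ^+ 2 / (r * G r ^+ 2) by [].
  by rewrite expr_div_n [(r * _)^-1]invfM; lra.
apply: lerD; last exact: fine_wt.
apply: le_trans (ler_wpM2l (ltW rp) (al_sum mb ba A)) _.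
by rewrite mulrCA ler_wpM2l ?(ltW CG0)//; exact: b_l2.
Qed.

Definition Kfar : R := Ctot * (Kco + Kfi).

(** Expand [cc] as the matrix applied to [al]. For [p] larger than [r] the whole row sum [a_total]
    suffices; a fine [p] with [al p] nonzero is near [L0], so a [q] outside [L1] is far from it and
    [a_tail] applies. *)
Lemma far_sum A : \sum_(q <- A | ~~ near L1 q) `|cc q| * sg ^+ lev q <= Kfar.
Proof.
have ct := Ctot_ge0.
have cv : (fun B : {fset J} => \sum_(q <- A | ~~ near L1 q)
     `|\sum_(p <- B) a p q * al p| * sg ^+ lev q) @ summability.totally -->
   \sum_(q <- A | ~~ near L1 q) `|cc q| * sg ^+ lev q.
  under eq_fun do rewrite -big_filter; rewrite -big_filter.
  apply: cvg_fsum => q; apply: cvgMl; apply: cvg_norm. exact: (cc_cvg mb ba).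
apply: (cvgr_to_le cv); apply: (near_totally (A0 := fset0)) => B _.
apply: (@le_trans _ _ (\sum_(p <- B) `|al p| * \sum_(q <- A | ~~ near L1 q) sg ^+ lev q * `|a q p|)).
  under [leRHS]eq_bigr do rewrite mulr_sumr.
  rewrite exchange_big/=; apply: ler_sum => q _.
  apply: le_trans (ler_wpM2r (ltW (sgX _)) (ler_norm_sum _ _ _)) _.
  rewrite mulr_suml; apply: ler_sum => p _.
  by rewrite normrM [a p q]a_sym; lra.
rewrite (bigID (fun p => r < de ^+ lev p))/= /Kfar mulrDr; apply: lerD.
  apply: le_trans _ (ler_wpM2l ct (coarse_sum B)); rewrite mulr_sumr; apply: ler_sum => p _.
  rewrite mulrCA ler_wpM2l//; apply: le_trans _ (a_total p A).
  rewrite [leRHS](bigID (near L1))/= ler_wpDl ?sumr_ge0// => q _.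
  by rewrite mulr_ge0// ltW// sgX.
apply: le_trans _ (ler_wpM2l ct (fine_sum B)); rewrite mulr_sumr.
under eq_bigl do rewrite -leNgt.
apply: ler_sum => p pr; rewrite mulrCA.
have [->|ap] := eqVneq (al p) 0; first by rewrite normr0 !mul0r.
rewrite ler_wpM2l//; apply: le_trans _ (a_tail p A rp).
rewrite big_mkcond [leRHS]big_mkcond/=; apply: ler_sum => q _.
case: ifPn => nq; last by case: ifP => // _; rewrite mulr_ge0// ltW// sgX.
rewrite ifT//; apply: near_far nq; rewrite /near pr; exact: al_pos.
Qed.

(** A summable majorant, uniform over atoms, that controls the H1 norm of partial expansions. Away
    from the ball it is the H1 size of the term. Near the ball, [r * cc q ^+ 2] serves the L2
    estimate, and both summands together dominate [|cc q| * (wt q / G r)], which enters the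
    tails. *)
Definition t q : R := if near L1 q then r * cc q ^+ 2 + wt q ^+ 2 / (r * G r ^+ 2)
  else `|cc q| * sg ^+ lev q.

Lemma t_ge0 q : 0 <= t q.
Proof.
rewrite /t; case: ifP => _; last by rewrite mulr_ge0// ltW// sgX.
have rp' := ltW rp; apply: addr_ge0; first by rewrite mulr_ge0 ?sqr_ge0.
by rewrite divr_ge0 ?sqr_ge0// mulr_ge0 ?sqr_ge0.
Qed.

Definition KT : R := nS ^+ 2 * (CG * (Ca ^+ 2 * A2)) + Wc L1 + Kfar.

Lemma t_sum A : \sum_(q <- A) t q <= KT.
Proof.
have [_ l1 _ _] := L_ge0.
rewrite (bigID (near L1))/=; apply: lerD; last first.
  by apply: le_trans _ (far_sum A); apply: ler_sum => q /negbTE h; rewrite /t h.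
rewrite (eq_bigr (fun q => r * cc q ^+ 2 + wt q ^+ 2 / (r * G r ^+ 2))); last first.
  by move=> q h; rewrite /t h.
rewrite big_split/=; apply: lerD; last exact: fine_wt.
apply: (@le_trans _ _ (r * \sum_(q <- A) cc q ^+ 2)).
  rewrite -mulr_sumr ler_wpM2l ?(ltW rp)// [leRHS](bigID (near L1))/= lerDl.
  by rewrite sumr_ge0// => q _; exact: sqr_ge0.
apply: le_trans (ler_wpM2l (ltW rp) (cc_sum mb ba A)) _.
rewrite mulrCA ler_wpM2l ?sqr_ge0// mulrCA ler_wpM2l ?(ltW CG0)//; exact: b_l2.
Qed.

Lemma S_fsum (x : J -> R) A p :
  S (fun j => \sum_(q <- A) x q * l2_delta q j) p = \sum_(q <- A) x q * a p q.
Proof.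
have [lin _] := oS.
elim: (enum_fset A) p => [|q s IH] p.
  under eq_fun do rewrite big_nil; rewrite big_nil.
  have := lin (-1) (fun=> 0) (fun=> 0) (@l2_0 R J) (@l2_0 R J).
  rewrite (_ : (fun j => _) = (fun=> 0 : R)); last by apply/funext => j; rewrite mulr0 addr0.
  by move=> /(congr1 (fun g => g p)); lra.
have ls : l2 (fun j => \sum_(q <- s) x q * l2_delta q j : R).
  elim: (s) => [|q' s' IH'].
    by under eq_fun do rewrite big_nil; exact: l2_0.
  by under eq_fun do rewrite big_cons; apply: l2D => //; exact: l2_e.
under eq_fun do rewrite big_cons.
by rewrite (lin _ _ _ (l2_e q) ls) big_cons IH.
Qed.

Lemma e_sum (x : J -> R) A (D : {fset J}) :
  \sum_(p <- D) (\sum_(q <- A) x q * a p q) ^+ 2 <= nS ^+ 2 * \sum_(q <- A) x q ^+ 2.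
Proof.
pose y (j : J) : R := \sum_(q <- A) x q * l2_delta q j.
have yE j : y j = if j \in A then x j else 0.
  rewrite /y; case: ifPn => jA.
    rewrite (bigD1_seq j)//= /l2_delta eqxx mulr1 big1 ?addr0// => q qj.
    by rewrite eq_sym (negbTE qj) mulr0.
  rewrite big_seq big1// => q qA; rewrite /l2_delta; case: eqP => [e|_]; last exact: mulr0.
  by rewrite e qA in jA.
have yB (D' : {fset J}) : \sum_(j <- D') y j ^+ 2 <= \sum_(q <- A) x q ^+ 2.
  have y0 j : 0 <= y j ^+ 2 by exact: sqr_ge0.
  apply: le_trans (fset_sum_le y0 (fsubsetUl D' A)) _.
  rewrite -(@big_fset_incl _ _ _ _ A (D' `|` A)%fset _ (fsubsetUr _ _)); last first.
    by move=> j _ jA; rewrite yE (negbTE jA) expr0n.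
  rewrite big_seq [leRHS]big_seq; apply: ler_sum => j jA.
  by rewrite yE jA.
have [yl yn] := dotxx_le yB.
apply: (@le_trans _ _ (l2norm (S y) ^+ 2)).
  rewrite (l2norm_sqr (opl2 oS yl)).
  apply: le_trans _ (dotxx_ge D (opl2 oS yl)).
  by rewrite le_eqVlt; apply/orP; left; apply/eqP; apply: eq_bigr => p _; rewrite S_fsum.
apply: (@le_trans _ _ ((nS * l2norm y) ^+ 2)).
  by rewrite ler_pXn2r ?nnegrE ?mulr_ge0 ?l2norm_ge0// S_le.
by rewrite exprMn ler_wpM2l ?sqr_ge0// (l2norm_sqr yl).
Qed.

Lemma common_fset (P : J -> {fset J} -> Prop) (s : seq J) :
  (forall q, exists A0, forall A, (A0 `<=` A)%fset -> P q A) ->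
  exists A0, forall A, (A0 `<=` A)%fset -> forall q, q \in s -> P q A.
Proof.
move=> hP; elim: s => [|q s [A1 h1]]; first by exists fset0.
have [A2' h2] := hP q; exists (A1 `|` A2')%fset => A; rewrite fsubUset => /andP[s1 s2] q'.
by rewrite inE => /predU1P[->|]; [exact: h2|exact: h1].
Qed.

Lemma cc_r0 : cc r0 = 0.
Proof.
have cv := cc_cvg mb ba (q := r0).
rewrite -(cvg_lim (@Rhausdorff R) cv).
rewrite (_ : (fun A => _) = (fun=> 0)); first exact: (lim_cst (@Rhausdorff R)).
apply/funext => A; rewrite big1// => p _.
have [->|pr] := eqVneq p r0; first by rewrite al_r0 mulr0.
by rewrite a_sym a_r0// mul0r.
Qed.

Lemma t_ge_near q : near L1 q -> `|cc q| * (wt q / G r) <= t q /\ r * cc q ^+ 2 <= t q.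
Proof.
move=> nq; have rp' := ltW rp; have g0 := G_gt0; rewrite /t nq; split.
  have := amgm `|cc q| (wt q / G r) rp; rewrite real_normK ?num_real//.
  suff -> : (wt q / G r) ^+ 2 / r = wt q ^+ 2 / (r * G r ^+ 2) by [].
  by rewrite expr_div_n [(r * _)^-1]invfM; lra.
by rewrite lerDl divr_ge0 ?sqr_ge0// mulr_ge0 ?sqr_ge0.
Qed.

Section Key.
Variables (CL : R).
Hypothesis CL0 : 0 <= CL.
Hypothesis LH : forall b : X -> R, measurable_fun setT b -> (exists Bb, forall x, `|b x| <= Bb) ->
  (forall eps, 0 < eps -> exists2 rho, 0 < rho & forall x y, d x y <= rho -> `|b x - b y| <= eps) ->
  (forall y, ~ qball d x0 (C3 * r) y -> b y = 0) -> \int[mu]_x b x = 0 ->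
  forall e, 0 < e ->
  Hbd mu d b (CL * (Num.sqrt r * Num.sqrt (\int[mu]_x (b x ^+ 2))) + e).
Variable A : {fset J}.

(** [xx] keeps the near coefficients, and [ee] is its image under [S], so that the near part [Nf] of
    the expansion equals the sum of the [ee p * ph p]. *)
Let xx q : R := if near L1 q then cc q else 0.
Let ee p : R := \sum_(q <- A) xx q * a p q.
Let Tt : R := \sum_(q <- A) t q.
Let Nf y : R := \sum_(q <- A) xx q * f q y.

Lemma ee_sum (P : pred J) (w : J -> R) (D : {fset J}) :
  (forall q, near L1 q -> \sum_(p <- D | P p) sg ^+ lev p * `|a p q| <= w q) ->
  \sum_(p <- D | P p) `|ee p| * sg ^+ lev p <= \sum_(q <- A) `|xx q| * w q.
Proof.
move=> hw; apply: (@le_trans _ _ (\sum_(q <- A) `|xx q| * \sum_(p <- D | P p) sg ^+ lev p * `|a p q|)).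
  under [leRHS]eq_bigr do rewrite mulr_sumr.
  rewrite exchange_big/=; apply: ler_sum => p _.
  apply: le_trans (ler_wpM2r (ltW (sgX _)) (ler_norm_sum _ _ _)) _.
  rewrite mulr_suml; apply: ler_sum => q _; rewrite normrM; lra.
apply: ler_sum => q _; rewrite /xx; case: ifPn => nq; last by rewrite normr0 !mul0r.
by rewrite ler_wpM2l// hw.
Qed.

(** The indices [q] of [xx] are near [L1] and [p] is not near [L2], so [a_tail] bounds the matrix by
    [wt q / G r], which is summed against [xx] by [t_ge_near]. *)
Lemma ee_far (D : {fset J}) : \sum_(p <- D | ~~ near L2 p) `|ee p| * sg ^+ lev p <= Ctot * Tt.
Proof.
apply: le_trans (@ee_sum (fun p => ~~ near L2 p) (fun q => Ctot * (wt q / G r)) D _) _ => [q nq|].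
  apply: le_trans _ (a_tail q D rp).
  rewrite big_mkcond [leRHS]big_mkcond/=; apply: ler_sum => p _.
  case: ifPn => np; last by case: ifP => // _; rewrite mulr_ge0// ltW// sgX.
  by rewrite ifT//; exact: near_far nq np.
rewrite mulr_sumr; apply: ler_sum => q _; rewrite mulrCA ler_wpM2l ?Ctot_ge0//.
rewrite /xx; case: ifPn => nq; first by have [] := t_ge_near nq.
by rewrite normr0 mul0r t_ge0.
Qed.

Lemma ee_r0 : ee r0 = 0.
Proof.
rewrite /ee big1// => q _; have [->|qr] := eqVneq q r0.
  by rewrite /xx cc_r0; case: ifP; rewrite mul0r.
by rewrite a_r0// mulr0.
Qed.

Lemma far_Hbd : Hbd mu d (fun y => \sum_(q <- A) (cc q - xx q) * f q y) (Kf * Tt).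
Proof.
apply: HbdW (Hbd_sum muT0 muT mball (enum_fset A) (P := xpredT)
  (cs := fun q => `|cc q - xx q| * (Kf * sg ^+ lev q)) _) _ => [q _|].
  by apply: HbdZ => //; exact: f_Hbd.
rewrite mulr_sumr; apply: ler_sum => q _; rewrite mulrCA ler_wpM2l ?Kf_ge0//.
rewrite /xx; have h := t_ge0 q; case: ifPn => nq; first by rewrite subrr normr0 mul0r.
by rewrite subr0 /t (negbTE nq).
Qed.

Section Truncation.
Variable B0 : {fset J}.
Variable e1 : R.
Hypothesis e10 : 0 < e1.
Hypothesis B0_tail : forall D : {fset J}, [disjoint D & B0]%fset ->
  \sum_(p <- D) `|ee p| * sg ^+ lev p <= e1.
(** Restricting to the finite set [B0] makes the local part [bb] bounded and uniformly continuous,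
    as [LH] requires; by [B0_tail] the omitted terms cost at most [e1]. *)
Let ww p : R := if (p \in B0) && near L2 p then ee p else 0.
Let bb y : R := \sum_(p <- B0) ww p * ph p y.

Lemma ww_le p : `|ww p| <= `|ee p|.
Proof. by rewrite /ww; case: ifP => // _; rewrite normr0. Qed.

Lemma bb_itg : itg mu bb.
Proof. by apply: itg_sum => p _; apply: itgZ; exact: wave_itg. Qed.

(** [bb] has mean zero and lives in the ball of radius [C3 * r]. Its squared L2 norm is at most
    [CG * nS ^+ 2] times the sum of squares of [xx], and [r] times that sum is at most [Tt]; [LH]
    turns this into an H1 bound. *)
Lemma bb_Hbd e : 0 < e ->
  Hbd mu d bb (CL * (Num.sqrt CG * nS * Num.sqrt Tt) + e).
Proof.
move=> e0.
have T0 : 0 <= Tt by apply: sumr_ge0 => q _; exact: t_ge0.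
have I0 : 0 <= \int[mu]_x (bb x ^+ 2) by apply: Rintegral_ge0 => // x _; exact: sqr_ge0.
have rI : r * \int[mu]_x (bb x ^+ 2) <= CG * nS ^+ 2 * Tt.
  apply: le_trans (ler_wpM2l (ltW rp) (ph_bessel ww B0)) _.
  have h1 : \sum_(p <- B0) ww p ^+ 2 <= nS ^+ 2 * \sum_(q <- A) xx q ^+ 2.
    apply: le_trans _ (e_sum xx A B0); apply: ler_sum => p _.
    rewrite -[ww p ^+ 2]real_normK ?num_real// -[leRHS]real_normK ?num_real//.
    by rewrite ler_pXn2r ?nnegrE//; exact: ww_le.
  have h2 : r * \sum_(q <- A) xx q ^+ 2 <= Tt.
    rewrite mulr_sumr; apply: ler_sum => q _; rewrite /xx; case: ifPn => nq.
      by have [] := t_ge_near nq.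
    by rewrite expr0n mulr0 t_ge0.
  have h3 := ler_wpM2l (ltW CG0) h1.
  apply: le_trans (ler_wpM2l (ltW rp) h3) _.
  set s := \sum_(q <- A) xx q ^+ 2 in h2 *.
  have -> : r * (CG * (nS ^+ 2 * s)) = CG * nS ^+ 2 * (r * s) by lra.
  by apply: ler_wpM2l h2; rewrite mulr_ge0 ?sqr_ge0// ltW.
apply: HbdW (LH _ _ _ _ _ e0) _.
- by apply: measurable_sum => p; apply: measurable_funM.
- exists (\sum_(p <- B0) `|ww p| * (Cp / sg ^+ lev p)) => x.
  apply: le_trans (ler_norm_sum _ _ _) _; apply: ler_sum => p _.
  by rewrite normrM ler_wpM2l.
(* Each [ph p] oscillates by a multiple of [om ^+ N ^+ 2] over distances [de ^+ N], so the finite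
   sum is uniformly continuous. *)
- move=> eps eps0.
  pose K := \sum_(p <- B0) `|ww p| * (Cp / sg ^+ lev p * (om ^+ lev p ^+ 2)^-1).
  have K0 : 0 <= K.
    apply: sumr_ge0 => p _; apply: mulr_ge0 => //; apply: mulr_ge0.
      by rewrite divr_ge0// ltW// sgX.
    by rewrite invr_ge0 sqr_ge0.
  have [N hN] : exists N, K * om ^+ N ^+ 2 <= eps.
    have kk : 0 < eps / (K + 1) by rewrite divr_gt0// ltr_wpDl.
    have := cvg_expr (z := om); rewrite ger0_norm ?(ltW om0)// => /(_ om1).
    move=> /cvgrPdist_le/(_ _ kk)[N _ /(_ N (leqnn N))].
    rewrite /= sub0r normrN (ger0_norm (ltW (omX N))) => h; exists N.
    have oN : om ^+ N ^+ 2 <= om ^+ N.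
      by rewrite expr2 ler_piMl ?(ltW (omX _))// exprn_ile1// ltW.
    apply: le_trans (ler_wpM2l K0 (le_trans oN h)) _.
    by rewrite mulrCA ler_piMr ?(ltW eps0)// ler_pdivrMr ?ltr_wpDl// mul1r lerDl.
  exists (de ^+ N); first exact: deX.
  move=> x y xy; apply: le_trans _ hN; rewrite -sumrB.
  apply: le_trans (ler_norm_sum _ _ _) _; rewrite mulr_suml; apply: ler_sum => p _.
  rewrite -mulrBr normrM -mulrA ler_wpM2l//.
  apply: le_trans (ph_osc p (deX N) xy) _; rewrite -[leRHS]mulrA ler_wpM2l//.
    by rewrite divr_ge0// ltW// sgX.
  have := GM (divr_gt0 (deX N) (deX (lev p))) (deX (lev p)).
  rewrite divfK ?gt_eqF ?deX// !(Gdelta G0 GM Gde de_gt0) => ->.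
  by rewrite exprMn mulrCA mulVf ?mulr1// gt_eqF// exprn_gt0// omX.
- move=> y hy; rewrite /bb big1// => p _; rewrite /ww.
  case: ifPn => [/andP[_ /andP[n1 n2]]|_]; last by rewrite mul0r.
  have [->|/ph_supp py] := eqVneq (ph p y) 0; first by rewrite mulr0.
  exfalso; apply: hy; rewrite /qball/=; apply: le_lt_trans (dT _ _ (pos p)) _.
  have K1 : 0 <= Kt by exact: le_trans Kt1.
  have h1 : d x0 (pos p) + d (pos p) y <= (L2 + Cs) * r.
    rewrite mulrDl lerD//; apply: le_trans py _; exact: (ler_wpM2l Cs0 n1).
  apply: le_lt_trans (ler_wpM2l K1 h1) _.
  by rewrite mulrA ltr_pM2r// /C3 ltrDl.
- rewrite int_sum => [|p _]; last by apply: itgZ; exact: wave_itg.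
  rewrite big1// => p _; rewrite (RintegralZl _ measurableT (wave_itg p)).
  (* Only [ph r0] has a nonzero integral, and its coefficient vanishes because the atom has mean
     zero. *)
  have [->|pr] := eqVneq p r0; last by rewrite ph_int// mulr0.
  by rewrite /ww ee_r0; case: ifP => _; rewrite mul0r.
- rewrite lerD2r ler_wpM2l// -sqrtrM ?(ltW rp)//.
  apply: le_trans (ler_wsqrtr rI) _.
  rewrite sqrtrM ?mulr_ge0 ?sqr_ge0 ?(ltW CG0)// sqrtrM ?(ltW CG0)// sqrtr_sqr.
  by rewrite (ger0_norm nS0).
Qed.

(** What remains consists of the [ee p * ph p] with [p] away from the ball, summed by [ee_far], and
    of the tail outside [B0]. *)
Lemma rest_Hbd : Hbd mu d (fun y => Nf y - bb y) (Cp * (Ctot * Tt + e1)).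
Proof.
have INf : itg mu Nf by apply: itg_sum => q _; apply: itgZ; exact: f_itg.
pose uu p : R := if (p \in B0) && near L2 p then 0 else ee p.
apply: (Hbd_fam muT0 muT mball (u := fun p y => uu p * ph p y)
  (cs := fun p => `|uu p| * (Cp * sg ^+ lev p))) => [p|D||e e0].
- exact: HbdZ.
- rewrite (eq_bigr (fun p => Cp * (`|uu p| * sg ^+ lev p))); last by move=> p _; lra.
  rewrite -mulr_sumr ler_wpM2l//.
  pose v p := if p \in B0 then 0 else `|ee p| * sg ^+ lev p.
  have v0 p : 0 <= v p by rewrite /v; case: ifP => // _; rewrite mulr_ge0// ltW// sgX.
  apply: (@le_trans _ _ (\sum_(p <- D | ~~ near L2 p) `|ee p| * sg ^+ lev p + \sum_(p <- D) v p)).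
    rewrite [X in X + _]big_mkcond -big_split/=; apply: ler_sum => p _.
    have h0 : 0 <= `|ee p| * sg ^+ lev p by rewrite mulr_ge0// ltW// sgX.
    rewrite /uu /v; case: (p \in B0) => /=; case: (near L2 p) => /=.
    - by rewrite normr0 mul0r addr0.
    - by rewrite addr0.
    - by rewrite add0r.
    - by rewrite lerDl.
  apply: lerD; first exact: ee_far.
  have DB : [disjoint (D `\` B0) & B0]%fset by rewrite -fsetI_eq0 fsetIC fsetIDA fsetDIl fsetDv fset0I.
  rewrite -(@big_fset_incl _ _ _ _ (D `\` B0)%fset D _ (fsubsetDl _ _)); last first.
    by move=> p pD; rewrite in_fsetD pD andbT negbK /v => ->.
  apply: le_trans _ (B0_tail DB); apply: ler_sum => p _.
  by rewrite /v; case: ifP => // _; rewrite mulr_ge0// ltW// sgX.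
- by apply: itgB => //; exact: bb_itg.
- pose Sx := \sum_(q <- A) `|xx q| + 1.
  have Sx0 : 0 < Sx by rewrite ltr_wpDl// sumr_ge0.
  have [A1 hA1] := common_fset A (fun q => f_l1 q (divr_gt0 e0 Sx0)).
  exists (A1 `|` B0)%fset => D; rewrite fsubUset => /andP[s1 s2].
  have If q : itg mu (fun y => f q y - \sum_(p <- D) a p q * ph p y).
    apply: itgB; first exact: f_itg.
    by apply: itg_sum => p _; apply: itgZ; exact: wave_itg.
  have -> : (fun y => Nf y - bb y - \sum_(p <- D) uu p * ph p y) =
      (fun y => \sum_(q <- A) xx q * (f q y - \sum_(p <- D) a p q * ph p y)).
    apply/funext => y; under [RHS]eq_bigr do rewrite mulrBr.
    rewrite sumrB -addrA -opprD; congr (_ - _).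
    have -> : bb y = \sum_(p <- D) ww p * ph p y.
      apply: big_fset_incl => // p _ pB; by rewrite /ww (negbTE pB) mul0r.
    rewrite -big_split/=; under [RHS]eq_bigr do rewrite mulr_sumr.
    rewrite exchange_big/=; apply: eq_bigr => p _.
    rewrite -mulrDl (_ : ww p + uu p = ee p); last first.
      by rewrite /ww /uu; case: ifP; rewrite ?addr0 ?add0r.
    by rewrite /ee mulr_suml; apply: eq_bigr => q _; rewrite mulrA.
  apply: le_trans (l1norm_sum (enum_fset A) (P := xpredT) _) _ => [q _|]; first exact: itgZ.
  apply: (@le_trans _ _ (\sum_(q <- A) `|xx q| * (e / Sx))).
    rewrite big_seq [leRHS]big_seq; apply: ler_sum => q qA.
    by rewrite l1normZ// ler_wpM2l// hA1.
  rewrite -mulr_suml mulrCA ler_piMr ?(ltW e0)// ler_pdivrMr// mul1r /Sx lerDl//.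
Qed.

End Truncation.

Definition CK : R := Kf + Cp * Ctot + CL * (Num.sqrt CG * nS).

(** Three pieces: the terms away from the ball ([far_Hbd]), the local part of the near terms
    ([bb_Hbd]) and their remainder ([rest_Hbd]). The square root comes from the L2 estimate of the
    second. *)
Lemma key_Hbd e : 0 < e ->
  Hbd mu d (fun y => \sum_(q <- A) cc q * f q y) (CK * (Tt + Num.sqrt Tt) + e).
Proof.
move=> e0; have e2 : 0 < e / 2 by rewrite divr_gt0.
have e1 : 0 < e / 2 / (Cp + 1) by rewrite divr_gt0// ltr_wpDl.
have T0 : 0 <= Tt by apply: sumr_ge0 => q _; exact: t_ge0.
have [B0 hB] := fset_tail (t := fun p => `|ee p| * sg ^+ lev p)
  (C := \sum_(q <- A) `|xx q| * (Ctot * sg ^+ lev q))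
  (fun p => mulr_ge0 (normr_ge0 _) (ltW (sgX _)))
  (fun D => ee_sum (P := xpredT) (fun q _ => a_total q D)) e1.
have h := HbdD muT0 muT mball far_Hbd (HbdD muT0 muT mball (bb_Hbd B0 e2) (rest_Hbd hB)).
apply: Hbd_ext (HbdW h _).
  apply/funext => y; rewrite [X in _ + X]addrC subrK /Nf -big_split/=.
  by apply: eq_bigr => q _; rewrite -mulrDl subrK.
have c1 : Cp * (e / 2 / (Cp + 1)) <= e / 2.
  by rewrite mulrCA ler_piMr ?(ltW e2)// ler_pdivrMr ?ltr_wpDl// mul1r lerDl.
have s0 := sqrtr_ge0 Tt.
have k1 := Kf_ge0; have k2 : 0 <= Cp * Ctot by rewrite mulr_ge0// Ctot_ge0.
have k3 : 0 <= CL * (Num.sqrt CG * nS) by rewrite mulr_ge0// mulr_ge0 ?sqrtr_ge0.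
have m1 := mulr_ge0 k1 s0; have m2 := mulr_ge0 k2 s0; have m3 := mulr_ge0 k3 T0.
rewrite /CK !mulrDl !mulrDr; rewrite -!mulrA in m1 m2 m3 *.
lra.
Qed.

End Key.

End OneAtom.

End Estimate.

(** A constant is orthogonal to every [ph p] of mean zero, and [S] does not mix [r0] with the other
    indices. *)
Lemma const_coef k q : cc (cst k) q = (q == r0)%:R * (k * fine (mu setT) * a r0 r0).
Proof.
have al0 p : al (cst k) p = (p == r0)%:R * (k * fine (mu setT)).
  rewrite /al (RintegralZl _ measurableT (wave_itg p)).
  have [->|pr] := eqVneq p r0; last by rewrite ph_int// mul0r mulr0.
  by rewrite ph_r0 mul1r (_ : \int[mu]_x _ = \int[mu]_(x in setT) (1 : R))// Rintegral_cst// mul1r.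
have bk : {ae mu, forall x, `|cst k x| <= `|k|} by apply: aeW.
have cv := cc_cvg (@measurable_cst _ _ _ _ setT k) bk (q := q).
rewrite -(cvg_lim (@Rhausdorff R) cv); apply/cvg_lim; first exact: Rhausdorff.
apply: cvg_near_cst; apply: (near_totally (A0 := [fset r0]%fset)) => A; rewrite fsub1set => rA.
rewrite (big_fsetD1 r0)//= big_seq big1 ?addr0 => [|p]; last first.
  by rewrite in_fsetD1 => /andP[/negbTE pr _]; rewrite al0 pr mul0r mulr0.
rewrite al0 eqxx mul1r; have [->|qr] := eqVneq q r0; first by rewrite mul1r mulrC.
by rewrite a_r0// !mul0r.
Qed.

Section AllAtoms.
Variables (A1 A2 rmax : R).
Hypothesis A10 : 0 < A1.
Hypothesis A20 : 0 < A2.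
Hypothesis rmax0 : 0 < rmax.
Hypothesis lower : forall x r, 0 < r -> r <= rmax -> A1 * r <= fine (mu (qball d x r)).
Hypothesis full : forall x r, rmax < r -> qball d x r = setT.
Hypothesis upper : forall x r, 0 < r -> qball d x r = [set x] \/
  forall rho, r <= rho -> fine (mu (qball d x rho)) <= A2 * rho.
Hypothesis square_Hbd : forall C rM : R, 0 < C -> 0 < rM -> exists2 CL, 0 < CL &
  forall x0 r (b : X -> R), 0 < r -> r <= rM ->
  (forall rho, r <= rho -> fine (mu (qball d x0 rho)) <= A2 * rho) ->
  measurable_fun setT b -> (exists Bb, forall x, `|b x| <= Bb) ->
  (forall eps, 0 < eps -> exists2 rho, 0 < rho & forall x y, d x y <= rho -> `|b x - b y| <= eps) ->
  (forall y, ~ qball d x0 (C * r) y -> b y = 0) -> \int[mu]_x b x = 0 ->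
  forall e, 0 < e ->
  Hbd mu d b (CL * (Num.sqrt r * Num.sqrt (\int[mu]_x (b x ^+ 2))) + e).

(** If the ball of an atom is a single point, the vanishing integral makes the atom zero almost
    everywhere. Otherwise the measure of the ball is comparable to its radius, once radii are cut
    off at the size of the space. *)
Lemma atom_cases b : atom mu d b ->
  [\/ b = cst (fine (mu setT))^-1, {ae mu, forall x, b x = 0} |
   exists x0 r, [/\ [/\ 0 < r, r <= 2 * rmax &
     forall rho, r <= rho -> fine (mu (qball d x0 rho)) <= A2 * rho],
     {ae mu, forall x, `|b x| <= 2 / A1 / r},
     forall x, ~ qball d x0 r x -> b x = 0 & \int[mu]_x b x = 0]].
Proof.
move=> ab; have [mb [[x0 [r [rp bs ble b0]]]|->]] := ab; last by constructor 1.
have Ib := (atom_l1 muT0 muT mball ab).1.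
have b0' : \int[mu]_x b x = 0 by rewrite /Rintegral b0.
(* Balls of radius beyond [rmax] are the whole space, so this changes no ball; the lower bound of
   the measure then applies to the radius [r' / 2], which is at most [rmax]. *)
pose r' := Num.min r (2 * rmax).
have rr : 0 < 2 * rmax by rewrite mulr_gt0.
have r'p : 0 < r' by rewrite lt_min rp.
have eB : qball d x0 r = qball d x0 r'.
  rewrite /r'; have [h|h] := leP r (2 * rmax); first by [].
  by rewrite !full//; [rewrite ltr_pMl// ltr1n|rewrite (lt_trans _ h)// ltr_pMl// ltr1n].
have [eb|up] := upper x0 r'p.
  constructor 2; apply: l1norm_eq0 => //.
  have mx : measurable [set x0] by rewrite -eb.
  have e x : b x = b x0 * \1_[set x0] x.
    have [->|nx] := pselect (x = x0); first by rewrite indicE mem_set ?mulr1.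
    rewrite bs; last by rewrite eB eb.
    by rewrite indicE memNset ?mulr0.
  have z : b x0 * fine (mu [set x0]) = 0.
    by rewrite -(int_indic mu _ mx) -[RHS]b0'; apply: eq_Rintegral => x _; rewrite [RHS]e.
  have -> : l1norm mu b = `|b x0| * fine (mu [set x0]).
    rewrite -(int_indic mu _ mx); apply: eq_Rintegral => x _.
    by rewrite e normrM; congr (_ * _); rewrite ger0_norm.
  by rewrite -[fine _]ger0_norm ?fine_ge0// -normrM z normr0.
constructor 3; exists x0, r'; split => //.
- by split => //; rewrite ge_min lexx orbT.
- move: ble => /(LnormooP muT0); apply: filterS => x bx; apply: le_trans bx _.
  have h2 : 0 < r' / 2 by rewrite divr_gt0.
  have h3 : r' / 2 <= rmax by rewrite ler_pdivrMr// mulrC ge_min lexx orbT.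
  have low := lower x0 h2 h3.
  have h4 : A1 * (r' / 2) <= fine (mu (qball d x0 r)).
    apply: le_trans low _; rewrite eB fine_le ?mu_fin//.
    apply: le_measure; rewrite ?inE// => y; rewrite /qball/= => hy.
    by apply: lt_trans hy _; rewrite ltr_pdivrMr// ltr_pMr// ltr1n.
  have Ar : 0 < A1 * (r' / 2) by rewrite mulr_gt0.
  rewrite (_ : 2 / A1 / r' = (A1 * (r' / 2))^-1).
    by rewrite lef_pV2 ?posrE// (lt_le_trans Ar).
  by rewrite !invfM invrK; lra.
- by move=> x; rewrite -eB; exact: bs.
Qed.

(** The constant atom projects to a multiple of [f r0], a null atom to zero, and for all others
    [key_Hbd] and [t_sum] feed [Hbd_unordered]. *)
Lemma proj_atoms : exists C0 C1, 0 < C0 /\ forall b, atom mu d b ->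
  (forall A, l1norm mu (fun x => \sum_(q <- A) cc b q * f q x) <= C1) /\
  exists2 g, Hbd mu d g C0 & forall e, 0 < e -> exists A0, forall A, (A0 `<=` A)%fset ->
     l1norm mu (fun x => g x - \sum_(q <- A) cc b q * f q x) <= e.
Proof.
pose Ca := 2 / A1; have Ca0 : 0 <= Ca by rewrite divr_ge0// ltW.
have [_ _ _ C30] := L_ge0.
have rr : 0 < 2 * rmax by rewrite mulr_gt0.
have [CL CL0 hL] := square_Hbd C30 rr.
pose K := CK CL; pose T := KT A2 Ca.
pose Kc := `|a r0 r0| * (Kf * sg ^+ lev r0).
have Kc0 : 0 <= Kc by rewrite mulr_ge0// mulr_ge0 ?Kf_ge0// ltW// sgX.
have K0 : 0 <= K.
  apply: addr_ge0; last by rewrite mulr_ge0 ?(ltW CL0)// mulr_ge0 ?sqrtr_ge0.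
  by apply: addr_ge0; [exact: Kf_ge0|rewrite mulr_ge0// Ctot_ge0].
pose C0 := K * (T + Num.sqrt T) + 1 + 2 * (2 * K + 1).
have C1 : R := K * (T + Num.sqrt T) + 1.
exists (`|C0| + Kc + 1), (`|K * (T + Num.sqrt T) + 1| + Kc).
split => [|b ab]; first by rewrite ltr_wpDl// addr_ge0.
have Ib := (atom_l1 muT0 muT mball ab).1; have mb := itg_meas Ib.
have Pi A : itg mu (fun x => \sum_(q <- A) cc b q * f q x).
  by apply: itg_sum => q _; apply: itgZ; exact: f_itg.
have [eb|z|[x0 [r [[rp rl up] ba bs b0]]]] := atom_cases ab.
- have m1 : fine (mu setT) != 0 by rewrite gt_eqF// fine_gt0// muT0 muT.
  have cE q : cc b q = (q == r0)%:R * a r0 r0 by rewrite eb const_coef mulVf// mul1r.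
  have PE A x : \sum_(q <- A) cc b q * f q x = (r0 \in A)%:R * (a r0 r0 * f r0 x).
    case: (boolP (r0 \in A)) => rA.
      rewrite (big_fsetD1 r0)//= big_seq big1 ?addr0 => [|q]; first by rewrite cE eqxx !mul1r.
      by rewrite in_fsetD1 => /andP[/negbTE qr _]; rewrite cE qr !mul0r.
    rewrite big_seq big1 ?mul0r// => q qA; rewrite cE; case: eqP => [qr|_]; last by rewrite !mul0r.
    by move: rA; rewrite -qr qA.
  have Hr : Hbd mu d (fun x => a r0 r0 * f r0 x) Kc by apply: HbdZ => //; exact: f_Hbd.
  split=> [A|].
    under eq_fun do rewrite PE; case: (r0 \in A) => /=.
      under eq_fun do rewrite mul1r.
      by apply: le_trans (Hbd_l1 muT0 muT mball Hr) _; rewrite lerDr.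
    by under eq_fun do rewrite mul0r; rewrite l1norm0 addr_ge0.
  exists (fun x => a r0 r0 * f r0 x).
    by apply: HbdW Hr _; rewrite -addrA addrCA lerDl addr_ge0.
  move=> e e0; exists [fset r0]%fset => A; rewrite fsub1set => rA.
  under eq_fun do rewrite PE rA mul1r subrr.
  by rewrite l1norm0 ltW.
- have cE q : cc b q = 0.
    rewrite /cc -[RHS](_ : \int[mu]_(x in setT) (0 : R) = 0); last by rewrite Rintegral_cst// mul0r.
    have mf := itg_meas (f_itg q).
    apply: eq_ae_int; [exact: measurable_funM|by []|].
    by apply: filterS z => x ->; rewrite mul0r.
  have PE A : (fun x => \sum_(q <- A) cc b q * f q x) = (fun=> 0).
    by apply/funext => x; rewrite big1// => q _; rewrite cE mul0r.
  split=> [A|]; first by rewrite PE l1norm0 addr_ge0.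
  exists (fun=> 0); first by apply: HbdW (Hbd0 muT0 muT mball) _; rewrite !addr_ge0.
  move=> e e0; exists fset0 => A _; have := PE A => PEA.
  rewrite (_ : (fun x => _) = (fun=> 0)) ?l1norm0 ?ltW//.
  by apply/funext => x; rewrite (congr1 (fun g => g x) PEA) subrr.
have tS := t_sum (A2 := A2) (ltW A20) Ca0 rp up mb ba bs b0.
have tg := t_ge0 x0 b rp.
have hb A e (e0 : 0 < e) := key_Hbd rp mb ba b0 (ltW CL0)
  (fun b' => @hL x0 r b' rp rl up) A e0.
have T0 : 0 <= T by apply: le_trans (tS fset0); rewrite big_seq_fset0.
split=> [A|].
  apply: le_trans (Hbd_l1 muT0 muT mball (hb A 1 ltr01)) _.
  rewrite ler_wpDr//; apply: le_trans _ (ler_norm _).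
  by rewrite lerD2r ler_wpM2l// lerD ?ler_wsqrtr.
have [g [Hg hg]] := Hbd_unordered muT0 muT mball (u := fun q y => cc b q * f q y) K0 tg tS hb.
exists g => //; apply: HbdW Hg _; apply: le_trans (ler_norm C0) _.
by rewrite -addrA lerDl addr_ge0.
Qed.

Theorem bounded_projection : exists2 C, 0 < C & forall g, H1 mu d g -> exists g',
  Lp_sum mu 1%E (fun q x => (\int[mu]_y (g y * f q y)) * f q x) g' /\
  (H1norm mu d g' <= C%:E * H1norm mu d g)%E.
Proof.
have [C0 [C1 [C00 hC]]] := proj_atoms.
have /choice[Cf fC] := f_bdd.
exists C0 => // g Hg; apply: (proj_H1 muT0 muT mball _ fC C00 hC Hg) => q.
exact: itg_meas (f_itg q).
Qed.

End AllAtoms.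

End Atoms.


(** * Measures of dyadic cubes in a normal space *)

Section Geometry.
Context {R : realType} {disp : measure_display} {X : measurableType disp}.
Variables (mu : {measure set X -> \bar R}) (d : X -> X -> R).
Hypothesis muT0 : (0 < mu setT)%E.
Hypothesis muT : (mu setT < +oo)%E.
Hypothesis mball : forall x r, measurable (qball d x r).
Variables (Kt A1 A2 rmax : R).
Hypothesis d0 : forall x y, 0 <= d x y.
Hypothesis dxx : forall x, d x x = 0.
Hypothesis dC : forall x y, d x y = d y x.
Hypothesis Kt1 : 1 <= Kt.
Hypothesis dT : forall x y z, d x y <= Kt * (d x z + d z y).
Hypothesis A10 : 0 < A1.
Hypothesis A20 : 0 < A2.
Hypothesis rmax0 : 0 < rmax.

Definition ms (A : set X) : R := fine (mu A).

Hypothesis lower : forall x r, 0 < r -> r <= rmax -> A1 * r <= ms (qball d x r).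
Hypothesis upper : forall x r, 0 < r -> qball d x r = [set x] \/
  forall rho, r <= rho -> ms (qball d x rho) <= A2 * rho.

Lemma ms_ge0 A : 0 <= ms A. Proof. by rewrite fine_ge0. Qed.

Lemma le_ms A B : measurable A -> measurable B -> A `<=` B -> ms A <= ms B.
Proof.
move=> mA mB AB; apply: fine_le; [exact: mu_fin|exact: mu_fin|].
by apply: le_measure => //; rewrite inE.
Qed.

Lemma int_ind A : measurable A -> \int[mu]_x \1_A x = ms A.
Proof.
move=> mA; have := int_indic mu 1 mA; rewrite mul1r -/(ms A) => <-.
by apply: eq_Rintegral => x _; rewrite mul1r.
Qed.

Lemma itg_ind A : measurable A -> itg mu \1_A.
Proof.
move=> mA; have := itg_indic muT 1 mA; apply: eq_integrable => // x _ /=.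
by rewrite mul1r.
Qed.

Lemma indE (A : set X) x : A x -> \1_A x = 1 :> R.
Proof. by move=> Ax; rewrite indicE mem_set. Qed.

Lemma indNE (A : set X) x : ~ A x -> \1_A x = 0 :> R.
Proof. by move=> Ax; rewrite indicE memNset. Qed.

Lemma ind_ge0 (A : set X) x : 0 <= \1_A x :> R.
Proof. by rewrite indicE. Qed.

Lemma ind_le1 (A : set X) x : \1_A x <= 1 :> R.
Proof. by rewrite indicE; case: (_ \in _). Qed.

Variables (de a0 eta C1 C2 : R) (E : nat -> set (set X)).
Hypothesis de0 : 0 < de.
Hypothesis de1 : de < 1.
Hypothesis a00 : 0 < a0.
Hypothesis C10 : 0 < C1.
Hypothesis DC : dyadic_cubes mu d de a0 eta C1 C2 E.

Let dn0 n : 0 < de ^+ n. Proof. exact: exprn_gt0. Qed.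

Definition c0 : R := A1 * Num.min a0 rmax.

Lemma c00 : 0 < c0.
Proof. by rewrite mulr_gt0// lt_min a00 rmax0. Qed.

Lemma cube_eq n P Q : E n P -> E n Q -> P `&` Q !=set0 -> P = Q.
Proof.
move=> EP EQ [x [Px Qx]].
have h A B : E n A -> E n B -> A x -> B x -> A `<=` B.
  move=> EA EB Ax Bx; have [//|h] := cube_nested DC (leqnn n) EB EA.
  by have : set0 x by rewrite -h.
by apply/seteqP; split; apply: h.
Qed.

Lemma cube_d n Q x y : E n Q -> Q x -> Q y -> d x y <= C1 * de ^+ n.
Proof.
move=> EQ Qx Qy; rewrite -lee_fin; apply: le_trans (cube_diam DC EQ).
by apply: ereal_sup_ubound; exists x => //; exists y.
Qed.

Lemma cube_center n Q : E n Q -> exists z, Q z /\ qball d z (a0 * de ^+ n) `<=` Q.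
Proof.
move=> EQ; have [z zQ] := cube_ball DC EQ; exists z; split => //; apply: zQ.
by rewrite /qball/= dxx mulr_gt0.
Qed.

(** The radius of the inner ball is reduced to [Num.min a0 rmax * de ^+ n], where the lower bound on
    the measure of balls holds. *)
Lemma cube_lower n Q : E n Q -> c0 * de ^+ n <= ms Q.
Proof.
move=> EQ; have [z [zQ bQ]] := cube_center EQ.
have h : 0 < Num.min a0 rmax * de ^+ n by rewrite mulr_gt0// lt_min a00 rmax0.
have dle : de ^+ n <= 1 by rewrite exprn_ile1 ?ltW.
rewrite /c0 -mulrA; apply: le_trans (lower z h _) _.
  apply: (@le_trans _ _ (rmax * de ^+ n)); first by rewrite ler_pM2r// ge_min lexx orbT.
  by rewrite ler_piMr// ltW.
apply: le_ms; [exact: mball|exact: (cube_measurable DC EQ)|].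
move=> y hy; apply: bQ; apply: lt_le_trans hy _.
by rewrite ler_pM2r// ge_min lexx.
Qed.

Lemma cube_ms_gt0 n Q : E n Q -> 0 < ms Q.
Proof. by move=> /cube_lower; apply: lt_le_trans; rewrite mulr_gt0// c00. Qed.

Lemma cube_in_ball n Q z r : E n Q -> Q z -> C1 * de ^+ n < r -> Q `<=` qball d z r.
Proof. by move=> EQ Qz hr y Qy; apply: le_lt_trans (cube_d EQ Qz Qy) hr. Qed.

Definition Cu : R := 2 * A2 * C1.

Lemma cube_upper n Q z : E n Q -> Q z -> qball d z (2 * C1 * de ^+ n) = [set z] \/
  ms (qball d z (2 * C1 * de ^+ n)) <= Cu * de ^+ n.
Proof.
move=> EQ Qz; have r0 : 0 < 2 * C1 * de ^+ n by rewrite !mulr_gt0.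
have [?|h] := upper z r0; [by left|right].
by apply: le_trans (h _ (lexx _)) _; rewrite /Cu; lra.
Qed.

Lemma cube_in_ball2 n Q z : E n Q -> Q z -> Q `<=` qball d z (2 * C1 * de ^+ n).
Proof.
move=> EQ Qz; apply: cube_in_ball EQ Qz _.
by rewrite -mulrA ltr_pMl ?mulr_gt0// ltr1n.
Qed.

Lemma sum_cubes n (s : {fset set X}) B : (forall Q, Q \in s -> E n Q) ->
  (forall Q, Q \in s -> Q `<=` B) -> measurable B ->
  \sum_(Q <- s) ms Q <= ms B.
Proof.
move=> sE sB mB.
have mQ Q : Q \in s -> measurable Q by move=> /sE/(cube_measurable DC).
have IF Q : Q \in s -> itg mu \1_Q by move=> /mQ; exact: itg_ind.
have -> : \sum_(Q <- s) ms Q = \int[mu]_x (\sum_(Q <- s | Q \in s) \1_Q x).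
  rewrite int_sum// [LHS]big_seq; apply: eq_bigr => Q Qs.
  by rewrite int_ind//; exact: mQ.
rewrite -int_ind//; apply: le_int.
- exact: itg_sum.
- exact: itg_ind.
- apply: aeW => x.
  have [[Q [Qs Qx]]|nQ] := pselect (exists Q, Q \in s /\ Q x); last first.
    rewrite big1 ?ind_ge0// => Q Qs; rewrite indNE// => Qx; apply: nQ.
    by exists Q.
  rewrite indE; last exact: sB Qs _ Qx.
  rewrite -big_seq (big_fsetD1 Q Qs)/= big1_seq ?addr0 ?ind_le1// => P /=.
  rewrite !inE => /andP[PQ Ps]; rewrite indNE// => Px.
  by move/eqP: PQ; apply; apply: (cube_eq (sE _ Ps) (sE _ Qs)); exists x.
Qed.

Lemma card_cubes n (s : {fset set X}) B : (forall Q, Q \in s -> E n Q) ->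
  (forall Q, Q \in s -> Q `<=` B) -> measurable B ->
  #|` s|%:R * (c0 * de ^+ n) <= ms B.
Proof.
move=> sE sB mB; apply: le_trans (sum_cubes sE sB mB).
rewrite [leRHS]big_seq (@le_trans _ _ (\sum_(Q <- s | Q \in s) c0 * de ^+ n))//.
  by rewrite -big_seq big_const_seq count_predT iter_addr_0 mulr_natl.
by apply: ler_sum => Q Qs; apply: cube_lower (sE _ Qs).
Qed.

(** Distinct cubes of one level are disjoint and have measure at least [c0 * de ^+ n], in a space of
    finite measure. *)
Lemma finite_E n : finite_set (E n).
Proof.
apply: contrapT => infE; have [N NX] : exists N : nat, ms setT < N%:R * (c0 * de ^+ n).
  exists (Num.bound (ms setT / (c0 * de ^+ n))).
  have cd : 0 < c0 * de ^+ n by rewrite mulr_gt0 ?c00.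
  by rewrite -ltr_pdivrMr//; apply: archi_boundP; rewrite divr_ge0 ?ms_ge0// ltW.
have [s sE] := infinite_set_fset N infE.
move=> /= Ns; have := @card_cubes n s setT sE (fun _ _ _ _ => Logic.I) measurableT.
apply/negP; rewrite -ltNge; apply: lt_le_trans NX _.
by rewrite ler_pM2r ?ler_nat// mulr_gt0 ?c00.
Qed.

Definition chl n Q : {fset set X} := fset_set (children E n Q).

Lemma finite_children n Q : finite_set (children E n Q).
Proof. by apply: sub_finite_set (finite_E n.+1) => P []. Qed.

Lemma chlP n Q P : P \in chl n Q <-> E n.+1 P /\ P `<=` Q.
Proof.
have h := in_fset_set (finite_children n Q) P.
by rewrite /chl h; split => [/set_mem|/mem_set].
Qed.

Lemma cover_level n : {ae mu, forall x, exists2 Q, E n Q & Q x}.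
Proof.
by have [N [mN N0 hN]] := cube_cover DC n; exists N; split.
Qed.

Lemma chl_cover n Q : E n Q -> {ae mu, forall x,
  \1_Q x = \sum_(P <- chl n Q) \1_P x :> R}.
Proof.
move=> EQ; apply: filterS (cover_level n.+1) => x [P EP Px].
have [Qx|Qx] := pselect (Q x); last first.
  rewrite indNE// big1_seq// => P' /= /chlP[EP' PQ]; rewrite indNE// => P'x.
  exact: Qx (PQ _ P'x).
have PQ : P `<=` Q.
  have [//|h] := cube_nested DC (leqnSn n) EQ EP.
  by have : set0 x by rewrite -h.
have Pc : P \in chl n Q by apply/chlP.
rewrite indE// (big_fsetD1 P Pc)/= indE// big1_seq ?addr0// => P' /=.
rewrite !inE => /andP[PP' /chlP[EP' _]]; rewrite indNE// => P'x.
by move/eqP: PP'; apply; apply: (cube_eq EP' EP); exists x.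
Qed.

Definition Gam : R := Num.max 1 (Cu / (c0 * de)).

Lemma Gam1 : 1 <= Gam. Proof. by rewrite /Gam le_max lexx. Qed.

Lemma Cu0 : 0 < Cu. Proof. by rewrite !mulr_gt0. Qed.

Lemma Gam_c : Cu <= Gam * (c0 * de).
Proof. have cd : 0 < c0 * de by rewrite mulr_gt0// c00.
by rewrite -ler_pdivrMr// /Gam le_max lexx orbT. Qed.

Lemma Gam_c' : Cu <= Gam * c0.
Proof.
apply: le_trans Gam_c _; apply: ler_wpM2l; first exact: le_trans ler01 Gam1.
by rewrite ler_piMr ?ltW// c00.
Qed.

(** Parent and child both have measure comparable to their diameters, except when the ball around
    the parent is a single point, and then the two cubes coincide. *)
Lemma child_ratio n Q P : E n Q -> P \in chl n Q -> ms Q <= Gam * ms P.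
Proof.
move=> EQ /chlP[EP PQ]; have [z [Pz _]] := cube_center EP.
have Qz := PQ _ Pz; have mQ := cube_measurable DC EQ; have mP := cube_measurable DC EP.
have [h|h] := cube_upper EQ Qz.
  have QP : Q `<=` P.
    by move=> y /(cube_in_ball2 EQ Qz); rewrite h => ->.
  apply: le_trans (le_ms mQ mP QP) _; rewrite ler_peMl ?ms_ge0//.
  exact: Gam1.
apply: (@le_trans _ _ (Cu * de ^+ n)).
  by apply: le_trans h; apply: le_ms => //; exact: cube_in_ball2 Qz.
apply: (@le_trans _ _ (Gam * (c0 * de) * de ^+ n)).
  by rewrite ler_pM2r//; exact: Gam_c.
rewrite (_ : Gam * (c0 * de) * de ^+ n = Gam * (c0 * de ^+ n.+1)); last by rewrite exprS; lra.
by apply: ler_wpM2l; [exact: le_trans ler01 Gam1|exact: cube_lower EP].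
Qed.

(** The cube fits in a ball of comparable measure, so the function is a multiple of an atom. If that
    ball is a point, the vanishing integral forces the function to be zero. *)
Lemma cube_atom n Q (f : X -> R) (c : R) : E n Q -> measurable_fun setT f ->
  (forall x, ~ Q x -> f x = 0) -> (forall x, `|f x| <= c) ->
  \int[mu]_x f x = 0 -> Hbd mu d f (Gam * c * ms Q).
Proof.
move=> EQ mf f0 fc intf.
have [z [Qz _]] := cube_center EQ.
have cc : 0 <= c := le_trans (normr_ge0 _) (fc point).
have G0 : 0 <= Gam := le_trans ler01 Gam1.
have mQ := cube_measurable DC EQ.
have [h|h] := cube_upper EQ Qz.
  have QE : Q = [set z].
    by apply/seteqP; split => y; [move/(cube_in_ball2 EQ Qz); rewrite h|move=> ->].
  have fE : f = fun x => f z * \1_Q x.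
    apply/funext => x; have [Qx|Qx] := pselect (Q x); last by rewrite f0// indNE// mulr0.
    by rewrite indE// mulr1; move: Qx; rewrite QE => ->.
  have fz0 : f z = 0.
    have : f z * ms Q = 0.
      by rewrite -(int_indic mu (f z) mQ) -intf; apply: eq_Rintegral => x _; rewrite [in RHS]fE.
    by move/eqP; rewrite mulf_eq0 (gt_eqF (cube_ms_gt0 EQ)) orbF => /eqP.
  have := Hbd0 muT0 muT mball => h0; apply: HbdW (Hbd_ext _ h0) _.
    by apply/funext => x; rewrite fE /= fz0 mul0r.
  by rewrite !mulr_ge0// ms_ge0.
have r0 : 0 < 2 * C1 * de ^+ n by rewrite !mulr_gt0.
have hb : forall y, ~ qball d z (2 * C1 * de ^+ n) y -> f y = 0.
  by move=> y hy; apply: f0 => Qy; apply: hy; exact: cube_in_ball2 Qy.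
apply: HbdW (Hbd_ball muT0 muT mball r0 mf (aeW _ fc) hb intf cc) _.
rewrite -/(ms _); apply: le_trans (ler_wpM2l cc h) _.
rewrite (_ : Gam * c * ms Q = c * (Gam * ms Q)); last by lra.
apply: ler_wpM2l => //.
apply: (@le_trans _ _ (Gam * c0 * de ^+ n)); first by rewrite ler_pM2r// Gam_c'.
rewrite (_ : Gam * c0 * de ^+ n = Gam * (c0 * de ^+ n)); last by lra.
by apply: ler_wpM2l => //; exact: cube_lower EQ.
Qed.

Lemma itg_bounded (f : X -> R) (c : R) : measurable_fun setT f ->
  (forall x, `|f x| <= c) -> itg mu f.
Proof.
move=> mf fc; apply: (le_itg mf (itg_cst muT c)); apply: aeW => x.
exact: le_trans (fc x) (ler_norm _).
Qed.

Lemma measurable_ind (A : set X) : measurable A -> measurable_fun setT (\1_A : X -> R).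
Proof. by move=> mA; exact/itg_meas/itg_ind. Qed.

Lemma at_most_one n (s : seq (set X)) (F : set X -> X -> R) (c : R) x : uniq s ->
  (forall P, P \in s -> E n P) -> 0 <= c ->
  (forall P, P \in s -> ~ P x -> F P x = 0) ->
  (forall P, P \in s -> `|F P x| <= c) -> `|\sum_(P <- s) F P x| <= c.
Proof.
move=> us sE cc F0 Fc.
have [[P [Ps Px]]|nP] := pselect (exists P, P \in s /\ P x); last first.
  rewrite big1_seq ?normr0// => P /= Ps; apply: F0 => // Px.
  by apply: nP; exists P.
rewrite (bigD1_seq P)//= big1_seq ?addr0 ?Fc// => P' /= /andP[PP' P's].
apply: F0 => // P'x; move/eqP: PP'; apply.
by apply: (cube_eq (sE _ P's) (sE _ Ps)); exists x.
Qed.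

(** * A Calderon-Zygmund stopping argument on dyadic cubes *)

Section CZ.
Variables (b : X -> R) (Bb : R).
Hypothesis mb : measurable_fun setT b.
Hypothesis bB : forall x, `|b x| <= Bb.

Definition intsq (Q : set X) : R := \int[mu]_x (b x ^+ 2 * \1_Q x).
Definition intb (Q : set X) : R := \int[mu]_x (b x * \1_Q x).
Definition av (Q : set X) : R := intb Q / ms Q.

Lemma itg_b1 Q : measurable Q -> itg mu (fun x => b x * \1_Q x).
Proof.
move=> mQ; apply: (@itg_bounded _ Bb).
  by apply: measurable_funM => //; exact: measurable_ind.
by move=> x; rewrite normrM -[leRHS]mulr1 ler_pM// ger0_norm ?ind_ge0 ?ind_le1.
Qed.

Lemma itg_b2 Q : measurable Q -> itg mu (fun x => b x ^+ 2 * \1_Q x).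
Proof.
move=> mQ; apply: (@itg_bounded _ (Bb ^+ 2)).
  by apply: measurable_funM; [exact: measurable_funX|exact: measurable_ind].
move=> x; have B0 := le_trans (normr_ge0 _) (bB x).
rewrite normrM -[leRHS]mulr1 ler_pM// ?(ger0_norm (ind_ge0 _ _)) ?ind_le1//.
by rewrite normrX ler_pXn2r ?nnegrE.
Qed.

Lemma intsq_ge0 Q : 0 <= intsq Q.
Proof. by apply: Rintegral_ge0 => x _; rewrite mulr_ge0 ?sqr_ge0// ind_ge0. Qed.

Lemma av_sqr n Q : E n Q -> av Q ^+ 2 * ms Q <= intsq Q.
Proof.
move=> EQ; have mQ := cube_measurable DC EQ; have m0 := cube_ms_gt0 EQ.
have I1 := itg_b1 mQ; have I2 := itg_b2 mQ; have I3 := itg_indic muT (av Q ^+ 2) mQ.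
have : 0 <= \int[mu]_x ((b x ^+ 2 * \1_Q x + (- (2 * av Q)) * (b x * \1_Q x)) + av Q ^+ 2 * \1_Q x).
  apply: Rintegral_ge0 => x _.
  have := ind_ge0 Q x; set i := \1_Q x => i0.
  rewrite (_ : _ + _ = (b x - av Q) ^+ 2 * i); last by lra.
  by rewrite mulr_ge0 ?sqr_ge0.
have J1 := itgZ (- (2 * av Q)) I1; have I12 := itgD I2 J1.
rewrite (RintegralD measurableT I12 I3) (RintegralD measurableT I2 J1).
rewrite (RintegralZl _ measurableT I1) int_indic// -/(ms Q) -/(intsq Q) -/(intb Q).
have -> : intb Q = av Q * ms Q by rewrite /av divfK// gt_eqF.
lra.
Qed.

Lemma int_av n Q : E n Q -> \int[mu]_x (b x * \1_Q x - av Q * \1_Q x) = 0.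
Proof.
move=> EQ; have mQ := cube_measurable DC EQ; have m0 := cube_ms_gt0 EQ.
rewrite (RintegralB measurableT (itg_b1 mQ) (itg_indic muT (av Q) mQ)).
by rewrite int_indic// -/(intb Q) -/(ms Q) /av divfK ?subrr// gt_eqF.
Qed.

Lemma int_children (F : X -> R) n Q : E n Q -> measurable_fun setT F ->
  (forall P, measurable P -> itg mu (fun x => F x * \1_P x)) ->
  \int[mu]_x (F x * \1_Q x) = \sum_(P <- chl n Q) \int[mu]_x (F x * \1_P x).
Proof.
move=> EQ mF IF; have mQ := cube_measurable DC EQ.
have mP P : P \in chl n Q -> measurable P by move=> /chlP[/(cube_measurable DC)].
rewrite [RHS]big_seq -int_sum; last by move=> P /mP; exact: IF.
apply: eq_ae_int.
- exact/itg_meas/IF.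
- by apply/itg_meas/itg_sum => P /mP; exact: IF.
- apply: filterS (chl_cover EQ) => x hx.
  by rewrite hx mulr_sumr [LHS]big_seq.
Qed.

Variables (eps : R) (N : nat).
Hypothesis eps0 : 0 < eps.
Hypothesis osc : forall Q x y, E N Q -> Q x -> Q y -> `|b x - b y| <= eps.

(** Chosen so that the induction closes: [3/4 * Cz + 4 * Gam ^+ 2 = Cz]. *)
Let Cz := 16 * Gam ^+ 2.
Let Gam0 : 0 <= Gam. Proof. exact: le_trans ler01 Gam1. Qed.

(** The decomposition of [b] on [Q] at height [lam]: the bounded good part [g] has the integral of
    [b], and the bad part is bounded in H1. *)
Definition cz (Q : set X) (lam : R) := exists g : X -> R,
  [/\ measurable_fun setT g, forall x, ~ Q x -> g x = 0,
      forall x, `|g x| <= 3 * Gam * lam, \int[mu]_x g x = intb Q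
    & Hbd mu d (fun x => b x * \1_Q x - g x) (Cz * (3 / 4 / lam) * intsq Q)].

Definition cz_av (Q : set X) :=
  Hbd mu d (fun x => b x * \1_Q x - av Q * \1_Q x)
    (Cz * ms Q * (Num.sqrt (intsq Q / ms Q) + eps)).

(** Decompose at the height of the quadratic mean of [b], plus [eps]. The bad part costs [3/4 * Cz],
    and the good part minus the mean is bounded by [4 * Gam * lam] and has integral zero, hence
    costs [4 * Gam ^+ 2]. *)
Lemma cz_claim n Q : E n Q ->
  (forall lam, eps <= lam -> intsq Q <= 4 * lam ^+ 2 * ms Q -> cz Q lam) -> cz_av Q.
Proof.
move=> EQ h; have mQ := cube_measurable DC EQ; have m0 := cube_ms_gt0 EQ.
have i0 := intsq_ge0 Q; have g1 := Gam1.
set r := Num.sqrt (intsq Q / ms Q); have r0 : 0 <= r by rewrite sqrtr_ge0.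
have r2 : r ^+ 2 * ms Q = intsq Q.
  by rewrite /r sqr_sqrtr ?divr_ge0 ?ms_ge0// divfK// gt_eqF.
have e0 := eps0.
pose lam := r + eps; have lam0 : 0 < lam by rewrite /lam; lra.
have rl : r ^+ 2 <= lam ^+ 2 by rewrite ler_pXn2r ?nnegrE ?(ltW lam0)// /lam; lra.
have il : intsq Q <= lam ^+ 2 * ms Q by rewrite -r2 ler_pM2r.
have [g [mg g0 gB gi gH]] : cz Q lam.
  apply: h; first by rewrite /lam lerDr.
  have : 0 <= lam ^+ 2 * ms Q by rewrite mulr_ge0 ?sqr_ge0 ?ms_ge0.
  lra.
have avl : `|av Q| <= lam.
  rewrite -(ler_pXn2r (n := 2))// ?nnegrE ?(ltW lam0)// real_normK ?num_real//.
  by rewrite -(ler_pM2r m0); apply: le_trans (av_sqr EQ) il.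
have Ig : itg mu g by exact: itg_bounded gB.
have H1 : Hbd mu d (fun x => g x - av Q * \1_Q x) (Gam * (4 * Gam * lam) * ms Q).
  apply: (cube_atom EQ).
  - by apply: measurable_funB => //; apply: measurable_funM => //; exact: measurable_ind.
  - by move=> x Qx; rewrite g0// indNE// mulr0 subrr.
  - move=> x; apply: le_trans (ler_normB _ _) _.
    have := gB x; have : `|av Q * \1_Q x| <= Gam * lam; last by lra.
    rewrite normrM -[Gam * lam]mulr1 ler_pM// ?(ger0_norm (ind_ge0 _ _)) ?ind_le1//.
    by apply: le_trans avl _; rewrite ler_peMl// ltW.
  - rewrite RintegralB//; last exact: itg_indic.
    by rewrite gi int_indic// -/(ms Q) /av divfK ?subrr// gt_eqF.
have := HbdD muT0 muT mball gH H1; rewrite /cz_av => H2.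
apply: HbdW (Hbd_ext _ H2) _; first by apply/funext => x; lra.
have : intsq Q / lam <= lam * ms Q by rewrite ler_pdivrMr//; apply: le_trans il _; rewrite expr2; lra.
rewrite -/r -/lam.
have C0 : 0 <= Cz by rewrite /Cz mulr_ge0// sqr_ge0.
move=> /(ler_wpM2l C0); rewrite /Cz; lra.
Qed.

(** Induction from the finest level [N] upwards. On that level [b] oscillates by at most
    [eps <= lam] and is its own good part. Above it each child is either decomposed at the same
    height or replaced by its mean, and the pieces are added. *)
Lemma cz_ind k : forall n Q, (n + k)%N = N -> E n Q ->
  forall lam, eps <= lam -> intsq Q <= 4 * lam ^+ 2 * ms Q -> cz Q lam.
Proof.
elim: k => [|k IH] n Q nk EQ lam el il.
  rewrite addn0 in nk; rewrite nk in EQ.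
  have mQ := cube_measurable DC EQ; have m0 := cube_ms_gt0 EQ.
  have e0 := eps0; have lam0 : 0 < lam by apply: lt_le_trans el.
  exists (fun x => b x * \1_Q x); split.
  - exact/itg_meas/itg_b1.
  - by move=> x Qx; rewrite indNE// mulr0.
  - move=> x; have [Qx|Qx] := pselect (Q x); last first.
      by rewrite indNE// mulr0 normr0 !mulr_ge0// ltW.
    rewrite indE// mulr1.
    have avl : `|av Q| <= 2 * lam.
      rewrite -(ler_pXn2r (n := 2))// ?nnegrE ?mulr_ge0 ?(ltW lam0)// real_normK ?num_real//.
      by rewrite -(ler_pM2r m0); apply: le_trans (av_sqr EQ) _; rewrite exprMn; lra.
    have : `|b x - av Q| <= eps.
      rewrite -(ler_pM2r m0) -[X in _ * X](ger0_norm (ltW m0)) -normrM mulrBl.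
      rewrite /av divfK ?gt_eqF//.
      have -> : b x * ms Q - intb Q = \int[mu]_y (b x * \1_Q y - b y * \1_Q y).
        by rewrite (RintegralB measurableT (itg_indic muT (b x) mQ) (itg_b1 mQ)) int_indic.
      have IB : itg mu (fun y => b x * \1_Q y - b y * \1_Q y).
        by apply: itgB; [exact: itg_indic|exact: itg_b1].
      apply: le_trans (le_int_l1 IB) _; apply: (l1norm_bdd muT mQ (itg_meas IB)).
      apply: aeW => y; have [Qy|Qy] := pselect (Q y); last by rewrite indNE// !mulr0 subrr normr0.
      by rewrite indE// !mulr1; exact: (osc EQ).
    have := ler_normD (b x - av Q) (av Q); rewrite subrK.
    have : 3 * lam <= 3 * Gam * lam by rewrite ler_pM2r// ler_peMr// Gam1.
    lra.
  - by [].
  - apply: HbdW (Hbd_ext _ (Hbd0 muT0 muT mball)) _.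
      by apply/funext => x; rewrite subrr.
    by rewrite mulr_ge0 ?intsq_ge0// mulr_ge0 ?divr_ge0 ?(ltW lam0)// mulr_ge0 ?sqr_ge0.
have nk' : (n.+1 + k)%N = N by rewrite addSnnS.
have e0 := eps0; have lam0 : 0 < lam by apply: lt_le_trans el.
have m0 := cube_ms_gt0 EQ; have mQ := cube_measurable DC EQ; have g1 := Gam1.
have child P : P \in chl n Q -> cz P lam.
  move=> Pc; have /chlP[EP PQ] := Pc.
  have p0 := cube_ms_gt0 EP; have mP := cube_measurable DC EP.
  (* Stopping rule: a child whose quadratic mean exceeds [2 * lam] contributes its mean to the good
     part. That mean is at most [2 * Gam * lam], because the parent was not stopped and the two
     measures are comparable. *)
  have [|iP] := leP (intsq P) (4 * lam ^+ 2 * ms P); first exact: (IH _ _ nk' EP lam el).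
  have clP : cz_av P by exact: (cz_claim EP (IH _ _ nk' EP)).
  exists (fun x => av P * \1_P x); split.
  - by apply: measurable_funM => //; exact: measurable_ind.
  - by move=> x Px; rewrite indNE// mulr0.
  - move=> x; have : `|av P| <= 2 * Gam * lam.
      rewrite -(ler_pXn2r (n := 2))// ?nnegrE ?mulr_ge0 ?(ltW lam0)// real_normK ?num_real//.
      rewrite -(ler_pM2r p0); apply: le_trans (av_sqr EP) _.
      have iPQ : intsq P <= intsq Q.
        apply: le_int; [exact: itg_b2|exact: itg_b2|apply: aeW => x'].
        rewrite ler_wpM2l ?sqr_ge0//; have [Px|Px] := pselect (P x').
          by rewrite !indE//; exact: PQ.
        by rewrite [leLHS]indNE// ind_ge0.
      apply: le_trans iPQ _; apply: le_trans il _.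
      have cr := child_ratio EQ Pc.
      have l2 : 0 <= 4 * lam ^+ 2 by rewrite mulr_ge0// sqr_ge0.
      apply: le_trans (ler_wpM2l l2 cr) _.
      rewrite (_ : (2 * Gam * lam) ^+ 2 * ms P = 4 * lam ^+ 2 * (Gam * (Gam * ms P))); last by lra.
      by rewrite ler_wpM2l// ler_peMl// mulr_ge0// ms_ge0.
    move=> h; rewrite normrM (ger0_norm (ind_ge0 P x)).
    have := ler_pM (normr_ge0 _) (ind_ge0 P x) h (ind_le1 P x); rewrite mulr1.
    have : 0 <= Gam * lam by rewrite mulr_ge0// ltW.
    lra.
  - by rewrite int_indic// -/(ms P) /av divfK// gt_eqF.
  - apply: HbdW clP _.
    set r := Num.sqrt (intsq P / ms P).
    have r0 : 0 <= r by rewrite sqrtr_ge0.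
    have r2 : r ^+ 2 * ms P = intsq P.
      by rewrite /r sqr_sqrtr ?divr_ge0 ?intsq_ge0 ?ms_ge0// divfK// gt_eqF.
    (* The source of the factor [3/4]: [eps <= lam] gives [r + eps <= 3/2 * r], and
       [r <= r ^+ 2 / (2 * lam)]. *)
    have rl : 2 * lam <= r.
      rewrite -(ler_pXn2r (n := 2))// ?nnegrE ?mulr_ge0 ?(ltW lam0)//.
      by rewrite -(ler_pM2r p0) r2; apply: ltW; rewrite exprMn; lra.
    have C0 : 0 <= Cz by rewrite /Cz mulr_ge0// sqr_ge0.
    rewrite -r2 [leRHS](_ : _ = Cz * (ms P * (3 / 4 * r ^+ 2 / lam))); last by lra.
    rewrite -[leLHS]mulrA; apply: ler_wpM2l => //.
    apply: ler_wpM2l; first exact: ms_ge0.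
    rewrite ler_pdivlMr//.
    have : (r + eps) * lam <= (3 / 2 * r) * lam by rewrite ler_pM2r//; lra.
    have : r * (2 * lam) <= r * r by rewrite ler_wpM2l.
    rewrite expr2; lra.
have /choice[g hg] : forall P, exists g : X -> R, P \in chl n Q ->
  [/\ measurable_fun setT g, forall x, ~ P x -> g x = 0,
      forall x, `|g x| <= 3 * Gam * lam, \int[mu]_x g x = intb P
    & Hbd mu d (fun x => b x * \1_P x - g x) (Cz * (3 / 4 / lam) * intsq P)].
  move=> P; have [Pc|Pc] := boolP (P \in chl n Q); last by exists (fun=> 0).
  by have [g hg] := child P Pc; exists g.
have cE P : P \in chl n Q -> E n.+1 P by move=> /chlP[].
have gl : 0 <= 3 * Gam * lam by rewrite !mulr_ge0// ltW.
have Ig P : P \in chl n Q -> itg mu (g P).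
  by move=> /hg[mg _ gB _ _]; exact: itg_bounded gB.
exists (fun x => \sum_(P <- chl n Q | P \in chl n Q) g P x).
have IG : itg mu (fun x => \sum_(P <- chl n Q | P \in chl n Q) g P x) by exact: itg_sum.
split.
- exact: itg_meas IG.
- move=> x Qx; rewrite big1// => P Pc; have [_ g0 _ _ _] := hg P Pc.
  by apply: g0 => Px; apply: Qx; have /chlP[_ PQ] := Pc; exact: PQ.
- move=> x; rewrite -big_seq.
  apply: (at_most_one (n := n.+1) (F := g) (fset_uniq _)) => //.
  + by move=> P /hg[_ g0 _ _ _]; exact: g0.
  + by move=> P /hg[].
- rewrite int_sum// /intb (int_children EQ)//; last exact: itg_b1.
  by rewrite [RHS]big_seq; apply: eq_bigr => P /hg[].
- have HS : Hbd mu d (fun x => \sum_(P <- chl n Q | P \in chl n Q) (b x * \1_P x - g P x))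
     (\sum_(P <- chl n Q | P \in chl n Q) (Cz * (3 / 4 / lam) * intsq P)).
    by apply: Hbd_sum => // P /hg[].
  rewrite /intsq (int_children EQ); [|exact: measurable_funX|exact: itg_b2].
  rewrite mulr_sumr [X in Hbd _ _ _ X]big_seq.
  apply: (Hbd_ae muT0 muT mball HS).
    exact: (itg_meas (itgB (itg_b1 mQ) IG)).
  apply: filterS (chl_cover EQ) => x hx.
  by rewrite hx mulr_sumr [in RHS]big_seq -sumrB.
Qed.

Lemma CZ n Q : (n <= N)%N -> E n Q -> cz_av Q.
Proof.
move=> nN EQ; apply: (cz_claim EQ); apply: (cz_ind (k := (N - n)%N)) EQ.
by rewrite subnKC.
Qed.

End CZ.

(** The first level whose size is at most [r]; the bound [rM] on the radius handles the case where
    this is already level [0]. *)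
Lemma level_choice r rM : 0 < r -> r <= rM -> exists k,
  de ^+ k <= r /\ Num.min de rM^-1 * r <= de ^+ k.
Proof.
move=> r0 rrM; have rM0 : 0 < rM by apply: lt_le_trans rrM.
have ex : exists k, de ^+ k <= r.
  have := cvg_expr (z := de); rewrite ger0_norm ?ltW// => /(_ de1).
  move=> /cvgrPdist_le/(_ r r0)[k _ /(_ k (leqnn k))].
  by rewrite /= sub0r normrN (ger0_norm (ltW (dn0 k))) => h; exists k.
case: (ex_minnP ex) => k hk mink; exists k; split => //.
case: k hk mink => [|k] hk mink.
  rewrite expr0; apply: (@le_trans _ _ (rM^-1 * r)).
    by rewrite ler_pM2r// ge_min lexx orbT.
  by rewrite mulrC ler_pdivrMr// mul1r.
rewrite exprS; apply: (@le_trans _ _ (de * r)).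
  by rewrite ler_pM2r// ge_min lexx.
rewrite ler_pM2l// ltW// ltNge; apply/negP => /mink.
by rewrite ltnn.
Qed.

(** At the level of size about [r] boundedly many cubes meet the support, each of measure comparable
    to [r]. On each cube [CZ] bounds [b] minus its mean; the means form a function of integral zero
    on a ball, bounded by a multiple of [||b||_2 / sqrt r], hence a multiple of an atom. *)
Lemma L2_H1 (C3 rM : R) : 0 < C3 -> 0 < rM -> exists2 CL, 0 < CL &
  forall x0 r (b : X -> R), 0 < r -> r <= rM ->
  (forall rho, r <= rho -> ms (qball d x0 rho) <= A2 * rho) ->
  measurable_fun setT b -> (exists Bb, forall x, `|b x| <= Bb) ->
  (forall eps, 0 < eps -> exists N0, forall N, (N0 <= N)%N ->
     forall Q x y, E N Q -> Q x -> Q y -> `|b x - b y| <= eps) ->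
  (forall y, ~ qball d x0 (C3 * r) y -> b y = 0) -> \int[mu]_x b x = 0 ->
  forall e, 0 < e ->
  Hbd mu d b (CL * (Num.sqrt r * Num.sqrt (\int[mu]_x (b x ^+ 2))) + e).
Proof.
move=> C30 rM0.
pose c := Num.min de rM^-1.
have cp : 0 < c by rewrite lt_min de0 invr_gt0.
have Kt0 : 0 < Kt := lt_le_trans ltr01 Kt1.
pose C4 := Kt * (C3 + C1) + 1.
have C40 : 0 < C4 by rewrite /C4 ltr_wpDl// mulr_ge0 ?addr_ge0// ltW.
pose a := A2 * C4; have a0' : 0 < a by rewrite mulr_gt0.
pose g := c0 * c; have g0 : 0 < g by rewrite mulr_gt0// c00.
pose nu := a / g; have nu0 : 0 < nu by rewrite divr_gt0.
pose Cz := 16 * Gam ^+ 2.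
have Gam0 : 0 < Gam := lt_le_trans ltr01 Gam1.
have Cz0 : 0 < Cz by rewrite mulr_gt0// exprn_gt0.
exists (nu * (Cz * Num.sqrt a) + a / Num.sqrt g).
  by rewrite addr_gt0 ?mulr_gt0 ?invr_gt0 ?sqrtr_gt0.
move=> x0 r b r0 rrM good mb [Bb bB] osc bsup intb0 e e0.
have [k [dk ck]] := level_choice r0 rrM; rewrite -/c in ck.
pose B := qball d x0 (C4 * r); have mB : measurable B by exact: mball.
have msB : ms B <= a * r.
  rewrite /a -mulrA; apply: good; apply: ler_peMl; first exact: ltW.
  by rewrite /C4 lerDr mulr_ge0 ?addr_ge0// ltW.
pose meets (Q : set X) := exists2 y, Q y & qball d x0 (C3 * r) y.
pose s := [fset Q in fset_set (E k) | `[< meets Q >]]%fset.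
have sP Q : Q \in s <-> E k Q /\ meets Q.
  rewrite !inE /= in_fset_set; last exact: finite_E.
  by split => [/andP[/set_mem ? /asboolP]//|[? ?]]; apply/andP; split; [exact/mem_set|exact/asboolP].
have sE Q : Q \in s -> E k Q by move=> /sP[].
have sB Q : Q \in s -> Q `<=` B.
  move=> /sP[EQ [w Qw dw]] y Qy; rewrite /B /qball/=.
  apply: le_lt_trans (dT x0 y w) _; have dwy := cube_d EQ Qw Qy.
  have : d x0 w + d w y <= (C3 + C1) * r.
    rewrite mulrDl lerD ?(ltW dw)//; apply: le_trans dwy _; rewrite ler_wpM2l// ltW//.
  move/(ler_wpM2l (ltW Kt0)); rewrite /C4; lra.
have mQ Q : Q \in s -> measurable Q by move=> /sE /(cube_measurable DC).
have msQ Q : Q \in s -> ms Q <= a * r.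
  by move=> Qs; apply: le_trans msB; apply: le_ms (sB _ Qs); [exact: mQ|].
have gr Q : Q \in s -> g * r <= ms Q.
  move=> /sE EQ; apply: le_trans (cube_lower EQ); rewrite /g -mulrA ler_wpM2l//.
  exact/ltW/c00.
have cards : #|` s|%:R <= nu.
  have := card_cubes sE sB mB => h.
  rewrite /nu ler_pdivlMr//; rewrite -(ler_pM2r r0); apply: le_trans msB.
  apply: le_trans h; rewrite -mulrA ler_wpM2l// /g -mulrA ler_wpM2l//.
  exact/ltW/c00.
have Ib : itg mu b by exact: (itg_bounded mb bB).
have Ib2 : itg mu (fun x => b x ^+ 2).
  apply: (@itg_bounded _ (Bb ^+ 2)); first exact: measurable_funX.
  move=> x; rewrite normrX ler_pXn2r ?nnegrE//.
  exact: le_trans (bB x).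
set n2 := \int[mu]_x (b x ^+ 2).
have iQ Q : Q \in s -> intsq b Q <= n2.
  move=> Qs; apply: le_int => //; first exact: (itg_b2 mb bB (mQ _ Qs)).
  apply: aeW => x; rewrite ler_piMr ?sqr_ge0//; exact: ind_le1.
have n20 : 0 <= n2 by apply: Rintegral_ge0 => x _; exact: sqr_ge0.
(* Small enough that the [eps] terms of all the cubes together cost at most [e]. *)
pose eps := e / (nu * (Cz * (a * r)) + 1).
have den0 : 0 < nu * (Cz * (a * r)) + 1 by rewrite ltr_wpDl// ltW//; do 3 (apply: mulr_gt0 => //).
have eps0 : 0 < eps by rewrite divr_gt0.
have [N0 hN0] := osc _ eps0.
pose N := maxn N0 k.
have hz Q : Q \in s -> Hbd mu d (fun x => b x * \1_Q x - av b Q * \1_Q x)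
    (Cz * (Num.sqrt a * (Num.sqrt r * Num.sqrt n2) + eps * (a * r))).
  move=> Qs; have EQ := sE _ Qs; have m0 := cube_ms_gt0 EQ.
  have i0 := intsq_ge0 b Q.
  have := @CZ b Bb mb bB eps N eps0 (hN0 N (leq_maxl _ _)) k Q (leq_maxr _ _) EQ.
  move=> h; apply: HbdW h _; rewrite -mulrA ler_pM2l// mulrDr lerD//; last first.
    by rewrite mulrC ler_pM2l//; exact: msQ.
  have -> : ms Q * Num.sqrt (intsq b Q / ms Q) = Num.sqrt (ms Q) * Num.sqrt (intsq b Q).
    rewrite -sqrtrM ?ms_ge0// -{1}(ger0_norm (ltW m0)) -sqrtr_sqr -sqrtrM ?sqr_ge0//.
    congr Num.sqrt; rewrite expr2 -mulrA; congr (_ * _).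
    by rewrite mulrCA divff ?mulr1// gt_eqF.
  rewrite mulrA ler_pM ?sqrtr_ge0//; last by rewrite ler_wsqrtr// iQ.
  by rewrite -sqrtrM ?(ltW a0')// ler_wsqrtr// msQ.
have HS := Hbd_sum muT0 muT mball (enum_fset s) (P := fun Q => Q \in s) hz.
pose h x := \sum_(Q <- s | Q \in s) av b Q * \1_Q x.
have Iav Q : Q \in s -> itg mu (fun x => av b Q * \1_Q x).
  by move=> /mQ; exact: itg_indic.
have Ih : itg mu h by exact: itg_sum.
have bae : {ae mu, forall x, b x = \sum_(Q <- s | Q \in s) b x * \1_Q x}.
  apply: filterS (cover_level k) => x [Q EQ Qx].
  have [xB|xB] := pselect (qball d x0 (C3 * r) x); last first.
    by rewrite bsup// big1// => P _; rewrite mul0r.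
  have Qs : Q \in s by apply/sP; split => //; exists x.
  rewrite -big_seq (bigD1_seq Q Qs (fset_uniq _)) /=.
  rewrite (@indE Q)// mulr1 big1_seq ?addr0// => P /= /andP[PQ Ps].
  rewrite indNE ?mulr0// => Px; move/eqP: PQ; apply.
  by apply: (cube_eq (sE _ Ps) EQ); exists x.
have inth : \int[mu]_x h x = 0.
  rewrite -intb0 int_sum//.
  rewrite (eq_bigr (fun Q => \int[mu]_x (b x * \1_Q x))).
    rewrite -int_sum; last by move=> Q /mQ; exact: (itg_b1 mb bB).
    apply: eq_ae_int; [|exact: mb|by apply: filterS bae => x hx; exact: esym].
    by apply/itg_meas/itg_sum => Q /mQ; exact: (itg_b1 mb bB).
  move=> Q Qs; rewrite int_indic; last exact: mQ.
  by rewrite -/(ms Q) /av divfK// gt_eqF// (cube_ms_gt0 (sE _ Qs)).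
have avle Q : Q \in s -> `|av b Q| <= Num.sqrt n2 / (Num.sqrt g * Num.sqrt r).
  move=> Qs; have EQ := sE _ Qs; have m0 := cube_ms_gt0 EQ.
  have gr0 : 0 < Num.sqrt (g * r) by rewrite sqrtr_gt0 (mulr_gt0 g0 r0).
  rewrite -(sqrtrM r (ltW g0)) ler_pdivlMr//.
  rewrite -sqrtr_sqr -sqrtrM ?sqr_ge0// ler_wsqrtr//.
  apply: le_trans (iQ _ Qs); apply: le_trans (av_sqr mb bB EQ).
  by rewrite ler_wpM2l ?sqr_ge0// gr.
have cc : 0 <= Num.sqrt n2 / (Num.sqrt g * Num.sqrt r).
  by rewrite divr_ge0 ?mulr_ge0 ?sqrtr_ge0.
have HB : Hbd mu d h (Num.sqrt n2 / (Num.sqrt g * Num.sqrt r) * ms B).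
  apply: (Hbd_ball muT0 muT mball) => //.
  - by rewrite mulr_gt0.
  - exact: itg_meas Ih.
  - apply: aeW => x; rewrite /h -big_seq.
    apply: (at_most_one (n := k) (F := fun Q x => av b Q * \1_Q x) (fset_uniq _)) => //.
      by move=> P Ps Px; rewrite indNE// mulr0.
    move=> P Ps; rewrite normrM (ger0_norm (ind_ge0 P x)).
    by apply: (le_trans _ (avle _ Ps)); rewrite ler_piMr// ind_le1.
  - move=> y By; rewrite /h big1// => Q Qs; rewrite indNE ?mulr0// => Qy.
    exact: By (sB _ Qs _ Qy).
have := HbdD muT0 muT mball HS HB => H.
apply: (HbdW (f := b)).
  apply: (Hbd_ae muT0 muT mball H mb); apply: filterS bae => x hx.
  by rewrite [RHS]hx /h -big_split/=; apply: eq_bigr => Q _; rewrite subrK.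
set t := Num.sqrt r * Num.sqrt n2; have t0 : 0 <= t by rewrite mulr_ge0 ?sqrtr_ge0.
set u := Cz * _.
have u0 : 0 <= u.
  rewrite /u; apply: mulr_ge0; first exact: ltW.
  apply: addr_ge0; first by apply: mulr_ge0 => //; exact: sqrtr_ge0.
  by apply/ltW; apply: mulr_gt0 => //; exact: mulr_gt0.
have -> : \sum_(Q <- s | Q \in s) u = #|` s|%:R * u.
  by rewrite -big_seq big_const_seq count_predT iter_addr_0 mulr_natl.
have h1 : #|` s|%:R * u <= nu * u by rewrite ler_wpM2r.
have h2 : nu * (Cz * (eps * (a * r))) <= e.
  have -> : nu * (Cz * (eps * (a * r))) = eps * (nu * (Cz * (a * r))) by lra.
  rewrite /eps mulrAC ler_pdivrMr// ler_pM2l// lerDl//.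
have h3 : Num.sqrt n2 / (Num.sqrt g * Num.sqrt r) * ms B <= a / Num.sqrt g * t.
  apply: le_trans (ler_wpM2l cc msB) _.
  have sr0 : 0 < Num.sqrt r by rewrite sqrtr_gt0.
  have sr : Num.sqrt r / Num.sqrt r = 1 by rewrite divff// gt_eqF.
  rewrite -{2}[r](sqr_sqrtr (ltW r0)) invfM.
  rewrite [leLHS](_ : _ = a / Num.sqrt g * t * (Num.sqrt r / Num.sqrt r)); last by rewrite /t; lra.
  by rewrite sr mulr1.
move: h1 h2 h3; rewrite /u; lra.
Qed.

#[local] Hint Resolve c00 ms_ge0 Gam1 : core.

(** * Open sets and boundary layers are measurable *)

Variables (theta K0 : R).
Hypothesis theta0 : 0 < theta.
Hypothesis K00 : 0 < K0.
Hypothesis dHolder : forall r x y z, 0 < r -> d x z < r -> d y z < r ->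
  `|d x z - d y z| <= K0 * r `^ (1 - theta) * d x y `^ theta.

Lemma ball_pos x r : 0 < r -> 0 < ms (qball d x r).
Proof.
move=> r0; have m0 : 0 < Num.min r rmax by rewrite lt_min r0 rmax0.
apply: lt_le_trans (_ : A1 * Num.min r rmax <= _); first by rewrite mulr_gt0.
apply: le_trans (lower x m0 _) _; first by rewrite ge_min lexx orbT.
apply: le_ms => // y hy; apply: lt_le_trans hy _.
by rewrite ge_min lexx.
Qed.

(** For a mere quasi-metric balls may fail to be open; the Hoelder condition makes [z |-> d z x]
    continuous, which suffices. *)
Lemma ball_open x r y : qball d x r y -> exists2 e, 0 < e & qball d y e `<=` qball d x r.
Proof.
rewrite /qball/= => xy.
have K1 := Kt1; have K0' : 0 < Kt by lra.
have r0 : 0 < r := le_lt_trans (d0 x y) xy.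
pose r1 := Kt * (1 + r) + r.
have r10 : 0 < r1 by rewrite addr_gt0// mulr_gt0// addr_gt0.
pose A := K0 * r1 `^ (1 - theta) + 1.
have A0 : 0 < A by rewrite ltr_wpDl// mulr_ge0 ?powR_ge0// ltW.
pose q := (r - d x y) / A.
have q0 : 0 < q by rewrite divr_gt0// subr_gt0.
pose e := Num.min 1 (q `^ theta^-1).
have e0 : 0 < e by rewrite lt_min ltr01/= powR_gt0.
exists e => // z; rewrite /qball/= => yz.
have yz1 : d y z < 1 by apply: lt_le_trans yz _; rewrite ge_min lexx.
have dyr : d y x < r1.
  rewrite dC; apply: lt_le_trans xy _; rewrite lerDr mulr_ge0 ?addr_ge0// ltW//.
have dzr : d z x < r1.
  apply: le_lt_trans (dT z x y) _.
  have : d z y + d y x < 1 + r by rewrite dC [d y x]dC; lra.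
  by rewrite -(ltr_pM2l K0') => h; apply: lt_le_trans h _; rewrite lerDl ltW.
have := dHolder r10 dyr dzr.
have yzt : d y z `^ theta <= q.
  apply: (@le_trans _ _ (e `^ theta)); first by rewrite ge0_ler_powR ?nnegrE ?d0 ?ltW.
  apply: (@le_trans _ _ ((q `^ theta^-1) `^ theta)).
    by rewrite ge0_ler_powR ?nnegrE ?powR_ge0 ?(ltW e0) ?(ltW theta0)// ge_min lexx orbT.
  by rewrite -powRrM mulVf ?gt_eqF// powRr1// ltW.
have KA : 0 <= K0 * r1 `^ (1 - theta) by rewrite mulr_ge0 ?powR_ge0// ltW.
move=> /le_trans/(_ (ler_wpM2l KA yzt)) h.
have h2 : K0 * r1 `^ (1 - theta) * q < r - d x y.
  have -> : r - d x y = A * q by rewrite /q mulrC divfK// gt_eqF.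
  by rewrite ltr_pM2r// /A ltrDl.
have := ler_norm (- (d y x - d z x)); rewrite normrN [d z x]dC [d y x]dC => h3.
rewrite [d z x]dC [d y x]dC in h; lra.
Qed.

(** Only balls are known to be measurable. One point from each cube gives a countable dense set, so
    an open set is a countable union of balls of radii [1 / (m + 1)] around these points. *)
Lemma open_measurable (U : set X) :
  (forall x, U x -> exists2 e, 0 < e & qball d x e `<=` U) -> measurable U.
Proof.
move=> oU; have K1 := Kt1; have K0' : 0 < Kt by lra.
have /choice[zc hzc] : forall nQ : nat * set X, exists z, E nQ.1 nQ.2 -> nQ.2 z.
  move=> [n Q]; have [EQ|nE] := pselect (E n Q); last by exists point.
  by have [z [Qz _]] := cube_center EQ; exists z.
pose B n Q m := if `[< qball d (zc (n, Q)) m.+1%:R^-1 `<=` U >]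
  then qball d (zc (n, Q)) m.+1%:R^-1 else set0.
have -> : U = \bigcup_n \bigcup_(Q in E n) \bigcup_m B n Q m.
  apply/seteqP; split => [x Ux|x [n _ [Q _ [m _]]]]; last first.
    by rewrite /B; case: ifP => // /asboolP h; exact: h.
  have [e e0 eU] := oU x Ux.
  have [m hm] : exists m : nat, m.+1%:R^-1 <= e / (2 * Kt).
    have ek : 0 < e / (2 * Kt) by rewrite divr_gt0// mulr_gt0.
    by have [m _ hm] := near_infty_natSinv_lt (PosNum ek); exists m; exact/ltW/hm/leqnn.
  set k := m.+1%:R^-1 in hm.
  have k0 : 0 < k by rewrite invr_gt0.
  pose rho := k / (4 * Kt).
  have rho0 : 0 < rho by rewrite divr_gt0// mulr_gt0.
  have [n hn] : exists n, C1 * de ^+ n <= rho.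
    have rc : 0 < rho / C1 by rewrite divr_gt0.
    have := cvg_expr (z := de); rewrite ger0_norm ?(ltW de0)// => /(_ de1).
    move=> /cvgrPdist_le/(_ _ rc)[n _ /(_ n (leqnn n))].
    by rewrite /= sub0r normrN (ger0_norm (ltW (dn0 n))) ler_pdivlMr// mulrC; exists n.
  (* The cubes of a level miss only a null set, while every ball has positive measure. *)
  have [y [xy [Q EQ Qy]]] : exists y, qball d x rho y /\ exists2 Q, E n Q & Q y.
    apply: contrapT => nex.
    have [N [mN N0 hN]] := cover_level n.
    have : ms (qball d x rho) <= ms N.
      apply: le_ms => // y hy; apply: hN => hQ; apply: nex.
      by exists y; split.
    by rewrite {2}/ms N0 /= leNgt ball_pos.
  have Qz : Q (zc (n, Q)) by apply: (hzc (n, Q)).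
  have xz : d x (zc (n, Q)) < k.
    apply: le_lt_trans (dT _ _ y) _.
    have : d x y + d y (zc (n, Q)) < 2 * rho + rho.
      have := cube_d EQ Qy Qz; move: xy; rewrite /qball/=; lra.
    rewrite -(ltr_pM2l K0') => h; apply: lt_le_trans h _.
    rewrite /rho (_ : Kt * _ = 3 / 4 * k * (Kt / Kt)); last by lra.
    by rewrite divff ?gt_eqF// mulr1; lra.
  exists n => //; exists Q => //; exists m => //.
  rewrite /B ifT; first by rewrite /qball/= dC.
  apply/asboolP => w; rewrite /qball/= => zw; apply: eU; rewrite /qball/=.
  apply: le_lt_trans (dT _ _ (zc (n, Q))) _.
  have : d x (zc (n, Q)) + d (zc (n, Q)) w < 2 * k by move: zw; rewrite -/k; lra.
  rewrite -(ltr_pM2l K0') => h; apply: lt_le_trans h _.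
  move: hm; rewrite ler_pdivlMr ?mulr_gt0//; lra.
apply: bigcup_measurable => n _; apply: fin_bigcup_measurable; first exact: finite_E.
move=> Q _; apply: bigcup_measurable => m _; rewrite /B.
by case: ifP.
Qed.

(** Inside [P], the layer is the intersection over [m] of unions of balls of radius
    [t + 1 / (m + 1)] with centres outside [P], which are open. *)
Lemma bdry_measurable (P : set X) t : measurable P ->
  measurable [set x | P x /\ (qdist d [set x] (~` P) <= t%:E)%E].
Proof.
move=> mP; pose V (m : nat) := [set x | exists2 y, ~ P y & d y x < t + m.+1%:R^-1].
have -> : [set x | P x /\ (qdist d [set x] (~` P) <= t%:E)%E] = P `&` \bigcap_m V m.
  apply/seteqP; split => [x [Px /= hx]|x [Px hx]]; split => //.
    move=> m _; have : (qdist d [set x] (~` P) < (t + m.+1%:R^-1)%:E)%E.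
      by apply: le_lt_trans hx _; rewrite lte_fin ltrDl invr_gt0.
    move=> /ereal_inf_lt[_ [_ ->] [y Py <-]]; rewrite lte_fin dC => h.
    by exists y.
  apply/lee_addgt0Pr => e e0.
  have [m _ hm] := near_infty_natSinv_lt (PosNum e0).
  have [y Py hy] := hx m Logic.I.
  apply: (@le_trans _ _ (d x y)%:E); first by apply: ereal_inf_lbound; exists x => //; exists y.
  by rewrite -EFinD lee_fin dC ltW// (lt_le_trans hy)// lerD2l ltW//; apply: (hm m); exact: leqnn.
apply: measurableI => //; apply: bigcap_measurable => // m _.
apply: open_measurable => x [y Py hy].
have [e e0 he] := @ball_open y (t + m.+1%:R^-1) x hy.
by exists e => // w /he hw; exists y.
Qed.

(** * Size, regularity and support of the smoothed functions *)

Hypothesis d_eq0 : forall x y, d x y = 0 -> x = y.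
Variables (tau beta Ch : R) (M : nat).
Variables (h : nat -> set X -> nat -> X -> R) (psi : nat -> nat -> X -> R).
Hypothesis tau0 : 0 < tau.
Hypothesis beta0 : 0 < beta.
Hypothesis Ch0 : 0 < Ch.
Hypothesis C2tau : C2 * tau `^ eta <= 2^-1.
Hypothesis PU : partitions_of_unity d beta tau de M psi.
Hypothesis TV : three_valued_system mu E Ch h.

Lemma psi_dist n k x y : psi n k x != 0 -> psi n k y != 0 -> d x y <= tau * de ^+ n.
Proof.
move=> px py; have [_ /(_ n k)[_ _ hd _]] := PU.
rewrite -lee_fin; apply: le_trans hd; apply: ereal_sup_ubound.
by exists x => //; exists y.
Qed.

Lemma psi_lip n k x y :
  `|psi n k x - psi n k y| <= (tau * de ^+ n) `^ (- beta) * d x y `^ beta.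
Proof.
have [_ /(_ n k)[_ _ _ hL]] := PU.
have [->|/eqP xy] := eqVneq x y; first by rewrite subrr normr0 mulr_ge0 ?powR_ge0.
have dxy : 0 < d x y by rewrite lt_def d0 andbT; apply/eqP => /d_eq0.
rewrite -ler_pdivrMr ?powR_gt0// -lee_fin; apply: le_trans hL.
by apply: ereal_sup_ubound; exists x, y.
Qed.

(** The two-sided norm inequality of the system, tested on the [i]-th coordinate vector. *)
Lemma h_norm n Q i : E n Q -> (1 <= i <= nchild E n Q)%N ->
  itg mu (fun x => h n Q i x ^+ 2) ->
  Ch^-1 ^+ 2 <= \int[mu]_x (h n Q i x ^+ 2) <= Ch ^+ 2.
Proof.
move=> EQ hi Ih; have [_ /(_ (fun k => (k == i)%:R))/=] := TV EQ.
have iN : i \in index_iota 1 (nchild E n Q).+1 by rewrite mem_index_iota ltnS.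
have e1 : \sum_(1 <= k < (nchild E n Q).+1) ((k == i)%:R : R) ^+ 2 = 1.
  rewrite (bigD1_seq i)//= ?iota_uniq// eqxx expr1n big1 ?addr0// => k /negPf ->.
  by rewrite expr0n.
have e2 : (fun x => \sum_(1 <= k < (nchild E n Q).+1) (k == i)%:R * h n Q k x) = h n Q i.
  apply/funext => x; rewrite (bigD1_seq i)//= ?iota_uniq// eqxx mul1r big1 ?addr0//.
  by move=> k /negPf ->; rewrite mul0r.
rewrite e1 e2 sqrtr1 !mulr1 LnormE2// !lee_fin => /andP[h1 h2].
have I0 : 0 <= \int[mu]_x (h n Q i x ^+ 2).
  by apply: Rintegral_ge0 => // x _; rewrite sqr_ge0.
have Ci : 0 <= Ch^-1 by rewrite invr_ge0 ltW.
rewrite -(sqr_sqrtr I0); apply/andP; split; rewrite ler_pXn2r// nnegrE ?sqrtr_ge0//.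
exact: ltW.
Qed.

Section OneCube.
Variables (n : nat) (Q : set X) (i : nat).
Hypothesis EQ : E n Q.
Hypothesis hi : (1 <= i <= nchild E n Q)%N.
Let hh := h n Q i.

Lemma h_basic : [/\ measurable_fun setT hh, forall x, ~ Q x -> hh x = 0,
  forall P, P \in chl n Q -> exists v, forall x, P x -> hh x = v,
  exists B, forall x, `|hh x| <= B & \int[mu]_x hh x = 0].
Proof.
have [/(_ i hi)[mh hQ hP [u [v huv]] h0] _] := TV EQ; split => //.
- move=> P /chlP PQ; have [[z Pz]|Pe] := pselect (P !=set0).
    by exists (hh z) => x Px; apply: (hP P).
  by exists 0 => x Px; case: Pe; exists x.
- exists (`|u| + `|v|) => x; rewrite /hh; case: (huv x) => ->.
  + by rewrite normr0 addr_ge0.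
  + by rewrite lerDl.
  + by rewrite lerDr.
- by rewrite /Rintegral h0.
Qed.

Lemma itg_hh2 : itg mu (fun x => hh x ^+ 2).
Proof.
have [mh _ _ [B hB] _] := h_basic.
apply: (itg_bounded (c := B ^+ 2)); first by apply: measurable_funX.
move=> x; rewrite normrX ler_pXn2r ?nnegrE//; exact: le_trans (hB x).
Qed.

Lemma h_child : {ae mu, forall x, Q x -> exists2 P, P \in chl n Q & P x}.
Proof.
apply: filterS (chl_cover EQ) => x hx Qx; apply: contrapT => hn.
move: hx; rewrite indE// big_seq big1 => [/eqP|P PQ]; first by rewrite oner_eq0.
by rewrite indNE// => Px; apply: hn; exists P.
Qed.

Definition Hn : R := Ch / Num.sqrt (c0 * de ^+ n.+1).

Lemma Hn_ge0 : 0 <= Hn.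
Proof. by rewrite divr_ge0 ?sqrtr_ge0// ltW. Qed.

Lemma cube_meas m P : E m P -> measurable P.
Proof. by move=> EP; exact: (cube_measurable DC EP). Qed.

Lemma int_on (P : set X) v : measurable P ->
  (forall x, P x -> hh x = v) -> v ^+ 2 * ms P <= \int[mu]_x (hh x ^+ 2).
Proof.
move=> mP hv; rewrite -int_ind// -RintegralZl//; last exact: itg_ind.
apply: le_int; first exact/itgZ/itg_ind.
  exact: itg_hh2.
apply: aeW => x; have [Px|Px] := pselect (P x); first by rewrite indE// mulr1 hv.
by rewrite indNE// mulr0 sqr_ge0.
Qed.

(** On a child the function is constant and its square integral is at most [Ch ^+ 2]; the child has
    measure at least [c0 * de ^+ n.+1]. *)
Lemma h_le : {ae mu, forall x, `|hh x| <= Hn}.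
Proof.
have [mh hQ hP _ _] := h_basic.
apply: filterS h_child => x hx; have [Qx|/hQ ->] := pselect (Q x); last first.
  by rewrite normr0 Hn_ge0.
have [P PQ Px] := hx Qx; have [v hv] := hP P PQ; rewrite hv//.
have /chlP[EP _] := PQ.
have /andP[_ h2] := h_norm EQ hi itg_hh2.
have h3 := int_on (cube_meas EP) hv.
have cd : 0 < c0 * de ^+ n.+1 by rewrite mulr_gt0.
rewrite /Hn ler_pdivlMr ?sqrtr_gt0// -(ler_pXn2r (n := 2))// ?nnegrE ?mulr_ge0 ?sqrtr_ge0 ?(ltW Ch0)//.
rewrite exprMn real_normK ?num_real// sqr_sqrtr ?(ltW cd)//.
apply: le_trans (ler_wpM2l (sqr_ge0 v) (cube_lower EP)) _.
exact: le_trans h3 h2.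
Qed.

(** If the square were below this value on every child, its integral would be at most half of its
    lower bound. *)
Lemma h_big : exists P v, [/\ P \in chl n Q, forall x, P x -> hh x = v &
  Ch^-1 ^+ 2 / (2 * ms Q) <= v ^+ 2].
Proof.
have [mh hQ hP _ _] := h_basic.
have mQ0 := cube_ms_gt0 EQ.
set c := _ / (2 * _); apply: contrapT => hn.
have /andP[h1 _] := h_norm EQ hi itg_hh2.
have : \int[mu]_x (hh x ^+ 2) <= c * ms Q.
  have <- : \int[mu]_x (c * \1_Q x) = c * ms Q by rewrite int_indic//; exact: cube_meas EQ.
  apply: le_int; [exact: itg_hh2|exact: (itg_indic muT c (cube_meas EQ))|].
  apply: filterS h_child => x hx; have [Qx|nQ] := pselect (Q x); last first.
    by rewrite hQ// indNE// mulr0 expr0n.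
  rewrite indE// mulr1; have [P PQ Px] := hx Qx; have [v hv] := hP P PQ.
  rewrite hv// leNgt; apply/negP => hc; apply: hn; exists P, v; split => //.
  exact: ltW.
have -> : c * ms Q = Ch^-1 ^+ 2 / 2.
  by rewrite /c invfM mulrA divfK// gt_eqF.
have : 0 < Ch^-1 ^+ 2 by rewrite exprn_gt0// invr_gt0.
by move: h1; rewrite -/hh; lra.
Qed.

Let sm := smo mu (psi n.+1) hh.
Let ep := tau * de ^+ n.+1.
Let Lp := ep `^ (- beta).

Lemma sm_facts : [/\ measurable_fun setT sm, forall x, `|sm x| <= Hn,
  forall x y, `|sm x - sm y| <= 2 * M%:R * Lp * Hn * d x y `^ beta,
  forall x, sm x != 0 -> exists2 y, Q y & d x y <= ep &
  \int[mu]_x sm x = 0].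
Proof.
have [mh hQ hP [B hB] h0] := h_basic.
have [pu1 pu2] := PU.
have pM x : ([set k | psi n.+1 k x != 0%R] #<= `I_M)%card by case: (pu1 n.+1 x).
have p1 x : \sum_(k \in [set: nat]) psi n.+1 k x = 1 by case: (pu1 n.+1 x).
have mp k : measurable_fun setT (psi n.+1 k) by case: (pu2 n.+1 k).
have p0 k x : 0 <= psi n.+1 k x by case: (pu2 n.+1 k).
have pd k x y := @psi_dist n.+1 k x y.
have pL k x y := @psi_lip n.+1 k x y.
have L0 : 0 <= Lp by exact: powR_ge0.
split.
- exact: (smo_meas muT pM p1 mp p0 mh h_le).
- by move=> x; exact: (smo_le muT pM p1 mp p0 mh h_le Hn_ge0).
- by move=> x y; exact: (smo_holder muT pM p1 mp p0 L0 pL mh h_le Hn_ge0).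
- by move=> x; exact: (smo_supp muT pM p1 mp p0 pd mh h_le hQ).
- exact: (smo_int0 muT pM p1 mp p0 mh hB h_le Hn_ge0 h0).
Qed.

Definition nlow : R := Num.sqrt (Ch^-1 ^+ 2 / (4 * Gam)).

(** Smoothing leaves [h] unchanged, almost everywhere, at points of a child farther than [ep] from
    its complement. By [C2tau] the boundary layer takes at most half of the child; the child of
    [h_big] therefore keeps enough mass. *)
Lemma sm_low : nlow <= Num.sqrt (\int[mu]_x (sm x ^+ 2)).
Proof.
rewrite ler_wsqrtr//.
have [mh hQ _ [B hB] h0] := h_basic.
have [pu1 pu2] := PU.
have pM x : ([set k | psi n.+1 k x != 0%R] #<= `I_M)%card by case: (pu1 n.+1 x).
have p1 x : \sum_(k \in [set: nat]) psi n.+1 k x = 1 by case: (pu1 n.+1 x).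
have mp k : measurable_fun setT (psi n.+1 k) by case: (pu2 n.+1 k).
have p0 k x : 0 <= psi n.+1 k x by case: (pu2 n.+1 k).
have pd k x y := @psi_dist n.+1 k x y.
have [P [v [PQ hv vb]]] := h_big.
have /chlP[EP _] := PQ; have mP := cube_meas EP.
pose Z := [set x | P x /\ (qdist d [set x] (~` P) <= (tau * de ^+ n.+1)%:E)%E].
have mZ : measurable Z by exact: bdry_measurable.
have ZP : Z `<=` P by move=> x [].
have msZ : ms Z <= ms P / 2.
  have := cube_boundary DC EP (ltW tau0); rewrite -/Z.
  rewrite -[mu Z]fineK ?(mu_fin muT)// -[mu P]fineK ?(mu_fin muT)// -EFinM lee_fin => hz.
  apply: le_trans hz _; rewrite -/(ms P) mulrC ler_wpM2l//.
have mD : measurable (P `\` Z) by exact: measurableD.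
have msD : ms P / 2 <= ms (P `\` Z).
  have : ms P = ms (P `\` Z) + ms Z.
    rewrite /ms -fineD ?(mu_fin muT)// -measureU//; last by rewrite setDKI.
    by rewrite setUC setDUK.
  by lra.
have vP : v ^+ 2 * ms (P `\` Z) <= \int[mu]_x (sm x ^+ 2).
  rewrite -int_ind// -RintegralZl//; last exact: itg_ind.
  have [msm smle _ _ _] := sm_facts.
  apply: le_int; first exact/itgZ/itg_ind.
    apply: (itg_bounded (c := Hn ^+ 2)); first by apply: measurable_funX.
    by move=> x; rewrite normrX ler_pXn2r ?nnegrE// Hn_ge0.
  have := smo_eq muT pM p1 mp p0 pd mh h_le hv.
  apply: filterS => x hx; have [[Px Zx]|nx] := pselect ((P `\` Z) x); last first.
    by rewrite indNE// mulr0 sqr_ge0.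
  rewrite indE// mulr1 /sm hx// => y xy; apply: contrapT => Py; apply: Zx; split => //.
  apply: le_trans (_ : (d x y)%:E <= _)%E; last by rewrite lee_fin.
  by apply: ereal_inf_lbound; exists x => //; exists y.
apply: le_trans vP.
have mP0 := cube_ms_gt0 EP; have mQ0 := cube_ms_gt0 EQ.
have G1 := Gam1; have G0 : 0 < Gam by lra.
apply: le_trans (ler_pM _ _ vb msD); last by rewrite divr_ge0.
  have cr := child_ratio EQ PQ.
  have Chi : 0 <= Ch^-1 ^+ 2 by rewrite sqr_ge0.
  rewrite (_ : _ / (2 * ms Q) * _ = Ch^-1 ^+ 2 / 4 * (ms P / ms Q)); last by rewrite invfM; lra.
  have hG : Gam^-1 <= ms P / ms Q.
    by rewrite ler_pdivlMr// mulrC ler_pdivrMr// mulrC.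
  have -> : Ch^-1 ^+ 2 / (4 * Gam) = Ch^-1 ^+ 2 / 4 * Gam^-1 by rewrite invfM mulrA.
  by apply: ler_wpM2l hG; rewrite divr_ge0.
by rewrite divr_ge0 ?sqr_ge0 ?mulr_ge0 ?(ltW mQ0).
Qed.

Definition Cphi : R := Ch / Num.sqrt (c0 * de) / nlow.
Definition Cphi' : R := 2 * M%:R * (tau * de) `^ (- beta) * Cphi.

Lemma nlow_gt0 : 0 < nlow.
Proof.
have G1 := Gam1; have G0 : 0 < Gam by lra.
by rewrite sqrtr_gt0 divr_gt0 ?mulr_gt0 ?exprn_gt0 ?invr_gt0.
Qed.

Lemma Cphi_ge0 : 0 <= Cphi.
Proof. by rewrite divr_ge0 ?(ltW nlow_gt0)// divr_ge0 ?sqrtr_ge0 ?(ltW Ch0). Qed.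

Lemma Cphi'_ge0 : 0 <= Cphi'.
Proof. by rewrite mulr_ge0 ?Cphi_ge0// mulr_ge0 ?powR_ge0// mulr_ge0. Qed.

Local Notation phi := (phi_cube mu psi h n Q i).

Lemma phi_facts : [/\ measurable_fun setT phi,
  forall x, `|phi x| <= Cphi / Num.sqrt (de ^+ n),
  forall x y, `|phi x - phi y| <=
    Cphi' / Num.sqrt (de ^+ n) * (d x y / de ^+ n) `^ beta,
  forall x, phi x != 0 -> exists2 y, Q y & d x y <= tau * de ^+ n.+1 &
  \int[mu]_x phi x = 0 /\ \int[mu]_x (phi x ^+ 2) = 1].
Proof.
have [msm sle slip ssupp s0] := sm_facts.
have Is2 : itg mu (fun x => sm x ^+ 2).
  apply: (itg_bounded (c := Hn ^+ 2)); first by apply: measurable_funX.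
  by move=> x; rewrite normrX ler_pXn2r ?nnegrE// Hn_ge0.
have low := sm_low; have n0 := nlow_gt0.
set N2 := Num.sqrt _ in low.
have N20 : 0 < N2 by exact: lt_le_trans n0 low.
have e x : phi x = N2^-1 * sm x.
  rewrite /phi_cube (_ : phi_tilde _ _ _ _ _ _ = sm)//.
  by rewrite (LnormE2 Is2) mulrC.
have dn := dn0 n.
have HN : N2^-1 * Hn <= Cphi / Num.sqrt (de ^+ n).
  have cd : 0 <= c0 * de by apply: mulr_ge0; apply: ltW.
  have -> : Cphi / Num.sqrt (de ^+ n) = nlow^-1 * Hn.
    rewrite /Cphi /Hn exprS mulrA [Num.sqrt (_ * de * _)]sqrtrM//.
    by rewrite [(Num.sqrt _ * _)^-1]invfM; lra.
  by apply: ler_wpM2r Hn_ge0 _ _ _; rewrite lef_pV2.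
have Ni : 0 <= N2^-1 by rewrite invr_ge0 ltW.
have -> : phi = (fun x => N2^-1 * sm x) by apply/funext.
split.
- exact: measurable_funM.
- move=> x; rewrite normrM (ger0_norm Ni); apply: le_trans HN.
  by rewrite ler_wpM2l.
- move=> x y; rewrite -mulrBr normrM (ger0_norm Ni).
  apply: le_trans (ler_wpM2l Ni (slip x y)) _.
  have eL : Lp * d x y `^ beta = (tau * de) `^ (- beta) * (d x y / de ^+ n) `^ beta.
    have e1 : (de ^+ n)^-1 `^ beta = (de ^+ n) `^ (- beta).
      by rewrite -powR_inv1 ?(ltW dn)// -powRrM mulN1r.
    have td : 0 <= tau * de by apply: mulr_ge0; exact: ltW.
    rewrite /Lp /ep exprS mulrA (powRM _ td (ltW dn)).
    have di : 0 <= (de ^+ n)^-1 by rewrite invr_ge0 ltW.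
    rewrite (powRM _ (d0 x y) di) e1; lra.
  rewrite (_ : N2^-1 * _ = 2 * M%:R * (Lp * d x y `^ beta) * (N2^-1 * Hn)); last by lra.
  rewrite eL (_ : _ / _ * _ = 2 * M%:R * ((tau * de) `^ (- beta) * (d x y / de ^+ n) `^ beta)
    * (Cphi / Num.sqrt (de ^+ n))); last by rewrite /Cphi'; lra.
  by apply: ler_wpM2l HN; rewrite !mulr_ge0 ?powR_ge0.
- move=> x hx; apply: ssupp; by apply: contraNneq hx => ->; rewrite mulr0.
- have Is : itg mu sm by apply: itg_bounded msm sle.
  split; first by rewrite (RintegralZl _ measurableT Is) s0 mulr0.
  under eq_Rintegral do rewrite exprMn.
  rewrite (RintegralZl _ measurableT Is2) -(sqr_sqrtr (a := \int[mu]_x (sm x ^+ 2))).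
    by rewrite -/N2 exprVn mulVf// gt_eqF// exprn_gt0.
  by apply: Rintegral_ge0 => // x _; exact: sqr_ge0.
Qed.

End OneCube.

(** * The Gram matrix of the separated family *)

Section Family.
Context {J : choiceType}.
Variables (lev : J -> nat) (pos : J -> X) (cu : J -> set X) (i0 m : nat) (r0 : J).
Variable ph : J -> X -> R.
Implicit Types A : {fset J}.
Hypothesis cuE : forall p, p != r0 ->
  [/\ E (lev p) (cu p), (1 <= i0 <= nchild E (lev p) (cu p))%N & cu p (pos p)].
Hypothesis sep : forall p r x y, p != r0 -> r != r0 -> p != r -> lev p = lev r ->
  cu p x -> cu r y -> 2 * Kt * tau * de ^+ lev p <= d x y.
Hypothesis levm : forall p r, p != r0 -> r != r0 -> lev p != lev r ->
  (m <= ldist lev p r)%N.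
Hypothesis lev0 : lev r0 = 0%N.
Hypothesis ph_r0 : ph r0 = cst 1.
Hypothesis ph_cube : forall p, p != r0 -> ph p = phi_cube mu psi h (lev p) (cu p) i0.

Definition Gb (x : R) : R := x `^ (beta / 2).
Definition om : R := Gb de.
Definition sg : R := Num.sqrt de.

Lemma sg0 : 0 < sg. Proof. by rewrite sqrtr_gt0. Qed.

Lemma sg2 : sg ^+ 2 = de. Proof. by rewrite sqr_sqrtr// ltW. Qed.

Lemma sgn n : Num.sqrt (de ^+ n) = sg ^+ n.
Proof.
by rewrite -sg2 exprAC sqrtr_sqr ger0_norm// exprn_ge0// ltW// sg0.
Qed.

Lemma Gb0 x : 0 < x -> 0 < Gb x. Proof. exact: powR_gt0. Qed.

Lemma GbM x y : 0 < x -> 0 < y -> Gb (x * y) = Gb x * Gb y.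
Proof. by move=> hx hy; rewrite /Gb powRM// ltW. Qed.

Lemma Gbmono x y : 0 < x -> x <= y -> Gb x <= Gb y.
Proof.
move=> hx xy; rewrite /Gb ge0_ler_powR ?nnegrE//.
- by rewrite divr_ge0// ltW.
- exact: ltW.
- exact: le_trans (ltW hx) xy.
Qed.

Lemma Gb2 : 1 < Gb 2.
Proof.
have b0 : 0 < beta / 2 by rewrite divr_gt0.
have := gt0_ltr_powR b0; rewrite /Gb => h1.
by have := h1 1 2; rewrite !nnegrE powR1 => /(_ ler01 (ler0n _ _)); apply; rewrite ltr1n.
Qed.

Lemma om0 : 0 < om. Proof. exact: Gb0. Qed.

Lemma om1 : om < 1.
Proof.
have b0 : 0 < beta / 2 by rewrite divr_gt0.
have := gt0_ltr_powR b0; rewrite /om /Gb => h1.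
by have := h1 de 1; rewrite !nnegrE powR1 ltW//= => /(_ erefl ler01 de1).
Qed.

Lemma Gb_sqr x : Gb x ^+ 2 = x `^ beta.
Proof. by rewrite /Gb -powR_mulrn ?powR_ge0// -powRrM divfK. Qed.

Definition Cs : R := Kt * (C1 + tau).
Definition Cl : R := Cphi * (A2 * (2 * Cs)).
Definition Ct : R := Cl * Cphi' * Gb Cs ^+ 2.
Definition Cn : R := 2 * Kt * Cs.
Definition Cc : R := A2 * (Kt * (1 + C1)) / c0 + 1.

Lemma Cs_ge : C1 < Cs.
Proof.
have K1 := Kt1; have c1 := C10; have t1 := tau0; rewrite /Cs.
have : 1 * (C1 + tau) <= Kt * (C1 + tau) by rewrite ler_wpM2r// addr_ge0// ltW.
lra.
Qed.

Lemma Cs_gt0 : 0 < Cs. Proof. exact: lt_trans Cs_ge. Qed.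

Lemma Cl_ge0 : 0 <= Cl.
Proof. by rewrite mulr_ge0 ?Cphi_ge0// mulr_ge0 ?(ltW A20)// mulr_ge0// ltW// Cs_gt0. Qed.

(** At least one function means at least two children, which are disjoint and nonempty. This
    excludes the point-like balls of a normal space. *)
Lemma two_points p : p != r0 -> exists y z, [/\ cu p y, cu p z & y <> z].
Proof.
move=> pr; have [EP hi zP] := cuE pr.
have : (1 < #|` chl (lev p) (cu p)|)%N.
  by move: hi; rewrite /nchild /chl; case: (X in X.-1) => [|[|k]]//; rewrite andbC; case: i0.
have := fset_uniq (chl (lev p) (cu p)).
case e : (enum_fset (chl (lev p) (cu p))) => [|P1 [|P2 l]] //.
rewrite /= inE negb_or => /andP[/andP[/eqP n12 _] _] _.
have h1 : P1 \in chl (lev p) (cu p) by rewrite -[_ \in _]/(_ \in enum_fset _) e inE eqxx.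
have h2 : P2 \in chl (lev p) (cu p) by rewrite -[_ \in _]/(_ \in enum_fset _) e !inE eqxx orbT.
have [E1 s1] := (chlP (lev p) (cu p) P1).1 h1.
have [E2 s2] := (chlP (lev p) (cu p) P2).1 h2.
have [z1 [Pz1 _]] := cube_center E1; have [z2 [Pz2 _]] := cube_center E2.
exists z1, z2; split; [exact: s1|exact: s2|] => z12; apply: n12.
by apply: (cube_eq E1 E2); exists z1; split => //; rewrite z12.
Qed.

Lemma not_singleton p rho : p != r0 -> 2 * C1 * de ^+ lev p <= rho ->
  ms (qball d (pos p) rho) <= A2 * rho.
Proof.
move=> pr; have [EP hi zP] := cuE pr; move: rho.
have dn := dn0 (lev p).
have r0' : 0 < 2 * C1 * de ^+ lev p by rewrite !mulr_gt0.
have [b1|//] := upper (pos p) r0'.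
exfalso; have PB := cube_in_ball2 EP zP; rewrite b1 in PB.
by have [y [z [/PB -> /PB ->]]] := two_points pr.
Qed.

Lemma ph_facts p : p != r0 -> [/\ measurable_fun setT (ph p),
  forall x, `|ph p x| <= Cphi / sg ^+ lev p,
  forall x y, `|ph p x - ph p y| <=
    Cphi' / sg ^+ lev p * Gb (d x y / de ^+ lev p) ^+ 2,
  forall x, ph p x != 0 -> d (pos p) x <= Cs * de ^+ lev p &
  \int[mu]_x ph p x = 0 /\ \int[mu]_x (ph p x ^+ 2) = 1].
Proof.
move=> pr; have [EP hi zP] := cuE pr; rewrite ph_cube//.
have [h1 h2 h3 h4 h5] := phi_facts EP hi; rewrite !sgn in h2 h3; split => //.
- by move=> x y; rewrite Gb_sqr.
- move=> x /h4[y Py xy]; apply: le_trans (dT _ _ y) _.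
  rewrite /Cs -mulrA ler_wpM2l ?(le_trans ler01)// mulrDl lerD ?(cube_d EP)//.
  rewrite dC; apply: le_trans xy _; rewrite exprS mulrA ler_wpM2r ?(ltW (dn0 _))//.
  by rewrite ler_piMr// ltW.
Qed.

Lemma ph_ball p x : p != r0 -> ~ qball d (pos p) (2 * Cs * de ^+ lev p) x -> ph p x = 0.
Proof.
move=> pr hx; have [_ _ _ hs _] := ph_facts pr; apply/eqP; apply: contra_notT hx => /hs h1.
apply: le_lt_trans h1 _; rewrite ltr_pM2r//; have := Cs_gt0; lra.
Qed.

Lemma sg_ge0 n : 0 < sg ^+ n. Proof. by rewrite exprn_gt0// sg0. Qed.

Lemma sgdiv n : de ^+ n / sg ^+ n = sg ^+ n.
Proof. by rewrite -sg2 exprAC expr2 mulfK// gt_eqF// sg_ge0. Qed.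

Lemma ms_ph p : p != r0 ->
  Cphi / sg ^+ lev p * ms (qball d (pos p) (2 * Cs * de ^+ lev p)) <= Cl * sg ^+ lev p.
Proof.
move=> pr; have := not_singleton pr (rho := 2 * Cs * de ^+ lev p).
have le1 : 2 * C1 * de ^+ lev p <= 2 * Cs * de ^+ lev p.
  by rewrite ler_wpM2r ?(ltW (dn0 _))//; have := Cs_ge; lra.
move=> /(_ le1) h1.
have c0' : 0 <= Cphi / sg ^+ lev p by rewrite divr_ge0 ?Cphi_ge0// ltW// sg_ge0.
apply: le_trans (ler_wpM2l c0' h1) _.
rewrite (_ : _ / _ * _ = Cl * (de ^+ lev p / sg ^+ lev p)); first by rewrite sgdiv.
rewrite /Cl; lra.
Qed.

Lemma ph_itg p : itg mu (ph p).
Proof.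
have [->|pr] := eqVneq p r0; first by rewrite ph_r0; exact: itg_cst.
by have [h1 h2 _ _ _] := ph_facts pr; exact: itg_bounded h1 h2.
Qed.

Lemma ph_l1 p : p != r0 -> l1norm mu (ph p) <= Cl * sg ^+ lev p.
Proof.
move=> pr; have [h1 h2 _ _ _] := ph_facts pr.
apply: le_trans (ms_ph pr); apply: l1norm_bdd => //; apply: aeW => x.
have [hx|hx] := pselect (qball d (pos p) (2 * Cs * de ^+ lev p) x); first by rewrite indE// mulr1.
by rewrite ph_ball// normr0 indNE// mulr0.
Qed.

Lemma ph_Hbd p : p != r0 -> Hbd mu d (ph p) (Cl * sg ^+ lev p).
Proof.
move=> pr; have [h1 h2 _ _ [h5 _]] := ph_facts pr.
apply: HbdW (ms_ph pr); apply: Hbd_ball => //.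
- by apply: mulr_gt0 => //; apply: mulr_gt0 => //; exact: Cs_gt0.
- exact: aeW.
- by move=> y; exact: ph_ball.
- by rewrite divr_ge0 ?Cphi_ge0// ltW// sg_ge0.
Qed.

Definition gm p r : R := \int[mu]_x (ph p x * ph r x).
Definition tt p r : R := if (p == r0) || (r == r0) then 0 else (p == r)%:R - gm p r.

Lemma gmC p r : gm p r = gm r p.
Proof. by apply: eq_Rintegral => x _; rewrite mulrC. Qed.

Lemma ldistC p r : ldist lev p r = ldist lev r p.
Proof. by rewrite /ldist addnC. Qed.

Lemma gm_near p r : p != r0 -> r != r0 -> gm p r != 0 ->
  d (pos p) (pos r) <= Cn * de ^+ minn (lev p) (lev r).
Proof.
move=> pr rr g0.
have [x [px rx]] : exists x, ph p x != 0 /\ ph r x != 0.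
  apply: contrapT => hn; move/eqP: g0; apply.
  transitivity (\int[mu]_(y in setT) (0 : R)); last by rewrite Rintegral_cst// mul0r.
  apply: eq_Rintegral => y _; apply/eqP; rewrite mulf_eq0; apply/negPn/negP.
  by rewrite negb_or => /andP[py ry]; apply: hn; exists y.
have [_ _ _ /(_ x px) h1 _] := ph_facts pr.
have [_ _ _ /(_ x rx) h2 _] := ph_facts rr.
have dm l l' : de ^+ l <= de ^+ minn l l' /\ de ^+ l' <= de ^+ minn l l'.
  by split; rewrite ler_wiXn2l ?geq_minl ?geq_minr// ltW.
have [m1 m2] := dm (lev p) (lev r); have cs := Cs_gt0.
apply: le_trans (dT _ _ x) _; rewrite /Cn -mulrA -[2 * Kt * _]mulrA mulrCA.
rewrite ler_wpM2l ?(le_trans ler01)// [d x _]dC.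
have := ler_wpM2l (ltW cs) m1; have := ler_wpM2l (ltW cs) m2; lra.
Qed.

(** The smaller function [ph r] has mean zero, so the value of [ph p] at [pos r] may be subtracted.
    Hoelder regularity then gives [om ^+ (2 * k)], and the L1 norm of [ph r] against the size of
    [ph p] gives [sg ^+ k]. *)
Lemma gm_le p r : p != r0 -> r != r0 -> (lev p <= lev r)%N ->
  `|gm p r| <= Ct * sg ^+ (lev r - lev p) * om ^+ (2 * (lev r - lev p)).
Proof.
move=> pr rr plr; set k := (lev r - lev p)%N.
have [mp bp Lp _ _] := ph_facts pr; have [mr br _ sr [ir _]] := ph_facts rr.
have Ip := ph_itg p; have Ir := ph_itg r.
have c1 : 0 <= Cphi / sg ^+ lev p by rewrite divr_ge0 ?Cphi_ge0// ltW// sg_ge0.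
have Ipr : itg mu (fun x => ph r x * ph p x) by apply: itgM (aeW _ bp).
have -> : gm p r = \int[mu]_x (ph r x * ph p x - ph p (pos r) * ph r x).
  rewrite RintegralB//; last exact: itgZ.
  rewrite (RintegralZl _ measurableT Ir) ir mulr0 subr0.
  by apply: eq_Rintegral => x _; rewrite mulrC.
have cs := Cs_gt0.
pose w := Cphi' / sg ^+ lev p * Gb (Cs * de ^+ k) ^+ 2.
have w0 : 0 <= w by rewrite mulr_ge0 ?sqr_ge0// divr_ge0 ?Cphi'_ge0// ltW// sg_ge0.
have Id : itg mu (fun x => ph r x * ph p x - ph p (pos r) * ph r x).
  by apply: itgB => //; exact: itgZ.
apply: le_trans (le_int_l1 Id) _.
apply: (@le_trans _ _ (\int[mu]_x (w * `|ph r x|))).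
  apply: le_l1norm => //; first exact/itgZ/itg_norm.
  apply: aeW => x; rewrite [_ * ph p x]mulrC -mulrBl normrM.
  have [->|/sr rx] := eqVneq (ph r x) 0; first by rewrite normr0 !mulr0.
  rewrite ler_wpM2r//; apply: le_trans (Lp _ _) _.
  rewrite ler_wpM2l ?divr_ge0 ?Cphi'_ge0 ?(ltW (sg_ge0 _))//.
  have e1 : de ^+ lev r / de ^+ lev p = de ^+ k.
    by rewrite -(subnK plr) exprD mulfK ?gt_eqF.
  have [->|dx] := eqVneq (d x (pos r)) 0.
    by rewrite mul0r /Gb powR0 ?expr0n ?sqr_ge0// gt_eqF// divr_gt0.
  have dx0 : 0 < d x (pos r) by rewrite lt_def dx d0.
  rewrite ler_pXn2r ?nnegrE ?powR_ge0//; apply: Gbmono; first by rewrite divr_gt0.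
  by rewrite -e1 mulrA ler_wpM2r ?invr_ge0 ?(ltW (dn0 _))// dC.
rewrite (RintegralZl _ measurableT (itg_norm Ir)) -/(l1norm mu (ph r)).
apply: le_trans (ler_wpM2l w0 (ph_l1 rr)) _.
have Gk : Gb (Cs * de ^+ k) = Gb Cs * om ^+ k.
  by rewrite GbM// (Gdelta Gb0 GbM (erefl om)).
have sk : sg ^+ lev r / sg ^+ lev p = sg ^+ k.
  by rewrite -(subnK plr) exprD mulfK ?gt_eqF ?sg_ge0.
rewrite /w Gk -sk mulnC exprM /Ct; lra.
Qed.

(** The diagonal vanishes by normalization. On one level the supports reach less than the separation
    of the cubes, so the functions are orthogonal; what is left are levels at least [m] apart, where
    [gm_le] applies. *)
Lemma tt_facts p r : tt p r != 0 -> [/\ (m <= ldist lev p r)%N,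
  d (pos p) (pos r) <= Cn * de ^+ minn (lev p) (lev r)
  & `|tt p r| <= Ct * sg ^+ ldist lev p r * om ^+ (2 * ldist lev p r)].
Proof.
rewrite /tt; case: ifPn => [|/norP[pr rr]]; first by rewrite eqxx.
have [<-|npr] := eqVneq p r.
  have [_ _ _ _ [_ h1]] := ph_facts pr.
  rewrite /gm; under eq_Rintegral do rewrite -expr2.
  by rewrite h1 subrr eqxx.
rewrite sub0r oppr_eq0 normrN => g0; have near := gm_near pr rr g0.
have ll : lev p != lev r.
  apply: contra g0 => /eqP ll; apply/eqP.
  transitivity (\int[mu]_(y in setT) (0 : R)); last by rewrite Rintegral_cst// mul0r.
  apply: eq_Rintegral => x _; apply/eqP; rewrite mulf_eq0; apply/negPn/negP.
  rewrite negb_or => /andP[px rx].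
  have [EP hp zP] := cuE pr; have [ER hr zR] := cuE rr.
  rewrite ph_cube// in px; rewrite ph_cube// in rx.
  have [_ _ _ /(_ x px)[y Py xy] _] := phi_facts EP hp.
  have [_ _ _ /(_ x rx)[y' Ry xy'] _] := phi_facts ER hr.
  have := sep pr rr npr ll Py Ry; rewrite leNgt => /negP; apply.
  apply: le_lt_trans (dT _ _ x) _; rewrite -!mulrA mulrCA ltr_pM2l ?(lt_le_trans ltr01)//.
  move: xy xy'; rewrite ll [d x y]dC !exprS => xy xy'.
  have : tau * (de * de ^+ lev r) < tau * de ^+ lev r.
    by rewrite ltr_pM2l// gtr_pMl.
  lra.
split => //; first exact: levm.
have [plr|/ltnW rlp] := leqP (lev p) (lev r).
  have -> : ldist lev p r = (lev r - lev p)%N by rewrite /ldist (eqP plr).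
  exact: gm_le.
have -> : ldist lev p r = (lev p - lev r)%N by rewrite /ldist (eqP rlp) addn0.
by rewrite gmC; exact: gm_le.
Qed.

(** By separation, distinct indices of one level have distinct cubes; these are disjoint, have
    measure at least [c0 * de ^+ n] and lie in one ball of radius comparable to [rho]. The summand
    [1] in [Cc] accounts for [r0]. *)
Lemma count n x rho A : de ^+ n <= rho ->
  \sum_(r <- A | (lev r == n) && (d x (pos r) < rho)) 1 <= Cc * (rho / de ^+ n).
Proof.
move=> nr; have dn := dn0 n; have rho0 : 0 < rho := lt_le_trans dn nr.
have rn1 : 1 <= rho / de ^+ n by rewrite ler_pdivlMr// mul1r.
have Kc : 0 < Kt * (1 + C1) by rewrite mulr_gt0 ?addr_gt0// (lt_le_trans ltr01).
pose s := [fset cu r | r in A & [&& r != r0, lev r == n & d x (pos r) < rho]]%fset.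
have sE Q : Q \in s -> exists r, [/\ Q = cu r, r != r0, lev r = n & d x (pos r) < rho].
  by move=> /imfsetP[r /=]; rewrite !inE => /and4P[_ r1 /eqP r2 r3] ->; exists r.
have h1 : \sum_(r <- A | (lev r == n) && (d x (pos r) < rho)) 1 <= #|` s|%:R + 1 :> R.
  apply: (@le_trans _ _ (\sum_(r <- A | [&& r != r0, lev r == n & d x (pos r) < rho]) 1
      + \sum_(r <- A | r == r0) 1)).
    rewrite [leLHS](bigID (fun r => r == r0))/= addrC lerD//.
      rewrite le_eqVlt; apply/orP; left; apply/eqP; apply: eq_bigl => r.
      by rewrite andbC.
    rewrite [leRHS](bigID (fun r => (lev r == n) && (d x (pos r) < rho)))/=.
    rewrite ler_wpDr ?sumr_ge0//.
    by rewrite le_eqVlt; apply/orP; left; apply/eqP; apply: eq_bigl => r; rewrite andbC.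
  apply: lerD; last first.
    rewrite -big_filter (big_nth r0) sumr_const_nat subn0.
    rewrite lern1 -[1%N]/(size [:: r0]); apply: uniq_leq_size.
      by rewrite filter_uniq// fset_uniq.
    by move=> r; rewrite mem_filter inE => /andP[].
  rewrite -big_filter (big_nth r0) sumr_const_nat subn0 ler_nat.
  rewrite -(size_map cu); apply: uniq_leq_size.
    rewrite map_inj_in_uniq ?filter_uniq ?fset_uniq// => p r.
    rewrite !mem_filter => /andP[/and3P[pr /eqP pn _] _] /andP[/and3P[rr /eqP rn _] _] e.
    apply/eqP/negPn/negP => npr; have [_ _ zP] := cuE pr.
    have Rp : cu r (pos p) by rewrite -e.
    have := sep pr rr npr (etrans pn (esym rn)) zP Rp.
    by rewrite dxx leNgt !mulr_gt0// (lt_le_trans ltr01).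
  move=> Q /mapP[r]; rewrite mem_filter => /andP[hr rA] ->.
  by apply/imfsetP; exists r => //=; rewrite !inE rA.
apply: le_trans h1 _; rewrite /Cc mulrDl mul1r lerD//.
have cdn : 0 < c0 * de ^+ n by apply: mulr_gt0.
have -> : A2 * (Kt * (1 + C1)) / c0 * (rho / de ^+ n) =
    A2 * (Kt * (1 + C1) * rho) / (c0 * de ^+ n) by rewrite [(c0 * de ^+ n)^-1]invfM; lra.
rewrite ler_pdivlMr//.
have [s0|s1] := pselect (forall Q, Q \notin s).
  have -> : s = fset0 by apply/fsetP => Q; rewrite inE (negbTE (s0 Q)).
  by rewrite cardfs0 !mul0r; apply: mulr_ge0; [exact: ltW|apply: mulr_ge0; exact: ltW].
pose rho' := Kt * (1 + C1) * rho.
have sB Q : Q \in s -> Q `<=` qball d x rho'.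
  move=> /sE[r [-> rr rn xr]] y Qy; have [EP hi zP] := cuE rr; rewrite /qball/=.
  apply: le_lt_trans (dT _ _ (pos r)) _.
  rewrite /rho' -mulrA ltr_pM2l ?(lt_le_trans ltr01)// mulrDl mul1r ltr_leD//.
  apply: le_trans (cube_d EP zP Qy) _; rewrite rn ler_wpM2l//; exact: ltW.
have rho'0 : 0 < rho' by rewrite mulr_gt0.
have [b1|b1] := upper x rho'0.
  exfalso; apply: s1 => Q; apply/negP => Qs; have [r [Qr rr rn xr]] := sE Q Qs.
  have := sB Q Qs; rewrite b1 Qr => QB.
  by have [y [z [/QB -> /QB ->]]] := two_points rr.
have sEn Q : Q \in s -> E n Q.
  by move=> /sE[r [-> rr <- xr]]; have [] := cuE rr.
exact: le_trans (card_cubes sEn sB (mball _ _)) (b1 _ (lexx rho')).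
Qed.

Hypothesis dmax : exists Dm, forall x y, d x y <= Dm.
Variables (Gop Sop : (J -> R) -> J -> R).
Hypothesis oG : l2_operator Gop.
Hypothesis oS : l2_operator Sop.
Hypothesis pG : l2_positive Gop.
Hypothesis pS : l2_positive Sop.
Hypothesis GSS : forall x, l2 x -> Gop (Sop (Sop x)) = x /\ Sop (Sop (Gop x)) = x.
Hypothesis GE : forall p r, Gop (l2_delta r) p = gm p r.
Hypothesis mA : schurA Cc Ct Cn om * om ^+ m <= 8^-1.
Hypothesis mB : schurB Gb Kt Cc Ct Cn om * om ^+ m <= 8^-1.

Lemma Cc_ge0 : 0 <= Cc.
Proof.
have c1 : 0 <= A2 * (Kt * (1 + C1)).
  apply: mulr_ge0; first exact: ltW.
  by apply: mulr_ge0; [exact: le_trans Kt1|apply: addr_ge0 => //; exact: ltW].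
by rewrite addr_ge0// divr_ge0// ltW.
Qed.

Lemma Ct_ge0 : 0 <= Ct.
Proof. by rewrite mulr_ge0 ?sqr_ge0// mulr_ge0 ?Cphi'_ge0// Cl_ge0. Qed.

Lemma Cn_ge0 : 0 <= Cn.
Proof.
apply: mulr_ge0; last exact: ltW Cs_gt0.
by apply: mulr_ge0 => //; exact: le_trans Kt1.
Qed.

Let mT : R := ms setT.
Let mT0 : 0 < mT. Proof. by rewrite fine_gt0// muT0 muT. Qed.

Lemma gm_r0 p : gm p r0 = mT * (p == r0)%:R.
Proof.
rewrite /gm ph_r0; have [->|pr] := eqVneq p r0.
  rewrite mulr1 ph_r0 (_ : \int[mu]_x _ = \int[mu]_(x in setT) (1 : R)).
    by rewrite Rintegral_cst// mul1r.
  by apply: eq_Rintegral => x _; rewrite mulr1.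
have [_ _ _ _ [hf _]] := ph_facts pr.
by rewrite mulr0 -[RHS]hf; apply: eq_Rintegral => x _; rewrite mulr1.
Qed.

Lemma Gr0 : Gop (l2_delta r0) = fun p => mT * l2_delta r0 p.
Proof. by apply/funext => p; rewrite GE gm_r0. Qed.

Lemma tmE p r : tm r0 Gop p r = tt p r.
Proof. by rewrite /tm /tt; case: ifP => // _; rewrite GE. Qed.

Definition Cm : R := (2 + (Num.sqrt mT)^-1) / ker Gb 2.

Lemma a_r0E : Sop (l2_delta r0) = fun p => (Num.sqrt mT)^-1 * l2_delta r0 p.
Proof. exact: S_r0 oS pS GSS mT0 Gr0. Qed.

Lemma a_r0 q : q != r0 -> Sop (l2_delta q) r0 = 0.
Proof.
move=> qr; have e0 := @l2_e R J r0; have eq := @l2_e R J q.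
have := pS.1 _ _ eq e0; rewrite dot_e; last exact: (opl2 oS eq).
move=> ->; rewrite dotC dot_e; last exact: (opl2 oS e0).
by rewrite a_r0E /l2_delta (negbTE qr) mulr0.
Qed.

(** Columns other than that of [r0] come from [S_le_weight] with the weights [sg ^+ lev r] and
    [wq q], whose Schur conditions hold as [m] is large. The column of [r0] is known exactly, and
    [Cm] covers both. *)
Lemma a_le p q : `|Sop (l2_delta q) p| <=
  Cm * (wt om sg lev p * wt om sg lev q * ker Gb (qd d de lev pos p q)).
Proof.
have k2 : 0 < ker Gb 2 by exact: (ker_gt0 Gb0).
have w0 r : 0 < wt om sg lev r by apply: wt_gt0; [exact: sg0|exact: om0].
have kq r r' : 0 < ker Gb (qd d de lev pos r r').
  by apply: (ker_gt0 Gb0); apply: (qd_gt0 d0 sg0 sg2).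
have rest0 : 0 <= wt om sg lev p * wt om sg lev q * ker Gb (qd d de lev pos p q).
  by apply: mulr_ge0; [apply: mulr_ge0|]; exact: ltW.
have sm0 : 0 <= (Num.sqrt mT)^-1 by rewrite invr_ge0 sqrtr_ge0.
have [->|qr] := eqVneq q r0.
  rewrite a_r0E /l2_delta; have [->|pr] := eqVneq p r0; last first.
    rewrite mulr0 normr0; apply: mulr_ge0; last first.
      by apply: mulr_ge0; [apply: mulr_ge0|]; exact: ltW.
    by rewrite divr_ge0 ?addr_ge0// ltW.
  rewrite mulr1 ger0_norm// /wt /qd lev0 !expr0 !mulr1 dxx addr0.
  by rewrite -[1 + 1]/(2%:R) /Cm mul1r divfK ?gt_eqF// lerDr.
have hf := S_le_weight (kap := 8^-1) (s := fun p => sg ^+ lev p)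
  (u := wq d Gb de om sg lev pos q) oG oS pG pS GSS mT0 Gr0.
have {hf} : `|Sop (l2_delta q) p| <= 2 * (wq d Gb de om sg lev pos q p / wq d Gb de om sg lev pos q q).
  apply: hf => //.
  - by move=> r; rewrite exprn_gt0// sg0.
  - move=> r A; under eq_bigr do rewrite tmE.
    apply: le_trans (schur_sg sg0 sg2 de1 om0 om1 Cc_ge0 Ct_ge0 Cn_ge0 count tt_facts r A) _.
    by rewrite ler_wpM2r// exprn_ge0// ltW// sg0.
  - move=> r; apply: ltW; apply: mulr_gt0; [exact: w0|exact: kq].
  - move=> r A; under eq_bigr do rewrite tmE.
    apply: le_trans (schur_wq d0 dC Kt1 dT Gb0 GbM Gbmono Gb2 erefl sg0 sg2 de1 om0 om1
      Cc_ge0 Ct_ge0 Cn_ge0 count tt_facts r q A) _.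
    by apply: ler_wpM2r mB; apply: ltW; apply: mulr_gt0; [exact: w0|exact: kq].
  - by apply: mulr_gt0; [exact: w0|exact: kq].
rewrite (wqq dxx Gb0 GbM erefl sg0 sg2 om0) => hf; apply: le_trans hf _.
rewrite /wq.
rewrite (_ : 2 * _ = 2 / ker Gb 2 * (wt om sg lev p * wt om sg lev q * ker Gb (qd d de lev pos p q))).
  apply: ler_wpM2r => //; rewrite /Cm; apply: ler_wpM2r; last by rewrite lerDl.
  by rewrite invr_ge0 ltW.
by rewrite invf_div; lra.
Qed.

(** The left side is the quadratic form of the Gram operator, which is bounded on l2. *)
Lemma bessel : exists2 CG, 0 < CG & forall (x : J -> R) A,
  \int[mu]_y ((\sum_(p <- A) x p * ph p y) ^+ 2) <= CG * \sum_(p <- A) x p ^+ 2.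
Proof.
have [nG nG0 hG] := opN oG.
exists (2 * (nG + 1)); first by rewrite mulr_gt0// ltr_wpDl.
move=> x A; have ng : 0 < nG + 1 by rewrite ltr_wpDl.
have bphi p : exists B, forall y, `|ph p y| <= B.
  have [->|pr] := eqVneq p r0; first by exists 1 => y; rewrite ph_r0 normr1.
  by have [_ hf _ _ _] := ph_facts pr; exists (Cphi / sg ^+ lev p).
have Ipr p r : itg mu (fun y => ph p y * ph r y).
  have [B hB] := bphi r; apply: itgM (ph_itg p) (itg_meas (ph_itg r)) (aeW _ hB).
have -> : \int[mu]_y ((\sum_(p <- A) x p * ph p y) ^+ 2) =
    \sum_(p <- A) x p * \sum_(r <- A) x r * Gop (l2_delta r) p.
  transitivity (\int[mu]_y (\sum_(p <- A) \sum_(r <- A) (x p * x r) * (ph p y * ph r y))).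
    apply: eq_Rintegral => y _; rewrite expr2 mulr_suml; apply: eq_bigr => p _.
    by rewrite mulr_sumr; apply: eq_bigr => r _; lra.
  rewrite int_sum => [|p _]; last by apply: itg_sum => r _; exact: itgZ.
  apply: eq_bigr => p _; rewrite int_sum => [|r _]; last exact: itgZ.
  rewrite mulr_sumr; apply: eq_bigr => r _.
  by rewrite (RintegralZl _ measurableT (Ipr p r)) -/(gm p r) GE mulrA.
apply: (@le_trans _ _ (\sum_(p <- A) ((nG + 1) * x p ^+ 2 +
    (\sum_(r <- A) x r * Gop (l2_delta r) p) ^+ 2 / (nG + 1)))).
  by apply: ler_sum => p _; exact: amgm.
rewrite big_split/= -mulr_sumr -mulr_suml [2 * _]mulr_natl mulr2n [leRHS]mulrDl; apply: lerD => //.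
rewrite ler_pdivrMr//; apply: le_trans (e_sum oG nG0 hG x A A) _.
have s0 : 0 <= \sum_(q <- A) x q ^+ 2 by apply: sumr_ge0 => q _; exact: sqr_ge0.
rewrite [leRHS]mulrAC ler_wpM2r// -expr2 ler_pXn2r ?nnegrE ?(ltW ng)//.
by rewrite lerDl.
Qed.

Hypothesis full : forall x r, rmax < r -> qball d x r = setT.
Variable f : J -> X -> R.
Hypothesis f_sum : forall q, Lp_sum mu 2%:E (fun p x => Sop (l2_delta q) p * ph p x) (f q).

(** Uniform continuity supplies the small oscillation on fine cubes that [L2_H1] asks for, since the
    diameters of the cubes tend to zero. *)
Lemma square_Hbd : forall C rM : R, 0 < C -> 0 < rM -> exists2 CL, 0 < CL &
  forall x0 r (b : X -> R), 0 < r -> r <= rM ->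
  (forall rho, r <= rho -> fine (mu (qball d x0 rho)) <= A2 * rho) ->
  measurable_fun setT b -> (exists Bb, forall x, `|b x| <= Bb) ->
  (forall eps, 0 < eps -> exists2 rho, 0 < rho & forall x y, d x y <= rho -> `|b x - b y| <= eps) ->
  (forall y, ~ qball d x0 (C * r) y -> b y = 0) -> \int[mu]_x b x = 0 ->
  forall e, 0 < e ->
  Hbd mu d b (CL * (Num.sqrt r * Num.sqrt (\int[mu]_x (b x ^+ 2))) + e).
Proof.
move=> C rM C0 rM0; have [CL CL0 hL] := L2_H1 C0 rM0; exists CL => //.
move=> x0 r b rp rl up mb bb osc bs b0 e e0; apply: (hL x0) => // eps eps0.
have [rho rho0 h1] := osc eps eps0.
have [N hN] : exists N, forall n, (N <= n)%N -> C1 * de ^+ n <= rho.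
  have rc : 0 < rho / C1 by rewrite divr_gt0.
  have := cvg_expr (z := de); rewrite ger0_norm ?(ltW de0)// => /(_ de1).
  move=> /cvgrPdist_le/(_ _ rc)[n _ hn]; exists n => k /hn.
  by rewrite /= sub0r normrN (ger0_norm (ltW (dn0 k))) ler_pdivlMr// mulrC.
exists N => n Nn Q x y EQ Qx Qy; apply: h1; apply: le_trans (cube_d EQ Qx Qy) _; exact: hN.
Qed.

Lemma family_bounded : exists2 C, 0 < C & forall g, H1 mu d g -> exists g',
  Lp_sum mu 1%E (fun q x => (\int[mu]_y (g y * f q y)) * f q x) g' /\
  (H1norm mu d g' <= C%:E * H1norm mu d g)%E.
Proof.
have [CG CG0 hCG] := bessel; have [nS nS0 hS] := opN oS; have [Dm hD] := dmax.
pose Cp := Cphi + Cphi' + Cl + mT + 1.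
have cp1 := Cphi_ge0; have cp2 := Cphi'_ge0; have cp3 := Cl_ge0; have cp4 := ltW mT0.
have Cp0 : 0 <= Cp by rewrite /Cp !addr_ge0.
(* The constant function of [r0] has level [0] and is supported everywhere, so the diameter of the
   space is added to the support constant. *)
have CsD : 0 <= Cs + `|Dm| by rewrite addr_ge0// ltW// Cs_gt0.
have sgi n : 0 <= (sg ^+ n)^-1 by rewrite invr_ge0 ltW// sg_ge0.
have k2 : 0 <= ker Gb 2 by apply: ltW; exact: (ker_gt0 Gb0).
have Cm0 : 0 <= Cm by rewrite divr_ge0// addr_ge0// invr_ge0 sqrtr_ge0.
apply: (bounded_projection muT0 muT mball d0 dC Kt1 dT Gb0 GbM Gbmono Gb2 erefl sg0 sg2
  om0 om1 Cc_ge0 (r0 := r0) count (ph := ph) (Cp := Cp) (Cs := Cs + `|Dm|) Cp0 CsD CG0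
  _ _ _ _ _ _ ph_r0 hCG oS nS0 hS pS.1 Cm0 a_le a_r0 f_sum A10 A20 rmax0 lower full upper
  square_Hbd).
- by move=> p; exact: itg_meas (ph_itg p).
- move=> p x; have [->|pr] := eqVneq p r0.
    by rewrite ph_r0 lev0 expr0 divr1 normr1 /Cp lerDr !addr_ge0.
  have [_ hf _ _ _] := ph_facts pr; apply: le_trans (hf x) _.
  by rewrite ler_wpM2r//; rewrite /Cp; lra.
- move=> p x y rho rho0 xy; have [->|pr] := eqVneq p r0.
    rewrite ph_r0 subrr normr0; apply: mulr_ge0; last exact: sqr_ge0.
    by rewrite mulr_ge0.
  have [_ _ hf _ _] := ph_facts pr; apply: le_trans (hf x y) _.
  apply: ler_pM; [by rewrite mulr_ge0|exact: sqr_ge0|by rewrite ler_wpM2r//; rewrite /Cp; lra|].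
  have dl := dn0 (lev p).
  have [->|dx] := eqVneq (d x y) 0.
    by rewrite mul0r /Gb powR0 ?expr0n ?sqr_ge0// gt_eqF// divr_gt0.
  have dx0 : 0 < d x y by rewrite lt_def dx d0.
  rewrite ler_pXn2r ?nnegrE ?powR_ge0//; apply: Gbmono; first by rewrite divr_gt0.
  by rewrite ler_wpM2r// invr_ge0 ltW.
- move=> p x px; have [pr|pr] := eqVneq p r0.
    rewrite pr lev0 expr0 mulr1; apply: le_trans (hD _ _) _; apply: le_trans (ler_norm _) _.
    by rewrite lerDr ltW// Cs_gt0.
  have [_ _ _ hf _] := ph_facts pr; apply: le_trans (hf x px) _.
  by rewrite ler_wpM2r ?(ltW (dn0 _))// lerDl.
- move=> p; have [->|pr] := eqVneq p r0.
    have at1 : atom mu d (cst (fine (mu setT))^-1) by split; [exact: measurable_cst|right].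
    have := Hbd_atom muT0 muT mball mT at1; rewrite ph_r0 lev0 expr0 mulr1 => H1'.
    apply: Hbd_ext (HbdW H1' _); first by apply/funext => x; rewrite /= mulfV ?gt_eqF.
    by rewrite ger0_norm// /Cp; lra.
  apply: HbdW (ph_Hbd pr) _; rewrite ler_wpM2r ?(ltW (sg_ge0 _))// /Cp; lra.
- by move=> p pr; have [_ _ _ _ []] := ph_facts pr.
Qed.

End Family.

End Geometry.


(** * Choice of the parameters *)

Lemma lattice_dist m k k' s : (m * k + s != m * k' + s)%N ->
  (m <= ((m * k + s) - (m * k' + s)) + ((m * k' + s) - (m * k + s)))%N.
Proof.
rewrite eqn_add2r !subnDr -!mulnBr -mulnDr => ne; apply: leq_pmulr.
by rewrite addn_gt0 !subn_gt0 orbC -neq_ltn; apply: contraNneq ne => ->.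
Qed.

Lemma small_power (R : realType) (x B : R) : 0 < x -> x < 1 ->
  exists m0 : nat, forall m, (m0 <= m)%N -> B * x ^+ m <= 8^-1.
Proof.
move=> x0 x1; have B1 : 0 < `|B| + 1 by rewrite ltr_wpDl.
have e0 : 0 < 8^-1 / (`|B| + 1) by rewrite divr_gt0.
have := cvg_expr (z := x); rewrite ger0_norm ?(ltW x0)// => /(_ x1).
move=> /cvgrPdist_le/(_ _ e0)[m0 _ hm]; exists m0 => m /hm.
have xm : 0 <= x ^+ m by rewrite exprn_ge0// ltW.
rewrite /= sub0r normrN (ger0_norm xm) ler_pdivlMr// mulrC => h.
apply: le_trans _ h; rewrite ler_wpM2r//; apply: le_trans (ler_norm B) _; rewrite lerDl//.
Qed.

Theorem theorem7 (R : realType) (disp : measure_display)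
    (X : measurableType disp) (mu : {measure set X -> \bar R})
    (d : X -> X -> R) (theta : R) (a0 eta C1 C2 Ch beta : R) (M : nat) :
  normal_order_space mu d theta ->
  (0 < mu setT < +oo)%E ->
  0 < a0 -> 0 < eta -> 0 < C1 -> 0 < C2 -> 0 < Ch ->
  0 < beta <= theta ->
  exists2 tau0 : R, 0 < tau0 &
  forall tau : R, 0 < tau < tau0 -> tau < 1 / (500 * C1) ->
  exists2 delta0 : R, 0 < delta0 &
  forall delta : R, 0 < delta < delta0 -> delta < 1 ->
  exists K0 : R,
  forall alpha : R, 0 < alpha < beta / 2 ->
  exists m0 : nat,
  forall (K : R) (m : nat), 0 < K -> K0 <= K -> (2 <= m)%N -> (m0 <= m)%N ->
  forall (E : nat -> set (set X)) (h : nat -> set X -> nat -> X -> R)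
    (psi : nat -> nat -> X -> R) (l : nat) (Pc : nat -> nat -> set (set X))
    (s j i0 : nat),
  dyadic_cubes mu d delta a0 eta C1 C2 E ->
  three_valued_system mu E Ch h ->
  partitions_of_unity d beta tau delta M psi ->
  separated_splitting mu d E K l Pc ->
  (0 < s <= m)%N -> (1 <= j <= l)%N -> (1 <= i0)%N ->
  let F := cube_family E Pc m s j i0 in
  forall f_ : F -> X -> R,
  is_orthonormalized mu (fun q : F => phi_family mu psi h i0 (val q)) f_ ->
  exists2 C : R, 0 < C &
  forall f : X -> R, H1 mu d f ->
  exists g : X -> R,
    Lp_sum mu 1%E (fun q x => (\int[mu]_y (f y * f_ q y)) * f_ q x) g /\
    (H1norm mu d g <= C%:E * H1norm mu d f)%E.
Proof.
move=> [[d0 dC deq [K' dK]] mball theta0 [A1 [A2 [K1 [K2 [K0 [[A10 A20 K20 K21 K11] K00 hn]]]]]]].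
move=> /andP[muT0 muT] a00 eta0 C10 C20 Ch0 /andP[beta0 betat].
pose Kt := Num.max K' 1.
have Kt1 : 1 <= Kt by rewrite le_max lexx orbT.
have dxx x : d x x = 0 by apply/deq.
have d_eq0 x y : d x y = 0 -> x = y by move/deq.
have dT x y z : d x y <= Kt * (d x z + d z y).
  by apply: le_trans (dK x y z) _; rewrite ler_wpM2r ?addr_ge0// le_max lexx.
pose mT := fine (mu setT).
have mTE : mu setT = mT%:E by rewrite fineK// (mu_fin muT).
have mT0 : 0 < mT by rewrite fine_gt0// muT0 muT.
pose rmax := K1 * mT.
have rmax0 : 0 < rmax by rewrite mulr_gt0// (lt_le_trans ltr01).
have lower x r : 0 < r -> r <= rmax -> A1 * r <= ms mu (qball d x r).
  move=> r0 rm; have [+ _ _ _ _] := hn x r r0; rewrite mTE -EFinM lee_fin => /(_ rm) h1.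
  by rewrite -lee_fin fineK// (mu_fin muT).
have full x r : rmax < r -> qball d x r = setT.
  move=> rm; have [_ + _ _ _] := hn x r (lt_trans rmax0 rm).
  by rewrite mTE -EFinM lte_fin => /(_ rm).
have upper x r : 0 < r -> qball d x r = [set x] \/
    forall rho, r <= rho -> ms mu (qball d x rho) <= A2 * rho.
  move=> r0; have [hr|hr] := ltP r%:E (K2%:E * mu [set x])%E.
    by left; have [_ _ _ + _] := hn x r r0; exact.
  right=> rho rr; have [_ _ + _ _] := hn x rho (lt_le_trans r0 rr).
  rewrite -lee_fin fineK ?(mu_fin muT)//; apply.
  by apply: le_trans hr _; rewrite lee_fin.
have dHolder r x y z : 0 < r -> d x z < r -> d y z < r ->
    `|d x z - d y z| <= K0 * r `^ (1 - theta) * d x y `^ theta.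
  move=> r0 xz yz; have [_ _ _ _ h1] := hn x r r0; have := h1 y z xz yz; exact.
(* Makes [C2 * tau^eta <= 1/2], so that the layer disturbed by smoothing fills at most half of a
   cube. *)
exists ((2^-1 / C2) `^ eta^-1); first by rewrite powR_gt0// divr_gt0.
move=> tau /andP[tau0 tau1] _.
have C2tau : C2 * tau `^ eta <= 2^-1.
  rewrite mulrC -ler_pdivlMr//.
  have -> : 2^-1 / C2 = ((2^-1 / C2) `^ eta^-1) `^ eta.
    by rewrite -powRrM mulVf ?gt_eqF// powRr1// divr_ge0// ltW.
  by rewrite ge0_ler_powR ?nnegrE ?powR_ge0 ?(ltW tau0) ?(ltW eta0) ?(ltW tau1).
exists 1 => // delta /andP[de0 _] de1.
(* As a cube of level [n] has measure at least [c0 * delta^n], this separates cubes of one level by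
   [2 * Kt * tau * delta^n], beyond the reach of the smoothed functions. *)
exists (2 * Kt * tau / c0 A1 rmax a0) => alpha _.
pose cA := schurA (Cc Kt A1 A2 rmax a0 C1) (Ct Kt A1 A2 rmax delta a0 C1 tau beta Ch M)
  (Cn Kt C1 tau) (om delta beta).
pose cB := schurB (Gb beta) Kt (Cc Kt A1 A2 rmax a0 C1)
  (Ct Kt A1 A2 rmax delta a0 C1 tau beta Ch M) (Cn Kt C1 tau) (om delta beta).
have o0 : 0 < om delta beta by exact: powR_gt0.
have o1 : om delta beta < 1 := om1 de0 de1 beta0.
have [mA hA] := small_power cA o0 o1; have [mB hB] := small_power cB o0 o1.
(* Both Schur constants carry the factor [om ^+ m]; from here on they are at most [1/8], as the
   iteration for the inverse square root requires. *)
exists (maxn mA mB) => K m Kgt0 KK _ mm E h psi l Pc s j i0 DC TV PU [PE _ Psep] _ jl i01 F f_.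
move=> [a [[Gop [Sop [[oG oS] [pG pS] GE SE GSS]]] fs]].
have c00' : 0 < c0 A1 rmax a0 := c00 A10 rmax0 a00.
(* The space [X] itself is the distinguished index, placed at level [0]. *)
pose r0 : F := exist _ None (mem_set I).
pose lev (q : F) : nat := if val q is Some p then p.1 else 0%N.
pose cu (q : F) : set X := if val q is Some p then p.2 else setT.
have val_r0 (q : F) : q != r0 -> exists p, val q = Some p.
  case: q => -[p|] hp; first by exists p.
  by case/eqP; apply: val_inj.
have Fmem (q : F) p : val q = Some p ->
    [/\ exists k, p.1 = (m * k + s)%N, Pc p.1 j p.2 & (i0 <= nchild E p.1 p.2)%N].
  by move=> e; have := set_mem (valP q); rewrite /cube_family/= e; case: p e.
have EP n Q : Pc n j Q -> E n Q.
  by move=> PQ; rewrite PE; exists j.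
have /choice[pos hpos] : forall q : F, exists z, q != r0 -> cu q z.
  move=> q; have [->|/val_r0[p e]] := eqVneq q r0; first by exists point.
  have [_ /EP Ep _] := Fmem q p e.
  by have [z [Qz _]] := cube_center dxx de0 a00 DC Ep; exists z => _; rewrite /cu e.
apply: (family_bounded muT0 muT mball d0 dxx dC Kt1 dT A10 A20 rmax0 lower upper de0 de1 a00 C10
  DC theta0 K00 dHolder d_eq0 tau0 beta0 Ch0 C2tau PU TV (lev := lev) (pos := pos) (cu := cu)
  (i0 := i0) (m := m) (r0 := r0) (ph := fun q : F => phi_family mu psi h i0 (val q))
  _ _ _ erefl erefl _ _ oG oS pG pS GSS _ _ _ full).
- move=> p pr; have [[n Q] e] := val_r0 p pr; have [_ /EP Ep hi] := Fmem p _ e.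
  by move: (hpos p pr); rewrite /lev /cu e; split => //; rewrite i01.
- move=> p r x y pr rr pnr; have [[n Q] e] := val_r0 p pr; have [[n' Q'] e'] := val_r0 r rr.
  have [_ PQ _] := Fmem p _ e; have [_ PQ' _] := Fmem r _ e'.
  rewrite /lev /cu e e' /= => nn Qx Q'y; rewrite -nn/= in PQ' e'.
  have QQ : Q <> Q'.
    by move=> eq; move/eqP: pnr; apply; apply: val_inj; rewrite /= e e' eq.
  have cQ := cube_lower muT mball dxx rmax0 lower de0 de1 a00 DC (EP _ _ PQ).
  have := Psep n j Q Q' jl PQ PQ' QQ; rewrite -lee_fin.
  move=> hsep; apply: le_trans (le_trans _ hsep) _; last first.
    by apply: ereal_inf_lbound; exists x => //; exists y.
  have mQ : measurable Q := cube_measurable DC (EP _ _ PQ).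
  apply: (@le_trans _ _ (K%:E * mu Q)%E); last first.
    by rewrite lee_pmul2l// ?le_max ?lexx.
  rewrite -[mu Q]fineK ?(mu_fin muT)// -EFinM lee_fin -/(ms mu Q).
  apply: le_trans _ (ler_wpM2l (ltW Kgt0) cQ); rewrite mulrA ler_wpM2r ?exprn_ge0 ?(ltW de0)//.
  by rewrite -ler_pdivrMr.
- move=> p r pr rr; have [[n Q] e] := val_r0 p pr; have [[n' Q'] e'] := val_r0 r rr.
  have [[k ek] _ _] := Fmem p _ e; have [[k' ek'] _ _] := Fmem r _ e'.
  rewrite /ldist /lev e e'; rewrite /= in ek ek' *; rewrite ek ek'; exact: lattice_dist.
- by move=> p pr; have [[n Q] e] := val_r0 p pr; rewrite /lev /cu e.
- exists (rmax + 1) => x y; apply: ltW.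
  have : qball d x (rmax + 1) y by rewrite full// ltrDl.
  by [].
- by move=> p r; have := congr1 (fun g => g p r) GE.
- by apply: hA; exact: leq_trans (leq_maxl _ _) mm.
- by apply: hB; exact: leq_trans (leq_maxr _ _) mm.
- by move=> q; move: (fs q); rewrite -SE.
Qed.
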